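(* Let $S=S_1\cup\dots\cup S_Q\subset\mathbf{R}^2$ be a finite union of scatterers, let $k>0$, and let $u_s$ be the scattered field, i.e. the solution of $$\Delta u_s+k^2u_s=0 \text{ in the exterior of } S,\qquad u_s=-u_i \text{ on } \partial S,\qquad \lim_{r\to\infty}\sqrt{r}\left(\frac{\partial u_s}{\partial r}-ik\,u_s\right)=0,$$ where $u_i$ is the incident field. Let $O_1,\dots,O_L$ be arbitrarily chosen points of $S$, with at least one of them in each scatterer $S_q$, and let $(r_l,\theta_l)$ be the polar coordinates centered at $O_l$. If $u_s$ can be analytically continued to an open domain containing $\mathbf{R}^2\setminus S$ (boundaries of the scatterers included), then there exist complex coefficients $\beta^N_{nl}$ ($N\in\mathbf{N}$, $n\in\mathbf{Z}$, $1\le l\le L$), only finitely many of which are nonzero for each given $N$, such that the functions $$u^N=\sum_{l=1}^L\sum_{n\in\mathbf{Z}}\beta^N_{nl}\,H_n(kr_l)e^{in\theta_l}$$ converge to $u_s$ as $N\to\infty$, uniformly on $\mathbf{R}^2\setminus S$, including on the boundaries of the scatterers.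
   Context: The scatterers $S_1,\dots,S_Q$ are bounded, simply connected open subsets of the plane with pairwise disjoint closures, so that $\mathbf{R}^2\setminus S$ is closed and contains the boundaries $\partial S_q$; they are all contained in some disk of radius $R_1$. $H_n$ denotes the outgoing Hankel function (first kind, $H_n=H_n^{(1)}=J_n+iY_n$) of integer order $n$. The limit in the problem for $u_s$ is the Sommerfeld radiation condition, where $r$ is the distance to the origin, and is understood uniformly in the direction. The analytic continuation is a (complex-valued) real-analytic function on a connected open set containing $\mathbf{R}^2\setminus S$ that coincides with $u_s$ on $\mathbf{R}^2\setminus S$; it is thus also a solution of the Helmholtz equation. *)

(* Defs.v *)
From HB Require Import structures.
From mathcomp Require Import all_boot all_order all_algebra.
From mathcomp Require Import all_classical all_reals all_analysis.
From mathcomp Require Import complex.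

Set Implicit Arguments.
Unset Strict Implicit.
Unset Printing Implicit Defensive.

Import Order.TTheory GRing.Theory Num.Theory.
Import numFieldNormedType.Exports.

Local Open Scope classical_set_scope.
Local Open Scope ring_scope.

(* The plane is R * R and complex values live in R[i]. The norm of R * R is the
   sup norm, which is only used for its topology; distances to a point are
   measured with [eucl]. Fields on the plane are total functions, of which only
   the values on the relevant region matter. *)

Section Plane.
Variable R : realType.
Implicit Types (A S : set (R * R)) (f : R * R -> R) (u : R * R -> R[i]).

Definition eucl (x : R * R) : R := Num.sqrt (x.1 ^+ 2 + x.2 ^+ 2).

(* [r] and [theta] are polar coordinates centered at [O]; [theta] is only
   determined modulo 2 pi (and arbitrary at [O]). *)
Definition polar_coordinates (O : R * R) (r theta : R * R -> R) : Prop :=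
  forall x, [/\ 0 <= r x,
                x.1 = O.1 + r x * cos (theta x) &
                x.2 = O.2 + r x * sin (theta x)].

Definition boundary A : set (R * R) := closure A `\` interior A.

Definition path_connected A : Prop :=
  forall x y, A x -> A y -> exists g : R -> R * R,
    [/\ {within `[0, 1], continuous g}, g @` `[0, 1] `<=` A,
        g 0 = x & g 1 = y].

(* The homotopy parameter is the first argument of [h]. *)
Definition simply_connected A : Prop :=
  path_connected A /\
  forall g : R -> R * R,
    {within `[0, 1], continuous g} -> g @` `[0, 1] `<=` A -> g 0 = g 1 ->
    exists h : R * R -> R * R,
      [/\ {within `[0, 1] `*` `[0, 1], continuous h},
          h @` (`[0, 1] `*` `[0, 1]) `<=` A,
          forall t, t \in `[0, 1] -> h (0, t) = g t /\ h (1, t) = g 0 &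
          forall s, s \in `[0, 1] -> h (s, 0) = g 0 /\ h (s, 1) = g 0].

Definition axis (j : bool) : R * R := if j then (0, 1) else (1, 0).

Definition C2_on A f : Prop :=
  forall x, A x ->
  [/\ forall i, derivable f x (axis i),
      forall i j, derivable ('D_(axis i) f) x (axis j) &
      forall i j, {for x, continuous ('D_(axis j) ('D_(axis i) f))}].

Definition laplacian f (x : R * R) : R := \sum_j 'D_(axis j) ('D_(axis j) f) x.

(* The terms are grouped by total degree [d]; absolute convergence of the
   double series makes the grouping immaterial. *)
Definition real_analytic_at f (a : R * R) : Prop :=
  exists (c : nat -> nat -> R) (rho : R), 0 < rho /\
  forall x, `|x - a| < rho ->
    let t (i j : nat) := c i j * (x.1 - a.1) ^+ i * (x.2 - a.2) ^+ j in
    cvgn (series (fun d => \sum_(i < d.+1) `|t i (d - i)%N|)) /\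
    series (fun d => \sum_(i < d.+1) t i (d - i)%N) @ \oo --> f x.

Definition reF u (x : R * R) : R := complex.Re (u x).
Definition imF u (x : R * R) : R := complex.Im (u x).

Definition derivC u (v x : R * R) : R[i] :=
  ('D_v (reF u) x +i* 'D_v (imF u) x)%C.

Definition laplacianC u (x : R * R) : R[i] :=
  (laplacian (reF u) x +i* laplacian (imF u) x)%C.

Definition radial_deriv u (x : R * R) : R[i] :=
  derivC u ((eucl x)^-1 *: x) x.

Definition helmholtz_on A (k : R) u : Prop :=
  [/\ C2_on A (reF u), C2_on A (imF u) &
      forall x, A x -> laplacianC u x + (k ^+ 2)%:C%C * u x = 0].

(* Uniform in the direction x / r. *)
Definition sommerfeld (k : R) u : Prop :=
  forall eps : R, 0 < eps -> exists A : R, forall x, A < eucl x ->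
    `|(Num.sqrt (eucl x))%:C%C * (radial_deriv u x - 'i%C * k%:C%C * u x)|
      < eps%:C%C.

(* Classical solution: C^2 in the exterior ~` closure S, continuous up to the
   boundary. Nothing is required of the incident field. *)
Definition scattered_field S (k : R) (ui us : R * R -> R[i]) : Prop :=
  [/\ helmholtz_on (~` closure S) k us,
      {within ~` S, continuous (reF us)} /\ {within ~` S, continuous (imF us)},
      forall x, boundary S x -> us x = - ui x &
      sommerfeld k us].

Definition analytically_continuable S u : Prop :=
  exists (D : set (R * R)) (v : R * R -> R[i]),
  [/\ open D /\ connected D, ~` S `<=` D,
      forall x, D x -> real_analytic_at (reF v) x /\ real_analytic_at (imF v) x &
      forall x, ~ S x -> v x = u x].

Definition uniformly_converges_on A (uN : nat -> R * R -> R[i]) u : Prop :=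
  forall eps : R, 0 < eps ->
  \forall N \near \oo, forall x, A x -> `|uN N x - u x| < eps%:C%C.

End Plane.

Section Bessel.
Variable R : realType.
Implicit Types (x : R) (m n : nat).

Definition euler_gamma : R :=
  limn (fun n => series (@harmonic R) n - ln n%:R).

(* The digamma function at the integer m + 1: H_m - gamma. *)
Definition digammaS m : R := series (@harmonic R) m - euler_gamma.

Definition besselJn n x : R :=
  limn (series (fun m =>
    (-1) ^+ m / (m`!%:R * (m + n)`!%:R) * (x / 2) ^+ (m.*2 + n))).

(* The usual expansion of the Bessel function of the second kind at integer
   order (x > 0):
     pi Y_n(x) = 2 ln(x/2) J_n(x)
       - sum_(m < n) (n-m-1)!/m! (x/2)^(2m-n)
       - sum_m (psi(m+1) + psi(m+n+1)) (-1)^m / (m! (m+n)!) (x/2)^(2m+n). *)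
Definition besselYn n x : R :=
  pi^-1 * (2 * ln (x / 2) * besselJn n x
    - \sum_(m < n) (n - m.+1)`!%:R / m`!%:R * (x / 2) ^+ m.*2 / (x / 2) ^+ n
    - limn (series (fun m => (digammaS m + digammaS (m + n)) *
        ((-1) ^+ m / (m`!%:R * (m + n)`!%:R)) * (x / 2) ^+ (m.*2 + n)))).

(* J_(-n) = (-1)^n J_n and Y_(-n) = (-1)^n Y_n. *)
Definition int_order (F : nat -> R -> R) (n : int) x : R :=
  match n with
  | Posz m => F m x
  | Negz m => (-1) ^+ m.+1 * F m.+1 x
  end.

Definition besselJ := int_order besselJn.
Definition besselY := int_order besselYn.

(* H_n = H_n^(1) = J_n + i Y_n. *)
Definition hankel (n : int) x : R[i] := (besselJ n x +i* besselY n x)%C.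

Definition cis (t : R) : R[i] := (cos t +i* sin t)%C.

(* The sum over n is a finitely supported sum. *)
Definition multipole_sum (k : R) (L : nat) (r theta : 'I_L -> R * R -> R)
    (beta : int -> 'I_L -> R[i]) (x : R * R) : R[i] :=
  \sum_(l < L) \sum_(n \in [set: int])
    beta n l * hankel n (k * r l x) * cis (n%:~R * theta l x).

End Bessel.

(* Main.v *)
(* The analytic continuation v of u_s satisfies the Helmholtz equation on its whole domain D, by the identity theorem.
   Let H be the outgoing fundamental solution with pole at a point x outside S. Cut the plane into the cells of a
   polar grid so fine that the cells that leave D lie in S, and sum over the cells the flux of v grad H - H grad v
   through their boundary. Cells in D contribute 0, except for the one containing x, which contributes 4 i v(x),
   while the flux through a large circle tends to 0 by the radiation condition. Hence v(x) is, up to a constant, the sum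
   of the fluxes through the finitely many remaining cells. Their edges lie in S, so that these fluxes
   are uniform limits outside S of linear combinations of multipoles with poles in S. A multipole is, at a fixed distance from
   its pole and beyond, the sum of its Taylor series in the position of the pole, whose terms are again multipoles; so its
   pole can be moved step by step along a path in S_q to one of the points O_l. *)

Require Import Defs.
From HB Require Import structures.
From mathcomp Require Import all_boot all_order all_algebra.
From mathcomp Require Import all_classical all_reals all_analysis.
From mathcomp Require Import complex ring lra zify.
Set Implicit Arguments.
Unset Strict Implicit.
Unset Printing Implicit Defensive.
Import Order.TTheory GRing.Theory Num.Theory.
Import numFieldNormedType.Exports.
Local Open Scope classical_set_scope.
Local Open Scope ring_scope.
Import ComplexField.Normc.

(** * Integrals over a segment *)

(** The Hankel functions are given by their expansions at the origin, which do not show their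
    behaviour at infinity, whereas the proof needs the radiating behaviour of the fundamental
    solution and bounds on H_n away from the pole. Both come from order 0: J_0 and Y_0 are
    identified with integrals over a quarter circle and a half-line, because both sides solve the
    same second-order equation and agree near 0; it is in this comparison that Euler's constant
    matters. The Wronskian then yields the decay of H_0 and the flux around the pole (the constant 4
    i), and the recurrence yields the growth n! B^n of H_n. Because of this growth, a pole can be
    moved by a step whose length depends on its distance to the region but not on n. The grid is
    polar because its cells are rectangles in the variables (r, t), where Green's formula reduces to
    differentiation under an integral sign, and because its outer boundary is a circle, to which the
    radiation condition applies directly. *)

Notation mu := (@lebesgue_measure _).

Section Calculus.
Variable R : realType.
Implicit Types (f g F : R -> R) (a b c x : R).

Lemma within_cont (f : R -> R) a b : (forall x, a <= x <= b -> {for x, continuous f}) ->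
  {within `[a, b], continuous f}.
Proof.
move=> h; apply: continuous_in_subspaceT => x; rewrite inE /= in_itv /=; exact: h.
Qed.

Lemma is_derive_cont (f : R -> R) x d : is_derive x 1 f d -> {for x, continuous f}.
Proof. by move=> [h _]; apply: differentiable_continuous; apply/derivable1_diffP. Qed.

Lemma mvt f (df : R -> R) a b : a <= b -> (forall x, a <= x <= b -> is_derive x 1 f (df x)) ->
  exists2 c, a <= c <= b & f b - f a = df c * (b - a).
Proof.
move=> ab h; have [||c] := @MVT_segment _ f df a b ab; first 1 last.
- apply: within_cont => x xab; exact: is_derive_cont (h x xab).
- by rewrite in_itv /= => cab ->; exists c.
- move=> x; rewrite in_itv /= => /andP[ax xb]; apply: h; rewrite !ltW//.
Qed.

Lemma der0_eq f a b : a <= b -> (forall x, a <= x <= b -> is_derive x 1 f 0) -> f b = f a.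
Proof. by move=> ab h; have [c _] := mvt ab h; rewrite mul0r => /subr0_eq. Qed.

Definition Int a b f : R := \int[mu]_(x in `[a, b]) f x.

Lemma integrable_itv a b f : {within `[a, b], continuous f} -> mu.-integrable `[a, b] (EFin \o f).
Proof. by move=> h; apply: continuous_compact_integrable => //; exact: segment_compact. Qed.

Lemma IntD a b f g : {within `[a, b], continuous f} -> {within `[a, b], continuous g} ->
  Int a b (fun x => f x + g x) = Int a b f + Int a b g.
Proof. by move=> hf hg; apply: RintegralD => //; exact: integrable_itv. Qed.

Lemma IntZ a b r f : {within `[a, b], continuous f} -> Int a b (fun x => r * f x) = r * Int a b f.
Proof. by move=> hf; apply: RintegralZl => //; exact: integrable_itv. Qed.

Lemma IntB a b f g : {within `[a, b], continuous f} -> {within `[a, b], continuous g} ->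
  Int a b (fun x => f x - g x) = Int a b f - Int a b g.
Proof. by move=> hf hg; apply: RintegralB => //; exact: integrable_itv. Qed.

Lemma eq_Int a b f g : (forall x, a <= x <= b -> f x = g x) -> Int a b f = Int a b g.
Proof. by move=> h; apply: eq_Rintegral => x; rewrite inE /= in_itv /=; exact: h. Qed.

Lemma Int_cst a b r : a <= b -> Int a b (fun=> r) = r * (b - a).
Proof.
move=> ab; rewrite /Int Rintegral_cst//= lebesgue_measure_itv /= lte_fin.
case: ltP => // ba; have -> : a = b by apply/eqP; rewrite eq_le ab.
by rewrite subrr.
Qed.

Lemma le_Int a b f g : {within `[a, b], continuous f} -> {within `[a, b], continuous g} ->
  (forall x, a <= x <= b -> f x <= g x) -> Int a b f <= Int a b g.
Proof.
move=> hf hg h; apply: le_Rintegral => //.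
- exact: integrable_itv.
- exact: integrable_itv.
Qed.

Lemma cst_within a b (r : R) : {within `[a, b], continuous (fun=> r)}.
Proof. by apply: continuous_subspaceT => x; exact: cst_continuous. Qed.

Lemma Int_bound a b f M : a <= b -> {within `[a, b], continuous f} ->
  (forall x, a <= x <= b -> `|f x| <= M) -> `|Int a b f| <= M * (b - a).
Proof.
move=> ab hf h; rewrite ler_norml -mulNr -!Int_cst//.
apply/andP; split; apply: le_Int => //; try exact: cst_within.
  by move=> x /h; rewrite ler_norml => /andP[].
by move=> x /h; rewrite ler_norml => /andP[].
Qed.

Lemma Int_split a b c f : a <= c -> c <= b -> {within `[a, b], continuous f} ->
  Int a b f = Int a c f + Int c b f.
Proof.
move=> ac cb hf.
have hi := integrable_itv hf.
have := @Rintegral_itvB R f (BLeft a) (BRight b) c hi.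
rewrite !bnd_simp => /(_ ac cb) h.
rewrite /Int.
have -> : \int[mu]_(x in `[c, b]) f x = \int[mu]_(x in `]c, b]) f x.
  rewrite Rintegral_itv_obnd_cbnd//; apply: integrableS hi => //.
  by apply: subset_itvr; rewrite bnd_simp.
by rewrite -h addrC subrK.
Qed.

Lemma Int_xx a f : Int a a f = 0.
Proof. by rewrite /Int set_itv1 Rintegral_set1. Qed.

Lemma Int_FTC a b f F : a <= b -> (forall x, a <= x <= b -> is_derive x 1 F (f x)) ->
  {within `[a, b], continuous f} -> Int a b f = F b - F a.
Proof.
rewrite le_eqVlt => /predU1P[<- _ _|ab h hf]; first by rewrite Int_xx subrr.
rewrite /Int /Rintegral (@continuous_FTC2 R f F a b ab hf)//.
- split.
  + move=> x; rewrite in_itv /= => /andP[ax xb].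
    by have [] := h x; rewrite ?ltW.
  + by apply: cvg_at_right_filter; apply: is_derive_cont (h a _); rewrite lexx ltW.
  + by apply: cvg_at_left_filter; apply: is_derive_cont (h b _); rewrite lexx ltW.
- move=> x; rewrite in_itv /= => /andP[ax xb].
  by rewrite derive1E; apply: derive_val; apply: h; rewrite !ltW.
Qed.

End Calculus.

(** * Bessel functions as entire series *)

Lemma is_derive_ext (R : numFieldType) (V W : normedModType R) (f g : V -> W) x v d d' :
  is_derive x v f d -> f =1 g -> d = d' -> is_derive x v g d'.
Proof. by move=> h /funext <- <-. Qed.

Lemma nbhs_gtr (R : realFieldType) (a t : R) : a < t -> \forall x \near t, a < x.
Proof. by move=> h; apply: (@cvgr_gt _ _ (nbhs t) _ id t) => //; exact: cvg_id. Qed.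

Section PowerSeries.
Variable R : realType.
Implicit Types (c d : nat -> R) (t x : R).

(** The slack [2 ^+ m] over 1/m! absorbs the harmonic numbers in the coefficients of Y_n; the series
    still converges everywhere, by comparison with exp(2 |t|). *)
Definition entire_coef c := exists K : R, forall m, `|c m| <= K * (2 ^+ m / m`!%:R).

Definition psum c t : R := limn (pseries c t).

Lemma cvg_psum c t : entire_coef c -> pseries c t @ \oo --> psum c t.
Proof.
move=> [K hK].
have K0 : 0 <= K by have := hK 0; rewrite expr0 fact0 divr1 mulr1; apply: le_trans.
rewrite /psum; suff : cvgn (pseries c t) by [].
apply: normed_cvg; rewrite /normed_series_of.
apply: (@series_le_cvg _ _ (fun m => K * exp_coeff (2 * `|t|) m)) => [m|m|m|].
- exact: normr_ge0.
- by rewrite mulr_ge0// exp_coeff_ge0// mulr_ge0.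
- rewrite /= normrM normrX /exp_coeff /= exprMn.
  apply: le_trans (ler_wpM2r _ (hK m)) _; first exact: exprn_ge0.
  by rewrite le_eqVlt; apply/orP; left; apply/eqP; ring.
- have -> : series (fun m => K * exp_coeff (2 * `|t|) m) =
    (fun n => K * series (exp_coeff (2 * `|t|)) n).
    by apply/funext => n; rewrite /series /= mulr_sumr.
  apply: is_cvgM; first exact: is_cvg_cst.
  exact: is_cvg_series_exp_coeff.
Qed.

Lemma entire_coef_diffs c : entire_coef c -> entire_coef (pseries_diffs c).
Proof.
move=> [K hK]; exists (2 * K) => m; rewrite /pseries_diffs normrM ger0_norm//.
apply: (le_trans (ler_wpM2l _ (hK m.+1))) => //.
rewrite factS natrM exprS invfM.
have m1 : m.+1%:R != 0 :> R by rewrite pnatr_eq0.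
have mf : (m`!)%:R != 0 :> R by rewrite pnatr_eq0 -lt0n fact_gt0.
rewrite le_eqVlt; apply/orP; left; apply/eqP; field.
by rewrite mf -natr1 addrC in m1 *.
Qed.

Lemma entire_coefS c : entire_coef c -> entire_coef (fun m => c m.+1).
Proof.
move=> [K hK]; exists (2 * K) => i; apply: le_trans (hK i.+1) _.
have K0 : 0 <= K by have := hK 0; rewrite expr0 fact0 divr1 mulr1; apply: le_trans.
rewrite (mulrC 2) -mulrA ler_wpM2l// exprS -mulrA ler_wpM2l// ler_wpM2l// ?exprn_ge0//.
by rewrite lef_pV2 ?posrE ?ltr0n ?fact_gt0// ler_nat factS leq_pmull.
Qed.

Lemma entire_coefD c d : entire_coef c -> entire_coef d -> entire_coef (fun m => c m + d m).
Proof.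
move=> [K hK] [L hL]; exists (K + L) => m; rewrite mulrDl.
by apply: le_trans (ler_normD _ _) _; exact: lerD.
Qed.

Lemma entire_coefZ a c : entire_coef c -> entire_coef (fun m => a * c m).
Proof.
move=> [K hK]; exists (`|a| * K) => m.
by rewrite normrM -mulrA; apply: ler_wpM2l.
Qed.

Lemma psumD c d t : entire_coef c -> entire_coef d ->
  psum (fun m => c m + d m) t = psum c t + psum d t.
Proof.
move=> hc hd; apply/cvg_lim => //.
have -> : pseries (fun m => c m + d m) t = pseries c t \+ pseries d t.
  by apply/funext => n; rewrite /pseries /series /= -big_split; apply: eq_bigr => i _ /=; rewrite mulrDl.
by apply: cvgD; exact: cvg_psum.
Qed.

Lemma psumZ a c t : entire_coef c -> psum (fun m => a * c m) t = a * psum c t.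
Proof.
move=> hc; apply/cvg_lim => //.
have -> : pseries (fun m => a * c m) t = (fun n => a * pseries c t n).
  by apply/funext => n; rewrite /pseries /series /= mulr_sumr; apply: eq_bigr => i _ /=; rewrite mulrA.
by apply: cvgM; [exact: cvg_cst|exact: cvg_psum].
Qed.

Lemma psum_recl c t : entire_coef c -> entire_coef (fun m => c m.+1) ->
  psum c t = c 0%N + t * psum (fun m => c m.+1) t.
Proof.
move=> hc hd; apply/cvg_lim => //.
rewrite -(cvg_shiftn 1).
have -> : (fun n => pseries c t (n + 1)%N) = (fun n => c 0%N + t * pseries (fun m => c m.+1) t n).
  apply/funext => n; rewrite addn1 /pseries /series /= big_nat_recl// expr0 mulr1 mulr_sumr.
  by congr (_ + _); apply: eq_bigr => i _; rewrite exprS mulrCA.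
by apply: cvgD; [exact: cvg_cst|apply: cvgM; [exact: cvg_cst|exact: cvg_psum]].
Qed.

Lemma is_derive_psum c t : entire_coef c -> is_derive t 1 (psum c) (psum (pseries_diffs c) t).
Proof.
move=> hc; apply: (@pseries_snd_diffs _ c (`|t| + 1)).
- by apply/cvg_ex; eexists; exact: cvg_psum.
- by apply/cvg_ex; eexists; apply: cvg_psum; exact: entire_coef_diffs.
- by apply/cvg_ex; eexists; apply: cvg_psum; do 2 apply: entire_coef_diffs.
- by rewrite (@ger0_norm _ (`|t| + 1)) ?addr_ge0// ltrDl.
Qed.

Lemma psum0 c : entire_coef c -> psum c 0 = c 0%N.
Proof.
move=> hc; apply/cvg_lim => //; apply: cvg_near_cst; near=> n.
rewrite /pseries /series /=.
have n0 : (0 < n)%N by near: n; exists 1%N.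
rewrite -(prednK n0) big_nat_recl// expr0 mulr1 big1 ?addr0// => i _.
by rewrite exprS mul0r mulr0.
Unshelve. all: by end_near.
Qed.

End PowerSeries.

(** * The series of J_n and Y_n in the variable t = (s/2)^2 *)

Section BesselSeries.
Variable R : realType.
Implicit Types (n m : nat) (t x s : R).

Definition jcoef n m : R := (-1) ^+ m / (m`!%:R * (m + n)`!%:R).
Definition qcoef n m : R := (digammaS R m + digammaS R (m + n)) * jcoef n m.

Lemma fact_neq0 m : (m`!)%:R != 0 :> R.
Proof. by rewrite pnatr_eq0 -lt0n fact_gt0. Qed.

Lemma jcoef_le n m : `|jcoef n m| <= (m`!)%:R^-1.
Proof.
rewrite /jcoef normrM normrX normrN1 expr1n mul1r invfM normrM.
rewrite !ger0_norm ?invr_ge0// ler_piMr// ?invr_ge0//.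
by rewrite invf_le1 ?ltr0n ?fact_gt0// ler1n fact_gt0.
Qed.

Lemma entire_jcoef n : entire_coef (jcoef n).
Proof.
exists 1 => m; rewrite mul1r; apply: le_trans (jcoef_le n m) _.
by rewrite ler_peMl ?invr_ge0// exprn_ege1// ler1n.
Qed.

Lemma digammaS_le m : `|digammaS R m| <= m%:R + `|euler_gamma R|.
Proof.
rewrite /digammaS; apply: le_trans (ler_normB _ _) _; rewrite lerD2r.
rewrite /series /=; apply: le_trans (ler_norm_sum _ _ _) _.
rewrite -[leRHS]mulr1 -[X in (X%:R * _)]subn0 mulr_natl -sumr_const_nat.
apply: ler_sum => i _; rewrite /harmonic ger0_norm ?invr_ge0//.
by rewrite invf_le1 ?ler1n ?ltr0n.
Qed.

Lemma entire_qcoef n : entire_coef (qcoef n).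
Proof.
pose K := 2 + n%:R + 2 * `|euler_gamma R|; exists K => m.
rewrite /qcoef normrM.
have K0 : 0 <= K by rewrite /K !addr_ge0 ?mulr_ge0.
have -> : K * (2 ^+ m / m`!%:R) = (K * 2 ^+ m) / m`!%:R by rewrite mulrA.
apply: ler_pM => //; last exact: jcoef_le.
apply: le_trans (ler_normD _ _) _; apply: le_trans (lerD (digammaS_le _) (digammaS_le _)) _.
rewrite natrD.
have h1 : 1 <= 2 ^+ m :> R by rewrite exprn_ege1// ler1n.
have h2 : m%:R <= 2 ^+ m :> R by rewrite -natrX ler_nat ltnW// ltn_expl.
have n0 : 0 <= n%:R :> R by [].
have g0 := normr_ge0 (euler_gamma R).
rewrite /K; nra.
Qed.

(** J_n(s) is (s/2)^n times [bj n] at t = (s/2)^2, and likewise for Y_n and [by_]. After division by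
    (s/2)^n, differentiation in t raises the order and produces no other term; the power split off
    later combines with e^(i n theta) into a power of the complex coordinate. *)
Definition bj n t : R := psum (jcoef n) t.
Definition bq n t : R := psum (qcoef n) t.
Definition by_ n t : R :=
  pi^-1 * (ln t * bj n t - \sum_(m < n) (n - m.+1)`!%:R / m`!%:R * t ^+ m / t ^+ n - bq n t).

Lemma besselJnE n s : besselJn n s = (s / 2) ^+ n * bj n ((s / 2) ^+ 2).
Proof.
rewrite /besselJn; apply/cvg_lim => //.
have -> : series (fun m => (-1) ^+ m / (m`!%:R * (m + n)`!%:R) * (s / 2) ^+ (m.*2 + n)) =
  (fun N => (s / 2) ^+ n * pseries (jcoef n) ((s / 2) ^+ 2) N).
  apply/funext => N; rewrite /pseries /series /= mulr_sumr; apply: eq_bigr => i _.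
  by rewrite -exprM mul2n exprD mulrCA mulrC mulrA /jcoef (mulrC (_ ^+ _ / _)).
by apply: cvgM; [exact: cvg_cst|apply: cvg_psum; exact: entire_jcoef].
Qed.

Lemma besselYnE n s : 0 < s -> besselYn n s = (s / 2) ^+ n * by_ n ((s / 2) ^+ 2).
Proof.
move=> s0; rewrite /besselYn besselJnE /by_ [RHS]mulrCA; congr (_ * _).
have w0 : 0 < s / 2 by rewrite divr_gt0.
rewrite lnXn// !mulrBr; congr (_ - _ - _).
- by rewrite -mulr_natl; ring.
- rewrite mulr_sumr; apply: eq_bigr => i _.
  rewrite -!exprM mul2n.
  have -> : (s / 2) ^+ (2 * n) = (s / 2) ^+ n * (s / 2) ^+ n by rewrite -exprD addnn mul2n.
  have wn : (s / 2) ^+ n != 0 by rewrite expf_neq0// gt_eqF.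
  move: wn; set W := (s / 2) ^+ n; set V := (s / 2) ^+ _ => wn.
  by field; rewrite wn fact_neq0.
- apply/cvg_lim => //.
  have -> : series (fun m => (digammaS R m + digammaS R (m + n)) *
      ((-1) ^+ m / (m`!%:R * (m + n)`!%:R)) * (s / 2) ^+ (m.*2 + n)) =
    (fun N => (s / 2) ^+ n * pseries (qcoef n) ((s / 2) ^+ 2) N).
    apply/funext => N; rewrite /pseries /series /= mulr_sumr; apply: eq_bigr => i _.
    by rewrite -exprM mul2n exprD mulrCA mulrC mulrA /qcoef /jcoef (mulrC (_ ^+ n)).
  by apply: cvgM; [exact: cvg_cst|apply: cvg_psum; exact: entire_qcoef].
Qed.

Lemma jcoefS n m : m.+1%:R * jcoef n m.+1 = - jcoef n.+1 m.
Proof.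
rewrite /jcoef factS natrM exprS addSnnS.
have := fact_neq0 m; have := fact_neq0 (m + n.+1).
have : m.+1%:R != 0 :> R by rewrite pnatr_eq0.
by move=> h1 h2 h3; field; rewrite h2 h3 addrC natr1 h1.
Qed.

Lemma is_derive_bj n t : is_derive t 1 (bj n) (- bj n.+1 t).
Proof.
have := @is_derive_psum _ _ t (entire_jcoef n).
suff -> : psum (pseries_diffs (jcoef n)) t = - bj n.+1 t by [].
have -> : pseries_diffs (jcoef n) = (fun m => - 1 * jcoef n.+1 m).
  by apply/funext => m; rewrite /pseries_diffs jcoefS mulN1r.
by rewrite psumZ ?mulN1r//; exact: entire_jcoef.
Qed.

Lemma digammaSS m : digammaS R m.+1 = digammaS R m + m.+1%:R^-1.
Proof. by rewrite /digammaS /series /= big_nat_recr//= addrAC. Qed.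

(** The digamma values grow by 1/(m+1) from [m] to [m.+1]; these increments sum to the extra term
    (bj n t - bj n 0) / t, where bj n 0 = 1/n!. *)
Lemma is_derive_bq n t : t != 0 ->
  is_derive t 1 (bq n) (- bq n.+1 t + (bj n t - (n`!)%:R^-1) / t).
Proof.
move=> t0.
have := @is_derive_psum _ _ t (entire_qcoef n).
suff -> : psum (pseries_diffs (qcoef n)) t = - bq n.+1 t + (bj n t - (n`!)%:R^-1) / t by [].
have ej m : entire_coef (fun i => jcoef m i.+1) by exact: entire_coefS (entire_jcoef m).
have -> : pseries_diffs (qcoef n) = (fun m => - 1 * qcoef n.+1 m + jcoef n m.+1).
  apply/funext => m; rewrite /pseries_diffs /qcoef mulrCA jcoefS digammaSS.
  have -> : jcoef n m.+1 = - m.+1%:R^-1 * jcoef n.+1 m.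
    rewrite mulNr -mulrN -jcoefS mulrA mulVf ?mul1r//.
  by rewrite addSnnS; ring.
rewrite psumD; [|apply: entire_coefZ; exact: entire_qcoef|exact: ej].
rewrite psumZ ?mulN1r; last exact: entire_qcoef.
congr (_ + _).
rewrite /bj (psum_recl t (entire_jcoef n) (ej n)).
have -> : jcoef n 0 = (n`!)%:R^-1 by rewrite /jcoef expr0 fact0 add0n mul1r mul1r.
by rewrite (addrC (_^-1)) addrK mulrC mulKf.
Qed.

Lemma is_derive_powB m n t : t != 0 ->
  is_derive t 1 (fun x => x ^+ m / x ^+ n) ((m%:R - n%:R) * t ^+ m / t ^+ n.+1).
Proof.
move=> t0.
have tn : t ^+ n != 0 by rewrite expf_neq0.
have dX k : is_derive t 1 (fun x : R => x ^+ k) (k%:R * t ^+ k.-1).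
  have := is_deriveX k (is_derive_id t 1).
  move=> h; apply: (is_derive_ext h) => [x|]; first by rewrite fctE.
  by rewrite /GRing.scale /= mulr1.
have h := is_deriveM (dX m) (@is_deriveV _ (fun x : R => x ^+ n) t _ 1 tn (dX n)).
apply: (is_derive_ext h) => //; rewrite /GRing.scale /=.
rewrite (exprS t n); set a := m%:R; set b := n%:R; set A := t ^+ n in tn *.
have -> : a * t ^+ m.-1 = a * t ^+ m / t.
  by rewrite /a; case: (m) => [|k]; rewrite ?mul0r//= exprS; field.
have -> : b * t ^+ n.-1 = b * A / t.
  by rewrite /b /A; case: (n) => [|k]; rewrite ?mul0r//= exprS; field.
by field; rewrite t0 tn.
Qed.

(** The derivative of ln t produces bj n t / t, which cancels against the extra term of
    [is_derive_bq]. What remains, 1/(n! t), is the summand m = n by which the finite sum of order n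
    + 1 is longer. *)
Lemma is_derive_by n t : 0 < t -> is_derive t 1 (by_ n) (- by_ n.+1 t).
Proof.
move=> t0; have tn0 : t != 0 by rewrite gt_eqF.
pose S (x : R) := \sum_(m < n) (n - m.+1)`!%:R / m`!%:R * x ^+ m / x ^+ n.
pose S' := \sum_(m < n) (n - m)`!%:R / m`!%:R * t ^+ m / t ^+ n.+1.
have dS : is_derive t 1 S (- S').
  rewrite /S /S'.
  have -> : (fun x : R => \sum_(m < n) (n - m.+1)`!%:R / m`!%:R * x ^+ m / x ^+ n) =
    \sum_(m < n) (fun x => (n - m.+1)`!%:R / m`!%:R * (x ^+ m / x ^+ n)).
    by apply/funext => x; rewrite fct_sumE; apply: eq_bigr => m _; rewrite mulrA.
  have := @is_derive_sum R R R n (fun m : 'I_n => fun x => (n - m.+1)`!%:R / m`!%:R * (x ^+ m / x ^+ n)) t 1 _ (fun m : 'I_n => is_deriveZ ((n - m.+1)`!%:R / m`!%:R) (is_derive_powB m n tn0)).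
  move=> h; refine (is_derive_eq h _).
  rewrite -sumrN; apply: eq_bigr => m _.
  have -> : (n - m = (n - m.+1).+1)%N by rewrite subnSK.
  rewrite factS natrM.
  have -> : (n - m.+1).+1%:R = n%:R - m%:R :> R by rewrite subnSK// natrB// ltnW.
  by rewrite /GRing.scale /=; ring.
have dl := is_derive1_ln t0.
have dj := is_derive_bj n t.
have dq := is_derive_bq n tn0.
have := is_deriveZ (pi^-1 : R) (is_deriveB (is_deriveB (is_deriveM dl dj) dS) dq).
move=> h; refine (is_derive_eq h _).
rewrite /by_ /S' big_ord_recr /= subnn fact0 /GRing.scale /= exprS.
have tn : t ^+ n != 0 by rewrite expf_neq0.
have nf := fact_neq0 n.

have -> : \sum_(i < n) (n.+1 - i.+1)`!%:R / i`!%:R * t ^+ i / (t * t ^+ n) =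
   \sum_(m < n) (n - m)`!%:R / m`!%:R * t ^+ m / (t * t ^+ n) by [].
rewrite invfM; set p1 : R := pi^-1; set X := bj _ _; set Y := bj _ _.
by field; rewrite nf tn0 tn.
Qed.

Section CylinderFamily.
(* The renormalised cylinder functions g_n(t) = C_n(s) / (s/2)^n, t = (s/2)^2. *)
Definition cyl_family (g : nat -> R -> R) :=
  (forall n t, 0 < t -> is_derive t 1 (g n) (- g n.+1 t)) /\
  (forall n t, 0 < t -> t * g n.+2 t = n.+1%:R * g n.+1 t - g n t).

(** Differentiating the recurrence at [n] gives the recurrence at [n.+1], so the case n = 0 is
    enough. *)
Lemma cyl_familyP (g : nat -> R -> R) :
  (forall n t, 0 < t -> is_derive t 1 (g n) (- g n.+1 t)) ->
  (forall t, 0 < t -> t * g 2%N t = g 1%N t - g 0 t) -> cyl_family g.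
Proof.
move=> dg g2; split=> //; elim => [t t0|n IH t t0]; first by rewrite mul1r g2.
have e : {near t, (fun x => x * g n.+2 x) =1 (fun x => n.+1%:R * g n.+1 x - g n x)}.
  by near=> x; apply: IH; near: x; exact: nbhs_gtr.
have d1 : is_derive t 1 (fun x => x * g n.+2 x) (g n.+2 t - t * g n.+3 t).
  have h := is_deriveM (is_derive_id t 1) (dg n.+2 t t0).
  by apply: (is_derive_ext h) => //; rewrite /GRing.scale /=; ring.
have d2 : is_derive t 1 (fun x => n.+1%:R * g n.+1 x - g n x) (- n.+1%:R * g n.+2 t + g n.+1 t).
  have h := is_deriveB (is_deriveZ n.+1%:R (dg n.+1 t t0)) (dg n t t0).
  by apply: (is_derive_ext h) => //; rewrite /GRing.scale /=; ring.
have d3 := near_eq_is_derive e d1.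
have := @derive_val _ _ _ _ _ _ _ d3; rewrite (@derive_val _ _ _ _ _ _ _ d2) => h.
by rewrite -(natr1 n.+1); lra.
Unshelve. all: by end_near.
Qed.

End CylinderFamily.

Lemma cyl_bj : cyl_family bj.
Proof.
refine (cyl_familyP (fun n t _ => is_derive_bj n t) _) => t t0.
have e1 := entire_jcoef 1; have e0 := entire_jcoef 0.
have e2 := entire_jcoef 2.
pose c m := jcoef 1 m + - 1 * jcoef 0 m.
(* The constant terms of the two series cancel, so their difference is [t] times the shifted series,
   which is that of order 2. *)
have cS : (fun m => c m.+1) = jcoef 2.
  apply/funext => m; rewrite /c /jcoef !addnS !addn0 exprS !factS !natrM.
  have := fact_neq0 m; have : m.+1%:R != 0 :> R by rewrite pnatr_eq0.
  have : m.+2%:R != 0 :> R by rewrite pnatr_eq0.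
  rewrite -[m.+2%:R]natr1 -[m.+1%:R]natr1 => h1 h2 h3; field.
  by rewrite h1 h2 h3.
have ec : entire_coef c by apply: entire_coefD => //; exact: entire_coefZ.
have : psum c t = bj 1 t - bj 0 t.
  by rewrite /c psumD ?psumZ ?mulN1r//; exact: entire_coefZ.
move=> <-; rewrite (psum_recl t ec) cS//.
by rewrite /c /jcoef /= fact0 !expr0 /=; rewrite -/(bj 2%N t); ring.
Qed.

Lemma cyl_by : cyl_family by_.
Proof.
refine (cyl_familyP is_derive_by _) => t t0.
have e1 := entire_qcoef 1; have e0 := entire_qcoef 0.
have e2 := entire_qcoef 2.
pose c m := qcoef 1 m + - 1 * qcoef 0 m.
have cS : (fun m => c m.+1) = qcoef 2.
  apply/funext => m; rewrite /c /qcoef /jcoef !addnS !addn0 exprS !factS !natrM.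
  rewrite (digammaSS m.+1) !(digammaSS m).
  have := fact_neq0 m; have : m.+1%:R != 0 :> R by rewrite pnatr_eq0.
  have : m.+2%:R != 0 :> R by rewrite pnatr_eq0.
  rewrite -[m.+2%:R]natr1 -[m.+1%:R]natr1 => h1 h2 h3; field.
  by rewrite h1 h2 h3.
have ec : entire_coef c by apply: entire_coefD => //; exact: entire_coefZ.
have h : psum c t = bq 1 t - bq 0 t.
  by rewrite /c psumD ?psumZ ?mulN1r//; exact: entire_coefZ.
(* Here a constant term psi(2) - psi(1) = 1 is left over; the finite sums of orders 1 and 2
   compensate it. *)
have {}h : bq 1 t - bq 0 t = 1 + t * bq 2%N t.
  rewrite -h (psum_recl t ec) cS//; congr (_ + _).
  rewrite /c /qcoef /jcoef !add0n (digammaSS 0) !expr0 (_ : (1`!)%N = 1%N)// fact0 !mulr1 !invr1.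
  by rewrite !mulr1; ring.
have hj := cyl_bj.2 0%N t t0; rewrite mul1r in hj.
have tn0 : t != 0 by rewrite gt_eqF.
rewrite /by_ big_ord0 big_ord1 !big_ord_recr big_ord0 /=.
rewrite !subnn subn1 /= (_ : (1`!)%N = 1%N)// fact0 expr0 expr1 invr1.
have -> : bq 1 t = bq 0 t + 1 + t * bq 2%N t by lra.
have -> : bj 1 t = bj 0 t + t * bj 2%N t by lra.

by set p1 : R := pi^-1; field; rewrite tn0.
Qed.

End BesselSeries.

(** * Integrals over a half-line *)

Section HalfLine.
Variable R : realType.
Implicit Types (f g F : R -> R) (C d t x : R).

Definition HInt f : R := \int[mu]_(t in `[0, +oo[) f t.

Lemma expN_cvg0 d : 0 < d -> expR (- (d * t)) @[t --> +oo] --> (0 : R).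
Proof.
move=> d0; have h : (d * t) @[t --> +oo] --> +oo by exact: gt0_cvgMry.
exact: (cvg_comp _ _ h (@cvgr_expR R)).
Qed.

Lemma is_derive_expN d t : is_derive t 1 (fun t => expR (- (d * t))) (- d * expR (- (d * t))).
Proof.
have h1 : is_derive t 1 (fun t : R => - d * t) (- d).
  have h := is_deriveZ (- d) (is_derive_id t 1).
  by apply: (is_derive_ext h) => //; rewrite /GRing.scale /= mulr1.
have h := is_derive1_comp (is_derive_expR (- d * t)) h1.
by apply: (is_derive_ext h) => [x|]; rewrite /= mulNr// mulrC.
Qed.

Lemma FTC_half_ge0 f F : (forall t, 0 <= t -> 0 <= f t) -> continuous f ->
  (forall t, is_derive t 1 F (f t)) -> F t @[t --> +oo] --> 0 ->
  (\int[mu]_(t in `[(0:R)%R, +oo[) (f t)%:E)%E = (- F 0)%:E.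
Proof.
move=> f0 cf dF F0.
rewrite (@ge0_continuous_FTC2y R f F 0 0)//.
- by rewrite sub0e.
- by apply: continuous_subspaceT.
- by apply: cvg_at_right_filter; exact: is_derive_cont (dF 0).
- by move=> x _; rewrite derive1E; have := dF x => h; rewrite derive_val.
Qed.

Lemma exp_half d : 0 < d ->
  (\int[mu]_(t in `[(0:R)%R, +oo[) (expR (- (d * t)))%:E = (d^-1)%:E)%E.
Proof.
move=> d0.
have dn : d != 0 by rewrite gt_eqF.
have h1 t : is_derive t 1 (fun t => - d^-1 * expR (- (d * t))) (expR (- (d * t))).
  have h := is_deriveZ (- d^-1) (is_derive_expN d t).
  by apply: (is_derive_ext h) => //; rewrite /GRing.scale /= mulrA mulrNN mulVf ?mul1r.
have h2 : - d^-1 * expR (- (d * t)) @[t --> +oo] --> (0 : R).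
  by rewrite -[X in _ --> X](mulr0 (- d^-1)); apply: cvgM; [exact: cvg_cst|exact: expN_cvg0].
have h3 : continuous (fun t => expR (- (d * t))).
  by move=> t; exact: is_derive_cont (is_derive_expN d t).
have h4 t : 0 <= t -> 0 <= expR (- (d * t)) by move=> _; exact: expR_ge0.
by rewrite (FTC_half_ge0 h4 h3 h1 h2) mulr0 oppr0 expR0 mulr1 opprK.
Qed.

Lemma exp_half_integrable C d : 0 < d -> mu.-integrable `[0, +oo[ (EFin \o (fun t => C * expR (- (d * t)))).
Proof.
move=> d0.
have -> : EFin \o (fun t => C * expR (- (d * t))) = (fun t => (C%:E * (expR (- (d * t)))%:E)%E).
  by apply/funext.
apply: integrableZl => //.
apply/integrableP; split.
  apply/measurable_realfun.measurable_EFinP; apply: measurable_funTS; apply: measurable_realfun.continuous_measurable_fun.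
  by move=> t; exact: is_derive_cont (is_derive_expN d t).
under eq_integral do rewrite /= ger0_norm ?expR_ge0//.
by rewrite exp_half// ltry.
Qed.

Lemma half_integrable f C d : continuous f -> 0 < d ->
  (forall t, 0 <= t -> `|f t| <= C * expR (- (d * t))) -> mu.-integrable `[0, +oo[ (EFin \o f).
Proof.
move=> cf d0 h; apply: (le_integrable _ _ _ (exp_half_integrable C d0)) => //.
- apply/measurable_realfun.measurable_EFinP; apply: measurable_funTS; exact: measurable_realfun.continuous_measurable_fun.
- move=> t; rewrite /= in_itv /= andbT => t0; rewrite lee_fin.
  by rewrite (le_trans (h t t0))// ler_norm.
Qed.

Lemma HInt_exp C d : 0 < d -> HInt (fun t => C * expR (- (d * t))) = C / d.
Proof.
move=> d0; rewrite /HInt RintegralZl//.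
  by rewrite /Rintegral exp_half.
have := exp_half_integrable 1 d0; congr (integrable _ _ _).
by apply/funext => t /=; rewrite mul1r.
Qed.

Lemma HInt_bound f C d : continuous f -> 0 < d ->
  (forall t, 0 <= t -> `|f t| <= C * expR (- (d * t))) -> `|HInt f| <= C / d.
Proof.
move=> cf d0 h; have hi := half_integrable cf d0 h.
apply: (le_trans (le_normr_Rintegral _ hi)) => //.
rewrite -(HInt_exp C d0); apply: le_Rintegral => //.
- exact: integrable_norm.
- exact: exp_half_integrable.
- by move=> t; rewrite /= in_itv /= andbT; exact: h.
Qed.

(** The fundamental theorem on the half-line is applied to nonnegative integrands: the exponential
    dominating [f] is added first, and its integral C / d is removed afterwards. *)
Lemma HInt_FTC f F C d : continuous f -> 0 < d ->
  (forall t, 0 <= t -> `|f t| <= C * expR (- (d * t))) ->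
  (forall t, is_derive t 1 F (f t)) -> F t @[t --> +oo] --> 0 -> HInt f = - F 0.
Proof.
move=> cf d0 h dF F0.
have dn : d != 0 by rewrite gt_eqF.
have cg : continuous (fun t => C * expR (- (d * t))).
  by move=> t; apply: cvgM; [exact: cvg_cst|exact: is_derive_cont (is_derive_expN d t)].
have h1 t : is_derive t 1 (fun t => F t + - (C / d) * expR (- (d * t))) (f t + C * expR (- (d * t))).
  have h1 := is_deriveD (dF t) (is_deriveZ (- (C / d)) (is_derive_expN d t)).
  by apply: (is_derive_ext h1) => //; rewrite /GRing.scale /=; congr (_ + _); field.
have h2 : F t + - (C / d) * expR (- (d * t)) @[t --> +oo] --> (0 : R).
  rewrite -[X in _ --> X](addr0 0); apply: cvgD => //.
  by rewrite -[X in _ --> X](mulr0 (- (C / d))); apply: cvgM; [exact: cvg_cst|exact: expN_cvg0].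
have h3 : continuous (fun t => f t + C * expR (- (d * t))).
  by move=> t; apply: cvgD; [exact: cf|exact: cg].
have h4 t : 0 <= t -> 0 <= f t + C * expR (- (d * t)).
  by move=> /h; rewrite ler_norml => /andP[h5 _]; rewrite addrC -[f t]opprK subr_ge0 lerNl.
have H : HInt (fun t => f t + C * expR (- (d * t))) = - F 0 + C / d.
  rewrite /HInt /Rintegral (FTC_half_ge0 h4 h3 h1 h2).
  by rewrite mulr0 oppr0 expR0 mulr1 opprD opprK.
move: H; rewrite /HInt RintegralD//.
- by rewrite -/(HInt _) -/(HInt _) HInt_exp// => /addIr.
- exact: half_integrable h.
- exact: exp_half_integrable.
Qed.

End HalfLine.

(** * Differentiation under the integral sign *)

Section UnderIntegral.
Variable R : realType.

Implicit Types (x t : R).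

Lemma is_derive_under (B : set R) (f df : R -> R -> R) (G : R -> R) (a u v : R) :
  measurable B -> u < a < v ->
  (forall x, u < x < v -> mu.-integrable B (EFin \o f x)) ->
  (forall x t, u < x < v -> B t -> is_derive x 1 (f ^~ t) (df x t)) ->
  (forall t, 0 <= G t) -> mu.-integrable B (EFin \o G) ->
  (forall x t, u < x < v -> B t -> `|df x t| <= G t) ->
  is_derive a 1 (fun x => \int[mu]_(t in B) f x t) (\int[mu]_(t in B) df a t).
Proof.
move=> mB uav fi dfx G0 iG Gb.
have Ia : `]u, v[%classic a by rewrite /= in_itv.
have fi' x : `]u, v[%classic x -> mu.-integrable B (EFin \o f x) by rewrite /= in_itv /=; exact: fi.
have dd x t : `]u, v[%classic x -> B t -> derivable (f ^~ t) x 1 by rewrite /= in_itv /= => ux Bt; have [] := dfx x t ux Bt.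
have p1 x t : u < x < v -> B t -> partial1of2 f x t = df x t.
  by move=> ux Bt; have h := dfx x t ux Bt; rewrite partial1of2E derive_val.
have bb x t : `]u, v[%classic x -> B t -> `|partial1of2 f x t| <= G t.
  by rewrite /= in_itv /= => ux Bt; rewrite p1// Gb.
have h1 := @derivable_under_integral R _ _ (@lebesgue_measure R) f B mB a u v Ia fi' dd G G0 iG bb.
have h2 := @differentiation_under_integral R _ _ (@lebesgue_measure R) f B mB a u v Ia fi' dd G G0 iG bb.
apply: (DeriveDef h1); rewrite -derive1E h2; apply: eq_Rintegral => t.
by rewrite inE => Bt; rewrite p1.
Qed.

End UnderIntegral.

(** * Two integrals of Bessel type *)

Section CircularMeans.
Variable R : realType.
Implicit Types (p q : R -> R) (s x t a : R) (m : nat).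

(** For m = 0 this is pi/2 times J_0(s) if p = cos, and pi/2 times the Struve function of order 0 if
    p = sin. Each derivative in [s] brings a factor cos t, counted by [m]. *)
Definition cmean m p s : R := Int 0 (pi / 2) (fun t => cos t ^+ m * p (s * cos t)).

Lemma pihalf_ge0 : 0 <= pi / 2 :> R.
Proof. by rewrite divr_ge0// pi_ge0. Qed.

Lemma is_derive_mulcos s t : is_derive t 1 (fun t => s * cos t) (- s * sin t).
Proof.
have h := is_deriveZ s (is_derive_cos t).
by apply: (is_derive_ext h) => //; rewrite /GRing.scale /= mulrN mulNr.
Qed.

Lemma cmean_cont m p s : continuous p -> continuous (fun t => cos t ^+ m * p (s * cos t)).
Proof.
move=> cp t; apply: cvgM.
  apply: (@continuous_comp _ _ _ cos (fun x => x ^+ m)); first exact: continuous_cos.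
  exact: exprn_continuous.
apply: (@continuous_comp _ _ _ (fun t => s * cos t) p); last exact: cp.
exact: is_derive_cont (is_derive_mulcos s t).
Qed.

Lemma within_cmean m p s a b : continuous p ->
  {within `[a, b], continuous (fun t => cos t ^+ m * p (s * cos t))}.
Proof. by move=> cp; apply: continuous_subspaceT; exact: cmean_cont. Qed.

Lemma is_derive_cmean m p q s : (forall x, is_derive x 1 p (q x)) -> (forall x, `|q x| <= 1) ->
  is_derive s 1 (cmean m p) (cmean m.+1 q s).
Proof.
move=> dp q1.
have cp : continuous p by move=> x; exact: is_derive_cont (dp x).
apply: (@is_derive_under _ `[0, pi / 2]%classic (fun s t => cos t ^+ m * p (s * cos t))
  (fun s t => cos t ^+ m.+1 * q (s * cos t)) (fun=> 1) s (s - 1) (s + 1)) => //.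
- by rewrite ltrBlDr ltrDl ltr01.
- by move=> x _; apply: integrable_itv; exact: within_cmean.
- move=> x t _ _.
  have h0 : is_derive x 1 (fun x => x * cos t) (cos t).
    have h := is_deriveM (is_derive_id x 1) (is_derive_cst (cos t) x 1).
    by apply: (is_derive_ext h) => //; rewrite /GRing.scale /= mulr0 add0r mulr1.
  have h := is_deriveZ (cos t ^+ m) (@is_derive1_comp _ p (fun x => x * cos t) x _ _ (dp (x * cos t)) h0).
  by apply: (is_derive_ext h) => //; rewrite /GRing.scale /= exprS; ring.
- by apply: integrable_itv; exact: cst_within.
- move=> x t _ _; rewrite normrM normrX mulr_ile1 ?exprn_ge0//.
  by rewrite exprn_ile1// cos_max.
Qed.

(** The integrand is the derivative of sin t * p (s cos t), with sin^2 rewritten as 1 - cos^2. For p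
    = sin and p = cos this is, up to sign, Bessel's equation of order 0 for the mean of [q], with
    [p 0] as right-hand side. *)
Lemma cmean_parts p q s : (forall x, is_derive x 1 p (q x)) -> continuous q ->
  cmean 1 p s - s * cmean 0 q s + s * cmean 2 q s = p 0.
Proof.
move=> dp cq.
have cp : continuous p by move=> x; exact: is_derive_cont (dp x).
have dF t : is_derive t 1 (fun t => sin t * p (s * cos t))
    (cos t ^+ 1 * p (s * cos t) - s * (cos t ^+ 0 * q (s * cos t)) + s * (cos t ^+ 2 * q (s * cos t))).
  have h := is_deriveM (is_derive_sin t) (@is_derive1_comp _ p (fun t => s * cos t) t _ _ (dp (s * cos t)) (is_derive_mulcos s t)).
  apply: (is_derive_ext h) => //; rewrite /GRing.scale /= expr0 expr1.
  have -> : cos t ^+ 2 = 1 - sin t ^+ 2 by rewrite -(cos2Dsin2 t) addrK.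
  by ring.
have c0 := @within_cmean 0 q s 0 (pi / 2) cq.
have c1 := @within_cmean 1 p s 0 (pi / 2) cp.
have c2 := @within_cmean 2 q s 0 (pi / 2) cq.
have cZ (f : R -> R) : {within `[0, pi / 2], continuous f} -> {within `[0, pi / 2], continuous (fun t => s * f t)}.
  by move=> cf x; apply: cvgM; [exact: cvg_cst|exact: cf].
have cB : {within `[0, pi / 2], continuous (fun t => cos t ^+ 1 * p (s * cos t) - s * (cos t ^+ 0 * q (s * cos t)))}.
  by move=> x; apply: cvgB; [exact: c1|exact: (cZ _ c0)].
have := @Int_FTC R 0 (pi / 2) _ _ pihalf_ge0 (fun t _ => dF t) _.
rewrite sin_pihalf cos_pihalf sin0 mulr0 mul0r subr0 mul1r => <-.
  by rewrite (IntD cB (cZ _ c2)) (IntB c1 (cZ _ c0)) (IntZ s c0) (IntZ s c2).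
by move=> x; apply: cvgD; [exact: cB|exact: (cZ _ c2)].
Qed.

(** On the quarter circle the phase s cos t is stationary at t = 0 only, where the factor 1 - cos t
    of the difference vanishes; hence one integration by parts gains 1/s. *)
Lemma cmean_diff_bound p q s : 0 < s -> (forall x, is_derive x 1 p (q x)) -> continuous q ->
  (forall x, `|p x| <= 1) -> `|cmean 0 q s - cmean 1 q s| <= (1 + pi / 2) / s.
Proof.
move=> s0 dp cq p1.
have cp : continuous p by move=> x; exact: is_derive_cont (dp x).
have sn0 : s != 0 by rewrite gt_eqF.
have cpos t : 0 <= t <= pi / 2 -> 0 <= cos t.
  move=> /andP[t0 tp]; apply: cos_ge0_pihalf; rewrite tp andbT (le_trans _ t0)// oppr_le0 pihalf_ge0//.
pose T t : R := sin t / (1 + cos t).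
have c1 t : 0 <= t <= pi / 2 -> 1 + cos t != 0 by move=> /cpos h; rewrite gt_eqF// ltr_pwDl.
have dT t : 0 <= t <= pi / 2 -> is_derive t 1 T (1 + cos t)^-1.
  move=> ht; have h1 := is_deriveD (is_derive_cst (1:R) t 1) (is_derive_cos t).
  have h2 := is_deriveM (is_derive_sin t) (@is_deriveV _ (fun t => 1 + cos t) t _ 1 (c1 t ht) h1).
  apply: (is_derive_ext h2) => //; rewrite /GRing.scale /= add0r.
  have -> : sin t * (- (1 + cos t) ^- 2 * - sin t) = sin t ^+ 2 / (1 + cos t) ^+ 2 by ring.
  have -> : sin t ^+ 2 = 1 - cos t ^+ 2 by rewrite -(cos2Dsin2 t) addrC addKr.
  by field; exact: c1.
pose r t : R := s^-1 * (p (s * cos t) / (1 + cos t)).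
have dF t : 0 <= t <= pi / 2 -> is_derive t 1 (fun t => - s^-1 * (T t * p (s * cos t)))
    (cos t ^+ 0 * q (s * cos t) - cos t ^+ 1 * q (s * cos t) - r t).
  move=> ht; have h := is_deriveZ (- s^-1) (is_deriveM (dT t ht) (@is_derive1_comp _ p (fun t => s * cos t) t _ _ (dp (s * cos t)) (is_derive_mulcos s t))).
  apply: (is_derive_ext h) => //; rewrite /GRing.scale /= expr0 expr1 /r /T.
  have e : sin t * sin t = (1 + cos t) * (1 - cos t).
    by have := cos2Dsin2 t; rewrite !expr2; nra.
  have -> : - s^-1 * (sin t / (1 + cos t) * (q (s * cos t) * (- s * sin t)) + p (s * cos t) / (1 + cos t)) =
     (sin t * sin t) / (1 + cos t) * q (s * cos t) - s^-1 * (p (s * cos t) / (1 + cos t)).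
    by field; rewrite sn0 c1.
  by rewrite e; field; rewrite sn0 c1.
have cr : {within `[0, pi / 2], continuous r}.
  apply: within_cont => t ht; apply: cvgM; first exact: cvg_cst.
  apply: cvgM.
    apply: (@continuous_comp _ _ _ (fun t => s * cos t) p); last exact: cp.
    exact: is_derive_cont (is_derive_mulcos s t).
  apply: cvgV; first exact: c1.
  by apply: cvgD; [exact: cvg_cst|exact: continuous_cos].
have w0 := @within_cmean 0 q s 0 (pi / 2) cq.
have w1 := @within_cmean 1 q s 0 (pi / 2) cq.
have wB : {within `[0, pi / 2], continuous (fun t => cos t ^+ 0 * q (s * cos t) - cos t ^+ 1 * q (s * cos t))}.
  by move=> x; apply: cvgB; [exact: w0|exact: w1].
have := @Int_FTC R 0 (pi / 2) _ _ pihalf_ge0 dF _.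
rewrite IntB// IntB// -/(cmean 0 q s) -/(cmean 1 q s).
rewrite /T sin_pihalf cos_pihalf sin0 mul0r !mul0r mulr0 addr0 invr1 !mul1r mulr0 subr0.
move=> /(_ _)/eqP; rewrite subr_eq => /(_ _)/eqP -> //; last first.
  by move=> x; apply: cvgB; [exact: wB|exact: cr].
rewrite [leRHS]mulrDl mul1r; apply: le_trans (ler_normD _ _) _; apply: lerD.
  by rewrite normrM normrN (gtr0_norm (_ : 0 < s^-1)) ?invr_gt0// ler_piMr// invr_ge0 ltW.
apply: le_trans (Int_bound pihalf_ge0 cr (_ : forall x, 0 <= x <= pi / 2 -> `|r x| <= s^-1)) _.
  move=> t ht; rewrite /r normrM (gtr0_norm (_ : 0 < s^-1)) ?invr_gt0//.
  rewrite ler_piMr ?invr_ge0 ?(ltW s0)// normrM mulr_ile1//.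
  rewrite normfV invf_le1 ?normr_gt0 ?c1// ger0_norm ?addr_ge0 ?cpos//.
  by rewrite lerDl cpos.
by rewrite subr0 mulrC.
Qed.

End CircularMeans.

(** * Laplace transform of (1 + t^2)^(-1/2) *)

Section LaplaceT.
Variable R : realType.
Implicit Types (s x t a : R) (m : nat).

Definition rt t : R := Num.sqrt (1 + t ^+ 2).

Lemma rt_gt0 t : 0 < rt t.
Proof. by rewrite sqrtr_gt0 ltr_pwDl// sqr_ge0. Qed.

Lemma rt_ge1 t : 1 <= rt t.
Proof. by rewrite -[leLHS]sqrtr1 ler_wsqrtr// lerDl sqr_ge0. Qed.

Lemma rt_sqr t : rt t ^+ 2 = 1 + t ^+ 2.
Proof. by rewrite sqr_sqrtr// addr_ge0// sqr_ge0. Qed.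

Lemma le_rt t : 0 <= t -> t <= rt t.
Proof. by move=> t0; rewrite -[leLHS](ger0_norm t0) -sqrtr_sqr ler_wsqrtr// lerDr. Qed.

Lemma rt_le t : 0 <= t -> rt t <= 1 + t.
Proof.
move=> t0; rewrite -(@ler_pXn2r _ 2)// ?nnegrE ?addr_ge0// ?(ltW (rt_gt0 _))//.
by rewrite rt_sqr; nra.
Qed.

Lemma is_derive_rt t : is_derive t 1 rt (t / rt t).
Proof.
have h1 : is_derive t 1 (fun t => 1 + t ^+ 2) (2 * t).
  have h := is_deriveD (is_derive_cst (1:R) t 1) (is_deriveM (is_derive_id t 1) (is_derive_id t 1)).
  by apply: (is_derive_ext h) => //; rewrite /GRing.scale /=; ring.
have p : 0 < 1 + t ^+ 2 by rewrite ltr_pwDl// sqr_ge0.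
have h := @is_derive1_comp _ Num.sqrt (fun t => 1 + t ^+ 2) t _ _ (is_derive1_sqrt p) h1.
apply: (is_derive_ext h) => //; rewrite -/(rt t).
by field; rewrite gt_eqF// rt_gt0.
Qed.

(** For m = 0 this is pi/2 times the Struve function of order 0 minus Y_0; [m] counts derivatives in
    [s], up to sign. *)
Definition Tint m s : R := HInt (fun t => t ^+ m / rt t * expR (- (s * t))).

Lemma Tint_cont m s : continuous (fun t => t ^+ m / rt t * expR (- (s * t))).
Proof.
move=> t; apply: cvgM; last exact: is_derive_cont (is_derive_expN s t).
apply: cvgM; first by apply: exprn_continuous.
by apply: cvgV; [rewrite gt_eqF// rt_gt0|exact: is_derive_cont (is_derive_rt t)].
Qed.

Lemma texp_le a t : 0 < a -> 0 <= t -> t * expR (- (a * t)) <= a^-1.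
Proof.
move=> a0 t0; rewrite -ler_pdivlMr ?expR_gt0// -expRN opprK.
rewrite -ler_pdivrMl ?invr_gt0// invrK.
by apply: le_trans (expR_ge1Dx _); rewrite lerDr.
Qed.

(** Half of the exponential decay is given up to absorb the one power of t that is left when m = 2.
    The bound is uniform for s >= a, as domination under the integral requires. *)
Lemma Tint_le m s a t : 0 < a -> a <= s -> 0 <= t -> (m <= 2)%N ->
  `|t ^+ m / rt t * expR (- (s * t))| <= (1 + (a / 2)^-1) * expR (- (a / 2 * t)).
Proof.
move=> a0 as_ t0 m2.
have rt0 := rt_gt0 t; have rt1 := rt_ge1 t; have rt2 := le_rt t0.
have e0 := expR_gt0 (- (a / 2 * t)).
have es : expR (- (s * t)) <= expR (- (a / 2 * t)) * expR (- (a / 2 * t)).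
  rewrite -expRD ler_expR; have : a * t <= s * t by rewrite ler_wpM2r.
  lra.
have e1 : expR (- (a / 2 * t)) <= 1 by rewrite -expR0 ler_expR oppr_le0 mulr_ge0// divr_ge0// ltW.
have h := @texp_le (a / 2) t (divr_gt0 a0 (ltr0Sn R 1)) t0.
have i0 : 0 <= (a / 2)^-1 by rewrite invr_ge0 divr_ge0// ltW.
have q0 : 0 <= t ^+ m / rt t by rewrite divr_ge0 ?exprn_ge0// ltW.
rewrite ger0_norm; last by rewrite mulr_ge0// expR_ge0.
apply: le_trans (ler_wpM2l q0 es) _; rewrite mulrA ler_wpM2r ?(ltW e0)//.
have [m1|m1] := leqP m 1.
  have : t ^+ m / rt t <= 1.
    rewrite ler_pdivrMr// mul1r; case: m m1 {m2 q0} => [|[|//]] _; by rewrite ?expr0 ?expr1.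
  move=> hq; apply: (@le_trans _ _ (1 * 1)); first by apply: ler_pM => //; exact: ltW.
  by rewrite mulr1 lerDl.
have -> : m = 2%N by apply/eqP; rewrite eqn_leq m2.
apply: (@le_trans _ _ (t * expR (- (a / 2 * t)))).
  rewrite ler_wpM2r ?(ltW e0)// ler_pdivrMr// expr2 ler_wpM2l//.
by rewrite (le_trans h)// lerDr.
Qed.

Lemma is_derive_Tint m s : 0 < s -> (m <= 1)%N -> is_derive s 1 (Tint m) (- Tint m.+1 s).
Proof.
move=> s0 m1; pose a := s / 2.
have a0 : 0 < a by rewrite divr_gt0.
have a20 : 0 < a / 2 by rewrite divr_gt0.
have h : is_derive s 1 (Tint m) (HInt (fun t => - 1 * (t ^+ m.+1 / rt t * expR (- (s * t))))).
  apply: (@is_derive_under _ `[0, +oo[%classic (fun s t => t ^+ m / rt t * expR (- (s * t)))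
    (fun s t => - 1 * (t ^+ m.+1 / rt t * expR (- (s * t))))
    (fun t => (1 + (a / 2)^-1) * expR (- (a / 2 * t))) s a (s + 1)) => //.
  - by rewrite /a ltrDl ltr01 andbT ltr_pdivrMr// ltr_pMr// ltr1n.
  - move=> x /andP[ax _]; apply: (half_integrable (Tint_cont (m:=m) (s:=x)) a20) => t t0.
    by apply: Tint_le => //; [exact: ltW|exact: leq_trans m1 _].
  - move=> x t _ _.
    have h0 := is_derive_expN t x.
    have h := is_deriveZ (t ^+ m / rt t) h0.
    apply: (is_derive_ext h) => [y|]; first by rewrite (mulrC y).
    by rewrite /GRing.scale /= exprS (mulrC x); ring.
  - by move=> t; rewrite mulr_ge0 ?expR_ge0// addr_ge0// invr_ge0 ltW.
  - exact: exp_half_integrable.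
  - move=> x t /andP[ax _]; rewrite /= in_itv /= andbT => t0.
    by rewrite mulN1r normrN; apply: Tint_le => //; exact: ltW.
have -> : - Tint m.+1 s = HInt (fun t => - 1 * (t ^+ m.+1 / rt t * expR (- (s * t)))) => //.
rewrite -[LHS]mulN1r /Tint /HInt RintegralZl//.
apply: (@half_integrable _ _ (1 + (a / 2)^-1) _ (Tint_cont (m:=m.+1) (s:=s)) a20) => t t0.
by apply: Tint_le => //; rewrite ler_pdivrMr// ler_pMr// ler1n.
Qed.

Lemma Tint_bound m s : 0 < s -> (m <= 1)%N -> `|Tint m s| <= s^-1.
Proof.
move=> s0 m1; rewrite -[leRHS]mul1r; apply: HInt_bound => //; first exact: Tint_cont.
move=> t t0; rewrite normrM (ger0_norm (expR_ge0 _)) ler_wpM2r ?expR_ge0//.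
have rt0 := rt_gt0 t; have rt1 := rt_ge1 t; have rt2 := le_rt t0.
rewrite ger0_norm ?divr_ge0 ?exprn_ge0 ?(ltW rt0)//.
by rewrite ler_pdivrMr// mul1r; case: m m1 => [|[|//]] _; rewrite ?expr0 ?expr1.
Qed.

(** The integrand is the derivative of rt t * exp(- s t), because rt t = (1 + t^2) / rt t; the value
    -1 comes from the end t = 0. *)
Lemma Tint_parts s : 0 < s -> Tint 1 s - s * Tint 0 s - s * Tint 2 s = - 1.
Proof.
move=> s0; have s20 : 0 < s / 2 by rewrite divr_gt0.
have Tl m t : (m <= 2)%N -> 0 <= t -> `|t ^+ m / rt t * expR (- (s * t))| <=
   (1 + (s / 2)^-1) * expR (- (s / 2 * t)) by move=> m2 t0; exact: Tint_le.
pose f t := t ^+ 1 / rt t * expR (- (s * t)) - s * (t ^+ 0 / rt t * expR (- (s * t)))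
   - s * (t ^+ 2 / rt t * expR (- (s * t))).
have iT m : (m <= 2)%N -> mu.-integrable `[0, +oo[ (EFin \o (fun t => t ^+ m / rt t * expR (- (s * t)))).
  by move=> m2; apply: (half_integrable (Tint_cont (m:=m) (s:=s)) s20) => t; exact: Tl.
have iZ m : (m <= 2)%N -> mu.-integrable `[0, +oo[ (EFin \o (fun t => s * (t ^+ m / rt t * expR (- (s * t))))).
  move=> m2; have -> : (EFin \o (fun t => s * (t ^+ m / rt t * expR (- (s * t))))) =
    (fun t => (s%:E * (t ^+ m / rt t * expR (- (s * t)))%:E)%E) by apply/funext.
  by apply: integrableZl => //; exact: iT.
have -> : Tint 1 s - s * Tint 0 s - s * Tint 2 s = HInt f.
  rewrite /HInt /f RintegralB//; last exact: iZ.
  - rewrite RintegralB//; [|exact: iT|exact: iZ].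
    by rewrite !RintegralZl//; exact: iT.
  - have := integrableB _ (iT 1%N isT) (iZ 0%N isT); apply => //.
have cZ m : continuous (fun t => s * (t ^+ m / rt t * expR (- (s * t)))).
  by move=> t; apply: cvgM; [exact: cvg_cst|exact: Tint_cont].
have dF t : is_derive t 1 (fun t => rt t * expR (- (s * t))) (f t).
  have h := is_deriveM (is_derive_rt t) (is_derive_expN s t).
  apply: (is_derive_ext h) => //; rewrite /GRing.scale /= /f expr1 expr0.
  have r0 : rt t != 0 by rewrite gt_eqF// rt_gt0.
  have -> : t ^+ 2 = rt t ^+ 2 - 1 by rewrite rt_sqr; ring.
  by field.
rewrite (@HInt_FTC R f (fun t => rt t * expR (- (s * t))) ((1 + s + s) * (1 + (s / 2)^-1)) (s / 2))//.
- by rewrite /rt expr0n /= addr0 sqrtr1 mul1r mulr0 oppr0 expR0.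
- move=> t; apply: cvgB; last exact: cZ.
  by apply: cvgB; [exact: Tint_cont|exact: cZ].
- move=> t t0; rewrite /f -[leRHS]mulrA [leRHS]mulrDl [X in _ <= X + _]mulrDl [X in _ <= X + _ + _]mul1r.
  apply: le_trans (ler_normB _ _) _; apply: lerD.
    apply: le_trans (ler_normB _ _) _; apply: lerD; first exact: Tl.
    by rewrite normrM gtr0_norm// ler_wpM2l ?(ltW s0)//; exact: Tl.
  by rewrite normrM gtr0_norm// ler_wpM2l ?(ltW s0)//; exact: Tl.
- apply: (@squeeze_cvgr _ _ _ _ (fun=> 0) (fun t => (1 + (s / 2)^-1) * expR (- (s / 2 * t)))).
  + near=> t; have t0 : 0 <= t by near: t; exact: nbhs_pinfty_ge.
    rewrite mulr_ge0 ?(ltW (rt_gt0 _)) ?expR_ge0//=.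
    have e : expR (- (s * t)) = expR (- (s / 2 * t)) * expR (- (s / 2 * t)).
      by rewrite -expRD; congr expR; field.
    rewrite e mulrA ler_wpM2r ?expR_ge0//.
    have e1 : expR (- (s / 2 * t)) <= 1 by rewrite -[leRHS]expR0 ler_expR oppr_le0 (mulr_ge0 (ltW s20)).
    apply: le_trans (ler_wpM2r (expR_ge0 _) (rt_le t0)) _.
    by rewrite mulrDl mul1r lerD// texp_le.
  + exact: cvg_cst.
  + rewrite -[X in _ --> X](mulr0 (1 + (s / 2)^-1)).
    by apply: cvgM; [exact: cvg_cst|exact: expN_cvg0].
Unshelve. all: by end_near.
Qed.

End LaplaceT.

(** * Bessel functions of order 0 near the origin *)

Section Bessel0.
Variable R : realType.
Implicit Types (s x t a : R) (d w : R -> R).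

(* [(s d')' + s d = c] with [w = s d']: Bessel's equation of order 0. *)
Definition bessel0 (d w : R -> R) (c : R) :=
  forall s, 0 < s -> is_derive s 1 d (w s / s) /\ is_derive s 1 w (c - s * d s).

(** For the family g of a cylinder function C, these are C_0(s) and s C_0'(s). *)
Definition cylZ (g : nat -> R -> R) s : R := g 0%N ((s / 2) ^+ 2).
Definition cylW (g : nat -> R -> R) s : R := - (2 * ((s / 2) ^+ 2 * g 1%N ((s / 2) ^+ 2))).

Lemma is_derive_sqhalf s : is_derive s 1 (fun s => (s / 2) ^+ 2) (s / 2).
Proof.
have h1 : is_derive s 1 (fun s : R => s / 2) 2^-1.
  have h := is_deriveZ (2^-1 : R) (is_derive_id s 1).
  by apply: (is_derive_ext h) => [x|]; rewrite /GRing.scale /= ?mulr1// mulrC.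
have h := is_deriveM h1 h1.
by apply: (is_derive_ext h) => //; rewrite /GRing.scale /=; field.
Qed.

Lemma sqhalf_gt0 s : 0 < s -> 0 < (s / 2) ^+ 2.
Proof. by move=> s0; rewrite exprn_gt0// divr_gt0. Qed.

Lemma bessel0_cyl g : cyl_family g -> bessel0 (cylZ g) (cylW g) 0.
Proof.
move=> [dg rg] s s0; have t0 := sqhalf_gt0 s0.
have sn : s != 0 by rewrite gt_eqF.
split.
  have h := @is_derive1_comp _ (g 0%N) (fun s => (s / 2) ^+ 2) s _ _ (dg 0%N _ t0) (is_derive_sqhalf s).
  by apply: (is_derive_ext h) => //; rewrite /cylW; field.
have h1 := @is_derive1_comp _ (g 1%N) (fun s => (s / 2) ^+ 2) s _ _ (dg 1%N _ t0) (is_derive_sqhalf s).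
have h := is_deriveN (is_deriveZ (2 : R) (is_deriveM (is_derive_sqhalf s) h1)).
apply: (is_derive_ext h) => //; rewrite /GRing.scale /= /cylZ.
have := rg 0%N _ t0; rewrite mul1r.
set G0 := g 0%N _; set G1 := g 1%N _; set G2 := g 2%N _ => e.
have -> : (s / 2) ^+ 2 * (- G2 * (s / 2)) = - ((s / 2) ^+ 2 * G2) * (s / 2) by ring.
by rewrite e; field.
Qed.

Lemma bessel0_wronskian d w d' w' : bessel0 d w 0 -> bessel0 d' w' 0 ->
  forall s x, 0 < s -> 0 < x -> d s * w' s - w s * d' s = d x * w' x - w x * d' x.
Proof.
move=> h h' s x.
wlog sx : s x / s <= x => [W|s0 x0].
  by move=> s0 x0; case: (leP s x) => sx; [exact: W|rewrite (W x s)// ltW].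
apply/esym; apply: (@der0_eq R (fun s => d s * w' s - w s * d' s) s x sx) => y /andP[sy yx].
have y0 : 0 < y by exact: lt_le_trans sy.
have [dd dw] := h y y0; have [dd' dw'] := h' y y0.
have H := is_deriveB (is_deriveM dd dw') (is_deriveM dw dd').
apply: (is_derive_ext H) => //; rewrite /GRing.scale /=.
by field; rewrite gt_eqF.
Qed.

(** With q = x^(1/4), |ln x| = 4 ln(1/q) and ln(1/q) <= 1/q. *)
Lemma sqrt_ln_le x : 0 < x -> x <= 1 -> Num.sqrt x * `|ln x| <= 4 * Num.sqrt (Num.sqrt x).
Proof.
move=> x0 x1; set q := Num.sqrt (Num.sqrt x).
have q0 : 0 < q by rewrite !sqrtr_gt0.
have xq : x = q ^+ 4.
  by rewrite (_ : 4 = 2 * 2)%N// exprM !sqr_sqrtr ?sqrtr_ge0 ?ltW.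
have q1 : q <= 1 by rewrite /q -[leRHS]sqrtr1 ler_wsqrtr// -[leRHS]sqrtr1 ler_wsqrtr.
have -> : Num.sqrt x = q ^+ 2 by rewrite sqr_sqrtr// sqrtr_ge0.
rewrite {1}xq lnXn// ler0_norm; last by rewrite mulrn_wle0// ln_le0.
have : - ln q <= q^-1.
  rewrite -lnV ?posrE//; apply: le_trans (ltW (ln_sublinear _)) _ => //; by rewrite invr_gt0.
move=> h.
have h2 : q * - ln q <= 1 by apply: le_trans (ler_wpM2l (ltW q0) h) _; rewrite mulfV// gt_eqF.
by rewrite -mulr_natl; nra.
Qed.

Lemma cvg_id0 : x @[x --> (0:R)^'+] --> (0:R).
Proof. exact: cvg_at_right_filter. Qed.

Lemma cvg_sqrt0 : Num.sqrt x @[x --> (0:R)^'+] --> (0:R).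
Proof. by rewrite -{2}(sqrtr0 R); apply: cvg_at_right_filter; exact: sqrt_continuous. Qed.

Lemma cvg_sqrtln : Num.sqrt x * ln x @[x --> (0:R)^'+] --> (0:R).
Proof.
apply/cvgr0Pnorm_le => e e0.
have h : 4 * Num.sqrt (Num.sqrt x) @[x --> (0:R)^'+] --> (0:R).
  rewrite -[X in _ --> X](mulr0 4); apply: cvgM; first exact: cvg_cst.
  rewrite -[X in _ --> X](sqrtr0 R).
  by apply: (@continuous_cvg _ _ _ _ _ Num.sqrt); [exact: sqrt_continuous|exact: cvg_sqrt0].
have hh := cvgr_le 0 h e e0.
near=> x.
have x0 : 0 < x by near: x; exact: nbhs_right_gt.
rewrite normrM ger0_norm ?sqrtr_ge0//; apply: le_trans (sqrt_ln_le x0 _) _.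
  by near: x; apply: nbhs_right_le.
by near: x; exact: hh.
Unshelve. all: by end_near.
Qed.

Lemma cvg_bj0 n : bj n x @[x --> (0:R)^'+] --> (n`!%:R^-1 : R).
Proof.
have -> : (n`!%:R^-1 : R) = bj n 0.
  by rewrite /bj psum0; [rewrite /jcoef expr0 fact0 add0n mul1r mul1r|exact: entire_jcoef].
by apply: cvg_at_right_filter; exact: is_derive_cont (is_derive_bj n 0).
Qed.

Lemma cvg_bq0 n : bq n x @[x --> (0:R)^'+] --> (digammaS R 0 + digammaS R n) / n`!%:R.
Proof.
have -> : (digammaS R 0 + digammaS R n) / n`!%:R = bq n 0.
  by rewrite /bq psum0; [rewrite /qcoef /jcoef expr0 fact0 add0n mul1r mul1r|exact: entire_qcoef].
by apply: cvg_at_right_filter; exact: (is_derive_cont (is_derive_psum 0 (entire_qcoef R n))).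
Qed.

Lemma by0E x : by_ 0 x = pi^-1 * (ln x * bj 0 x - bq 0 x).
Proof. by rewrite /by_ big_ord0 subr0. Qed.


Lemma cvg_by0 : Num.sqrt x * by_ 0 x @[x --> (0:R)^'+] --> (0:R).
Proof.
have -> : (fun x => Num.sqrt x * by_ 0 x) =
  (fun x => pi^-1 * (Num.sqrt x * ln x * bj 0 x - Num.sqrt x * bq 0 x)).
  by apply/funext => x; rewrite by0E; ring.
set b : R := (digammaS R 0 + digammaS R 0) / 0`!%:R.
rewrite [X in _ --> X](_ : 0 = pi^-1 * (0 * (0`!%:R^-1) - 0 * b) :> R); last by rewrite !mul0r subr0 mulr0.
apply: cvgM; first exact: cvg_cst.
apply: cvgB; apply: cvgM; [exact: cvg_sqrtln|exact: cvg_bj0|exact: cvg_sqrt0|exact: cvg_bq0].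
Qed.

Lemma cvg_by1 : x * by_ 1 x @[x --> (0:R)^'+] --> (- pi^-1 : R).
Proof.
set b : R := (digammaS R 0 + digammaS R 1) / 1`!%:R.
(* The factor x is split into two square roots, one of which tames the logarithm. *)
have h : pi^-1 * (Num.sqrt x * (Num.sqrt x * ln x) * bj 1 x - 1 - x * bq 1 x) @[x --> (0:R)^'+]
   --> (pi^-1 * (0 * 0 * (1`!%:R^-1) - 1 - 0 * b) : R).
  apply: cvgM; first exact: cvg_cst.
  apply: cvgB; first apply: cvgB; last by apply: cvgM; [exact: cvg_id0|exact: cvg_bq0].
    apply: cvgM; last exact: cvg_bj0.
    by apply: cvgM; [exact: cvg_sqrt0|exact: cvg_sqrtln].
  exact: cvg_cst.
have -> : - pi^-1 = pi^-1 * (0 * 0 * (1`!%:R^-1) - 1 - 0 * b) :> R by ring.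
apply: cvg_trans h; apply: near_eq_cvg; near=> x.
have x0 : 0 < x by near: x; exact: nbhs_right_gt.
have xn : x != 0 by rewrite gt_eqF.
rewrite /by_ big_ord1 subnn fact0 expr0 expr1 mulrA -expr2 sqr_sqrtr ?ltW//.
by set p1 : R := pi^-1; field.
Unshelve. all: by end_near.
Qed.

(* The left-hand side is constant; its value is read off at 0. *)
Lemma cyl_wronskian t : 0 < t -> t * (bj 0 t * by_ 1 t - bj 1 t * by_ 0 t) = - pi^-1.
Proof.
move=> t0.
pose W (x : R) := x * (bj 0 x * by_ 1 x - bj 1 x * by_ 0 x).
have cW x : 0 < x -> W x = W t.
  move=> x0; pose s := 2 * Num.sqrt x; pose s' := 2 * Num.sqrt t.
  have e (y : R) : 0 < y -> (2 * Num.sqrt y / 2) ^+ 2 = y.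
    by move=> y0; rewrite mulrAC divff ?mul1r ?sqr_sqrtr// ltW.
  have p (y : R) : 0 < y -> 0 < 2 * Num.sqrt y by move=> y0; rewrite mulr_gt0// sqrtr_gt0.
  have := bessel0_wronskian (bessel0_cyl (@cyl_bj R)) (bessel0_cyl (@cyl_by R)) (p _ x0) (p _ t0).
  by rewrite /cylZ /cylW !e// /W; nra.
have h : W x @[x --> (0:R)^'+] --> (- pi^-1 : R).
  have h : bj 0 x * (x * by_ 1 x) - Num.sqrt x * bj 1 x * (Num.sqrt x * by_ 0 x) @[x --> (0:R)^'+] -->
      (0`!%:R^-1 * - pi^-1 - 0 * 1`!%:R^-1 * 0 : R).
    apply: cvgB; apply: cvgM; [exact: cvg_bj0|exact: cvg_by1| |exact: cvg_by0].
    by apply: cvgM; [exact: cvg_sqrt0|exact: cvg_bj0].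
  rewrite [X in _ --> X](_ : _ = 0`!%:R^-1 * - pi^-1 - 0 * 1`!%:R^-1 * 0 :> R); last first.
    by rewrite fact0 invr1; ring.
  apply: cvg_trans h; apply: near_eq_cvg; near=> x.
  have x0 : 0 < x by near: x; exact: nbhs_right_gt.
  have : Num.sqrt x ^+ 2 = x by rewrite sqr_sqrtr// ltW.
  by rewrite /W; set q := Num.sqrt x => <-; ring.
have h2 : W x @[x --> (0:R)^'+] --> W t.
  apply: cvg_near_cst; near=> x; apply: cW; near: x; exact: nbhs_right_gt.
exact: (cvg_unique _ h2 h).
Unshelve. all: by end_near.
Qed.

End Bessel0.

(** * Euler's constant as an integral *)

Section EulerGamma.
Variable R : realType.
Implicit Types (t u x : R) (n N : nat).

(** [euler_gamma] is defined as a limit before its existence is known; the sequence decreases and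
    stays nonnegative. The shift by one index avoids the value of [ln] at 0. *)
Lemma gamma_cvg : (fun n => series (@harmonic R) n - ln n%:R) @ \oo --> euler_gamma R.
Proof.
have sS n : series (@harmonic R) n.+1 = series (@harmonic R) n + n.+1%:R^-1.
  by rewrite /series /= big_nat_recr.
have lnS n : n.+2%:R = n.+1%:R * (1 + n.+1%:R^-1) :> R.
  by rewrite mulrDr mulr1 mulfV ?pnatr_eq0// natr1.
have i0 n : 0 < n.+1%:R^-1 :> R by rewrite invr_gt0.
have lnD n : ln n.+2%:R = ln n.+1%:R + ln (1 + n.+1%:R^-1) :> R.
  by rewrite lnS lnM ?posrE// addr_gt0.
suff: cvgn (fun n => series (@harmonic R) n.+1 - ln n.+1%:R).
  move=> h; rewrite -(cvg_shiftS (fun n => series (@harmonic R) n - ln n%:R)).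
  suff -> : euler_gamma R = limn (fun n => series (@harmonic R) n.+1 - ln n.+1%:R) by [].
  apply/cvg_lim => //.
  by rewrite -(cvg_shiftS (fun n => series (@harmonic R) n - ln n%:R)).
apply: nonincreasing_is_cvgn.
  apply/nonincreasing_seqP => n; rewrite sS lnD opprD addrACA gerDl subr_le0.
  rewrite -[leLHS]opprK lerNl -lnV ?posrE ?addr_gt0//.
  have -> : (1 + n.+1%:R^-1)^-1 = 1 + - n.+2%:R^-1 :> R.
    rewrite lnS invfM; have := i0 n; set a := n.+1%:R => a0.
    have an : a != 0 by rewrite pnatr_eq0.
    have a1n : a + 1 != 0 by rewrite natr1 pnatr_eq0.
    by rewrite /= -/a; clearbody a; field; rewrite a1n an.
  by apply: le_ln1Dx; rewrite ltrN2 invf_lt1// ltr1n.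
exists 0 => _ [n _ <-]; rewrite subr_ge0.
have : ln n.+2%:R <= series (@harmonic R) n.+1.
  elim: n => [|n IH].
    rewrite sS /series /= big_geq// add0r invr1 (lnD 0) ln1 add0r.
    by apply: le_trans (le_ln1Dx _) _; rewrite ?invr1// (lt_trans (ltrN10 _)).
  rewrite sS lnD; apply: lerD => //; apply: le_ln1Dx.
  exact: lt_trans (ltrN10 _) (i0 _).
apply: le_trans; rewrite ler_ln ?posrE// ler_nat.
exact: leqnSn.
Qed.

Lemma le_Int_prim a b (f g : R -> R) G : a <= b -> {within `[a, b], continuous f} ->
  {within `[a, b], continuous g} -> (forall x, a <= x <= b -> is_derive x 1 G (g x)) ->
  (forall x, a <= x <= b -> f x <= g x) -> Int a b f <= G b - G a.
Proof. by move=> ab cf cg dG fg; rewrite -(Int_FTC ab dG cg); exact: le_Int. Qed.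

Lemma ge_Int_prim a b (f g : R -> R) G : a <= b -> {within `[a, b], continuous f} ->
  {within `[a, b], continuous g} -> (forall x, a <= x <= b -> is_derive x 1 G (g x)) ->
  (forall x, a <= x <= b -> g x <= f x) -> G b - G a <= Int a b f.
Proof. by move=> ab cf cg dG fg; rewrite -(Int_FTC ab dG cg); exact: le_Int. Qed.

Lemma HInt_split u (f : R -> R) : 0 <= u -> mu.-integrable `[0, +oo[ (EFin \o f) ->
  HInt f = Int 0 u f + \int[mu]_(t in `]u, +oo[) f t.
Proof.
move=> u0 fi; have := @Rintegral_itvB R f (BLeft 0) (BInfty _ false) u fi.
by rewrite !bnd_simp => /(_ u0 isT) h; rewrite /HInt -h addrC subrK.
Qed.

Definition asinh t : R := ln (t + rt t).

Lemma asinh_arg_gt0 t : 0 <= t -> 0 < t + rt t.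
Proof. by move=> t0; rewrite ltr_wpDl// rt_gt0. Qed.

Lemma is_derive_asinh t : 0 <= t -> is_derive t 1 asinh (rt t)^-1.
Proof.
move=> t0; have p := asinh_arg_gt0 t0.
have h1 := is_deriveD (is_derive_id t 1) (is_derive_rt t).
have h := @is_derive1_comp _ (@ln R) (fun t => t + rt t) t _ _ (is_derive1_ln p) h1.
apply: (is_derive_ext h) => //.
by field; rewrite !gt_eqF// rt_gt0.
Qed.

Lemma rt0 : rt 0 = 1 :> R.
Proof. by rewrite /rt expr0n addr0 sqrtr1. Qed.

(* The harmonic number of order N + 1 is the integral of (1 - (1 - t / a^2)^(N+1)) / t over [0, a^2],
   and (1 - t / a^2)^(N+1) is close to exp (- t / a). *)
Section Nfixed.
Variables (N : nat) (a : R).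
Hypothesis aE : a = N.+1%:R.
Let e t := expR (- (a^-1 * t)).
Let q t := (1 - t / a ^+ 2) ^+ N.+1.
Let h t := (a ^+ 2)^-1 * \sum_(k < N.+1) (1 - t / a ^+ 2) ^+ k.
Let Q t := \sum_(k < N.+1) k.+1%:R^-1 * (1 - t / a ^+ 2) ^+ k.+1.
Let f t := t ^+ 0 / rt t * e t.

Let a0 : 0 < a. Proof. by rewrite aE. Qed.
Let an : a != 0. Proof. by rewrite gt_eqF. Qed.
Let a1 : 1 <= a. Proof. by rewrite aE ler1n. Qed.
Let ai0 : 0 < a^-1. Proof. by rewrite invr_gt0. Qed.

Let hE t : t * h t = 1 - q t.
Proof.
have := subrX1 (1 - t / a ^+ 2) N.+1; rewrite -/(q t) => E.
rewrite /h; set s := \sum_(k < N.+1) _ in E *.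
by rewrite -[1 - q t]opprB E; field.
Qed.

Let dlin t : is_derive t 1 (fun t => 1 - t / a ^+ 2) (- (a ^+ 2)^-1).
Proof.
have H := is_deriveB (is_derive_cst (1:R) t 1) (is_deriveM (is_derive_id t 1) (is_derive_cst ((a ^+ 2)^-1) t 1)).
by apply: (is_derive_ext H) => //; rewrite /GRing.scale /=; ring.
Qed.

Let dpow k t : is_derive t 1 (fun t => (1 - t / a ^+ 2) ^+ k.+1) (- (a ^+ 2)^-1 * (k.+1%:R * (1 - t / a ^+ 2) ^+ k)).
Proof.
have H := is_deriveX k.+1 (dlin t).
by apply: (is_derive_ext H) => [x|]; [rewrite fctE|rewrite /GRing.scale /=; ring].
Qed.

Let dQ t : is_derive t 1 Q (- h t).
Proof.
have H := @is_derive_sum R R R N.+1 (fun k : 'I_N.+1 => fun t => k.+1%:R^-1 * (1 - t / a ^+ 2) ^+ k.+1) t 1 _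
  (fun k : 'I_N.+1 => is_deriveZ (k.+1%:R^-1) (dpow k t)).
apply: (is_derive_ext H) => [x|]; first by rewrite fct_sumE.
rewrite /h mulr_sumr -sumrN; apply: eq_bigr => k _; rewrite /GRing.scale /=.
have kn : k.+1%:R != 0 :> R by rewrite pnatr_eq0.
by rewrite mulrCA (mulrA (k.+1%:R^-1)) mulVf// mul1r mulNr.
Qed.

Let Q0 : Q 0 = series (@harmonic R) N.+1.
Proof.
rewrite /Q /series /= big_mkord; apply: eq_bigr => k _.
by rewrite mul0r subr0 expr1n mulr1.
Qed.

Let Qa : Q (a ^+ 2) = 0.
Proof. by rewrite /Q big1// => k _; rewrite mulfV ?expf_neq0// subrr expr0n mulr0. Qed.

Let ch : continuous h.
Proof.
move=> t; apply: cvgM; first exact: cvg_cst.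
have cp k : {for t, continuous (fun t => (1 - t / a ^+ 2) ^+ k)}.
  apply: (@continuous_comp _ _ _ (fun t => 1 - t / a ^+ 2) (fun x => x ^+ k)); last exact: exprn_continuous.
  exact: is_derive_cont (dlin t).
elim: (N.+1) => [|n IH].
  under eq_cvg do rewrite big_ord0; rewrite big_ord0; exact: cvg_cst.
under eq_cvg do rewrite big_ord_recr; rewrite big_ord_recr.
by apply: cvgD; [exact: IH|exact: cp].
Qed.

(** With u = t / a^2, the inequalities exp(-u) (1 - u^2) <= 1 - u <= exp(-u) are raised to the power
    N + 1 = a. Bernoulli's inequality gives (1 - u^2)^a >= 1 - a u^2, and a u^2 = t^2 / a^3. *)
Let eq_bounds t : 0 <= t <= a ^+ 2 -> 0 <= e t - q t <= t ^+ 2 / a ^+ 3 * e t.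
Proof.
move=> /andP[t0 ta]; pose u := t / a ^+ 2.
have a20 : 0 < a ^+ 2 by rewrite exprn_gt0.
have u0 : 0 <= u by rewrite divr_ge0// ltW.
have u1 : u <= 1 by rewrite ler_pdivrMr// mul1r.
have eE : e t = expR (- u) ^+ N.+1.
  by rewrite -expRM_natl; congr expR; rewrite /u -aE; field.
have le1 : 1 - u <= expR (- u) by exact: expR_ge1Dx.
have ge1 : expR (- u) * (1 - u ^+ 2) <= 1 - u.
  have H : (1 + u) * expR (- u) <= 1.
    by rewrite -ler_pdivlMr ?expR_gt0// mul1r -expRN opprK expR_ge1Dx.
  have : 0 <= (1 - u) * (1 - (1 + u) * expR (- u)) by rewrite mulr_ge0 ?subr_ge0.
  by set E := expR _; nra.
have B : 1 - N.+1%:R * u ^+ 2 <= (1 - u ^+ 2) ^+ N.+1.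
  have v1 : 0 <= 1 - u ^+ 2 by rewrite subr_ge0 exprn_ile1.
  elim: (N.+1) => [|n IH]; first by rewrite mul0r subr0 expr0.
  rewrite [leRHS]exprS; have : (1 - u ^+ 2) * (1 - n%:R * u ^+ 2) <= (1 - u ^+ 2) * (1 - u ^+ 2) ^+ n.
    exact: ler_wpM2l.
  apply: le_trans; rewrite -natr1.
  have : 0 <= n%:R * u ^+ 2 * u ^+ 2 by apply: mulr_ge0; [apply: mulr_ge0|]; rewrite ?ler0n ?sqr_ge0.
  by set v := u ^+ 2; set m := n%:R; nra.
have qle : q t <= e t by rewrite eE lerXn2r ?nnegrE ?subr_ge0 ?expR_ge0.
rewrite subr_ge0 qle /= lerBlDr -lerBlDl.
have : e t * (1 - u ^+ 2) ^+ N.+1 <= q t.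
  by rewrite eE -exprMn lerXn2r ?nnegrE ?mulr_ge0 ?expR_ge0 ?subr_ge0// exprn_ile1.
apply: le_trans; have e0 : 0 <= e t by exact: expR_ge0.
have -> : e t - t ^+ 2 / a ^+ 3 * e t = e t * (1 - a * u ^+ 2) by rewrite /u; field.
by rewrite aE; exact: ler_wpM2l.
Qed.

Let e_bounds t : 0 <= t -> 0 <= 1 - e t <= t / a.
Proof.
move=> t0; rewrite subr_ge0 /e -[X in _ <= X]expR0 ler_expR oppr_le0 mulr_ge0 ?(ltW ai0)//=.
rewrite lerBlDr -lerBlDl mulrC; exact: expR_ge1Dx.
Qed.

Let cf : continuous f. Proof. exact: Tint_cont. Qed.

Let cinv t : 0 < t -> {for t, continuous (fun t : R => t^-1)}.
Proof. by move=> t0; apply: cvgV => //; rewrite gt_eqF. Qed.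

Let crti : continuous (fun t : R => (rt t)^-1).
Proof. by move=> t; apply: cvgV; [rewrite gt_eqF// rt_gt0|exact: is_derive_cont (is_derive_rt t)]. Qed.

(** Near 0 the main part of the integrand is 1/rt t - h t, with primitive asinh + Q; the errors are
    nonnegative and integrate to at most 2 / a. *)
Let part1 : asinh a + Q a - Q 0 <= Int 0 a f <= asinh a + Q a - Q 0 + 2 * a^-1.
Proof.
have as0 : asinh 0 = 0 by rewrite /asinh /rt expr0n addr0 add0r sqrtr1 ln1.
have d1 t : 0 <= t <= a -> is_derive t 1 (fun t => asinh t + Q t) ((rt t)^-1 - h t).
  by move=> /andP[t0 _]; exact: is_deriveD (is_derive_asinh t0) (dQ t).
have c1 : {within `[0, a], continuous (fun t => (rt t)^-1 - h t)}.
  by apply: continuous_subspaceT => t; apply: cvgB; [exact: crti|exact: ch].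
pose up t := t / a ^+ 3 + a^-1 * (1 - t / rt t).
pose Up t := 2^-1 * t ^+ 2 / a ^+ 3 + a^-1 * (t - rt t).
have dUp t : is_derive t 1 Up (up t).
  have H1 := is_deriveZ (2^-1 / a ^+ 3 : R) (is_deriveM (is_derive_id t 1) (is_derive_id t 1)).
  have H := is_deriveD H1 (is_deriveZ (a^-1) (is_deriveB (is_derive_id t 1) (is_derive_rt t))).
  apply: (is_derive_ext H) => [x|]; rewrite /Up /up /GRing.scale /=.
    have -> : ((2^-1 / a ^+ 3) \*: (id * id) + a^-1 \*: (id - rt (R:=R))) x =
      2^-1 / a ^+ 3 * (x * x) + a^-1 * (x - rt x) by [].
    by field.
  by field; rewrite an gt_eqF// rt_gt0.
have cup : continuous up.
  move=> t; apply: cvgD; apply: cvgM; [exact: cvg_id|exact: cvg_cst|exact: cvg_cst|].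
  by apply: cvgB; [exact: cvg_cst|apply: cvgM; [exact: cvg_id|exact: crti]].
have key t : 0 <= t <= a -> (rt t)^-1 - h t <= f t /\ f t <= (rt t)^-1 - h t + up t.
  move=> /andP[t0 ta]; have r0 := rt_gt0 t; have rn : rt t != 0 by rewrite gt_eqF.
  rewrite /f expr0 mul1r.
  move: t0; rewrite le_eqVlt => /predU1P[t0|t0].
    rewrite -t0 /e /up /h mulr0 oppr0 expR0 !mul0r !subr0 !mulr1 add0r.
    have -> : \sum_(k < N.+1) (1 : R) ^+ k = a.
      by rewrite (eq_bigr (fun=> 1)) ?sumr_const ?card_ord ?aE// => k _; rewrite expr1n.
    have -> : (a ^+ 2)^-1 * a = a^-1 by field.
    by rewrite subrK lexx gerBl ltW.
  have tn : t != 0 by rewrite gt_eqF.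
  have ta2 : t <= a ^+ 2 by rewrite (le_trans ta)// ler_eXnr.
  have /andP[q1 q2] : 0 <= e t - q t <= t ^+ 2 / a ^+ 3 * e t by apply: eq_bounds; rewrite ta2 ltW.
  have /andP[e1 e2] := e_bounds (ltW t0).
  have hh : h t = (1 - q t) / t by rewrite -hE mulrC mulKf.
  have i1 : 0 <= t^-1 - (rt t)^-1 by rewrite subr_ge0 lef_pV2 ?posrE// le_rt// ltW.
  have p1 : 0 <= (1 - e t) * (t^-1 - (rt t)^-1) by exact: mulr_ge0.
  have ti : 0 < t^-1 by rewrite invr_gt0.
  have p2 : (1 - e t) * (t^-1 - (rt t)^-1) <= t / a * (t^-1 - (rt t)^-1) by exact: ler_wpM2r.
  have p3 : (e t - q t) / t <= t / a ^+ 3.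
    rewrite ler_pdivrMr//; apply: le_trans q2 _.
    have -> : t / a ^+ 3 * t = t ^+ 2 / a ^+ 3 * 1 by rewrite mulr1 expr2; ring.
    by rewrite ler_wpM2l ?divr_ge0 ?exprn_ge0 ?(ltW a0) ?(ltW t0)//; move: e1; rewrite subr_ge0.
  have p4 : 0 <= (e t - q t) / t by rewrite divr_ge0 ?(ltW t0).
  have e3 : t / a * (t^-1 - (rt t)^-1) = a^-1 * (1 - t / rt t) by field; rewrite an tn rn.
  have e4 : (rt t)^-1 * e t = (rt t)^-1 - h t + ((e t - q t) / t + (1 - e t) * (t^-1 - (rt t)^-1)).
    by rewrite hh; field; rewrite tn rn.
  by rewrite e4 /up -e3; split; lra.
have wf := @continuous_subspaceT _ _ (`[0, a]%classic) f cf.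
have wu : {within `[0, a], continuous (fun t => (rt t)^-1 - h t + up t)}.
  by apply: continuous_subspaceT => t; apply: cvgD; [apply: cvgB; [exact: crti|exact: ch]|exact: cup].
have L := ge_Int_prim (ltW a0) wf c1 d1 (fun x hx => (key x hx).1).
have U := le_Int_prim (ltW a0) wf wu (fun x hx => is_deriveD (d1 x hx) (dUp x)) (fun x hx => (key x hx).2).
have {}L : asinh a + Q a - (asinh 0 + Q 0) <= Int 0 a f := L.
have {}U : Int 0 a f <= asinh a + Q a + Up a - (asinh 0 + Q 0 + Up 0) := U.
move: L U; rewrite as0 => L U; apply/andP; split; first lra.
apply: le_trans U _.
have r0 := rt0; have ra := le_rt (ltW a0).
have E : Up a - Up 0 <= 2 * a^-1.
  rewrite /Up r0 expr0n mulr0 mul0r add0r sub0r mulrN opprK.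
  have -> : 2^-1 * a ^+ 2 / a ^+ 3 = 2^-1 * a^-1 by field.
  have : a^-1 * (a - rt a) <= 0 by rewrite pmulr_rle0// subr_le0.
  by move: ai0; set b := a^-1; set y := b * _ => b0 y0; rewrite mulr1 (mulrC 2^-1 b); lra.
lra.
Qed.

(** Away from 0 the factor 1/rt t is replaced by 1/t, at the cost of 1/t^2. The main part then has
    the primitive ln + Q, and every error is of the form c / t^2, with integral at most c / a. *)
Let part2 : ln a - Q a - a^-1 <= Int a (a ^+ 2) f <= ln a - Q a + 27 * a^-1.
Proof.
have aa : a <= a ^+ 2 by rewrite ler_eXnr.
have tp t : a <= t <= a ^+ 2 -> 0 < t by move=> /andP[h1 _]; exact: lt_le_trans h1.
have d1 t : a <= t <= a ^+ 2 -> is_derive t 1 (fun t => ln t + Q t) (t^-1 - h t).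
  by move=> /tp t0; exact: is_deriveD (is_derive1_ln t0) (dQ t).
have dV (c : R) t : a <= t <= a ^+ 2 -> is_derive t 1 (fun t => - c * t^-1) (c / t ^+ 2).
  move=> /tp t0; have tn : t != 0 by rewrite gt_eqF.
  have H := is_deriveZ (- c) (@is_deriveV _ id t _ 1 tn (is_derive_id t 1)).
  by apply: (is_derive_ext H) => //; rewrite /GRing.scale /=; field.
have cV (c : R) : {within `[a, a ^+ 2], continuous (fun t => t^-1 - h t + c / t ^+ 2)}.
  apply: within_cont => t /tp t0; apply: cvgD.
    by apply: cvgB; [exact: cinv|exact: ch].
  apply: cvgM; first exact: cvg_cst.
  by apply: cvgV; [rewrite expf_neq0// gt_eqF|exact: exprn_continuous].
have wf := @continuous_subspaceT _ _ (`[a, a ^+ 2]%classic) f cf.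
have key t : a <= t <= a ^+ 2 -> t^-1 - h t + (-1) / t ^+ 2 <= f t /\ f t <= t^-1 - h t + 27 / t ^+ 2.
  move=> ht; have t0 := tp t ht; have /andP[at_ ta] := ht.
  have tn : t != 0 by rewrite gt_eqF.
  have r0 := rt_gt0 t; have rn : rt t != 0 by rewrite gt_eqF.
  have /andP[q1 q2] : 0 <= e t - q t <= t ^+ 2 / a ^+ 3 * e t by apply: eq_bounds; rewrite ta ltW.
  have /andP[e1 e2] := e_bounds (ltW t0).
  have e0 : 0 <= e t by exact: expR_ge0.
  have hh : h t = (1 - q t) / t by rewrite -hE mulrC mulKf.
  have i1 : 0 <= t^-1 - (rt t)^-1 by rewrite subr_ge0 lef_pV2 ?posrE// le_rt// ltW.
  have t2 : 0 < t ^+ 2 by rewrite exprn_gt0.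
  have i2 : t^-1 - (rt t)^-1 <= 1 / t ^+ 2.
    have H1 : (1 + t)^-1 <= (rt t)^-1 by rewrite lef_pV2 ?posrE ?addr_gt0// rt_le// ltW.
    have H2 : t^-1 - (1 + t)^-1 <= 1 / t ^+ 2.
      have -> : t^-1 - (1 + t)^-1 = 1 / (t * (1 + t)) by field; rewrite tn gt_eqF// addr_gt0.
      by rewrite !div1r lef_pV2 ?posrE ?mulr_gt0 ?addr_gt0// expr2 ler_pM2l// lerDr.
    lra.
  have p4 : 0 <= (e t - q t) / t by rewrite divr_ge0 ?(ltW t0).
  (* 27 = 3^3 comes from t^3 exp(- t / a) <= (3 a)^3, the cube of [texp_le] at the rate 1 / (3
     a). *)
  have p3 : (e t - q t) / t <= 27 / t ^+ 2.
    have -> : 27 / t ^+ 2 = 27 * a ^+ 3 / a ^+ 3 / t ^+ 2 by field; rewrite tn an.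
    rewrite ler_pdivrMr// -[leRHS]mulrA (_ : (t ^+ 2)^-1 * t = t^-1); last by field.
    rewrite ler_pdivlMr//; apply: le_trans (ler_wpM2r (ltW t0) q2) _.
    have -> : t ^+ 2 / a ^+ 3 * e t * t = t ^+ 2 * t * e t / a ^+ 3 by ring.
    rewrite ler_wpM2r ?invr_ge0 ?exprn_ge0 ?(ltW a0)//.
    have a30 : 0 < (3 * a)^-1 by rewrite invr_gt0 mulr_gt0.
    have T := texp_le a30 (ltW t0); rewrite invrK in T.
    have -> : t ^+ 2 * t * e t = (t * expR (- ((3 * a)^-1 * t))) ^+ 3.
      rewrite exprMn -expRM_natl -exprSr; congr (_ * expR _); by field.
    have -> : 27 * a ^+ 3 = (3 * a) ^+ 3 by rewrite exprMn; ring.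
    by rewrite lerXn2r ?nnegrE ?mulr_ge0 ?expR_ge0 ?(ltW t0) ?(ltW a0).
  have p5 : 0 <= e t * (t^-1 - (rt t)^-1) by exact: mulr_ge0.
  have p6 : e t * (t^-1 - (rt t)^-1) <= 1 / t ^+ 2.
    by apply: le_trans i2; rewrite ler_piMl//; move: e1; rewrite subr_ge0.
  rewrite /f expr0 mul1r.
  have e4 : (rt t)^-1 * e t = t^-1 - h t + ((e t - q t) / t - e t * (t^-1 - (rt t)^-1)).
    by rewrite hh; field; rewrite tn rn.
  rewrite e4 mulNr; split; lra.
have L := ge_Int_prim aa wf (cV _) (fun x hx => is_deriveD (d1 x hx) (dV _ x hx)) (fun x hx => (key x hx).1).
have U := le_Int_prim aa wf (cV _) (fun x hx => is_deriveD (d1 x hx) (dV _ x hx)) (fun x hx => (key x hx).2).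
have {}L : ln (a ^+ 2) + Q (a ^+ 2) + - (-1) * (a ^+ 2)^-1 - (ln a + Q a + - (-1) * a^-1) <= Int a (a ^+ 2) f := L.
have {}U : Int a (a ^+ 2) f <= ln (a ^+ 2) + Q (a ^+ 2) + - 27 * (a ^+ 2)^-1 - (ln a + Q a + - 27 * a^-1) := U.
move: L U; rewrite Qa lnXn// opprK mul1r (mulr2n (ln a)) => L U.
have ai2 : 0 < (a ^+ 2)^-1 by rewrite invr_gt0 exprn_gt0.
by apply/andP; split; lra.
Qed.

(** Beyond a^2 the factor 1/rt t is at most a^-2, while exp(- t / a) has integral at most a. *)
Let part3 : 0 <= Tint 0 a^-1 - Int 0 (a ^+ 2) f <= a^-1.
Proof.
have a20 : 0 < a ^+ 2 by rewrite exprn_gt0.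
have fle t : 0 <= t -> `|f t| <= 1 * expR (- (a^-1 * t)).
  move=> t0; rewrite /f expr0 mul1r normrM ger0_norm ?invr_ge0 ?(ltW (rt_gt0 _))//.
  rewrite ger0_norm ?expR_ge0// ler_wpM2r ?expR_ge0// invf_le1 ?rt_gt0// rt_ge1//.
have fi := half_integrable cf ai0 fle.
have gi := exp_half_integrable (a ^+ 2)^-1 ai0.
have S1 := HInt_split (ltW a20) fi; have S2 := HInt_split (ltW a20) gi.
have sub : `]a ^+ 2, +oo[%classic `<=` `[(0:R), +oo[%classic.
  by apply: subset_itv; rewrite bnd_simp// ltW.
have mI (b : itv_bound R) : measurable [set` Interval b (BInfty R false)] by [].
rewrite /Tint -/f S1 addrC addKr; apply/andP; split.
  apply: Rintegral_ge0 => t _; rewrite /f expr0 mul1r mulr_ge0 ?expR_ge0//.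
  by rewrite invr_ge0 ltW// rt_gt0.
apply: (@le_trans _ _ (HInt (fun t => (a ^+ 2)^-1 * expR (- (a^-1 * t))))); last first.
  by rewrite HInt_exp// le_eqVlt; apply/orP; left; apply/eqP; field.
rewrite S2 -[leLHS]add0r; apply: lerD.
  apply: Rintegral_ge0 => t _; rewrite mulr_ge0 ?expR_ge0// invr_ge0 ltW//.
apply: le_Rintegral => //; [exact: integrableS fi|exact: integrableS gi|].
move=> t; rewrite /= in_itv /= andbT => ta.
rewrite /f expr0 mul1r ler_wpM2r ?expR_ge0//.
rewrite lef_pV2 ?posrE ?rt_gt0//; apply: le_trans (ltW ta) _.
by apply: le_rt; rewrite (le_trans (ltW a20))// ltW.
Qed.

(** When the three pieces are added, the terms Q a cancel and Q 0 is the harmonic number. The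
    constant is 31 = 2 + 27 + 1 + 1, the last 1 from asinh a <= ln 2 + ln a + 1/a. *)
Lemma Tint_asymp : `|Tint 0 a^-1 - (ln 2 + ln a *+ 2 - series (@harmonic R) N.+1)| <= 31 / a.
Proof.
have := part1; have := part2; have := part3; rewrite Q0.
have wf := @continuous_subspaceT _ _ (`[0, a ^+ 2]%classic) f cf.
rewrite (Int_split (ltW a0) _ wf) ?ler_eXnr//.
have ra := le_rt (ltW a0); have ra1 := rt_le (ltW a0).
have A1 : ln 2 + ln a <= asinh a.
  by rewrite -lnM ?posrE// ler_ln ?posrE ?mulr_gt0 ?asinh_arg_gt0// ?(ltW a0)//; lra.
have A2 : asinh a <= ln 2 + ln a + a^-1.
  have : asinh a <= ln (2 * a * (1 + a^-1)).
    rewrite ler_ln ?posrE ?mulr_gt0 ?asinh_arg_gt0 ?addr_gt0// ?(ltW a0)//.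
    by rewrite mulrDr mulr1 -mulrA mulfV//; lra.
  rewrite lnM ?posrE ?mulr_gt0 ?addr_gt0// lnM ?posrE// => H.
  have := @le_ln1Dx R a^-1 (lt_trans (ltrN10 _) ai0); lra.
rewrite (mulr2n (ln a)) ler_norml; move: A1 A2 ai0; set b := a^-1 => A1 A2 b0.
move: A1 A2; set x1 := Int 0 a f; set x2 := Int a _ f; set x3 := Tint _ _; set x4 := asinh a; set x5 := series _ _; set x6 := Q a; set x7 := ln 2; set x8 := ln a; clearbody x1 x2 x3 x4 x5 x6 x7 x8.
by move=> A1 A2 /andP[h1 h2] /andP[h3 h4] /andP[h5 h6]; apply/andP; split; lra.
Qed.

End Nfixed.

End EulerGamma.

(** * Hankel function of order 0 at infinity *)

Section Outgoing.
Variable R : realType.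
Implicit Types (s t x : R) (d w : R -> R) (n : nat).

(** [Tint_asymp] describes s = 1/(N + 1) only, so the uniqueness argument tests the behaviour at 0
    along this sequence. *)
Definition hseq n : R := n.+1%:R^-1.

Lemma cvg_hseq : hseq n @[n --> \oo] --> (0 : R)^'+.
Proof.
move=> A /nbhs_right0P [e /= e0 eA].
have h := @cvg_harmonic R; move/cvgr0Pnorm_lt : h => /(_ e e0) h.
suff : \forall n \near \oo, A (hseq n) by [].
near=> n; rewrite -[hseq n]add0r; apply: eA => /=; last by rewrite /hseq invr_gt0.
by rewrite sub0r normrN; near: n.
Unshelve. all: by end_near.
Qed.

Lemma cvg_hseq_sq : (hseq n / 2) ^+ 2 @[n --> \oo] --> (0 : R)^'+.
Proof.
have h : (x / 2) ^+ 2 @[x --> (0:R)^'+] --> (0 : R)^'+.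
  move=> A /nbhs_right0P [e /= e0 eA].
  suff : \forall x \near (0:R)^'+, A ((x / 2) ^+ 2) by [].
  near=> x; have x0 : 0 < x by near: x; exact: nbhs_right_gt.
  have x1 : x < 1 by near: x; exact: nbhs_right_lt.
  have xe : x < e by near: x; exact: nbhs_right_lt.
  rewrite -[(x / 2) ^+ 2]add0r; apply: eA => /=; last exact: sqhalf_gt0.
  by rewrite sub0r normrN gtr0_norm ?sqhalf_gt0//; apply: le_lt_trans xe; nra.
exact: (cvg_comp _ _ cvg_hseq h).
Unshelve. all: by end_near.
Qed.

(** The Wronskians of [d] with J_0 and Y_0 are constants, and they determine [d] as a combination of
    J_0 and Y_0. At 0, J_0 tends to 1 and Y_0 is unbounded, so a limit 0 forces both constants to
    vanish. *)
Lemma bessel0_unique d w : bessel0 d w 0 -> d (hseq n) @[n --> \oo] --> (0 : R) ->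
  forall s, 0 < s -> d s = 0 /\ w s = 0.
Proof.
move=> hd d0.
pose tau n := (hseq n / 2) ^+ 2.
have hJ := bessel0_cyl (@cyl_bj R); have hY := bessel0_cyl (@cyl_by R).
pose c1 := d 1 * cylW (@bj R) 1 - w 1 * cylZ (@bj R) 1.
pose c2 := d 1 * cylW (@by_ R) 1 - w 1 * cylZ (@by_ R) 1.
have E1 s : 0 < s -> d s * cylW (@bj R) s - w s * cylZ (@bj R) s = c1.
  by move=> s0; exact: (bessel0_wronskian hd hJ).
have E2 s : 0 < s -> d s * cylW (@by_ R) s - w s * cylZ (@by_ R) s = c2.
  by move=> s0; exact: (bessel0_wronskian hd hY).
have W s : 0 < s -> cylZ (@bj R) s * cylW (@by_ R) s - cylW (@bj R) s * cylZ (@by_ R) s = 2 * pi^-1.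
  move=> s0; have := cyl_wronskian (sqhalf_gt0 s0); rewrite /cylZ /cylW.
  set t := (s / 2) ^+ 2 => h.
  have -> : 2 * pi^-1 = - (2 * - pi^-1) :> R by rewrite mulrN opprK.
  by rewrite -h; ring.
have p0 : pi^-1 != 0 :> R by rewrite invr_eq0 gt_eqF// pi_gt0.
have K s : 0 < s -> d s * (2 * pi^-1) = c2 * cylZ (@bj R) s - c1 * cylZ (@by_ R) s.
  by move=> s0; rewrite -(W s s0) -(E1 s s0) -(E2 s s0); ring.
have cJ : cylZ (@bj R) (hseq n) @[n --> \oo] --> (1 : R).
  have h : bj 0 (tau n) @[n --> \oo] --> (0`!%:R^-1 : R) := cvg_comp _ _ cvg_hseq_sq (@cvg_bj0 R 0).
  by rewrite fact0 invr1 in h.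
(* Otherwise Y_0, hence also ln tau, would converge along the sequence, and tau would have a
   positive limit although it tends to 0. *)
have c10 : c1 = 0.
  apply/eqP; apply: contraT => c1n.
  have cY : cylZ (@by_ R) (hseq n) @[n --> \oo] --> ((c2 * 1 - 0 * (2 * pi^-1)) / c1 : R).
    have -> : (fun n => cylZ (@by_ R) (hseq n)) =
      (fun n => (c2 * cylZ (@bj R) (hseq n) - d (hseq n) * (2 * pi^-1)) / c1).
      by apply/funext => n; rewrite (K (hseq n)) ?invr_gt0//; field.
    by apply: cvgM; [apply: cvgB; apply: cvgM; try exact: cvg_cst|exact: cvg_cst].
  have cq : bq 0 (tau n) @[n --> \oo] --> _ := cvg_comp _ _ cvg_hseq_sq (@cvg_bq0 R 0).
  set L := _ / c1 in cY; set M := _ / _ in cq.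
  have cl : ln (tau n) @[n --> \oo] --> ((pi * L + M) / 1 : R).
    have h : (pi * cylZ (@by_ R) (hseq n) + bq 0 (tau n)) / cylZ (@bj R) (hseq n) @[n --> \oo] --> ((pi * L + M) / 1 : R).
      apply: cvgM; last by apply: cvgV => //; exact: oner_neq0.
      by apply: cvgD => //; apply: cvgM => //; exact: cvg_cst.
    apply: cvg_trans h; apply: near_eq_cvg.
    have h2 : \forall n \near \oo, 0 < cylZ (@bj R) (hseq n).
      exact: (@cvgr_gt _ _ _ _ _ _ cJ 0 ltr01).
    near=> n; have J0 : 0 < cylZ (@bj R) (hseq n) by near: n.
    rewrite /cylZ by0E -/(tau n) mulrA mulfV ?gt_eqF ?pi_gt0// mul1r subrK mulfK//.
    by rewrite gt_eqF.
  have ce : expR (ln (tau n)) @[n --> \oo] --> (expR ((pi * L + M) / 1) : R).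
    by exact: (cvg_comp _ _ cl (@continuous_expR R _)).
  have ce' : expR (ln (tau n)) @[n --> \oo] --> (0 : R).
    have h := cvg_comp _ _ cvg_hseq_sq (@cvg_id0 R).
    apply: cvg_trans h; apply: near_eq_cvg; near=> n.
    by rewrite /= lnK// posrE sqhalf_gt0// invr_gt0.
  have := cvg_unique _ ce ce' => /(_ _) h; have := expR_gt0 ((pi * L + M) / 1 : R).
  by rewrite h// ltxx.
have c20 : c2 = 0.
  have h1 : d (hseq n) * (2 * pi^-1) @[n --> \oo] --> (0 * (2 * pi^-1) : R).
    by apply: cvgM => //; exact: cvg_cst.
  have h2 : d (hseq n) * (2 * pi^-1) @[n --> \oo] --> (c2 * 1 : R).
    have -> : (fun n => d (hseq n) * (2 * pi^-1)) = (fun n => c2 * cylZ (@bj R) (hseq n)).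
      by apply/funext => n; rewrite K ?invr_gt0// c10 mul0r subr0.
    by apply: cvgM => //; exact: cvg_cst.
  by have := cvg_unique _ h2 h1 => /(_ _); rewrite mulr1 mul0r; apply.
have dz s : 0 < s -> d s = 0.
  move=> s0; have := K s s0; rewrite c10 c20 !mul0r subr0 => /eqP.
  by rewrite mulf_eq0 (mulf_eq0 2) (negbTE p0) pnatr_eq0 !orbF => /eqP.
move=> s s0; split; first exact: dz.
have [h1 _] := hd s s0.
have h2 : is_derive s 1 d 0.
  apply: (near_eq_is_derive _ (is_derive_cst (0:R) s 1)).
  by near=> x; rewrite dz//; near: x; exact: nbhs_gtr.
have := @derive_val _ _ _ _ _ _ _ h1; rewrite (@derive_val _ _ _ _ _ _ _ h2) => /esym/eqP.
by rewrite mulf_eq0 invr_eq0 (gt_eqF s0) orbF => /eqP.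
Unshelve. all: by end_near.
Qed.

Lemma is_derive_cmean_cos m s : is_derive s 1 (cmean m (@cos R)) (- cmean m.+1 (@sin R) s).
Proof.
have h := @is_derive_cmean R m cos (fun x => - sin x) s (fun x => is_derive_cos x) (fun x => _).
have h2 : forall x : R, `|- sin x| <= 1 by move=> x; rewrite normrN sin_max.
apply: (is_derive_ext (h h2)) => //.
rewrite /cmean -mulN1r -IntZ; last by apply: within_cmean; exact: continuous_sin.
by apply: eq_Int => x _; rewrite mulN1r mulrN.
Qed.

Lemma is_derive_cmean_sin m s : is_derive s 1 (cmean m (@sin R)) (cmean m.+1 (@cos R) s).
Proof. exact: (@is_derive_cmean R m sin cos s (fun x => is_derive_sin x) (@cos_max R)). Qed.

Lemma bessel0_cos : bessel0 (cmean 0 (@cos R)) (fun s => - (s * cmean 1 (@sin R) s)) 0.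
Proof.
move=> s s0; split.
  by apply: (is_derive_ext (is_derive_cmean_cos 0 s)) => //; field; rewrite gt_eqF.
have h := is_deriveN (is_deriveM (is_derive_id s 1) (is_derive_cmean_sin 1 s)).
apply: (is_derive_ext h) => //; rewrite /GRing.scale /=.
have := @cmean_parts R sin cos s (fun x => is_derive_sin x) (@continuous_cos R).
rewrite sin0; lra.
Qed.

Lemma bessel0_sin : bessel0 (cmean 0 (@sin R)) (fun s => s * cmean 1 (@cos R) s) 1.
Proof.
move=> s s0; split.
  by apply: (is_derive_ext (is_derive_cmean_sin 0 s)) => //; field; rewrite gt_eqF.
have h := is_deriveM (is_derive_id s 1) (is_derive_cmean_cos 1 s).
apply: (is_derive_ext h) => //; rewrite /GRing.scale /=.
have cN : continuous (fun x : R => - sin x) by move=> x; apply: cvgN; exact: continuous_sin.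
have := @cmean_parts R cos (fun x => - sin x) s (fun x => is_derive_cos x) cN.
have E m : cmean m (fun x : R => - sin x) s = - cmean m (@sin R) s.
  rewrite /cmean -mulN1r -IntZ; last by apply: within_cmean; exact: continuous_sin.
  by apply: eq_Int => x _; rewrite mulN1r mulrN.
by rewrite !E cos0; lra.
Qed.

Lemma bessel0_Tint : bessel0 (@Tint R 0) (fun s => - (s * Tint 1 s)) 1.
Proof.
move=> s s0; split.
  by apply: (is_derive_ext (is_derive_Tint s0 (leq0n 1))) => //; field; rewrite gt_eqF.
have h := is_deriveN (is_deriveM (is_derive_id s 1) (is_derive_Tint s0 (leqnn 1))).
apply: (is_derive_ext h) => //; rewrite /GRing.scale /=.
have := Tint_parts s0; lra.
Qed.

Lemma bessel0_lin d w c d' w' c' a b : bessel0 d w c -> bessel0 d' w' c' ->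
  bessel0 (fun s => a * d s + b * d' s) (fun s => a * w s + b * w' s) (a * c + b * c').
Proof.
move=> h h' s s0; have [h1 h2] := h s s0; have [h1' h2'] := h' s s0; split.
  have H := is_deriveD (is_deriveZ a h1) (is_deriveZ b h1').
  by apply: (is_derive_ext H) => //; rewrite /GRing.scale /=; ring.
have H := is_deriveD (is_deriveZ a h2) (is_deriveZ b h2').
by apply: (is_derive_ext H) => //; rewrite /GRing.scale /=; ring.
Qed.

Lemma cvg_cmean m p q : (forall x, is_derive x 1 p (q x)) -> (forall x, `|q x| <= 1) ->
  cmean m p (hseq n) @[n --> \oo] --> cmean m p 0.
Proof.
move=> dp q1; apply: (cvg_comp _ _ cvg_hseq (_ : cmean m p x @[x --> (0:R)^'+] --> cmean m p 0)).
by apply: cvg_at_right_filter; exact: is_derive_cont (is_derive_cmean m 0 dp q1).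
Qed.

Lemma pi_neq0 : pi != 0 :> R.
Proof. by rewrite gt_eqF// pi_gt0. Qed.

Lemma besselJ0_rep s : 0 < s -> cylZ (@bj R) s = 2 / pi * cmean 0 (@cos R) s /\
  cylW (@bj R) s = - (2 / pi * (s * cmean 1 (@sin R) s)).
Proof.
move=> s0.
have H := bessel0_lin (2 / pi) (-1) bessel0_cos (bessel0_cyl (@cyl_bj R)).
rewrite !mulr0 addr0 in H.
have [] := bessel0_unique H _ s0; last by move=> h1 h2; split; lra.
have cJ : bj 0 ((hseq n / 2) ^+ 2) @[n --> \oo] --> (0`!%:R^-1 : R) := cvg_comp _ _ cvg_hseq_sq (@cvg_bj0 R 0).
have c0 : cmean 0 (@cos R) 0 = pi / 2.
  have -> : pi / 2 = Int 0 (pi / 2) (fun=> 1) :> R by rewrite Int_cst ?pihalf_ge0// mul1r subr0.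
  by apply: eq_Int => x _; rewrite expr0 mul0r cos0 mul1r.
have -> : 0 = 2 / pi * (pi / 2) + -1 * (0`!%:R^-1) :> R by rewrite fact0 invr1 mulrA (divfK pi_neq0) divff// mulr1 subrr.
apply: cvgD; (apply: cvgM; first exact: cvg_cst) => //.
rewrite -c0; apply: (@cvg_cmean 0 cos (fun x => - sin x) (fun x => is_derive_cos x)).
by move=> x; rewrite normrN sin_max.
Qed.

(* Both sides solve Bessel's equation, so by [bessel0_unique] it suffices to compare them near 0;
   this is where Euler's constant enters, through [Tint_asymp]. *)
Lemma besselY0_rep s : 0 < s -> cylZ (@by_ R) s = 2 / pi * (cmean 0 (@sin R) s - Tint 0 s) /\
  cylW (@by_ R) s = 2 / pi * (s * cmean 1 (@cos R) s + s * Tint 1 s).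
Proof.
move=> s0.
have H0 := bessel0_lin (2 / pi) (- (2 / pi)) bessel0_sin bessel0_Tint.
have H := bessel0_lin 1 (-1) H0 (bessel0_cyl (@cyl_by R)).
rewrite !mulr1 subrr !mulr0 addr0 in H.
have [] := bessel0_unique H _ s0; last by move=> h1 h2; split; lra.
pose tau n := (hseq n / 2) ^+ 2.
have cs : cmean 0 (@sin R) (hseq n) @[n --> \oo] --> (0 : R).
  have -> : 0 = cmean 0 (@sin R) 0.
    have -> : cmean 0 (@sin R) 0 = Int 0 (pi / 2) (fun=> 0).
      by apply: eq_Int => x _; rewrite expr0 mul0r sin0 mulr0.
    by rewrite Int_cst ?pihalf_ge0// mul0r.
  exact: (@cvg_cmean 0 sin cos (fun x => is_derive_sin x) (@cos_max R)).
have ceg : (fun n => Tint 0 (hseq n) - (ln 2 + ln n.+1%:R *+ 2 - series (@harmonic R) n.+1)) @ \oo --> (0 : R).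
  apply/cvgr0Pnorm_le => e e0; have h := @cvg_harmonic R.
  have {}h : (31 * harmonic n : R) @[n --> \oo] --> (31 * 0 : R) by apply: cvgM => //; exact: cvg_cst.
  rewrite mulr0 in h; move/cvgr0Pnorm_le : h => /(_ e e0) h.
  near=> n; apply: le_trans (Tint_asymp (erefl n.+1%:R)) _.
  apply: le_trans (ler_norm _) _; near: n; exact: h.
have eg : (fun n => series (@harmonic R) n.+1 - ln n.+1%:R) @ \oo --> euler_gamma R.
  by rewrite (cvg_shiftS (fun n => series (@harmonic R) n - ln n%:R)); exact: gamma_cvg.
have cq : bq 0 (tau n) @[n --> \oo] --> _ := cvg_comp _ _ cvg_hseq_sq (@cvg_bq0 R 0).
have cS : psum (fun m => jcoef R 0 m.+1) (tau n) @[n --> \oo] --> psum (fun m => jcoef R 0 m.+1) 0.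
  have e := entire_coefS (entire_jcoef R 0).
  apply: (cvg_comp _ _ cvg_hseq_sq (_ : psum (fun m => jcoef R 0 m.+1) x @[x --> (0:R)^'+] --> _)).
  by apply: cvg_at_right_filter; exact: (is_derive_cont (is_derive_psum 0 e)).
have csl : Num.sqrt (tau n) * ln (tau n) @[n --> \oo] --> (0 : R) := cvg_comp _ _ cvg_hseq_sq (@cvg_sqrtln R).
have cst : Num.sqrt (tau n) @[n --> \oo] --> (0 : R) := cvg_comp _ _ cvg_hseq_sq (@cvg_sqrt0 R).
set M := _ / _ in cq; set S0 := psum _ 0 in cS.
(* Twice psi(1) = - gamma; this cancels the constant that the harmonic numbers of [Tint_asymp] bring
   in. *)
have ME : M = - (2 * euler_gamma R).
  by rewrite /M fact0 divr1 /digammaS /series /= big_geq// sub0r; ring.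
have -> : 0 = 2 / pi * 0 - 2 / pi * 0 + 2 / pi * euler_gamma R + pi^-1 * M - pi^-1 * (0 * 0 * S0) :> R.
  by rewrite ME; set p1 : R := pi^-1; ring.
have h : 2 / pi * cmean 0 (@sin R) (hseq n) - 2 / pi * (Tint 0 (hseq n) - (ln 2 + ln n.+1%:R *+ 2 - series (@harmonic R) n.+1))
   + 2 / pi * (series (@harmonic R) n.+1 - ln n.+1%:R) + pi^-1 * bq 0 (tau n)
   - pi^-1 * (Num.sqrt (tau n) * (Num.sqrt (tau n) * ln (tau n)) * psum (fun m => jcoef R 0 m.+1) (tau n))
   @[n --> \oo] --> (2 / pi * 0 - 2 / pi * 0 + 2 / pi * euler_gamma R + pi^-1 * M - pi^-1 * (0 * 0 * S0) : R).
  have cc (r : R) : r @[_ --> \oo] --> r by exact: cvg_cst.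
  apply: cvgB; last by apply: cvgM => //; apply: cvgM => //; exact: cvgM.
  by apply: cvgD; [apply: cvgD; [apply: cvgB|]|]; apply: cvgM.
apply: cvg_trans h; apply: near_eq_cvg; near=> n.
have t0 : 0 < tau n by rewrite sqhalf_gt0// invr_gt0.
rewrite /cylZ -/(tau n) by0E mulrA -expr2 sqr_sqrtr ?(ltW t0)//.
have e := entire_jcoef R 0; rewrite /bj (psum_recl (tau n) e (entire_coefS e)).
have -> : jcoef R 0 0 = 1 by rewrite /jcoef add0n fact0 expr0 !mul1r invr1.
have lt : ln (tau n) = - (2 * (ln 2 + ln n.+1%:R)).
  rewrite /tau /hseq -invfM lnXn ?lnV ?posrE ?invr_gt0 ?mulr_gt0//.
  by rewrite lnM ?posrE//; ring.
set P := psum _ _; set T := Tint _ _; set c := cmean _ _ _; set H1 := series _ _; set Q := bq _ _.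
by rewrite lt; set l2 := ln 2; set l3 := ln _; set p1 : R := pi^-1; ring.
Unshelve. all: by end_near.
Qed.

(** Since [cylW g s / s] is the derivative of [cylZ g], these are the real and imaginary parts of
    H_0' - i H_0. In the integral representations they consist of differences estimated by
    [cmean_diff_bound] and of Laplace integrals bounded by 1/s. *)
Lemma hankel0_outgoing : exists2 C : R, 0 < C & forall s, 0 < s ->
  `|cylW (@bj R) s / s + cylZ (@by_ R) s| <= C / s /\ `|cylW (@by_ R) s / s - cylZ (@bj R) s| <= C / s.
Proof.
have p0 : 0 < 2 / pi :> R by rewrite divr_gt0// pi_gt0.
pose C : R := 2 / pi * (1 + pi / 2 + 1).
have C0 : 0 < C by rewrite mulr_gt0// ltr_wpDl// addr_ge0// pihalf_ge0.
exists C => // s s0; have sn : s != 0 by rewrite gt_eqF.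
have [-> ->] := besselJ0_rep s0; have [-> ->] := besselY0_rep s0.
have T0 := Tint_bound s0 (leq0n 1); have T1 := Tint_bound s0 (leqnn 1).
have cN : continuous (fun x : R => - sin x) by move=> x; apply: cvgN; exact: continuous_sin.
have B1 := @cmean_diff_bound R sin cos s s0 (fun x => is_derive_sin x) (@continuous_cos R) (@sin_max R).
have B2 := @cmean_diff_bound R cos (fun x => - sin x) s s0 (fun x => is_derive_cos x) cN (@cos_max R).
have E m : cmean m (fun x : R => - sin x) s = - cmean m (@sin R) s.
  rewrite /cmean -mulN1r -IntZ; last by apply: within_cmean; exact: continuous_sin.
  by apply: eq_Int => x _; rewrite mulN1r mulrN.
rewrite !E in B2.
have -> : - (2 / pi * (s * cmean 1 (@sin R) s)) / s + 2 / pi * (cmean 0 (@sin R) s - Tint 0 s) =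
  2 / pi * (- (- cmean 0 (@sin R) s - - cmean 1 (@sin R) s) - Tint 0 s) by set P : R := 2 / pi; field; rewrite sn.
have -> : 2 / pi * (s * cmean 1 (@cos R) s + s * Tint 1 s) / s - 2 / pi * cmean 0 (@cos R) s =
  2 / pi * (- (cmean 0 (@cos R) s - cmean 1 (@cos R) s) + Tint 1 s) by set P : R := 2 / pi; field; rewrite sn.
have -> : C / s = 2 / pi * ((1 + pi / 2) / s + s^-1) by rewrite /C; ring.
split; rewrite normrM (gtr0_norm p0) ler_wpM2l ?(ltW p0)//.
  by apply: le_trans (ler_normB _ _) _; rewrite normrN lerD.
by apply: le_trans (ler_normD _ _) _; rewrite normrN lerD.
Qed.

(** When the derivatives are replaced by means of [hankel0_outgoing], the Wronskian J_0 Y_0' - J_0'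
    Y_0 = 2 / (pi s) becomes J_0^2 + Y_0^2 up to terms that Young's inequality absorbs. *)
Lemma hankel0_decay : exists2 C : R, 0 < C & forall s, 1 <= s ->
  cylZ (@bj R) s ^+ 2 + cylZ (@by_ R) s ^+ 2 <= C / s.
Proof.
have [C C0 hC] := hankel0_outgoing.
have p0 : 0 < 2 / pi :> R by rewrite divr_gt0// pi_gt0.
exists (2 * (2 / pi + C ^+ 2)) => [|s s1]; first by rewrite mulr_gt0// addr_gt0// exprn_gt0.
have s0 : 0 < s by exact: lt_le_trans s1.
have sn : s != 0 by rewrite gt_eqF.
have [h1 h2] := hC s s0.
have := cyl_wronskian (sqhalf_gt0 s0).
have WW : cylZ (@bj R) s * cylW (@by_ R) s - cylW (@bj R) s * cylZ (@by_ R) s = 2 / pi.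
  have := cyl_wronskian (sqhalf_gt0 s0); rewrite /cylZ /cylW.
  set t := (s / 2) ^+ 2 => h.
  have -> : 2 / pi = - (2 * - pi^-1) :> R by rewrite mulrN opprK.
  by rewrite -h; ring.
move: h1 h2 WW; set J := cylZ (@bj R) _; set Y := cylZ (@by_ R) _; set WJ := cylW (@bj R) _; set WY := cylW (@by_ R) _.
set e1 := WJ / s + Y; set e2 := WY / s - J => h1 h2.
have -> : WJ = s * (e1 - Y) by rewrite /e1; field.
have -> : WY = s * (e2 + J) by rewrite /e2; field.
move=> WW _; rewrite ler_pdivlMr//.
have D0 : 0 <= C / s by rewrite divr_ge0 ?ltW.
have q1 : e1 ^+ 2 <= (C / s) ^+ 2 by rewrite -(real_normK (num_real e1)) lerXn2r ?nnegrE.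
have q2 : e2 ^+ 2 <= (C / s) ^+ 2 by rewrite -(real_normK (num_real e2)) lerXn2r ?nnegrE.
have r1 : s * e1 ^+ 2 <= C ^+ 2.
  apply: le_trans (ler_wpM2l (ltW s0) q1) _.
  have -> : s * (C / s) ^+ 2 = C ^+ 2 / s by field.
  by rewrite ler_pdivrMr// ler_peMr// exprn_ge0// ltW.
have r2 : s * e2 ^+ 2 <= C ^+ 2.
  apply: le_trans (ler_wpM2l (ltW s0) q2) _.
  have -> : s * (C / s) ^+ 2 = C ^+ 2 / s by field.
  by rewrite ler_pdivrMr// ler_peMr// exprn_ge0// ltW.
have a1 : 0 <= s * (J + e2) ^+ 2 by rewrite mulr_ge0 ?sqr_ge0// ltW.
have a2 : 0 <= s * (Y - e1) ^+ 2 by rewrite mulr_ge0 ?sqr_ge0// ltW.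
by move: WW a1 a2 r1 r2; set P : R := 2 / pi; rewrite !expr2; nra.
Qed.

End Outgoing.

(** * Multipoles *)

Section ComplexBasics.
Variable R : realType.
Local Notation C := R[i].
Implicit Types (z w : C) (r t : R).

Lemma normrE z : `|z| = (normc z)%:C%C.
Proof. by []. Qed.

Lemma normc_ge0 z : 0 <= normc z.
Proof. by case: z => a b /=; exact: sqrtr_ge0. Qed.

Lemma normc_real r : normc (r%:C%C : C) = `|r|.
Proof. by rewrite /= expr0n addr0 sqrtr_sqr. Qed.

Lemma normcX z n : normc (z ^+ n) = normc z ^+ n.
Proof.
elim: n => [|n IH]; first by rewrite !expr0 normc1.
by rewrite !exprS normcM IH.
Qed.

Lemma normc_conj z : normc (conjc z) = normc z.
Proof. by case: z => a b /=; rewrite sqrrN. Qed.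

Lemma le_normcB z w : normc (z - w) <= normc z + normc w.
Proof. by apply: le_trans (le_normcD _ _) _; rewrite normcN. Qed.

Lemma Re_le_normc z : `|complex.Re z| <= normc z.
Proof.
case: z => a b /=; rewrite -sqrtr_sqr ler_wsqrtr//.
by rewrite lerDl sqr_ge0.
Qed.

Lemma Im_le_normc z : `|complex.Im z| <= normc z.
Proof.
case: z => a b /=; rewrite -sqrtr_sqr ler_wsqrtr//.
by rewrite lerDr sqr_ge0.
Qed.

Lemma normc_le_ReIm z : normc z <= `|complex.Re z| + `|complex.Im z|.
Proof.
case: z => a b /=.
rewrite -(@ler_pXn2r _ 2)// ?nnegrE ?sqrtr_ge0 ?addr_ge0//.
rewrite sqr_sqrtr ?addr_ge0 ?sqr_ge0// sqrrD !real_normK ?num_real//.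
by rewrite addrAC lerDl mulrn_wge0// mulr_ge0.
Qed.

Definition is_derC (f : R -> C) t (d : C) :=
  is_derive t 1 (fun x => complex.Re (f x)) (complex.Re d) /\
  is_derive t 1 (fun x => complex.Im (f x)) (complex.Im d).

Lemma is_derC_ext f g t d d' : is_derC f t d -> f =1 g -> d = d' -> is_derC g t d'.
Proof. by move=> h /funext <- <-. Qed.

Lemma is_derC_cst z t : is_derC (fun=> z) t 0.
Proof. by split; exact: is_derive_cst. Qed.

Lemma is_derCD f g t d d' : is_derC f t d -> is_derC g t d' -> is_derC (fun x => f x + g x) t (d + d').
Proof.
move=> [h1 h2] [h3 h4]; split.
  apply: (is_derive_ext (is_deriveD h1 h3)) => [x|].
    by rewrite fctE; case: (f x) (g x) => a b [a' b'].
  by case: d d' {h1 h2 h3 h4} => a b [a' b'].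
apply: (is_derive_ext (is_deriveD h2 h4)) => [x|].
  by rewrite fctE; case: (f x) (g x) => a b [a' b'].
by case: d d' {h1 h2 h3 h4} => a b [a' b'].
Qed.

Lemma is_derCM f g t d d' : is_derC f t d -> is_derC g t d' ->
  is_derC (fun x => f x * g x) t (d * g t + f t * d').
Proof.
move=> [h1 h2] [h3 h4]; split.
  have H := is_deriveB (is_deriveM h1 h3) (is_deriveM h2 h4).
  apply: (is_derive_ext H) => [x|].
    by rewrite !fctE; case: (f x) (g x) => a b [a' b'].
  by case: (f t) (g t) d d' {H h1 h2 h3 h4} => a b [a' b'] [c e] [c' e']; rewrite /GRing.scale /=; ring.
have H := is_deriveD (is_deriveM h1 h4) (is_deriveM h2 h3).
apply: (is_derive_ext H) => [x|].
  by rewrite !fctE; case: (f x) (g x) => a b [a' b'].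
by case: (f t) (g t) d d' {H h1 h2 h3 h4} => a b [a' b'] [c e] [c' e']; rewrite /GRing.scale /=; ring.
Qed.

Lemma is_derC_real (f : R -> R) t d : is_derive t 1 f d -> is_derC (fun x => (f x)%:C%C) t (d%:C)%C.
Proof. by move=> h; split => //=; exact: is_derive_cst. Qed.

Lemma is_derCZ z f t d : is_derC f t d -> is_derC (fun x => z * f x) t (z * d).
Proof. by move=> h; apply: (is_derC_ext (is_derCM (is_derC_cst z t) h)) => //; rewrite mul0r add0r. Qed.

Lemma is_derCX f t d n : is_derC f t d -> is_derC (fun x => f x ^+ n) t (n%:R * d * f t ^+ n.-1).
Proof.
move=> h; elim: n => [|n IH].
  by apply: (is_derC_ext (is_derC_cst 1 t)) => [x|]; rewrite ?expr0// !mul0r.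
apply: (is_derC_ext (is_derCM h IH)) => [x|]; first by rewrite exprS.
case: n {IH} => [|n] /=; first by rewrite !mul0r mulr0 addr0 expr0 mul1r.
by rewrite exprS -(natr1 n.+1); ring.
Qed.

(** The factor 2 is the price of applying the mean value theorem to real and imaginary parts
    separately. *)
Lemma mvt_normc (f df : R -> C) (a b M : R) : a <= b ->
  (forall x, a <= x <= b -> is_derC f x (df x)) -> (forall x, a <= x <= b -> normc (df x) <= M) ->
  normc (f b - f a) <= 2 * M * (b - a).
Proof.
move=> ab h hM.
have [x xab ex] := mvt ab (fun x hx => (h x hx).1).
have [y yab ey] := mvt ab (fun x hx => (h x hx).2).
apply: le_trans (normc_le_ReIm _) _.
have -> : complex.Re (f b - f a) = complex.Re (f b) - complex.Re (f a) by case: (f b) (f a) => ? ? [].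
have -> : complex.Im (f b - f a) = complex.Im (f b) - complex.Im (f a) by case: (f b) (f a) => ? ? [].
rewrite ex ey !normrM (ger0_norm (_ : 0 <= b - a)) ?subr_ge0//.
rewrite -mulrDl ler_wpM2r ?subr_ge0// mulr_natl mulr2n lerD//.
  exact: le_trans (Re_le_normc _) (hM _ _).
exact: le_trans (Im_le_normc _) (hM _ _).
Qed.

End ComplexBasics.

(** * Uniform closure of a linear span *)

Section Approximation.
Variables (R : realType) (T I : Type).
Local Notation C := R[i].
Implicit Types (F : set T) (f : I -> T -> C) (g : T -> C) (l : seq (C * I)).

(** Lists may repeat an index, so that addition is concatenation; coefficients of equal indices are
    collected only at the end, in [coefs]. *)
Definition lincomb f l (x : T) : C := \sum_(p <- l) p.1 * f p.2 x.

Definition approx F f g := forall eps : R, 0 < eps ->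
  exists l, forall x, F x -> normc (g x - lincomb f l x) <= eps.

Lemma lincomb_cat f l l' x : lincomb f (l ++ l') x = lincomb f l x + lincomb f l' x.
Proof. by rewrite /lincomb big_cat. Qed.

Lemma lincombZ f l c x : lincomb f [seq (c * p.1, p.2) | p <- l] x = c * lincomb f l x.
Proof. by rewrite /lincomb big_map mulr_sumr; apply: eq_bigr => p _; rewrite mulrA. Qed.

Lemma approx_lim F f g : (forall eps : R, 0 < eps -> exists2 g', approx F f g' &
  forall x, F x -> normc (g x - g' x) <= eps) -> approx F f g.
Proof.
move=> h e e0; have e20 : 0 < e / 2 by rewrite divr_gt0.
have [g' ag' hg'] := h _ e20; have [l hl] := ag' _ e20.
exists l => x Fx; have -> : g x - lincomb f l x = (g x - g' x) + (g' x - lincomb f l x) by rewrite addrA subrK.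
apply: le_trans (le_normcD _ _) _.
by have := hg' x Fx; have := hl x Fx; lra.
Qed.

Lemma approx_gen F f i : approx F f (f i).
Proof.
move=> e e0; exists [:: (1, i)] => x _.
by rewrite /lincomb big_seq1 mul1r subrr normc0 ltW.
Qed.

Lemma approx0 F f : approx F f (fun=> 0).
Proof. by move=> e e0; exists [::] => x _; rewrite /lincomb big_nil subrr normc0 ltW. Qed.

Lemma approxD F f g g' : approx F f g -> approx F f g' -> approx F f (fun x => g x + g' x).
Proof.
move=> h h' e e0; have e20 : 0 < e / 2 by rewrite divr_gt0.
have [l hl] := h _ e20; have [l' hl'] := h' _ e20.
exists (l ++ l') => x Fx; rewrite lincomb_cat opprD addrACA.
apply: le_trans (le_normcD _ _) _.
by have := hl x Fx; have := hl' x Fx; lra.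
Qed.

Lemma approxZ F f g c : approx F f g -> approx F f (fun x => c * g x).
Proof.
move=> h e e0; pose M := normc c + 1.
have M0 : 0 < M by rewrite ltr_wpDl// normc_ge0.
have [l hl] := h _ (divr_gt0 e0 M0).
exists [seq (c * p.1, p.2) | p <- l] => x Fx; rewrite lincombZ -mulrBr normcM.
apply: (@le_trans _ _ (M * (e / M))).
  by apply: ler_pM; rewrite ?normc_ge0 ?hl// lerDl.
by rewrite mulrC divfK// gt_eqF.
Qed.

Lemma eq_approx F f g g' : (forall x, F x -> g x = g' x) -> approx F f g -> approx F f g'.
Proof. by move=> e h eps e0; have [l hl] := h eps e0; exists l => x Fx; rewrite -e// hl. Qed.

Lemma approx_sum F f (J : Type) (s : seq J) (g : J -> T -> C) :
  (forall j, approx F f (g j)) -> approx F f (fun x => \sum_(j <- s) g j x).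
Proof.
move=> h; elim: s => [|j s IH].
  by apply: eq_approx (approx0 F f) => x _; rewrite big_nil.
by apply: eq_approx (approxD (h j) IH) => x _; rewrite big_cons.
Qed.

End Approximation.

Lemma approx_trans (R : realType) (T I J : Type) (F : set T) (f : I -> T -> R[i])
    (f' : J -> T -> R[i]) (g : T -> R[i]) :
  (forall j, approx F f (f' j)) -> approx F f' g -> approx F f g.
Proof.
move=> h h'; apply: approx_lim => e e0; have [l hl] := h' e e0.
exists (lincomb f' l) => //.
by apply: approx_sum => p; exact: approxZ.
Qed.

Section Multipoles.
Variable R : realType.
Local Notation C := R[i].
Variable k : R.
Implicit Types (z v x y : R * R) (n m j : nat) (t : R).

(** The complex coordinate, scaled so that [tau] is its squared modulus and (k r / 2)^n e^(i n
    theta) its n-th power. *)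
Definition cpt z : C := ((k / 2 * z.1) +i* (k / 2 * z.2))%C.
Definition tau z : R := (k / 2) ^+ 2 * (z.1 ^+ 2 + z.2 ^+ 2).
Definition hcyl n (t : R) : C := (bj n t +i* by_ n t)%C.

(* [multipole n z = H_n(k r) e^(i n theta)] where [(r, theta)] are the polar coordinates of [z]. *)
Definition multipole (n : int) z : C :=
  match n with
  | Posz m => hcyl m (tau z) * cpt z ^+ m
  | Negz m => (-1) ^+ m.+1 * (hcyl m.+1 (tau z) * conjc (cpt z) ^+ m.+1)
  end.

Lemma tau_cpt z : (tau z)%:C%C = cpt z * conjc (cpt z).
Proof. by rewrite /tau /cpt /=; congr Complex; ring. Qed.

Lemma hcyl_rec n t : 0 < t -> t%:C%C * hcyl n.+2 t = n.+1%:R * hcyl n.+1 t - hcyl n t.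
Proof.
move=> t0; have h1 := (@cyl_bj R).2 n t t0; have h2 := (@cyl_by R).2 n t t0.
have -> : (n.+1%:R : C) = (n.+1%:R)%:C%C by rewrite rmorph_nat.
by rewrite /hcyl; apply/eqP; rewrite eq_complex /= !mul0r !subr0 !addr0 h1 h2 !eqxx.
Qed.

Lemma is_derC_line z v t : is_derC (fun t => cpt (z + t *: v)) t (cpt v).
Proof.
have h (a b : R) : is_derive t 1 (fun t : R => k / 2 * (a + t * b)) (k / 2 * b).
  have H := is_deriveZ (k / 2) (is_deriveD (is_derive_cst a t 1) (is_deriveM (is_derive_id t 1) (is_derive_cst b t 1))).
  by apply: (is_derive_ext H) => //; rewrite /GRing.scale /=; ring.
by split; rewrite /=; exact: h.
Qed.

Lemma is_derC_line_conj z v t : is_derC (fun t => conjc (cpt (z + t *: v))) t (conjc (cpt v)).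
Proof.
have [h1 h2] := is_derC_line z v t; split => //.
exact: is_deriveN h2.
Qed.

Lemma is_derive_tau z v t : is_derive t 1 (fun t => tau (z + t *: v))
  (2 * (k / 2) ^+ 2 * ((z + t *: v).1 * v.1 + (z + t *: v).2 * v.2)).
Proof.
have h (a b : R) : is_derive t 1 (fun t : R => a + t * b) b.
  have H := is_deriveD (is_derive_cst a t 1) (is_deriveM (is_derive_id t 1) (is_derive_cst b t 1)).
  by apply: (is_derive_ext H) => //; rewrite /GRing.scale /=; ring.
have H := is_deriveZ ((k / 2) ^+ 2) (is_deriveD (is_deriveM (h z.1 v.1) (h z.1 v.1)) (is_deriveM (h z.2 v.2) (h z.2 v.2))).
by apply: (is_derive_ext H) => //; rewrite /GRing.scale /= /GRing.scale /=; ring.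
Qed.

Lemma tau_derE z v t : (2 * (k / 2) ^+ 2 * ((z + t *: v).1 * v.1 + (z + t *: v).2 * v.2))%:C%C =
  cpt (z + t *: v) * conjc (cpt v) + conjc (cpt (z + t *: v)) * cpt v.
Proof. by rewrite /cpt /GRing.scale /=; congr Complex; rewrite /GRing.scale /=; ring. Qed.

Lemma is_derC_hcyl n z v t : 0 < tau (z + t *: v) ->
  is_derC (fun t => hcyl n (tau (z + t *: v))) t
    (- hcyl n.+1 (tau (z + t *: v)) * (cpt (z + t *: v) * conjc (cpt v) + conjc (cpt (z + t *: v)) * cpt v)).
Proof.
move=> t0; rewrite -tau_derE; have dt := is_derive_tau z v t.
set e := (2 * _ * _) in dt *.
have d1 := @is_derive1_comp _ (bj n) (fun t => tau (z + t *: v)) t _ _ ((@cyl_bj R).1 n _ t0) dt.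
have d2 := @is_derive1_comp _ (by_ n) (fun t => tau (z + t *: v)) t _ _ ((@cyl_by R).1 n _ t0) dt.
split; rewrite /=; [apply: (is_derive_ext d1)|apply: (is_derive_ext d2)] => //; ring.
Qed.

(** A multipole is a function of the squared modulus times a power of the coordinate or of its
    conjugate: one Wirtinger derivative lowers [n], the other raises it, and [hcyl_rec] brings the
    one that is not immediate into this form. Hence all derivatives of multipoles are combinations
    of multipoles with the same pole. *)
Lemma is_derC_multipole (n : int) z v t : 0 < tau (z + t *: v) ->
  is_derC (fun t => multipole n (z + t *: v)) t
    (cpt v * multipole (n - 1) (z + t *: v) - conjc (cpt v) * multipole (n + 1) (z + t *: v)).
Proof.
move=> t0; pose y : R * R := z + t *: v; rewrite -/y.
have dZ := is_derC_line z v t; have dZb := is_derC_line_conj z v t.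
have dh m := is_derC_hcyl m t0.
have ty := tau_cpt y.
case: n => [[|n]|n].
- apply: (is_derC_ext (dh 0%N)) => [x|]; first by rewrite /= expr0 mulr1.
  rewrite -/y (_ : 0%Z - 1 = Negz 0)// (_ : 0%Z + 1 = Posz 1)//= !exprS !expr0; ring.
- have H := is_derCM (dh n.+1) (is_derCX n.+1 dZ).
  apply: (is_derC_ext H) => //; rewrite -/y intS addrAC subrr add0r -intS.
  have -> : Posz n.+1 + 1 = Posz n.+2 by rewrite addrC -intS.
  have := hcyl_rec n t0; rewrite -/y ty /multipole => E.
  have {E} -> : hcyl n (tau y) = n.+1%:R * hcyl n.+1 (tau y) - cpt y * conjc (cpt y) * hcyl n.+2 (tau y).
    by rewrite E; ring.
  move: (conjc (cpt y)) (conjc (cpt v)) (cpt y) (cpt v) => Zb Vb Z V.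
  by rewrite [n.+1.-1]/= !exprS; ring.
- have H := is_derCZ ((-1) ^+ n.+1) (is_derCM (dh n.+1) (is_derCX n.+1 dZb)).
  apply: (is_derC_ext H) => //; rewrite -/y.
  have -> : Negz n - 1 = Negz n.+1 by rewrite !NegzE -opprD addrC -intS.
  have := hcyl_rec n t0; rewrite -/y ty => E.
  have E2 : hcyl n (tau y) = n.+1%:R * hcyl n.+1 (tau y) - cpt y * conjc (cpt y) * hcyl n.+2 (tau y).
    by rewrite E; ring.
  case: n E2 {E H} => [|n] E2.
    have -> : Negz 0 + 1 = Posz 0 by []; rewrite /multipole; move: (conjc (cpt y)) (conjc (cpt v)) (cpt y) (cpt v) E2 => Zb Vb Z V E2.
    by rewrite E2 [1.-1]/= !exprS !expr0; ring.
  have -> : Negz n.+1 + 1 = Negz n by rewrite !NegzE (intS n.+1) opprD addrC addNKr.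
  rewrite /multipole; move: (conjc (cpt y)) (conjc (cpt v)) (cpt y) (cpt v) E2 => Zb Vb Z V E2.
  by rewrite [n.+2.-1]/= E2 !exprS; ring.
Qed.

End Multipoles.

(** * Moving poles *)

Section MultipoleBounds.
Variable R : realType.
Local Notation C := R[i].
Implicit Types (n m j : nat) (t s : R).

Lemma bounded_itv (f : R -> R) a b : (forall x, a <= x <= b -> {for x, continuous f}) ->
  exists M, forall x, a <= x <= b -> `|f x| <= M.
Proof.
move=> cf; case: (leP a b) => [ab|ba]; last first.
  by exists 0 => x /andP[ax xb]; have := le_trans ax xb; rewrite leNgt ba.
have cn : {within `[a, b], continuous (fun x => `|f x|)}.
  by apply: within_cont => x xab; apply: (continuous_comp (cf x xab)); exact: norm_continuous.
have [c _ hc] := EVT_max ab cn; exists `|f c| => x xab.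
by apply: hc; rewrite in_itv.
Qed.

(** This is |H_m(s)| for t = (s/2)^2. *)
Definition hnorm m t : R := normc (hcyl m t) * Num.sqrt t ^+ m.

Lemma hnorm_rec n t : 0 < t -> hnorm n.+2 t <= n.+1%:R / Num.sqrt t * hnorm n.+1 t + hnorm n t.
Proof.
move=> t0; have w0 : 0 < Num.sqrt t by rewrite sqrtr_gt0.
have wn : Num.sqrt t != 0 by rewrite gt_eqF.
have E : Num.sqrt t ^+ 2 = t by rewrite sqr_sqrtr// ltW.
have h : t * normc (hcyl n.+2 t) <= n.+1%:R * normc (hcyl n.+1 t) + normc (hcyl n t).
  have -> : t * normc (hcyl n.+2 t) = normc (t%:C%C * hcyl n.+2 t).
    by rewrite normcM normc_real gtr0_norm.
  rewrite hcyl_rec//; apply: le_trans (le_normcB _ _) _; rewrite normcM.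
  have -> : (n.+1%:R : C) = (n.+1%:R)%:C%C by rewrite rmorph_nat.
  by rewrite normc_real ger0_norm.
have := ler_wpM2r (exprn_ge0 n (ltW w0)) h.
rewrite /hnorm !exprS -{1}E; set w := Num.sqrt t in wn *.
set a := normc (hcyl n.+2 t); set b := normc (hcyl n.+1 t); set c := normc (hcyl n t).
have -> : w ^+ 2 * a * w ^+ n = a * (w * (w * w ^+ n)) by ring.
move/le_trans; apply; rewrite mulrDl lerD2r le_eqVlt; apply/orP; left; apply/eqP.
by field.
Qed.

(** On a compact interval this is continuity; beyond it, [hankel0_decay] bounds order 0, and
    [hankel0_outgoing] then bounds order 1, since H_1 = - H_0'. *)
Lemma hnorm_base t0 : 0 < t0 -> exists2 M, 0 < M & forall t, t0 <= t -> hnorm 0 t <= M /\ hnorm 1 t <= M.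
Proof.
move=> p0.
have sq t : 0 < t -> (2 * Num.sqrt t / 2) ^+ 2 = t.
  by move=> tp; rewrite mulrAC divff ?mul1r ?sqr_sqrtr// ltW.
have cj n x : t0 <= x <= 4^-1 -> {for x, continuous (@bj R n)}.
  by move=> _; exact: is_derive_cont (is_derive_bj n x).
have cy n x : t0 <= x <= 4^-1 -> {for x, continuous (@by_ R n)}.
  by move=> /andP[h _]; exact: is_derive_cont (is_derive_by n (lt_le_trans p0 h)).
have [M1 hM1] := bounded_itv (cj 0%N); have [M2 hM2] := bounded_itv (cy 0%N).
have [M3 hM3] := bounded_itv (cj 1%N); have [M4 hM4] := bounded_itv (cy 1%N).
have [C1 C10 hC1] := hankel0_outgoing R; have [C2 C20 hC2] := hankel0_decay R.
pose M := `|M1| + `|M2| + `|M3| + `|M4| + 2 * (C2 + 1) + 2 * C1.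
have nM1 := normr_ge0 M1; have nM2 := normr_ge0 M2; have nM3 := normr_ge0 M3; have nM4 := normr_ge0 M4.
have M0 : 0 < M by rewrite /M; lra.
exists M => // t tt0; have tp : 0 < t by exact: lt_le_trans tt0.
have w0 : 0 < Num.sqrt t by rewrite sqrtr_gt0.
have hn n : normc (hcyl n t) <= `|bj n t| + `|by_ n t| by exact: normc_le_ReIm.
rewrite /hnorm expr0 expr1 mulr1.
(* t = 1/4 corresponds to s = 1, from where on [hankel0_decay] applies. *)
have [t4|t4] := leP t 4^-1.
  have tI : t0 <= t <= 4^-1 by rewrite tt0.
  have := hM1 t tI; have := hM2 t tI; have := hM3 t tI; have := hM4 t tI.
  have := hn 0%N; have := hn 1%N.
  have := ler_norm M1; have := ler_norm M2; have := ler_norm M3; have := ler_norm M4.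
  move=> n1 n2 n3 n4 h1 h0 b4 b3 b2 b1; rewrite /M; split.
    by move: n1 n2 n3 n4 h0 b1 b2 C10 C20 nM3 nM4; clear; lra.
  have w1 : Num.sqrt t <= 1.
    by rewrite -[leRHS]sqrtr1 ler_wsqrtr// (le_trans t4)// invf_le1// ler1n.
  apply: (@le_trans _ _ (normc (hcyl 1 t))); last first.
    by move: n1 n2 n3 n4 h1 b3 b4 C10 C20 nM1 nM2; clear; lra.
  by rewrite ler_piMr// normc_ge0.
pose s := 2 * Num.sqrt t.
have s1 : 1 <= s.
  rewrite /s -ler_pdivrMl// mulr1 -(@ler_pXn2r _ 2)// ?nnegrE ?invr_ge0 ?(ltW w0)//.
  by rewrite sqr_sqrtr ?(ltW tp)// exprVn -natrX (ltW t4).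
have s0 : 0 < s by exact: lt_le_trans s1.
have D := hC2 s s1; have [U1 U2] := hC1 s s0.
have zE g : cylZ g s = g 0%N t by rewrite /cylZ sq.
have wE g : cylW g s / s = - (Num.sqrt t * g 1%N t).
  rewrite /cylW sq// /s -{1}(sqr_sqrtr (ltW tp)); field.
  by rewrite gt_eqF.
rewrite !zE !wE in D U1 U2.
have i1 : s^-1 <= 1 by rewrite invf_le1.
have D1 : C2 / s <= C2 by rewrite ler_piMr// ltW.
have D2 : C1 / s <= C1 by rewrite ler_piMr// ltW.
have sqb (x : R) : x ^+ 2 <= C2 -> `|x| <= C2 + 1.
  move=> hx; rewrite -(@ler_pXn2r _ 2)// ?nnegrE ?addr_ge0 ?(ltW C20)//.
  by rewrite real_normK ?num_real//; move: hx C20; clear; nra.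
have bJ : `|bj 0 t| <= C2 + 1 by apply: sqb; move: D1 D i1 C20 (sqr_ge0 (by_ 0 t)); clear; lra.
have bY : `|by_ 0 t| <= C2 + 1 by apply: sqb; move: D1 D i1 C20 (sqr_ge0 (bj 0 t)); clear; lra.
split; first by move: (hn 0%N) bJ bY C10 nM1 nM2 nM3 nM4; rewrite /M; clear; lra.
apply: (@le_trans _ _ ((`|bj 1 t| + `|by_ 1 t|) * Num.sqrt t)).
  by rewrite ler_wpM2r ?hn// ltW.
have b1 : `|Num.sqrt t * bj 1 t| <= C1 + (C2 + 1).
  have -> : Num.sqrt t * bj 1 t = - (- (Num.sqrt t * bj 1 t) + by_ 0 t) + by_ 0 t by ring.
  by apply: le_trans (ler_normD _ _) _; rewrite normrN; move: U1 U2 D2 bJ bY; clear; lra.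
have b2 : `|Num.sqrt t * by_ 1 t| <= C1 + (C2 + 1).
  have -> : Num.sqrt t * by_ 1 t = - (- (Num.sqrt t * by_ 1 t) - bj 0 t) - bj 0 t by ring.
  by apply: le_trans (ler_normB _ _) _; rewrite normrN; move: U1 U2 D2 bJ bY; clear; lra.
rewrite normrM (gtr0_norm w0) in b1; rewrite normrM (gtr0_norm w0) in b2.
rewrite mulrDl (mulrC `|bj 1 t|) (mulrC `|by_ 1 t|) /M.
apply: le_trans (lerD b1 b2) _.
by move: nM1 nM2 nM3 nM4; move: `|M1| `|M2| `|M3| `|M4| => m1 m2 m3 m4; clear; lra.
Qed.

(** In the recurrence one more order costs a factor of about n / sqrt t. Growth like n! B^n, with B
    depending on [t0] only, gives the Taylor series in the position of the pole a radius of
    convergence independent of the order. *)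
Lemma hnorm_bound t0 : 0 < t0 -> exists M B, [/\ 0 < M, 1 <= B &
  forall t n, t0 <= t -> hnorm n t <= M * (n`!%:R * B ^+ n)].
Proof.
move=> p0; have [M M0 hM] := hnorm_base p0.
pose w := Num.sqrt t0; have w0 : 0 < w by rewrite sqrtr_gt0.
have wi : 0 < w^-1 by rewrite invr_gt0.
pose B := w^-1 + 1; have B1 : 1 <= B by rewrite lerDr ltW.
have B0 : 0 < B by exact: lt_le_trans B1.
exists M, B; split => // t n tt0.
have tp : 0 < t by exact: lt_le_trans tt0.
suff : hnorm n t <= M * (n`!%:R * B ^+ n) /\ hnorm n.+1 t <= M * (n.+1`!%:R * B ^+ n.+1) by case.
elim: n => [|n [IH1 IH2]].
  have [h0 h1] := hM t tt0.
  rewrite fact0 (_ : 1`! = 1%N)// expr0 expr1 !mul1r mulr1; split => //.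
  by apply: le_trans h1 _; rewrite ler_peMr// ltW.
split => //; apply: le_trans (hnorm_rec n tp) _.
have wt : (Num.sqrt t)^-1 <= w^-1 by rewrite lef_pV2 ?posrE ?sqrtr_gt0// ler_wsqrtr.
have a0 : 0 <= n.+1%:R :> R by [].
apply: (@le_trans _ _ (n.+1%:R * w^-1 * (M * (n.+1`!%:R * B ^+ n.+1)) + M * (n`!%:R * B ^+ n))).
  apply: lerD => //; apply: ler_pM => //.
  - by rewrite mulr_ge0 ?normc_ge0 ?exprn_ge0 ?sqrtr_ge0.
  - exact: ler_wpM2l.
rewrite !factS !natrM.
set f := n`!%:R; have f1 : 1 <= f by rewrite /f ler1n fact_gt0.
have Bn : 1 <= B ^+ n by rewrite exprn_ege1.
have BS : B ^+ n.+1 = B * B ^+ n by rewrite exprS.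
have BSS : B ^+ n.+2 = B * (B * B ^+ n) by rewrite !exprS.
rewrite BS BSS -[n.+2%:R]natr1.
set a := n.+1%:R in a0 *; set b := B ^+ n in Bn *.
have a1 : 1 <= a by rewrite /a ler1n.
have -> : a * w^-1 * (M * (a * f * (B * b))) + M * (f * b) = M * (f * b) * (a * a * w^-1 * B + 1) by ring.
have -> : M * ((a + 1) * (a * f) * (B * (B * b))) = M * (f * b) * ((a + 1) * a * (B * B)) by ring.
have f0 : 0 <= f by exact: le_trans ler01 f1.
have b0 : 0 <= b by exact: le_trans ler01 Bn.
rewrite ler_wpM2l//; first by rewrite !mulr_ge0 ?(ltW M0).
have BE : B = w^-1 + 1 by [].
have q : a * a * w^-1 * B <= a * a * (w^-1 * B) by rewrite mulrA.
have : 1 <= B * B by rewrite -[leLHS]mulr1 ler_pM.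
have : 0 <= w^-1 * B by rewrite mulr_ge0 ?ltW.
have -> : B * B = w^-1 * B + B by rewrite {1}BE mulrDl mul1r.
by set c := w^-1 * B in q *; nra.
Qed.

End MultipoleBounds.

Section PolePushing.
Variables (R : realType) (k : R).
Hypothesis k_gt0 : 0 < k.
Local Notation C := R[i].
Local Notation multipole := (multipole k).
Local Notation cpt := (cpt k).
Local Notation tau := (tau k).
Implicit Types (z v x y : R * R) (j : nat) (m n : int) (t : R).

Lemma normc_cpt z : normc (cpt z) = Num.sqrt (tau z).
Proof. by rewrite /tau /cpt /=; congr Num.sqrt; ring. Qed.

Lemma normc_multipole n z : normc (multipole n z) = hnorm `|n| (tau z).
Proof.
case: n => m; rewrite /multipole; first by rewrite normcM normcX normc_cpt.
by rewrite !normcM !normcX normcN normc1 expr1n mul1r normc_conj normc_cpt.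
Qed.

(** The [j]-th derivative of the multipole in the direction [v], expanded by [is_derC_multipole]. *)
Fixpoint taylor_coef v j n z : C :=
  if j is j'.+1 then cpt v * taylor_coef v j' (n - 1) z - conjc (cpt v) * taylor_coef v j' (n + 1) z
  else multipole n z.

Lemma is_derC_taylor v j n z t : 0 < tau (z + t *: v) ->
  is_derC (fun t => taylor_coef v j n (z + t *: v)) t (taylor_coef v j.+1 n (z + t *: v)).
Proof.
move=> t0; elim: j n => [|j IH] n; first exact: is_derC_multipole.
have h := is_derCD (is_derCZ (cpt v) (IH (n - 1))) (is_derCZ (- conjc (cpt v)) (IH (n + 1))).
by apply: (is_derC_ext h) => [x|] /=; rewrite ?mulNr.
Qed.

(** Each derivative doubles the number of terms, brings a factor of modulus |cpt v| and shifts the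
    order by one: there are 2^j multipoles, of order at most |n| + j in absolute value. *)
Lemma taylor_coef_bound t0 : 0 < t0 -> exists M B, [/\ 0 < M, 1 <= B & forall v j n z, t0 <= tau z ->
  normc (taylor_coef v j n z) <= (2 * normc (cpt v)) ^+ j * (M * ((`|n| + j)`!%:R * B ^+ (`|n| + j)))].
Proof.
move=> p0; have [M [B [M0 B1 hM]]] := hnorm_bound p0.
exists M, B; split => // v j n z tz; elim: j n => [|j IH] n.
  by rewrite expr0 mul1r addn0 /= normc_multipole; exact: hM.
have mono a b : (a <= b)%N -> M * (a`!%:R * B ^+ a) <= M * (b`!%:R * B ^+ b).
  move=> ab; rewrite ler_wpM2l ?(ltW M0)//; apply: ler_pM => //.
  - by rewrite exprn_ge0// (le_trans _ B1).
  - by rewrite ler_nat leq_fact.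
  - by rewrite ler_weXn2l.
have c0 := normc_ge0 (cpt v).
have p2 : 0 <= (2 * normc (cpt v)) ^+ j by rewrite exprn_ge0// mulr_ge0.
have n1 : (`|(n - 1)%R| + j <= `|n| + j.+1)%N by lia.
have n2 : (`|(n + 1)%R| + j <= `|n| + j.+1)%N by lia.
have h1 := le_trans (IH (n - 1)) (ler_wpM2l p2 (mono _ _ n1)).
have h2 := le_trans (IH (n + 1)) (ler_wpM2l p2 (mono _ _ n2)).
have -> : taylor_coef v j.+1 n z = cpt v * taylor_coef v j (n - 1) z - conjc (cpt v) * taylor_coef v j (n + 1) z by [].
apply: le_trans (le_normcB _ _) _; rewrite !normcM normc_conj exprS.
have := ler_wpM2l c0 h1; have := ler_wpM2l c0 h2.
set X := (2 * normc (cpt v)) ^+ j * _; move=> g1 g2.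
rewrite -[2 * _ * _ * _]mulrA -/X.
by rewrite -[2 * _ * _]mulrA mulr_natl mulr2n; exact: lerD g2 g1.
Qed.

(** The sum of (1 - t)^j / j! times the j-th derivative at z + t v has a derivative in t that
    telescopes to its last term. The mean value theorem is applied to this sum, whence K! and not (K
    + 1)! in the bound. *)
Lemma taylor_remainder v n z K (M : R) : (forall t, 0 <= t <= 1 -> 0 < tau (z + t *: v)) ->
  (forall t, 0 <= t <= 1 -> normc (taylor_coef v K.+1 n (z + t *: v)) <= M) ->
  normc (multipole n (z + v) - \sum_(j < K.+1) (j`!%:R^-1)%:C%C * taylor_coef v j n z) <= 2 * (M / K`!%:R).
Proof.
move=> tp hM.
pose P t : C := \sum_(j < K.+1) ((1 - t) ^+ j / j`!%:R)%:C%C * taylor_coef v j n (z + t *: v).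
have dw j t : is_derive t 1 (fun t : R => (1 - t) ^+ j.+1 / j.+1`!%:R) (- ((1 - t) ^+ j / j`!%:R)).
  have d1 := is_deriveB (is_derive_cst (1:R) t 1) (is_derive_id t 1).
  have d2 := is_deriveZ (j.+1`!%:R^-1 : R) (is_deriveX j.+1 d1).
  apply: (is_derive_ext d2) => [x|]; rewrite !fctE /GRing.scale /=; first by rewrite mulrC.
  rewrite factS natrM; have := fact_neq0 R j; have : j.+1%:R != 0 :> R by rewrite pnatr_eq0.
  by set a := j.+1%:R; set b := j`!%:R => an bn; rewrite sub0r invfM mulrN1 mulrN mulrACA mulVf// mul1r mulrC.
have dP t : 0 <= t <= 1 -> is_derC P t (((1 - t) ^+ K / K`!%:R)%:C%C * taylor_coef v K.+1 n (z + t *: v)).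
  move=> ht; have t0 := tp t ht; rewrite /P; elim: (K) => [|L IH].
    apply: (is_derC_ext (is_derC_taylor 0 n t0)) => [x|]; first by rewrite big_ord1 expr0 divr1 mul1r.
    by rewrite expr0 divr1 mul1r.
  have h := is_derCM (is_derC_real (dw L t)) (is_derC_taylor L.+1 n t0).
  apply: (is_derC_ext (is_derCD IH h)) => [x|]; first by rewrite [RHS]big_ord_recr.
  have -> : (- ((1 - t) ^+ L / L`!%:R))%:C%C = - ((1 - t) ^+ L / L`!%:R)%:C%C :> C by rewrite rmorphN.
  by rewrite mulNr addrA subrr add0r.
have b t : 0 <= t <= 1 -> normc (((1 - t) ^+ K / K`!%:R)%:C%C * taylor_coef v K.+1 n (z + t *: v)) <= M / K`!%:R.
  move=> /andP[t0 t1]; rewrite normcM normc_real mulrC ger0_norm; last first.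
    by rewrite divr_ge0// exprn_ge0// subr_ge0.
  have f0 : 0 <= K`!%:R^-1 :> R by rewrite invr_ge0.
  have M0 : 0 <= M by apply: le_trans (normc_ge0 _) (hM 0 _); rewrite lexx ler01.
  rewrite mulrA ler_wpM2r//; apply: (@le_trans _ _ (M * 1)); last by rewrite mulr1.
  apply: ler_pM; rewrite ?normc_ge0 ?exprn_ge0 ?subr_ge0 ?hM ?t0//.
  by rewrite exprn_ile1 ?subr_ge0// lerBlDr lerDl.
have := mvt_normc ler01 dP b; rewrite subr0 mulr1.
suff [-> ->] : P 1 = multipole n (z + v) /\ P 0 = \sum_(j < K.+1) (j`!%:R^-1)%:C%C * taylor_coef v j n z by [].
split; rewrite /P.
  rewrite big_ord_recl big1 ?addr0 => [|i _]; first by rewrite /= expr0 divr1 mul1r scale1r.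
  by rewrite subrr expr0n /= mul0r mul0r.
by apply: eq_bigr => j _; rewrite subr0 expr1n div1r scale0r addr0.
Qed.

Lemma fact_add_le a b : ((a + b)`! <= 2 ^ (a + b) * (a`! * b`!))%N.
Proof.
rewrite -(bin_fact (leq_addr b a)) addKn leq_mul2r; apply/orP; right.
rewrite -[2%N]/(1 + 1)%N expnDn (bigD1 (inord a)) //= inordK ?ltnS ?leq_addr//.
by rewrite !exp1n !muln1 leq_addr.
Qed.

(** The step length [s] is chosen before the order [n]: every move replaces one pole by another for
    all orders at once, so that moves can be chained. *)
Lemma push_step (t0 : R) : 0 < t0 -> exists2 s : R, 0 < s & forall (F : set (R * R)) y y',
  (forall x t, F x -> 0 <= t <= 1 -> t0 <= tau (x - y + t *: (y - y'))) ->
  normc (cpt (y - y')) <= s ->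
  forall n, approx F (fun m x => multipole m (x - y)) (fun x => multipole n (x - y')).
Proof.
move=> p0; have [M [B [M0 B1 hM]]] := taylor_coef_bound p0.
have B0 : 0 < B by exact: lt_le_trans B1.
(* The remainder contains (2 c B)^(K+1), a factor 2^(K+1) from (N + K + 1)! <= 2^(N+K+1) N! (K+1)!,
   and another from K + 1 <= 2^(K+1). Together these are (8 c B)^(K+1), at most 2^-(K+1) when c <= 1
   / (16 B). *)
exists (16 * B)^-1; first by rewrite invr_gt0 mulr_gt0.
move=> F y y' hF hv n; set v := y - y' in hF hv *.
pose c := normc (cpt v).
pose N := `|n|%N; pose D : R := 2 * (M * (N`!%:R * (2 * B) ^+ N)).
have D0 : 0 < D by rewrite /D !mulr_gt0 ?ltr0n ?fact_gt0// exprn_gt0// mulr_gt0.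
have ap j m : approx F (fun m x => multipole m (x - y)) (fun x => taylor_coef v j m (x - y)).
  elim: j m => [|j IH] m; first exact: (@approx_gen _ _ _ F (fun m x => multipole m (x - y))).
  have h := approxD (approxZ (cpt v) (IH (m - 1))) (approxZ (- conjc (cpt v)) (IH (m + 1))).
  by apply: eq_approx h => x _ /=; rewrite mulNr.
apply: approx_lim => e e0.
have [K hK] : exists K, D * (2^-1) ^+ K.+1 <= e.
  have h : D * (2^-1) ^+ n @[n --> \oo] --> (D * 0 : R).
    by apply: cvgM; [exact: cvg_cst|apply: cvg_expr; rewrite ger0_norm ?invr_ge0// invf_lt1// ltr1n].
  rewrite mulr0 in h; have [K _ hK] := cvgr_le 0 h e e0.
  by exists K; apply: hK => /=.
exists (fun x => \sum_(j < K.+1) (j`!%:R^-1)%:C%C * taylor_coef v j n (x - y)).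
  by apply: approx_sum => j; apply: approxZ; exact: ap.
move=> x Fx; have -> : x - y' = x - y + v by rewrite /v addrA subrK.
have tp t : 0 <= t <= 1 -> 0 < tau (x - y + t *: v).
  by move=> ht; exact: lt_le_trans p0 (hF _ _ Fx ht).
have bd t : 0 <= t <= 1 -> normc (taylor_coef v K.+1 n (x - y + t *: v)) <=
    (2 * c) ^+ K.+1 * (M * ((N + K.+1)`!%:R * B ^+ (N + K.+1))).
  by move=> ht; apply: hM; exact: hF.
apply: le_trans (taylor_remainder tp bd) _; apply: le_trans hK.
have c0 : 0 <= c by exact: normc_ge0.
have f1 : ((N + K.+1)`!%:R : R) <= 2 ^+ (N + K.+1) * (N`!%:R * K.+1`!%:R).
  by rewrite -natrX -!natrM ler_nat fact_add_le.
have f2 : (K.+1%:R : R) <= 2 ^+ K.+1 by rewrite -natrX ler_nat ltnW// ltn_expl.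
have kf : 0 < K`!%:R :> R by rewrite ltr0n fact_gt0.
have cB : 8 * c * B <= 2^-1.
  have h : c * (16 * B) <= 1 by rewrite -ler_pdivlMr ?mulr_gt0// div1r.
  lra.
have cBn : (8 * c * B) ^+ K.+1 <= (2^-1) ^+ K.+1.
  by rewrite lerXn2r ?nnegrE ?invr_ge0 ?mulr_ge0 ?(ltW B0).
apply: (@le_trans _ _ (2 * ((2 * c) ^+ K.+1 * (M * (2 ^+ (N + K.+1) * (N`!%:R * (2 ^+ K.+1 * K`!%:R)) * B ^+ (N + K.+1))) / K`!%:R))).
  rewrite ler_wpM2l// ler_wpM2r ?invr_ge0 ?(ltW kf)// ler_wpM2l ?exprn_ge0 ?mulr_ge0// ler_wpM2l ?(ltW M0)//.
  rewrite ler_wpM2r ?exprn_ge0 ?(ltW B0)//; apply: le_trans f1 _.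
  rewrite ler_wpM2l ?exprn_ge0// ler_wpM2l// factS natrM ler_wpM2r// ltW//.
have -> : 2 * ((2 * c) ^+ K.+1 * (M * (2 ^+ (N + K.+1) * (N`!%:R * (2 ^+ K.+1 * K`!%:R)) * B ^+ (N + K.+1))) / K`!%:R)
   = D * (8 * c * B) ^+ K.+1.
  rewrite /D (_ : 8 * c * B = 2 * c * 2 * 2 * B); last by ring.
  rewrite !exprD !exprMn; field; exact: lt0r_neq0.
by rewrite ler_wpM2l// ltW.
Qed.

(** Induction along an interval, through the supremum of the points reached. It takes the place of a
    subdivision, here for paths of poles and later for Riemann sums. *)
Lemma itv_chain (P : R -> Prop) a b : a <= b -> P a ->
  (forall t, a <= t <= b -> exists2 e, 0 < e & forall t1 t2, a <= t1 <= b -> a <= t2 <= b -> t1 <= t2 ->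
    `|t1 - t| < e -> `|t2 - t| < e -> P t1 -> P t2) -> P b.
Proof.
move=> ab P0 loc; pose A := [set t : R | a <= t <= b /\ P t].
have A0 : A a by split; rewrite ?lexx.
have hs : has_sup A by split; [exists a|exists b => t [/andP[]]].
pose s := sup A.
have s0 : a <= s by exact: sup_upper_bound.
have s1 : s <= b by apply: ge_sup; [exists a|move=> t [/andP[]]].
have s01 : a <= s <= b by rewrite s0.
have [e e0 he] := loc s s01.
have [t [t01 Pt] ts] := sup_adherent e0 hs.
have tle : t <= s by exact: sup_upper_bound.
have te : `|t - s| < e by rewrite ler0_norm ?subr_le0// opprB ltrBlDr -ltrBlDl.
pose s' := Num.min b (s + e / 2).
have s'1 : s' <= b by rewrite ge_min lexx.
have ss' : s <= s' by rewrite le_min s1 lerDl divr_ge0// ltW.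
have s'01 : a <= s' <= b by rewrite s'1 (le_trans s0).
have s'e : `|s' - s| < e.
  rewrite ger0_norm ?subr_ge0// ltrBlDl gt_min; apply/orP; right.
  by rewrite ltrD2l ltr_pdivrMr// ltr_pMr// ltr1n.
have Ps' : P s' by apply: he Pt => //; exact: le_trans ss'.
have : s' <= s by apply: sup_upper_bound.
rewrite ge_min => /orP[h|].
  have E : s' = b by apply/eqP; rewrite eq_le s'1 (le_trans h).
  by rewrite -E.
by rewrite gerDl leNgt divr_gt0.
Qed.

Lemma tau_ge z : (k / 2) ^+ 2 * `|z| ^+ 2 <= tau z.
Proof.
rewrite /tau ler_wpM2l ?sqr_ge0//; rewrite prod_normE.
case: (leP `|z.1| `|z.2|) => _; rewrite real_normK ?num_real//.
  by rewrite lerDr sqr_ge0.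
by rewrite lerDl sqr_ge0.
Qed.

Lemma normc_cpt_le z : normc (cpt z) <= k * `|z|.
Proof.
apply: le_trans (normc_le_ReIm _) _; rewrite /= !normrM.
have k2 : 0 < k / 2 by rewrite divr_gt0.
have z1 : `|z.1| <= `|z| by rewrite prod_normE le_max lexx.
have z2 : `|z.2| <= `|z| by rewrite prod_normE le_max lexx orbT.
by rewrite normfV (gtr0_norm k_gt0) (ger0_norm (ler0n R 2)); nra.
Qed.

(** Openness of [A] keeps [F] at a positive distance from each point of the path, so [push_step]
    applies near that point; [itv_chain] joins the local moves. *)
Lemma push_path (A F : set (R * R)) (g : R -> R * R) : open A -> (forall x, F x -> ~ A x) ->
  {within `[0, 1], continuous g} -> g @` `[0, 1] `<=` A ->
  forall n, approx F (fun m x => multipole m (x - g 0)) (fun x => multipole n (x - g 1)).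
Proof.
move=> oA FA cg gA.
pose P t := forall n, approx F (fun m x => multipole m (x - g 0)) (fun x => multipole n (x - g t)).
suff : P 1 by [].
apply: (@itv_chain P 0 1); [exact: ler01| |]; first by move=> n; exact: (@approx_gen _ _ _ F (fun m x => multipole m (x - g 0))).
move=> t t01.
have gt : A (g t) by apply: gA; exists t => //=; rewrite in_itv.
have := open_nbhs_nbhs (conj oA gt) => /nbhs_ballP[d /= d0 dA].
have far x : F x -> d <= `|x - g t|.
  move=> Fx; rewrite leNgt; apply/negP => h; apply: (FA x Fx); apply: dA.
  by rewrite -ball_normE /= distrC.
have t0 : 0 < (k / 2) ^+ 2 * (d / 2) ^+ 2 by rewrite mulr_gt0 ?exprn_gt0 ?divr_gt0.
have [s s0 hs] := push_step t0.
(* Both poles will lie within [r] of [g t]: [d / 6] keeps the segment between them at distance at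
   least d / 2 from [F], and [s / (2 * k)] makes the move short enough for [push_step]. *)
pose r := Num.min (d / 6) (s / (2 * k)).
have r0 : 0 < r by rewrite lt_min !divr_gt0// mulr_gt0.
have : g @ within `[0, 1] (nbhs t) --> g t.
  have h0 := (subspace_continuousP _ _ ).1 cg t.
  by apply: h0; rewrite /= in_itv.
move=> /cvgr_dist_lt /(_ r r0); rewrite near_withinE => /nbhs_ballP[e /= e0 he].
exists e; first exact: e0.
move=> t1 t2 h1 h2 _ e1 e2 P1 n.
have b1 : `|g t - g t1| < r by apply: he => /=; rewrite ?in_itv// -ball_normE /= distrC.
have b2 : `|g t - g t2| < r by apply: he => /=; rewrite ?in_itv// -ball_normE /= distrC.
apply: approx_trans (P1) _.
apply: hs => [x u Fx u01|].
  apply: le_trans (tau_ge _); rewrite ler_wpM2l ?sqr_ge0// lerXn2r ?nnegrE ?divr_ge0 ?(ltW d0)//.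
  have /andP[u0 u1] := u01.
  have E : x - g t1 + u *: (g t1 - g t2) = (x - g t) + ((g t - g t1) + u *: ((g t - g t2) - (g t - g t1))).
    have -> : g t - g t2 - (g t - g t1) = g t1 - g t2 by rewrite opprB addrC addrA subrK.
    by rewrite [RHS]addrA [x - g t + _]addrA subrK.
  have q : `|(g t - g t1) + u *: ((g t - g t2) - (g t - g t1))| <= d / 2.
    apply: le_trans (ler_normD _ _) _; rewrite normrZ (ger0_norm u0).
    have q1 : `|g t - g t2 - (g t - g t1)| <= 2 * r.
      by apply: le_trans (ler_normB _ _) _; rewrite mulr_natl mulr2n lerD// ltW.
    have q2 : u * `|g t - g t2 - (g t - g t1)| <= 1 * (2 * r) by apply: ler_pM.
    have r1 : r <= d / 6 by rewrite ge_min lexx.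
    lra.
  rewrite E; have := far x Fx; have := ler_normB (x - g t + ((g t - g t1) + u *: ((g t - g t2) - (g t - g t1)))) ((g t - g t1) + u *: ((g t - g t2) - (g t - g t1))).
  by rewrite addrK; lra.
apply: le_trans (normc_cpt_le _) _.
have -> : g t1 - g t2 = (g t - g t2) - (g t - g t1) by rewrite opprB [RHS]addrC addrA subrK.
have q1 : `|g t - g t2 - (g t - g t1)| <= 2 * r.
  by apply: le_trans (ler_normB _ _) _; rewrite mulr_natl mulr2n lerD// ltW.
apply: le_trans (ler_wpM2l (ltW k_gt0) q1) _.
have r1 : r <= s / (2 * k) by rewrite ge_min lexx orbT.
have : k * (2 * r) <= k * (2 * (s / (2 * k))) by rewrite !ler_wpM2l// ltW.
by have -> : k * (2 * (s / (2 * k))) = s by field; rewrite gt_eqF.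
Qed.

End PolePushing.

(** * Gradients *)

Section Gradient.
Variable R : realType.
Implicit Types (f : R * R -> R) (x p h : R * R) (C e t : R).

Lemma dnbhs0_neq : \forall t \near (0 : R)^', t != 0.
Proof. exact: nbhs_dnbhs_neq. Qed.

Lemma cvg_quot (F : R -> R) F0 (g : R) C e : 0 < e ->
  (forall t, `|t| < e -> `|F t - F0 - t * g| <= C * t ^+ 2) ->
  t^-1 *: (F t - F0) @[t --> 0^'] --> g.
Proof.
move=> e0 h; apply/cvgrPdist_le => eps eps0.
have C0 : 0 < `|C| + 1 by rewrite ltr_wpDl.
near=> t.
have t0 : t != 0 by near: t; exact: dnbhs0_neq.
have te : `|t| < e by near: t; exact: dnbhs0_lt.
have tp : `|t| < eps / (`|C| + 1) by near: t; apply: dnbhs0_lt; rewrite divr_gt0.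
have n0 : 0 < `|t| by rewrite normr_gt0.
have -> : g - t^-1 *: (F t - F0) = - (t^-1 * (F t - F0 - t * g)).
  by rewrite /GRing.scale /=; field.
rewrite normrN normrM normfV mulrC ler_pdivrMr//.
apply: le_trans (h t te) _; rewrite -[t ^+ 2]real_normK ?num_real//.
rewrite expr2 mulrA ler_pM2r//; rewrite ltr_pdivlMr// in tp.
apply: le_trans (ltW tp); rewrite mulrC ler_wpM2l// ?(ltW n0)//.
by rewrite (le_trans (ler_norm C))// lerDl.
Unshelve. all: by end_near. Qed.

Lemma is_derive_quot (V : normedModType R) (f : V -> R) (x v : V) (g : R) :
  t^-1 *: (f (t *: v + x) - f x) @[t --> 0^'] --> g -> is_derive x v f g.
Proof.
move=> h; apply: DeriveDef; first by apply/cvg_ex; exists g.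
by apply: cvg_lim h.
Qed.

Lemma quot_is_derive (F : R -> R) (t d : R) : is_derive t 1 F d ->
  s^-1 *: (F (s + t) - F t) @[s --> 0^'] --> d.
Proof.
move=> [h1 <-]; rewrite /derivable in h1.
have : (fun s : R => s^-1 *: ((F \o shift t) (s *: 1) - F t)) @ 0^' --> 'D_1 F t by exact: h1.
apply: cvg_trans; apply: near_eq_cvg; near=> s.
by rewrite /= /shift /GRing.scale /= mulr1.
Unshelve. all: by end_near. Qed.

(* The chain rule along curves is the only form of differentiability that is needed in the plane. *)
Definition is_grad f x p := forall (g1 g2 : R -> R) t d1 d2, (g1 t, g2 t) = x ->
  is_derive t 1 g1 d1 -> is_derive t 1 g2 d2 ->
  is_derive t 1 (fun s => f (g1 s, g2 s)) (p.1 * d1 + p.2 * d2).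

Lemma is_grad_quad f x p C e : 0 < e ->
  (forall h, `|h| < e -> `|f (x + h) - f x - (p.1 * h.1 + p.2 * h.2)| <= C * (h.1 ^+ 2 + h.2 ^+ 2)) ->
  is_grad f x p.
Proof.
move=> e0 H g1 g2 t d1 d2 gx dg1 dg2.
apply: is_derive_quot.
have q1 := quot_is_derive dg1; have q2 := quot_is_derive dg2.
set Q1 := fun s => _ in q1; set Q2 := fun s => _ in q2.
pose E (s : R) := s^-1 *: (f (g1 (s *: 1 + t), g2 (s *: 1 + t)) - f (g1 t, g2 t)) - (p.1 * Q1 s + p.2 * Q2 s).
suff E0 : E s @[s --> 0^'] --> (0 : R).
  have : E s + (p.1 * Q1 s + p.2 * Q2 s) @[s --> 0^'] --> 0 + (p.1 * d1 + p.2 * d2).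
    apply: cvgD => //; apply: cvgD; apply: cvgM => //; exact: cvg_cst.
  rewrite add0r; apply: cvg_trans; apply: near_eq_cvg; near=> s.
  by rewrite /E subrK.
have c0 (g : R -> R) d : is_derive t 1 g d -> g (s + t) @[s --> 0^'] --> g t.
  move=> dg; have cg := is_derive_cont dg; rewrite continuous_shift in cg.
  have : (g \o shift t) s @[s --> 0^'] --> (g \o shift t) 0.
    by apply: cvg_within_filter; exact: cg.
  by rewrite /shift /= add0r.
have B0 : C * (Q1 s ^+ 2 + Q2 s ^+ 2) * `|s| @[s --> 0^'] --> (0 : R).
  rewrite -[X in _ --> X](mulr0 (C * (d1 ^+ 2 + d2 ^+ 2))); apply: cvgM.
    apply: cvgM; first exact: cvg_cst.
    by rewrite !expr2; apply: cvgD; apply: cvgM.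
  have n0 : `|s| @[s --> (0:R)] --> `|0 : R| by exact: norm_continuous.
  by rewrite normr0 in n0; exact: cvg_within_filter n0.
have BN0 : - (C * (Q1 s ^+ 2 + Q2 s ^+ 2) * `|s|) @[s --> 0^'] --> (0 : R).
  by rewrite -[X in _ --> X]oppr0; exact: cvgN.
apply: squeeze_cvgr BN0 B0; near=> s.
have s0 : s != 0 by near: s; exact: dnbhs0_neq.
have n1 : `|g1 (s + t) - g1 t| < e.
  by rewrite distrC; near: s; move: e e0 {H}; apply/cvgrPdist_lt; exact: c0 dg1.
have n2 : `|g2 (s + t) - g2 t| < e.
  by rewrite distrC; near: s; move: e e0 {H}; apply/cvgrPdist_lt; exact: c0 dg2.
have := H (g1 (s + t) - g1 t, g2 (s + t) - g2 t).
rewrite prod_normE gt_max /= n1 n2 => /(_ isT).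
have -> : x + (g1 (s + t) - g1 t, g2 (s + t) - g2 t) = (g1 (s + t), g2 (s + t)).
  by rewrite -gx; congr pair; rewrite /= addrC subrK.
rewrite -gx => h.
have sn : 0 < `|s| by rewrite normr_gt0.
have ss : `|s| * `|s| = s * s by rewrite -!expr2 real_normK// num_real.
rewrite -ler_norml.
have -> : E s = s^-1 * (f (g1 (s + t), g2 (s + t)) - f (g1 t, g2 t)
    - (p.1 * (g1 (s + t) - g1 t) + p.2 * (g2 (s + t) - g2 t))).
  by rewrite /E /Q1 /Q2 /GRing.scale /= !mulr1; ring.
rewrite normrM normfV mulrC ler_pdivrMr//; apply: le_trans h _.
rewrite -!mulrA ss /Q1 /Q2 /GRing.scale /= le_eqVlt; apply/orP; left; apply/eqP.
by field.
Unshelve. all: by end_near. Qed.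

Lemma is_grad_derive f x p (v : R * R) : is_grad f x p -> is_derive x v f (p.1 * v.1 + p.2 * v.2).
Proof.
move=> h; have dl (a b : R) : is_derive (0:R) 1 (fun s : R => s * b + a) b.
  have H := is_deriveD (is_deriveM (is_derive_id (0:R) 1) (is_derive_cst b (0:R) 1)) (is_derive_cst a (0:R) 1).
  by apply: (is_derive_ext H) => //; rewrite /GRing.scale /=; ring.
have H := h _ _ 0 _ _ _ (dl x.1 v.1) (dl x.2 v.2).
apply: is_derive_quot; have {}H := H _.
have /quot_is_derive : is_derive (0:R) 1 (fun s => f (s * v.1 + x.1, s * v.2 + x.2)) (p.1 * v.1 + p.2 * v.2).
  by apply: H; case: (x) => a b; rewrite !mul0r !add0r.
apply: cvg_trans; apply: near_eq_cvg; near=> s.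
rewrite addr0 !mul0r !add0r; congr (_ *: (_ - _)).
by case: (x).
Unshelve. all: by end_near. Qed.

End Gradient.

(** * Real-analytic functions of two variables *)

Section Expansion.
Variable R : realType.
Implicit Types (f : R * R -> R) (c : nat -> nat -> R) (a x h : R * R) (rho s t u q : R) (d i j n : nat).

Definition hpoly c d h := \sum_(i < d.+1) c i (d - i)%N * h.1 ^+ i * h.2 ^+ (d - i).
Definition cnorm c d := \sum_(i < d.+1) `|c i (d - i)%N|.

(** Absolute convergence is stated for a one-variable series of norms, obtained from the diagonal
    point (s, s). Termwise derivatives inherit it by comparison, and [hpoly_le] bounds the
    homogeneous parts by it. *)
Definition expansion f a c rho := [/\ 0 < rho,
  forall s, 0 <= s < rho -> cvgn (series (fun d => cnorm c d * s ^+ d)) &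
  forall h, `|h| < rho -> series (hpoly c ^~ h) @ \oo --> f (a + h)].

Lemma cnorm_ge0 c d : 0 <= cnorm c d.
Proof. by apply: sumr_ge0. Qed.

Lemma eq_is_cvg_series (v w : nat -> R) : v =1 w -> cvgn (series v) -> cvgn (series w).
Proof. by move=> /funext ->. Qed.

Lemma eq_cvg_series (v w : nat -> R) (l : R) : v =1 w -> series v @ \oo --> l -> series w @ \oo --> l.
Proof. by move=> /funext ->. Qed.

Lemma cvg_series_shift (v : nat -> R) (l : R) : series v @ \oo --> l ->
  series (fun n => v n.+1) @ \oo --> l - v 0%N.
Proof.
move=> hl.
have : series v n.+1 - v 0%N @[n --> \oo] --> l - v 0%N.
  by apply: cvgB; [rewrite cvg_shiftS|exact: cvg_cst].
apply: cvg_trans; apply: near_eq_cvg; near=> n.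
by rewrite !seriesEord /= big_ord_recl addrAC subrr add0r.
Unshelve. all: by end_near. Qed.

Lemma expansionP f a : real_analytic_at f a -> exists c rho, expansion f a c rho.
Proof.
move=> [c [rho [rho0 h]]]; exists c, rho; split => // [s /andP[s0 sr]|y yr].
  have := h (a + (s, s)); rewrite addrAC subrr add0r prod_normE max_l// ger0_norm// => /(_ sr)[+ _].
  apply: eq_is_cvg_series => d.
  rewrite /cnorm mulr_suml; apply: eq_bigr => i _ /=.
  rewrite !(addrAC _ s) !subrr !add0r !normrM !normrX (ger0_norm s0) -mulrA -exprD subnKC//.
  by rewrite -ltnS.
have := h (a + y); rewrite addrAC subrr add0r => /(_ yr)[_].
apply: eq_cvg_series => d; apply: eq_bigr => i _ /=.
by rewrite [a.1 + _]addrC [a.2 + _]addrC !addrK.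
Qed.

Lemma norm_pair h s : (`|h| <= s) = (`|h.1| <= s) && (`|h.2| <= s).
Proof. by rewrite prod_normE ge_max. Qed.

Lemma hpoly_le c d h s : `|h| <= s -> `|hpoly c d h| <= cnorm c d * s ^+ d.
Proof.
rewrite norm_pair => /andP[h1 h2]; apply: le_trans (ler_norm_sum _ _ _) _.
rewrite /cnorm mulr_suml; apply: ler_sum => i _.
rewrite !normrM !normrX -mulrA ler_wpM2l//.
have -> : s ^+ d = s ^+ i * s ^+ (d - i) by rewrite -exprD subnKC// -ltnS.
by apply: ler_pM => //; rewrite lerXn2r// nnegrE ?(le_trans _ h1)// (le_trans _ h2).
Qed.

Lemma series_cvg_norm (v b : nat -> R) : (forall n, `|v n| <= b n) -> cvgn (series b) -> cvgn (series v).
Proof.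
move=> h cb; apply: normed_cvg; apply: (series_le_cvg _ _ _ cb) => n; first exact: normr_ge0.
  exact: le_trans (normr_ge0 _) (h n).
exact: h.
Qed.

Lemma series_bound (v b : nat -> R) l : (forall n, `|v n| <= b n) -> series v @ \oo --> l ->
  cvgn (series b) -> `|l| <= limn (series b).
Proof.
move=> h cv cb; have b0 n : 0 <= b n by exact: le_trans (normr_ge0 _) (h n).
have -> : l = limn (series v) by apply/esym; apply: cvg_lim cv.
rewrite ler_norml -lim_seriesN//; apply/andP; split; apply: lim_series_le => //.
- by rewrite is_cvg_seriesN.
- by apply/cvg_ex; exists l.
- by move=> n; have := h n; rewrite ler_norml => /andP[].
- by apply/cvg_ex; exists l.
- by move=> n; have := h n; rewrite ler_norml => /andP[].
Qed.

Lemma natX_bound q : 0 <= q < 1 -> exists2 K, 0 < K & forall n, n%:R * q ^+ n <= K.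
Proof.
move=> /andP[q0 q1]; have [->|qn0] := eqVneq q 0.
  by exists 1 => // -[|n]; rewrite ?mul0r// expr0n mulr0.
have qp : 0 < q by rewrite lt0r qn0.
pose e := q^-1 - 1; have e0 : 0 < e by rewrite subr_gt0 invf_gt1.
have B n : n%:R * e <= (1 + e) ^+ n.
  elim: n => [|n IH]; first by rewrite mul0r expr0.
  rewrite exprS mulrDl mul1r -natr1 mulrDl mul1r lerD//.
  rewrite ler_peMr ?(ltW e0)// -[leLHS](expr1n _ n) lerXn2r ?nnegrE ?lerDl ?(ltW e0)//.
  by rewrite addr_ge0// ltW.
exists e^-1; first by rewrite invr_gt0.
move=> n; rewrite -(ler_pM2r e0) mulVf ?gt_eqF// mulrAC.
have -> : q ^+ n = ((1 + e) ^+ n)^-1 by rewrite /e addrCA subrr addr0 exprVn invrK.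
rewrite ler_pdivrMr ?mul1r//; last by rewrite exprn_gt0// addr_gt0.
Qed.

Lemma nat2X_bound q : 0 <= q < 1 -> exists2 K, 0 < K & forall n, n%:R ^+ 2 * q ^+ n <= K.
Proof.
move=> /andP[q0 q1]; have [|K K0 hK] := @natX_bound (Num.sqrt q).
  by rewrite sqrtr_ge0 -[ltRHS]sqrtr1 ltr_sqrt.
exists (K ^+ 2); first by rewrite exprn_gt0.
move=> n; have -> : n%:R ^+ 2 * q ^+ n = (n%:R * Num.sqrt q ^+ n) ^+ 2.
  by rewrite exprMn -exprM mulnC exprM sqr_sqrtr.
by rewrite lerXn2r ?nnegrE ?mulr_ge0 ?exprn_ge0 ?sqrtr_ge0// ltW.
Qed.

(** The factor [s ^+ 2] on the left replaces an exponent i - 2 on the right, which would be negative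
    for small [i]. *)
Lemma monomial_quad s t u i : `|u| <= s -> `|u + t| <= s ->
  s ^+ 2 * `|(u + t) ^+ i - u ^+ i - t * (i%:R * u ^+ i.-1)| <= t ^+ 2 * (i%:R ^+ 2 * s ^+ i).
Proof.
move=> us uts; have s0 : 0 <= s by exact: le_trans us.
elim: i => [|i IH]; first by rewrite !expr0 subrr !mul0r mulr0 subr0 normr0 expr0n !mul0r !mulr0.
set E := (u + t) ^+ i - u ^+ i - t * (i%:R * u ^+ i.-1) in IH.
have -> : (u + t) ^+ i.+1 - u ^+ i.+1 - t * (i.+1%:R * u ^+ i.+1.-1) = (u + t) * E + i%:R * t ^+ 2 * u ^+ i.-1.
  rewrite /E; case: (i) => [|m] /=; first by rewrite !expr1 expr0; ring.
  by rewrite !exprS -[m.+2%:R]natr1; ring.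
have h1 : s ^+ 2 * `|(u + t) * E| <= s * (t ^+ 2 * (i%:R ^+ 2 * s ^+ i)).
  rewrite normrM mulrCA; apply: ler_pM => //.
  by rewrite mulr_ge0// sqr_ge0.
have h2 : s ^+ 2 * `|i%:R * t ^+ 2 * u ^+ i.-1| <= t ^+ 2 * (i%:R * s ^+ i.+1).
  case: (i) => [|m]; first by rewrite !mul0r normr0 !mulr0.
  have -> : `|m.+1%:R * t ^+ 2 * u ^+ m.+1.-1| = m.+1%:R * (t * t) * `|u| ^+ m.
    by rewrite normrM normrX ger0_norm// mulr_ge0// sqr_ge0.
  rewrite !exprS expr0 mulr1.
  have : `|u| ^+ m <= s ^+ m by rewrite lerXn2r.
  have : 0 <= (s * s) * (m.+1%:R * (t * t)) by apply: mulr_ge0; [|apply: mulr_ge0 => //]; rewrite -expr2 sqr_ge0.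
  set A := m.+1%:R; set B := s ^+ m; set D := `|u| ^+ m => p1 p2.
  have := ler_wpM2l p1 p2; rewrite expr0 mulr1; lra.
apply: (@le_trans _ _ (s * (t ^+ 2 * (i%:R ^+ 2 * s ^+ i)) + t ^+ 2 * (i%:R * s ^+ i.+1))).
  apply: le_trans (lerD h1 h2); rewrite -mulrDr ler_wpM2l ?sqr_ge0//; exact: ler_normD.
rewrite -natr1 (exprS s).
have p : 0 <= t ^+ 2 * (s * s ^+ i) by rewrite mulr_ge0 ?sqr_ge0// mulr_ge0// exprn_ge0.
have n0 : 0 <= i%:R :> R by [].
set A := t ^+ 2 in p *; set B := s ^+ i in p *; set n := i%:R in n0 *.
have -> : A * ((n + 1) ^+ 2 * (s * B)) = s * (A * (n ^+ 2 * B)) + A * (n * (s * B)) + (n + 1) * (A * (s * B)) by ring.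
by rewrite lerDl mulr_ge0// addr_ge0.
Qed.

Definition shift1 c i j := i.+1%:R * c i.+1 j.
Definition shift2 c i j := j.+1%:R * c i j.+1.

Lemma cnorm_shift1 c d : cnorm (shift1 c) d <= d.+1%:R * cnorm c d.+1.
Proof.
rewrite /cnorm [X in _ * X]big_ord_recl mulrDr mulr_sumr -[leLHS]add0r.
apply: lerD; first by rewrite mulr_ge0.
apply: ler_sum => i _; rewrite /shift1 normrM ger0_norm// !lift0 subSS ler_wpM2r//.
by rewrite ler_nat ltn_ord.
Qed.

Lemma hpoly_quad c d h t s : `|h| <= s -> `|h.1 + t| <= s ->
  s ^+ 2 * `|hpoly c d.+1 (h + (t, 0)) - hpoly c d.+1 h - t * hpoly (shift1 c) d h| <=
  t ^+ 2 * (cnorm c d.+1 * (d.+1%:R ^+ 2 * s ^+ d.+1)).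
Proof.
rewrite norm_pair => /andP[h1 h2] h1t.
have s0 : 0 <= s by exact: le_trans h1.
have -> : hpoly (shift1 c) d h = \sum_(i < d.+2) c i (d.+1 - i)%N * (i%:R * h.1 ^+ i.-1) * h.2 ^+ (d.+1 - i).
  rewrite [RHS]big_ord_recl !mul0r mulr0 mul0r add0r; apply: eq_bigr => i _.
  by rewrite /shift1 !lift0 subSS /=; ring.
rewrite /hpoly mulr_sumr -!sumrB /=; apply: (@le_trans _ _ (\sum_(i < d.+2) s ^+ 2 *
    `|c i (d.+1 - i)%N * (h.1 + t) ^+ i * (h.2 + 0) ^+ (d.+1 - i) -
      c i (d.+1 - i)%N * h.1 ^+ i * h.2 ^+ (d.+1 - i) -
      t * (c i (d.+1 - i)%N * (i%:R * h.1 ^+ i.-1) * h.2 ^+ (d.+1 - i))|)).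
  by rewrite -mulr_sumr ler_wpM2l ?sqr_ge0// ler_norm_sum.
rewrite /cnorm mulr_suml mulr_sumr; apply: ler_sum => i _.
rewrite addr0; set e := (d.+1 - i)%N.
have -> : c i e * (h.1 + t) ^+ i * h.2 ^+ e - c i e * h.1 ^+ i * h.2 ^+ e - t * (c i e * (i%:R * h.1 ^+ i.-1) * h.2 ^+ e)
  = c i e * (((h.1 + t) ^+ i - h.1 ^+ i - t * (i%:R * h.1 ^+ i.-1)) * h.2 ^+ e) by ring.
rewrite normrM mulrCA [leRHS]mulrCA ler_wpM2l// normrM [leLHS]mulrA.
have q := monomial_quad i h1 h1t.
apply: (@le_trans _ _ (t ^+ 2 * (i%:R ^+ 2 * s ^+ i) * s ^+ e)).
  have q2 : `|h.2 ^+ e| <= s ^+ e by rewrite normrX lerXn2r.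
  by apply: ler_pM => //; rewrite mulr_ge0// sqr_ge0.
have -> : s ^+ d.+1 = s ^+ i * s ^+ e by rewrite -exprD subnKC// -ltnS.
rewrite -[leLHS]mulrA ler_wpM2l ?sqr_ge0// -mulrA ler_wpM2r ?mulr_ge0 ?exprn_ge0//.
by rewrite lerXn2r ?nnegrE// ler_nat -ltnS ltn_ord.
Qed.

Lemma expansion_shift1_cvg c rho : (forall s, 0 <= s < rho -> cvgn (series (fun d => cnorm c d * s ^+ d))) ->
  forall s, 0 <= s < rho -> cvgn (series (fun d => cnorm (shift1 c) d * s ^+ d)).
Proof.
move=> H s /andP[s0 sr]; pose s' := (s + rho) / 2.
have ss' : s < s' by rewrite /s'; lra.
have s'r : s' < rho by rewrite /s'; lra.
have s'0 : 0 < s' by exact: le_lt_trans ss'.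
have [|K K0 hK] := @natX_bound (s / s').
  by rewrite divr_ge0 ?(ltW s'0)//= ltr_pdivrMr// mul1r.
have c1 : cvgn (series (fun d => cnorm c d * s' ^+ d)) by apply: H; rewrite s'r ltW.
have c2 : cvgn (series (fun d => cnorm c d.+1 * s' ^+ d.+1)).
  have [l hl] := (cvg_ex _).1 c1; apply/cvg_ex; exists (l - cnorm c 0 * s' ^+ 0).
  exact: cvg_series_shift hl.
have [->|sn] := eqVneq s 0.
  apply/cvg_ex; exists (cnorm (shift1 c) 0); rewrite -(cvg_shiftS (series _)).
  apply: cvg_near_cst; near=> n; apply/eqP.
  by rewrite seriesEord /= big_ord_recl expr0 mulr1 big1 ?addr0// => i _; rewrite expr0n mulr0.
have sp : 0 < s by rewrite lt0r sn.
have c3 : cvgn (series (fun d => (K / s) * (cnorm c d.+1 * s' ^+ d.+1))).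
  exact: eq_is_cvg_series (is_cvg_seriesZ (k := K / s) c2).
apply: series_le_cvg c3 => d.
- by rewrite mulr_ge0 ?cnorm_ge0// exprn_ge0.
- by rewrite mulr_ge0 ?mulr_ge0 ?cnorm_ge0 ?exprn_ge0 ?invr_ge0// ltW.
- apply: (@le_trans _ _ (d.+1%:R * cnorm c d.+1 * s ^+ d)).
    by rewrite ler_wpM2r ?exprn_ge0// cnorm_shift1.
  have := hK d.+1; rewrite expr_div_n => h.
  have : d.+1%:R * s ^+ d.+1 <= K * s' ^+ d.+1.
    by rewrite -ler_pdivrMr ?exprn_gt0// -mulrA.
  move=> /(ler_wpM2l (cnorm_ge0 c d.+1)) h2.
  rewrite -(ler_pM2r sp) (_ : K / s * (cnorm c d.+1 * s' ^+ d.+1) * s = K * (cnorm c d.+1 * s' ^+ d.+1)); last first.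
    by rewrite mulrAC divfK// gt_eqF.
  by move: h2; rewrite [s ^+ d.+1]exprSr; lra.
Unshelve. all: by end_near. Qed.

Lemma expansion_center f a c rho : expansion f a c rho -> f a = c 0%N 0%N.
Proof.
move=> [rho0 _ /(_ 0)]; rewrite normr0 addr0 => /(_ rho0) h.
have h2 : series (hpoly c ^~ 0) @ \oo --> c 0%N 0%N.
  rewrite -(cvg_shiftS (series _)); apply: cvg_near_cst; near=> n; apply/eqP.
  rewrite /= seriesEord /= big_ord_recl /hpoly big_ord1 !expr0 !mulr1 subnn big1 ?addr0// => i _.
  apply: big1 => j _; rewrite !expr0n; case: j => -[|m] hm /=; last by rewrite mulr0 mul0r.
  by rewrite subn0 /bump /= mulr0.
by have := cvg_unique _ h h2; apply.
Unshelve. all: by end_near. Qed.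

(** The quadratic remainders of the homogeneous parts are summable, so [f] differs from its termwise
    linearization by O(t^2). *)
Lemma expansion_derive1 f a c rho h : expansion f a c rho -> `|h| < rho ->
  derivable f (a + h) (1, 0) /\ series (hpoly (shift1 c) ^~ h) @ \oo --> 'D_(1, 0) f (a + h).
Proof.
(* Two intermediate radii: [s] leaves room for the increment [t], and powers of s / s' absorb the
   factor d^2. *)
move=> [rho0 cn cf] hr; pose s := (`|h| + rho) / 2; pose s' := (s + rho) / 2.
have hs : `|h| < s by rewrite /s; lra.
have ss' : s < s' by rewrite /s' /s; lra.
have s'r : s' < rho by rewrite /s' /s; lra.
have sp : 0 < s by exact: le_lt_trans hs.
have s'0 : 0 < s' by exact: lt_trans ss'.
have [|K K0 hK] := @nat2X_bound (s / s').
  by rewrite divr_ge0 ?(ltW s'0) ?(ltW sp)//= ltr_pdivrMr// mul1r.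
have [G hG] : exists G : R, series (hpoly (shift1 c) ^~ h) @ \oo --> G.
  apply/cvg_ex; apply: (@series_cvg_norm _ (fun d => cnorm (shift1 c) d * s ^+ d)).
    by move=> n; apply: hpoly_le; exact: ltW.
  by apply: expansion_shift1_cvg cn _ _; rewrite ltW//= (lt_trans ss').
have cs' : cvgn (series (fun d => cnorm c d.+1 * s' ^+ d.+1)).
  have [|l hl] := (cvg_ex _).1 (cn s' _); first by rewrite s'r ltW.
  by apply/cvg_ex; eexists; exact: cvg_series_shift hl.
pose B := limn (series (fun d => cnorm c d.+1 * s' ^+ d.+1)).
have D : is_derive (a + h) (1, 0) f G.
  apply: is_derive_quot; apply: (@cvg_quot _ _ _ _ (K * B / s ^+ 2) (s - `|h|)); first by rewrite subr_gt0.
  move=> t ts.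
  have -> : t *: (1, 0) + (a + h) = a + (h + (t, 0)) :> R * R.
    by rewrite addrC -addrA; congr (_ + (_ + _)); congr pair; rewrite /GRing.scale /= ?mulr1 ?mulr0.
  have h1t : `|h + (t, 0)| < s.
    apply: le_lt_trans (ler_normD _ _) _; rewrite -ltrBrDl.
    by rewrite prod_normE /= normr0 max_l.
  have h1' : `|h.1 + t| <= s by have := ltW h1t; rewrite norm_pair => /andP[].
  have l1 := cvg_series_shift (cf h hr).
  have l2 := cvg_series_shift (cf (h + (t, 0)) (lt_trans h1t (lt_trans ss' s'r))).
  have tG : series (fun d => t * hpoly (shift1 c) d h) @ \oo --> t * G.
    have : t * series (hpoly (shift1 c) ^~ h) n @[n --> \oo] --> t * G by apply: cvgM => //; exact: cvg_cst.
    apply: cvg_trans; apply: near_eq_cvg; near=> n.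
    by rewrite !seriesEord mulr_sumr.
  have L : series (fun d => hpoly c d.+1 (h + (t, 0)) - hpoly c d.+1 h - t * hpoly (shift1 c) d h) @ \oo -->
      f (a + (h + (t, 0))) - f (a + h) - t * G.
    have -> : series (fun d => hpoly c d.+1 (h + (t, 0)) - hpoly c d.+1 h - t * hpoly (shift1 c) d h) =
        series (fun d => hpoly c d.+1 (h + (t, 0))) \- series (fun d => hpoly c d.+1 h) \-
        series (fun d => t * hpoly (shift1 c) d h).
      by apply/funext => n; rewrite !seriesEord /= !sumrB.
    have -> : f (a + (h + (t, 0))) - f (a + h) = f (a + (h + (t, 0))) - hpoly c 0 (h + (t, 0)) - (f (a + h) - hpoly c 0 h).
      have -> : hpoly c 0 (h + (t, 0)) = hpoly c 0 h by rewrite /hpoly !big_ord1 !expr0.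
      by ring.
    exact: cvgB (cvgB l2 l1) tG.
  have cb : cvgn (series (fun d => t ^+ 2 * (K / s ^+ 2) * (cnorm c d.+1 * s' ^+ d.+1))).
    exact: eq_is_cvg_series (is_cvg_seriesZ (k := t ^+ 2 * (K / s ^+ 2)) cs').
  apply: le_trans (series_bound _ L cb) _; last first.
    have -> : K * B / s ^+ 2 * t ^+ 2 = (t ^+ 2 * (K / s ^+ 2)) * B by ring.
    by rewrite le_eqVlt; apply/orP; left; apply/eqP; exact: (lim_seriesZ (t ^+ 2 * (K / s ^+ 2)) cs').
  move=> d; have := hpoly_quad c d (ltW hs) h1'; set X := hpoly _ _ _ - _ - _.
  rewrite mulrC -ler_pdivlMr ?exprn_gt0// => q; apply: le_trans q _.
  rewrite -2!mulrA ler_wpM2l ?sqr_ge0// [K / _ * _]mulrAC ler_wpM2r ?invr_ge0 ?exprn_ge0 ?(ltW sp)//.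
  rewrite [leRHS]mulrCA ler_wpM2l ?cnorm_ge0//.
  by have := hK d.+1; rewrite expr_div_n mulrA ler_pdivrMr ?exprn_gt0.
split; first by case: D.
by have -> : 'D_(1, 0) f (a + h) = G by case: D.
Unshelve. all: by end_near. Qed.

Definition swap_pair h : R * R := (h.2, h.1).

Lemma expansion_swap f a c rho : expansion f a c rho ->
  expansion (f \o swap_pair) (swap_pair a) (fun i j => c j i) rho.
Proof.
move=> [rho0 h1 h2]; split => // [s sr|h hr].
  apply: eq_is_cvg_series (h1 s sr) => d; congr (_ * _).
  rewrite /cnorm (reindex_inj rev_ord_inj); apply: eq_bigr => i _ /=.
  by rewrite subSS subKn// -ltnS.
have := h2 (swap_pair h); rewrite /swap_pair prod_normE /= maxC => /(_ _).
rewrite prod_normE in hr => /(_ hr); apply: eq_cvg_series => d.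
rewrite /hpoly (reindex_inj rev_ord_inj); apply: eq_bigr => i _ /=.
by rewrite subSS subKn 1?mulrAC// -ltnS.
Qed.

Lemma expansion_D1 f a c rho : expansion f a c rho -> expansion ('D_(1, 0) f) a (shift1 c) rho.
Proof.
move=> H; have [rho0 h1 _] := H; split => //; first exact: expansion_shift1_cvg.
by move=> h hr; have [] := expansion_derive1 H hr.
Qed.

Lemma expansion_D2 f a c rho : expansion f a c rho -> expansion ('D_(0, 1) f) a (shift2 c) rho.
Proof. by move=> /expansion_swap/expansion_D1/expansion_swap; case: a. Qed.

Lemma cvg_shift_bound (v : nat -> R) (b : nat -> R) m (l s w : R) : 0 < s -> 0 <= w <= s -> (forall d, 0 <= b d) ->
  (forall d, `|v d| <= b d * w ^+ d) -> series v @ \oo --> l -> cvgn (series (fun d => b d * s ^+ d)) ->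
  `|l - \sum_(i < m) v i| <= w ^+ m * (limn (series (fun d => b (m + d)%N * s ^+ (m + d))) / s ^+ m).
Proof.
move=> s0 /andP[p0 ps] b0 hv hl cb.
have L : series (fun d => v (m + d)%N) @ \oo --> l - \sum_(i < m) v i /\
    cvgn (series (fun d => b (m + d)%N * s ^+ (m + d))).
  elim: m => [|m [IH1 IH2]]; first by rewrite big_ord0 subr0.
  split.
    have := cvg_series_shift IH1; rewrite addn0 big_ord_recr /= opprD addrA.
    by apply: eq_cvg_series => d; rewrite addSnnS.
  have [k hk] := (cvg_ex _).1 IH2; apply/cvg_ex; eexists.
  by apply: eq_cvg_series (cvg_series_shift hk) => d; rewrite addSnnS.
case: L => L1 L2.
have cz : cvgn (series (fun d => w ^+ m / s ^+ m * (b (m + d)%N * s ^+ (m + d)))).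
  exact: eq_is_cvg_series (is_cvg_seriesZ (k := w ^+ m / s ^+ m) L2).
apply: le_trans (series_bound _ L1 cz) _.
  move=> d; apply: le_trans (hv _) _; rewrite mulrCA ler_wpM2l// !exprD.
  rewrite mulrA divfK ?expf_neq0 ?gt_eqF// ler_wpM2l ?exprn_ge0//.
  by rewrite lerXn2r// nnegrE ltW.
rewrite mulrA mulrAC le_eqVlt; apply/orP; left; apply/eqP.
exact: (lim_seriesZ (w ^+ m / s ^+ m) L2).
Qed.

Lemma expansion_near f a c rho m : expansion f a c rho -> exists2 C, 0 <= C &
  forall h, `|h| < rho / 2 -> `|f (a + h) - \sum_(i < m) hpoly c i h| <= C * `|h| ^+ m.
Proof.
move=> [rho0 h1 h2]; have s0 : 0 < rho / 2 by rewrite divr_gt0.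
have sr : 0 <= rho / 2 < rho by rewrite (ltW s0)/= ltr_pdivrMr// ltr_pMr// ltr1n.
set s := rho / 2 in s0 sr *.
exists `|limn (series (fun d => cnorm c (m + d)%N * s ^+ (m + d))) / s ^+ m|; first exact: normr_ge0.
move=> h hs; have hr : `|h| < rho by case/andP: sr => _; exact: lt_trans.
have H := @cvg_shift_bound (hpoly c ^~ h) (cnorm c) m (f (a + h)) s `|h| s0.
rewrite normr_ge0 (ltW hs) in H.
apply: le_trans (H isT (cnorm_ge0 c) _ (h2 h hr) (h1 s sr)) _; first by move=> d; exact: hpoly_le.
by rewrite mulrC ler_wpM2r ?exprn_ge0// ler_norm.
Qed.

Lemma expansion_grad f a c rho : expansion f a c rho -> is_grad f a (c 1%N 0%N, c 0%N 1%N).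
Proof.
move=> H; have [C C0 hC] := expansion_near 2 H; have [rho0 _ _] := H.
apply: (@is_grad_quad _ _ _ _ C (rho / 2)); first by rewrite divr_gt0.
move=> h hr; have := hC h hr.
rewrite big_ord_recr big_ord1 /= /hpoly big_ord1 big_ord_recr big_ord1 /= !expr0 !expr1 !mulr1.
rewrite (expansion_center H) subn0 subnn opprD addrA (addrC (c 0%N 1%N * _)).
move=> h3; apply: le_trans h3 _; rewrite ler_wpM2l// prod_normE.
by case: (leP `|h.1| `|h.2|) => _; rewrite real_normK ?num_real// ?lerDl ?lerDr sqr_ge0.
Qed.

Lemma expansion_cont f a c rho : expansion f a c rho -> {for a, continuous f}.
Proof.
move=> H; have [C C0 hC] := expansion_near 1 H; have [rho0 _ _] := H.
have C1 : 0 < C + 1 by rewrite ltr_wpDl.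
have nb (e : R) : 0 < e -> \forall x \near a, `|a - x| < e.
  by move=> e0; apply/nbhs_ballP; exists e => // y; rewrite -ball_normE.
apply/cvgrPdist_lt => e e0; near=> x.
have xa : `|x - a| < rho / 2 by rewrite distrC; near: x; apply: nb; rewrite divr_gt0.
have xe : `|x - a| < e / (C + 1) by rewrite distrC; near: x; apply: nb; rewrite divr_gt0.
have := hC _ xa; rewrite [a + _]addrC subrK big_ord1 /hpoly big_ord1 /= !expr0 !mulr1 expr1 -(expansion_center H) distrC.
move=> h; apply: le_lt_trans h _; rewrite ltr_pdivlMr// in xe.
by apply: le_lt_trans xe; rewrite mulrC ler_wpM2l// lerDl.
Unshelve. all: by end_near. Qed.

Lemma expansion_le f a c rho rho' : 0 < rho' <= rho -> expansion f a c rho -> expansion f a c rho'.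
Proof.
move=> /andP[r0 rr] [_ h1 h2]; split => // [s /andP[s0 sr]|h hr]; first by apply: h1; rewrite s0 (lt_le_trans sr).
by apply: h2; exact: lt_le_trans rr.
Qed.

Lemma expansionD f g a c c' rho : expansion f a c rho -> expansion g a c' rho ->
  expansion (fun x => f x + g x) a (fun i j => c i j + c' i j) rho.
Proof.
move=> [r0 h1 h2] [_ h1' h2']; split => // [s sr|h hr].
  apply: series_cvg_norm (is_cvg_seriesD (h1 s sr) (h1' s sr)) => d /=.
  have s0 : 0 <= s ^+ d by case/andP: sr => s0 _; rewrite exprn_ge0.
  rewrite ger0_norm ?mulr_ge0 ?cnorm_ge0// -[leRHS]mulrDl ler_wpM2r// /cnorm -big_split /=.
  by apply: ler_sum => i _; exact: ler_normD.
have -> : series (hpoly (fun i j => c i j + c' i j) ^~ h) = series (hpoly c ^~ h) \+ series (hpoly c' ^~ h).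
  apply/funext => n; rewrite !seriesEord /= -big_split /=; apply: eq_bigr => d _; rewrite /hpoly -big_split.
  by apply: eq_bigr => i _ /=; ring.
exact: cvgD (h2 h hr) (h2' h hr).
Qed.

Lemma expansionZ f a c rho r : expansion f a c rho ->
  expansion (fun x => r * f x) a (fun i j => r * c i j) rho.
Proof.
move=> [r0 h1 h2]; split => // [s sr|h hr].
  apply: eq_is_cvg_series (is_cvg_seriesZ (k := `|r|) (h1 s sr)) => d /=.
  transitivity (`|r| * (cnorm c d * s ^+ d)) => //; rewrite mulrA; congr (_ * _).
  by rewrite mulr_sumr; apply: eq_bigr => i _; rewrite normrM.
have : r * series (hpoly c ^~ h) n @[n --> \oo] --> r * f (a + h) by apply: cvgM (h2 h hr); exact: cvg_cst.
apply: cvg_trans; apply: near_eq_cvg; near=> n.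
rewrite !seriesEord /= mulr_sumr; apply: eq_bigr => d _; rewrite /hpoly /= mulr_sumr.
by apply: eq_bigr => i _ /=; ring.
Unshelve. all: by end_near. Qed.

End Expansion.

(** * Analytic continuation of the Helmholtz equation *)

Section Analytic.
Variable R : realType.
Implicit Types (f g : R * R -> R) (D W U : set (R * R)) (x : R * R).

Notation "\d1 f" := ('D_(1, 0) f) (at level 10, f at level 9).
Notation "\d2 f" := ('D_(0, 1) f) (at level 10, f at level 9).

Definition analytic D f := forall x, D x -> exists c rho, expansion f x c rho.

Lemma analytic_d1 D f : analytic D f -> analytic D (\d1 f).
Proof. by move=> h x /h[c [rho H]]; do 2 eexists; exact: expansion_D1 H. Qed.

Lemma analytic_d2 D f : analytic D f -> analytic D (\d2 f).
Proof. by move=> h x /h[c [rho H]]; do 2 eexists; exact: expansion_D2 H. Qed.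

Lemma analyticD D f g : analytic D f -> analytic D g -> analytic D (fun x => f x + g x).
Proof.
move=> h h' x Dx; have [c [r H]] := h x Dx; have [c' [r' H']] := h' x Dx.
have [r0 _ _] := H; have [r0' _ _] := H'.
have m0 : 0 < Num.min r r' by rewrite lt_min r0.
do 2 eexists; apply: expansionD.
  by apply: (@expansion_le _ _ _ _ r (Num.min r r')); [rewrite m0 ge_min lexx|exact: H].
by apply: (@expansion_le _ _ _ _ r' (Num.min r r')); [rewrite m0 ge_min lexx orbT|exact: H'].
Qed.

Lemma analyticZ D f r : analytic D f -> analytic D (fun x => r * f x).
Proof. by move=> h x /h[c [rho H]]; do 2 eexists; exact: expansionZ H. Qed.

Lemma analytic_cont D f x : analytic D f -> D x -> {for x, continuous f}.
Proof. by move=> h /h[c [rho H]]; exact: expansion_cont H. Qed.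

Lemma analytic_grad D f x : analytic D f -> D x -> is_grad f x (\d1 f x, \d2 f x).
Proof.
move=> h /h[c [rho H]]; have G := expansion_grad H.
have -> : \d1 f x = c 1%N 0%N.
  by have [_ ->] := is_grad_derive (1, 0) G; rewrite /= mulr1 mulr0 addr0.
have -> // : \d2 f x = c 0%N 1%N.
by have [_ ->] := is_grad_derive (0, 1) G; rewrite /= mulr1 mulr0 add0r.
Qed.

Lemma derive_open_eq U f g v : open U -> (forall x, U x -> f x = g x) -> forall x, U x -> 'D_v f x = 'D_v g x.
Proof.
move=> oU e x Ux; apply: near_eq_derive.
by apply: filterS (open_nbhs_nbhs (conj oU Ux)) => y; exact: e.
Qed.

Lemma closure_zero W f x : open W -> (forall y, W y -> f y = 0) -> {for x, continuous f} -> closure W x -> f x = 0.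
Proof.
move=> oW f0 cf Wx; apply/eqP; apply/negP => /negP fx.
have : nbhs x (fun y => f y != 0).
  have : \forall y \near f x, y != 0 by apply: open_nbhs_nbhs; split => //; exact: open_neq.
  exact: cf.
by move=> /Wx[y [/f0 ->]]; rewrite /= eqxx.
Qed.

(** All derivatives of [f] vanish on [W], hence on its closure by continuity. Induction on the two
    indices replaces [f] by a partial derivative, whose coefficients are shifted and multiplied by
    nonzero integers. *)
Lemma expansion_closure_zero W D x i j f c rho : open W -> W `<=` D -> D x -> closure W x ->
  analytic D f -> (forall y, W y -> f y = 0) -> expansion f x c rho -> c i j = 0.
Proof.
move=> oW WD Dx Wx; elim: i f c rho => [|i IH] f c rho af f0 H; last first.
  have := IH _ _ _ (analytic_d1 af) _ (expansion_D1 H); rewrite /shift1 => E.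
  have /E/eqP : forall y, W y -> \d1 f y = 0.
    by move=> y Wy; rewrite (@derive_open_eq W f (cst 0))//; exact: derive_cst.
  by rewrite mulf_eq0 pnatr_eq0 => /eqP.
elim: j f c rho af f0 H => [|j IHj] f c rho af f0 H; last first.
  have := IHj _ _ _ (analytic_d2 af) _ (expansion_D2 H); rewrite /shift2 => E.
  have /E/eqP : forall y, W y -> \d2 f y = 0.
    by move=> y Wy; rewrite (@derive_open_eq W f (cst 0))//; exact: derive_cst.
  by rewrite mulf_eq0 pnatr_eq0 => /eqP.
rewrite -(expansion_center H); exact: closure_zero (expansion_cont H) Wx.
Qed.

Lemma analytic_identity D U f : open D -> connected D -> analytic D f -> open U -> U !=set0 -> U `<=` D ->
  (forall x, U x -> f x = 0) -> forall x, D x -> f x = 0.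
Proof.
move=> oD cD af oU U0 UD fU x Dx.
pose W := (D `&` [set y | f y = 0])^°.
have oW : open W by exact: open_interior.
have WD : W `<=` D by move=> y /interior_subset[].
have fW y : W y -> f y = 0 by move=> /interior_subset[].
(* The interior of the zero set is closed in [D]: at a limit point all coefficients vanish, so [f]
   vanishes on a whole neighbourhood. *)
have key y : D y -> closure W y -> W y.
  move=> Dy Wy; have [c [rho H]] := af y Dy; have [r0 _ h] := H.
  have c0 i j : c i j = 0 by exact: expansion_closure_zero WD Dy Wy af fW H.
  rewrite /W interiorI; split; first by rewrite /interior; apply: open_nbhs_nbhs.
  apply/nbhs_ballP; exists rho => // z; rewrite -ball_normE /= distrC => yz.
  have hz := h _ yz; rewrite [y + _]addrC subrK in hz.
  have h0 : series (hpoly c ^~ (z - y)) @ \oo --> (0 : R).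
    have -> : series (hpoly c ^~ (z - y)) = fun=> 0; last exact: cvg_cst.
    apply/funext => n; rewrite seriesEord; apply: big1 => d _; apply: big1 => i _.
    by rewrite c0 !mul0r.
  by apply: cvg_unique hz h0.
have WE : W = D.
  apply: cD.
  - have [y Uy] := U0; exists y; rewrite /W /interior.
    apply: filterS (open_nbhs_nbhs (conj oU Uy)) => z Uz; split; [exact: UD|exact: fU].
  - by exists W => //; apply/seteqP; split => [y Wy|y []]//; split => //; exact: WD.
  - exists (closure W); first exact: closed_closure.
    apply/seteqP; split => [y Wy|y [Dy /key]]; last exact.
    by split; [exact: WD|exact: subset_closure].
by apply: fW; rewrite WE.
Qed.

Lemma laplacianE f x : laplacian f x = \d1 (\d1 f) x + \d2 (\d2 f) x.
Proof. by rewrite /laplacian big_bool; exact: addrC. Qed.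

Lemma helmholtz_continuation D U (k : R) f g : open D -> connected D -> analytic D f ->
  open U -> U !=set0 -> U `<=` D -> (forall x, U x -> f x = g x) ->
  (forall x, U x -> laplacian g x + k ^+ 2 * g x = 0) ->
  forall x, D x -> \d1 (\d1 f) x + \d2 (\d2 f) x = - k ^+ 2 * f x.
Proof.
move=> oD cD af oU U0 UD fg hg x Dx.
suff : \d1 (\d1 f) x + \d2 (\d2 f) x + k ^+ 2 * f x = 0.
  by move=> /eqP; rewrite addr_eq0 mulNr => /eqP.
move: x Dx; apply: (analytic_identity oD cD _ oU U0 UD).
  apply: analyticD; last exact: analyticZ.
  by apply: analyticD; [apply: analytic_d1; exact: analytic_d1|apply: analytic_d2; exact: analytic_d2].
move=> x Ux; have e1 : \d1 (\d1 f) x = \d1 (\d1 g) x.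
  by apply: (derive_open_eq _ oU _ Ux) => y; exact: derive_open_eq.
have e2 : \d2 (\d2 f) x = \d2 (\d2 g) x.
  by apply: (derive_open_eq _ oU _ Ux) => y; exact: derive_open_eq.
by rewrite e1 e2 (fg x Ux) -laplacianE; exact: hg.
Qed.

End Analytic.

(** * Fluxes in polar coordinates *)

Section GreenRectangle.
Variable R : realType.
Implicit Types (P Q N : R -> R -> R) (r s t u : R).

(* [dP/dr = N = - dQ/dt] at [(r, t)]: the flow [(P, Q)] is divergence free. *)
Definition conserved P Q N r t :=
  (is_derive r 1 (P ^~ t) (N r t) /\ is_derive t 1 (Q r) (- N r t)) /\
  [/\ {for (r, t), continuous (fun z : R * R => P z.1 z.2)},
      {for (r, t), continuous (fun z : R * R => Q z.1 z.2)} &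
      {for (r, t), continuous (fun z : R * R => N z.1 z.2)}].

(** The outward flux through the boundary of a rectangle in the variables (r, t). *)
Definition rflux P Q r1 r2 t1 t2 :=
  Int t1 t2 (P r2) - Int t1 t2 (P r1) + (Int r1 r2 (Q ^~ t2) - Int r1 r2 (Q ^~ t1)).

Lemma eq0_of_small (x K e0 : R) : 0 < e0 -> (forall e, 0 < e -> e < e0 -> `|x| <= e * K) -> x = 0.
Proof.
move=> e00 h; apply/eqP; rewrite -normr_eq0; apply/negP => /negP x0.
have xp : 0 < `|x| by rewrite lt_neqAle eq_sym x0 normr_ge0.
have K0 : 0 < `|K| + 1 by rewrite ltr_wpDl.
pose e := Num.min (e0 / 2) (`|x| / (2 * (`|K| + 1))).
have ep : 0 < e by rewrite lt_min !divr_gt0// mulr_gt0.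
have ee : e < e0 by rewrite gt_min ltr_pdivrMr// ltr_pMr// ltr1n.
have := h e ep ee; apply/negP; rewrite -ltNge.
have e2 : e * (2 * (`|K| + 1)) <= `|x|.
  by rewrite -ler_pdivlMr ?mulr_gt0// ge_min lexx orbT.
have := ler_norm K; have := normr_ge0 K; set k := `|K| in K0 e2 * => k0 Kk.
by have : e * K <= e * k by [rewrite ler_pM2l]; nra.
Qed.

Lemma cont_slice1 (f : R * R -> R) r t : {for (r, t), continuous f} -> {for r, continuous (fun x => f (x, t))}.
Proof.
move=> cf; apply: (@continuous_comp _ _ _ (fun x : R => (x, t)) f) => //.
exact: (@cvg_pair R R R (nbhs r) (nbhs r) (nbhs t) _ _ _ id (cst t) cvg_id (cvg_cst t)).
Qed.

Lemma cont_slice2 (f : R * R -> R) r t : {for (r, t), continuous f} -> {for t, continuous (fun x => f (r, x))}.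
Proof.
move=> cf; apply: (@continuous_comp _ _ _ (fun x : R => (r, x)) f) => //.
exact: (@cvg_pair R R R (nbhs t) (nbhs r) (nbhs t) _ _ _ (cst r) id (cvg_cst r) cvg_id).
Qed.

Lemma bounded_rect (f : R * R -> R) r1 r2 t1 t2 :
  (forall r t, r1 <= r <= r2 -> t1 <= t <= t2 -> {for (r, t), continuous f}) ->
  exists2 M, 0 <= M & forall r t, r1 <= r <= r2 -> t1 <= t <= t2 -> `|f (r, t)| <= M.
Proof.
move=> cf; have cK : compact (`[r1, r2]%classic `*` `[t1, t2]%classic : set (R * R)).
  by apply: compact_setX; exact: segment_compact.
have : bounded_set (f @` (`[r1, r2]%classic `*` `[t1, t2]%classic)).
  apply: compact_bounded; apply: continuous_compact => //.
  apply: continuous_in_subspaceT => -[r t]; rewrite inE /= !in_itv /= => -[hr ht]; exact: cf.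
move=> [M [_ /(_ (`|M| + 1))]]; rewrite (le_lt_trans (ler_norm M))// ?ltrDl// => /(_ isT) h.
exists (`|M| + 1); first by rewrite addr_ge0.
by move=> r t hr ht; apply: h; exists (r, t) => //; split; rewrite /= in_itv.
Qed.

(** Differentiated under the integral, the flux through the side at [r] changes at a rate that is
    minus the difference of [Q] at its two ends. Green's formula is then the fundamental theorem of
    calculus in [r]. *)
Lemma rflux_zero P Q N r1 r2 t1 t2 : r1 <= r2 -> t1 <= t2 ->
  (forall r t, r1 <= r <= r2 -> t1 <= t <= t2 -> conserved P Q N r t) -> rflux P Q r1 r2 t1 t2 = 0.
Proof.
move=> + t12 H; rewrite le_eqVlt => /predU1P[<-|r12].
  by rewrite /rflux !Int_xx !subrr addr0.
have ct1 : t1 <= t1 <= t2 by rewrite lexx.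
have ct2 : t1 <= t2 <= t2 by rewrite lexx andbT.
have wP r : r1 <= r <= r2 -> {within `[t1, t2], continuous (P r)}.
  by move=> hr; apply: within_cont => t ht; have [_ [c _ _]] := H r t hr ht; exact: cont_slice2 c.
have wN r : r1 <= r <= r2 -> {within `[t1, t2], continuous (N r)}.
  by move=> hr; apply: within_cont => t ht; have [_ [_ _ c]] := H r t hr ht; exact: cont_slice2 c.
have wQ t a b : t1 <= t <= t2 -> r1 <= a -> b <= r2 -> {within `[a, b], continuous (Q ^~ t)}.
  move=> ht ha hb; apply: within_cont => r /andP[ar rb].
  by have [|_ [_ c _]] := H r t _ ht; [rewrite (le_trans ha)//= (le_trans rb)|exact: cont_slice1 c].
have [M M0 hM] : exists2 M, 0 <= M & forall r t, r1 <= r <= r2 -> t1 <= t <= t2 -> `|N r t| <= M.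
  apply: (@bounded_rect (fun z => N z.1 z.2)) => r t hr ht.
  by have [_ [_ _]] := H r t hr ht.
have [M' M'0 hM'] : exists2 M, 0 <= M & forall r t, r1 <= r <= r2 -> t1 <= t <= t2 -> `|Q r t| <= M.
  apply: (@bounded_rect (fun z => Q z.1 z.2)) => r t hr ht.
  by have [_ [_]] := H r t hr ht.
pose F r := Int t1 t2 (P r); pose q r := Q r t2 - Q r t1.
have wq a b : r1 <= a -> b <= r2 -> {within `[a, b], continuous q}.
  move=> ha hb; apply: within_cont => r /andP[ar rb].
  have hr : r1 <= r <= r2 by rewrite (le_trans ha)//= (le_trans rb).
  have [_ [_ c2 _]] := H r t2 hr ct2; have [_ [_ c1 _]] := H r t1 hr ct1.
  by apply: cvgB; [exact: cont_slice1 c2|exact: cont_slice1 c1].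
have dF r : r1 < r < r2 -> is_derive r 1 F (- q r).
  move=> /andP[rl rr]; have hr : r1 <= r <= r2 by rewrite !ltW.
  have -> : - q r = Int t1 t2 (N r).
    rewrite (@Int_FTC _ t1 t2 (N r) (fun t => - Q r t) t12 _ (wN r hr)); first by rewrite /q; ring.
    move=> t ht; have [[_ d] _] := H r t hr ht.
    by have := is_deriveN d; rewrite opprK.
  apply: (@is_derive_under _ `[t1, t2]%classic P N (fun=> M) r r1 r2) => //.
  - by rewrite rl.
  - move=> x /andP[xl xr]; apply: integrable_itv; apply: wP; by rewrite !ltW.
  - move=> x t /andP[xl xr]; rewrite /= in_itv /= => ht.
    by have [|[d _] _] := H x t _ ht; [rewrite !ltW|].
  - by apply: integrable_itv; exact: cst_within.
  - move=> x t /andP[xl xr]; rewrite /= in_itv /= => ht.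
    by apply: hM => //; rewrite !ltW.
have lip a b : r1 <= a -> a <= b -> b <= r2 -> `|F b - F a| <= M * (b - a) * (t2 - t1).
  move=> ha ab hb; have ia : r1 <= a <= r2 by rewrite ha (le_trans ab).
  have ib : r1 <= b <= r2 by rewrite hb (le_trans ha).
  rewrite /F -IntB; [|exact: wP|exact: wP].
  apply: Int_bound => //.
    apply: within_cont => t ht; have [_ [c1 _ _]] := H a t ia ht; have [_ [c2 _ _]] := H b t ib ht.
    by apply: cvgB; [exact: cont_slice2 c2|exact: cont_slice2 c1].
  move=> t ht; have [c /andP[ac cb] ->] : exists2 c, a <= c <= b & P b t - P a t = N c t * (b - a).
    apply: (@mvt _ (P ^~ t) (N ^~ t)) => // x /andP[ax xb].
    by have [|[d _] _] := H x t _ ht; [rewrite (le_trans ha)//= (le_trans xb)|].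
  rewrite normrM (ger0_norm (_ : 0 <= b - a)) ?subr_ge0// ler_wpM2r ?subr_ge0//.
  by apply: hM => //; rewrite (le_trans ha)//= (le_trans cb).
have bq a b : r1 <= a -> a <= b -> b <= r2 -> `|Int a b q| <= 2 * M' * (b - a).
  move=> ha ab hb; apply: Int_bound => //; first exact: wq.
  move=> r /andP[ar rb]; have hr : r1 <= r <= r2 by rewrite (le_trans ha)//= (le_trans rb).
  apply: le_trans (ler_normB _ _) _; have := hM' r t1 hr ct1; have := hM' r t2 hr ct2; lra.
have -> : rflux P Q r1 r2 t1 t2 = F r2 - F r1 + Int r1 r2 q.
  by rewrite /rflux /q IntB//; apply: wQ.
(* The derivative of [F] is known in the open interval only; margins of width [e] at both ends are
   controlled by the Lipschitz bound on [F] and the bound on [Q]. *)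
apply: (@eq0_of_small _ (2 * (M * (t2 - t1) + 2 * M')) ((r2 - r1) / 2)).
  by rewrite divr_gt0 ?subr_gt0.
move=> e e0 er; pose a := r1 + e; pose b := r2 - e.
have ra : r1 < a by rewrite /a ltrDl.
have br : b < r2 by rewrite /b ltrBlDr ltrDl.
have ab : a <= b by rewrite /a /b; lra.
have mid : Int a b (fun r => - q r) = F b - F a.
  apply: Int_FTC => //.
    by move=> x /andP[ax xb]; apply: dF; rewrite (lt_le_trans ra)//= (le_lt_trans xb).
  move=> x; apply: continuousN; exact: (wq a b (ltW ra) (ltW br)).
have mid2 : Int a b q = - (F b - F a).
  rewrite -mid -[RHS]mulN1r -IntZ; first by apply: eq_Int => x _; rewrite mulN1r opprK.
  move=> x; apply: continuousN; exact: (wq a b (ltW ra) (ltW br)).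
rewrite (@Int_split _ r1 r2 a q) ?(ltW ra) ?(le_trans ab (ltW br))//; last exact: wq.
rewrite (@Int_split _ a r2 b q) ?(ltW br)//; last by apply: wq => //; exact: ltW.
rewrite mid2.
have l1 := lip r1 a (lexx _) (ltW ra) (le_trans ab (ltW br)).
have l2 := lip b r2 (le_trans (ltW ra) ab) (ltW br) (lexx _).
have l3 := bq r1 a (lexx _) (ltW ra) (le_trans ab (ltW br)).
have l4 := bq b r2 (le_trans (ltW ra) ab) (ltW br) (lexx _).
have -> : F r2 - F r1 + (Int r1 a q + (- (F b - F a) + Int b r2 q)) =
  (F r2 - F b) + (F a - F r1) + (Int r1 a q + Int b r2 q) by ring.
have ea : a - r1 = e by rewrite /a; ring.
have eb : r2 - b = e by rewrite /b; ring.
rewrite ea in l1 l3; rewrite eb in l2 l4.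
apply: le_trans (ler_normD _ _) _; apply: le_trans (lerD (ler_normD _ _) (ler_normD _ _)) _.
move: l1 l2 l3 l4; lra.
Qed.

Lemma rflux_splitr P Q r1 r2 r3 t1 t2 : r1 <= r2 <= r3 ->
  {within `[r1, r3], continuous (Q ^~ t1)} -> {within `[r1, r3], continuous (Q ^~ t2)} ->
  rflux P Q r1 r3 t1 t2 = rflux P Q r1 r2 t1 t2 + rflux P Q r2 r3 t1 t2.
Proof.
move=> /andP[h1 h2] c1 c2; rewrite /rflux (Int_split h1 h2 c1) (Int_split h1 h2 c2); ring.
Qed.

Lemma rflux_splitt P Q r1 r2 t1 t2 t3 : t1 <= t2 <= t3 ->
  {within `[t1, t3], continuous (P r1)} -> {within `[t1, t3], continuous (P r2)} ->
  rflux P Q r1 r2 t1 t3 = rflux P Q r1 r2 t1 t2 + rflux P Q r1 r2 t2 t3.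
Proof.
move=> /andP[h1 h2] c1 c2; rewrite /rflux (Int_split h1 h2 c1) (Int_split h1 h2 c2); ring.
Qed.

(** Two strips are cut off in [r] and two in [t], each without flux by [rflux_zero]. Only the open
    inner rectangle is exempted from the hypothesis, so the flow is still regular on its sides. *)
Lemma rflux_localize P Q N r1 r2 t1 t2 s1 s2 u1 u2 : r1 <= s1 -> s1 <= s2 -> s2 <= r2 ->
  t1 <= u1 -> u1 <= u2 -> u2 <= t2 ->
  (forall r t, r1 <= r <= r2 -> t1 <= t <= t2 -> ~~ ((s1 < r < s2) && (u1 < t < u2)) -> conserved P Q N r t) ->
  rflux P Q r1 r2 t1 t2 = rflux P Q s1 s2 u1 u2.
Proof.
move=> rs ss sr tu uu ut H.
have out1 r t : (r <= s1) || (s2 <= r) -> ~~ ((s1 < r < s2) && (u1 < t < u2)).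
  by rewrite !negb_and -!leNgt => /orP[->|->]; rewrite ?orbT.
have out2 r t : (t <= u1) || (u2 <= t) -> ~~ ((s1 < r < s2) && (u1 < t < u2)).
  by rewrite !negb_and -!leNgt => /orP[->|->]; rewrite ?orbT.
have wQ t a b : t1 <= t <= t2 -> (t <= u1) || (u2 <= t) -> r1 <= a -> b <= r2 -> {within `[a, b], continuous (Q ^~ t)}.
  move=> ht tt ha hb; apply: within_cont => r /andP[ar rb].
  have [||_ [_ c _]] := H r t _ ht; [|exact: out2|exact: cont_slice1 c].
  by rewrite (le_trans ha)//= (le_trans rb).
have wP r a b : r1 <= r <= r2 -> (r <= s1) || (s2 <= r) -> t1 <= a -> b <= t2 -> {within `[a, b], continuous (P r)}.
  move=> hr rr ha hb; apply: within_cont => t /andP[at_ tb].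
  have [||_ [c _ _]] := H r t hr; [|exact: out1|exact: cont_slice2 c].
  by rewrite (le_trans ha)//= (le_trans tb).
have s1r : s1 <= r2 by exact: le_trans sr.
have u1t : u1 <= t2 by exact: le_trans ut.
have t12 : t1 <= t2 by exact: le_trans u1t.
have r12 : r1 <= r2 by exact: le_trans s1r.
have i1 : t1 <= t1 <= t2 by rewrite lexx.
have i2 : t1 <= t2 <= t2 by rewrite lexx andbT.
have o1 : (t1 <= u1) || (u2 <= t1) by rewrite tu.
have o2 : (t2 <= u1) || (u2 <= t2) by rewrite ut orbT.
rewrite (@rflux_splitr _ _ r1 s1 r2); [|by rewrite rs|exact: wQ|exact: wQ].
rewrite (@rflux_splitr _ _ s1 s2 r2); [|by rewrite ss|exact: wQ|exact: wQ].
rewrite (@rflux_zero P Q N r1 s1)//; last first.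
  move=> r t /andP[a b] ht; apply: H => //; first by rewrite a (le_trans b).
  by apply: out1; rewrite b.
rewrite (@rflux_zero P Q N s2 r2)//; last first.
  move=> r t /andP[a b] ht; apply: H => //; first by rewrite b (le_trans _ a)// (le_trans rs).
  by apply: out1; rewrite a orbT.
rewrite add0r addr0.
have j1 : r1 <= s1 <= r2 by rewrite rs.
have j2 : r1 <= s2 <= r2 by rewrite sr (le_trans rs).
have p1 : (s1 <= s1) || (s2 <= s1) by rewrite lexx.
have p2 : (s2 <= s1) || (s2 <= s2) by rewrite lexx orbT.
rewrite (@rflux_splitt _ _ s1 s2 t1 u1 t2); [|by rewrite tu|exact: wP|exact: wP].
rewrite (@rflux_splitt _ _ s1 s2 u1 u2 t2); [|by rewrite uu|exact: wP|exact: wP].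
rewrite (@rflux_zero P Q N s1 s2 t1 u1)//; last first.
  move=> r t /andP[a b] /andP[a' b']; apply: H; rewrite ?(le_trans rs) ?(le_trans b) ?a' ?(le_trans b')//.
  by apply: out2; rewrite b'.
rewrite (@rflux_zero P Q N s1 s2 u2 t2)//; last first.
  move=> r t /andP[a b] /andP[a' b']; apply: H; rewrite ?(le_trans rs) ?(le_trans b) ?b' ?andbT//.
    by rewrite (le_trans _ a')// (le_trans tu).
  by apply: out2; rewrite a' orbT.
by rewrite add0r addr0.
Qed.

(** The flux equals that of arbitrarily small squares about the singular point. On a square with
    sides 2 d a density of at most eta / d contributes 2 eta for each side, 8 eta in all. *)
Lemma rflux_singular P Q N r1 r2 t1 t2 r0 t0 : r1 < r0 < r2 -> t1 < t0 < t2 ->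
  (forall r t, r1 <= r <= r2 -> t1 <= t <= t2 -> (r != r0) || (t != t0) -> conserved P Q N r t) ->
  (forall eta, 0 < eta -> exists2 e, 0 < e & forall r t, `|r - r0| < e -> `|t - t0| < e ->
    (r != r0) || (t != t0) -> `|P r t| * Num.max `|r - r0| `|t - t0| <= eta /\
    `|Q r t| * Num.max `|r - r0| `|t - t0| <= eta) ->
  rflux P Q r1 r2 t1 t2 = 0.
Proof.
move=> /andP[r10 r02] /andP[t10 t02] H small.
apply: (@eq0_of_small _ 8 1) => // eta eta0 _.
have [e e0 he] := small eta eta0.
pose d := Num.min (e / 2) (Num.min (Num.min (r0 - r1) (r2 - r0)) (Num.min (t0 - t1) (t2 - t0))).
have d0 : 0 < d by rewrite !lt_min !subr_gt0 r10 r02 t10 t02 divr_gt0.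
have de : d < e.
  apply: (@le_lt_trans _ _ (e / 2)); first by rewrite ge_min lexx.
  by rewrite ltr_pdivrMr// ltr_pMr// ltr1n.
have d1 : d <= r0 - r1 by rewrite !ge_min lexx !orbT.
have d2 : d <= r2 - r0 by rewrite !ge_min lexx !orbT.
have d3 : d <= t0 - t1 by rewrite !ge_min lexx !orbT.
have d4 : d <= t2 - t0 by rewrite !ge_min lexx !orbT.
rewrite (@rflux_localize P Q N _ _ _ _ (r0 - d) (r0 + d) (t0 - d) (t0 + d)); try by move: d0 d1 d2 d3 d4; clear; lra.
  have nd (x : R) : x - d <= x + d by move: d0; clear; lra.
  have ed (x : R) : x + d - (x - d) = 2 * d by ring.
  have nrm : `|d| = d by rewrite gtr0_norm.
  have cP s t : `|s - r0| = d -> t0 - d <= t <= t0 + d -> {for t, continuous (P s)} /\ `|P s t| <= eta / d.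
    move=> sd td; have td' : `|t - t0| <= d by rewrite ler_distl.
    have sn : (s != r0) || (t != t0).
      by apply/orP; left; rewrite -subr_eq0 -normr_eq0 sd gt_eqF.
    split.
      have : `|s - r0| <= d by rewrite sd.
      rewrite ler_distl => /andP[s1 s2]; have /andP[t1' t2'] := td.
      have [||_ [c _ _]] := H s t _ _ sn; [| |exact: cont_slice2 c].
        by move: s1 s2 d1 d2; clear; lra.
      by move: t1' t2' d3 d4; clear; lra.
    have [||] := he s t _ _ sn; [by rewrite sd|exact: le_lt_trans de|].
    by rewrite sd max_l// ler_pdivlMr.
  have cQ s t : `|s - t0| = d -> r0 - d <= t <= r0 + d -> {for t, continuous (Q ^~ s)} /\ `|Q t s| <= eta / d.
    move=> sd td; have td' : `|t - r0| <= d by rewrite ler_distl.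
    have sn : (t != r0) || (s != t0).
      by apply/orP; right; rewrite -subr_eq0 -normr_eq0 sd gt_eqF.
    split.
      have : `|s - t0| <= d by rewrite sd.
      rewrite ler_distl => /andP[s1 s2]; have /andP[t1' t2'] := td.
      have [||_ [_ c _]] := H t s _ _ sn; [| |exact: cont_slice1 c].
        by move: t1' t2' d1 d2; clear; lra.
      by move: s1 s2 d3 d4; clear; lra.
    have [||_] := he t s _ _ sn; [exact: le_lt_trans de|by rewrite sd|].
    by rewrite sd max_r// ler_pdivlMr.
  have bP s : `|s - r0| = d -> `|Int (t0 - d) (t0 + d) (P s)| <= 2 * eta.
    move=> sd; have -> : 2 * eta = eta / d * (t0 + d - (t0 - d)) by rewrite ed; field; rewrite gt_eqF.
    apply: Int_bound => //; first by apply: within_cont => t /(cP s t sd)[].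
    by move=> t /(cP s t sd)[].
  have bQ s : `|s - t0| = d -> `|Int (r0 - d) (r0 + d) (Q ^~ s)| <= 2 * eta.
    move=> sd; have -> : 2 * eta = eta / d * (r0 + d - (r0 - d)) by rewrite ed; field; rewrite gt_eqF.
    apply: Int_bound => //; first by apply: within_cont => t /(cQ s t sd)[].
    by move=> t /(cQ s t sd)[].
  have ep (x : R) : `|x + d - x| = d by rewrite addrAC subrr add0r.
  have em (x : R) : `|x - d - x| = d by rewrite addrAC subrr add0r normrN.
  have := bP _ (ep r0); have := bP _ (em r0); have := bQ _ (ep t0); have := bQ _ (em t0).
  rewrite /rflux => a1 a2 a3 a4.
  apply: le_trans (ler_normD _ _) _; apply: le_trans (lerD (ler_normB _ _) (ler_normB _ _)) _.
  by move: a1 a2 a3 a4; clear; lra.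
move=> r t hr ht nin; apply: H => //; apply: contraNT nin; rewrite negb_or !negbK => /andP[/eqP-> /eqP->].
by move: d0; clear; lra.
Qed.

End GreenRectangle.

(** * Jets of solutions of the Helmholtz equation *)

Section GradientRules.
Variable R : realType.
Implicit Types (f g : R * R -> R) (x p q : R * R).

Lemma is_grad_cst (r : R) x : is_grad (fun=> r) x (0, 0).
Proof.
move=> g1 g2 t d1 d2 _ _ _; apply: (is_derive_ext (is_derive_cst r t 1)) => //.
by rewrite /= !mul0r addr0.
Qed.

Lemma is_grad_fst x : is_grad (@fst R R) x (1, 0).
Proof.
move=> g1 g2 t d1 d2 _ h _; apply: (is_derive_ext h) => //.
by rewrite /= mul1r mul0r addr0.
Qed.

Lemma is_grad_snd x : is_grad (@snd R R) x (0, 1).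
Proof.
move=> g1 g2 t d1 d2 _ _ h; apply: (is_derive_ext h) => //.
by rewrite /= mul1r mul0r add0r.
Qed.

Lemma is_grad_ext f g x p q : is_grad f x p -> f =1 g -> p = q -> is_grad g x q.
Proof. by move=> h /funext <- <-. Qed.

Lemma is_gradD f g x p q : is_grad f x p -> is_grad g x q -> is_grad (fun y => f y + g y) x (p.1 + q.1, p.2 + q.2).
Proof.
move=> hf hg g1 g2 t d1 d2 e h1 h2.
have H := is_deriveD (hf _ _ _ _ _ e h1 h2) (hg _ _ _ _ _ e h1 h2).
by apply: (is_derive_ext H) => //=; ring.
Qed.

Lemma is_gradM f g x p q : is_grad f x p -> is_grad g x q ->
  is_grad (fun y => f y * g y) x (f x * q.1 + g x * p.1, f x * q.2 + g x * p.2).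
Proof.
move=> hf hg g1 g2 t d1 d2 e h1 h2.
have H := is_deriveM (hf _ _ _ _ _ e h1 h2) (hg _ _ _ _ _ e h1 h2).
by apply: (is_derive_ext H) => //=; rewrite e /GRing.scale /=; ring.
Qed.

Lemma is_gradZ f (r : R) x p : is_grad f x p -> is_grad (fun y => r * f y) x (r * p.1, r * p.2).
Proof.
move=> hf; refine (is_grad_ext (is_gradM (@is_grad_cst r x) hf) _ _) => //=.
by congr pair; ring.
Qed.

Lemma is_gradB f g x p q : is_grad f x p -> is_grad g x q -> is_grad (fun y => f y - g y) x (p.1 - q.1, p.2 - q.2).
Proof.
move=> hf hg; refine (is_grad_ext (is_gradD hf (is_gradZ (-1) hg)) _ _) => [y|] /=; first by rewrite mulN1r.
by rewrite !mulN1r.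
Qed.

Lemma is_grad_comp f (phi : R -> R) x p (d : R) : is_derive (f x) 1 phi d -> is_grad f x p ->
  is_grad (fun y => phi (f y)) x (d * p.1, d * p.2).
Proof.
move=> hp hf g1 g2 t d1 d2 e h1 h2; rewrite -e in hp.
have H := @is_derive1_comp _ phi (fun s => f (g1 s, g2 s)) t _ _ hp (hf _ _ _ _ _ e h1 h2).
by apply: (is_derive_ext H) => //=; ring.
Qed.

End GradientRules.

(** * Divergence-free fields in polar coordinates *)

Section PolarFields.
Variable R : realType.
Implicit Types (V : R * R -> R) (r t : R) (y z : R * R).

Definition pol r t : R * R := (r * cos t, r * sin t).

Lemma cvg_pairR (f g : R * R -> R) z : {for z, continuous f} -> {for z, continuous g} ->
  {for z, continuous (fun y => (f y, g y))}.
Proof. by move=> cf cg; exact: (@cvg_pair _ _ _ (nbhs z) (nbhs (f z)) (nbhs (g z)) _ _ _ f g cf cg). Qed.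

Lemma fst_continuous z : {for z, continuous (@fst R R)}.
Proof. exact: cvg_fst. Qed.

Lemma snd_continuous z : {for z, continuous (@snd R R)}.
Proof. exact: cvg_snd. Qed.

Lemma cos2_continuous z : {for z, continuous (fun y : R * R => cos y.2)}.
Proof. by apply: (@continuous_comp _ _ _ snd cos); [exact: snd_continuous|exact: continuous_cos]. Qed.

Lemma sin2_continuous z : {for z, continuous (fun y : R * R => sin y.2)}.
Proof. by apply: (@continuous_comp _ _ _ snd sin); [exact: snd_continuous|exact: continuous_sin]. Qed.

Lemma pol_continuous z : {for z, continuous (fun y : R * R => pol y.1 y.2)}.
Proof.
apply: cvg_pairR; apply: cvgM; first [exact: fst_continuous|exact: cos2_continuous|exact: sin2_continuous].
Qed.

Lemma comp_pol_continuous V r t : {for pol r t, continuous V} -> {for (r, t), continuous (fun z => V (pol z.1 z.2))}.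
Proof. by move=> cV; apply: (@continuous_comp _ _ _ (fun z => pol z.1 z.2) V); [exact: pol_continuous|]. Qed.

(** The factor [r] is the Jacobian: if V_r and V_t are the radial and angular components of a field,
    its divergence is (d(r V_r)/dr + dV_t/dt) / r. *)
Definition radial V1 V2 r t := r * (V1 (pol r t) * cos t + V2 (pol r t) * sin t).
Definition angular V1 V2 r t := V2 (pol r t) * cos t - V1 (pol r t) * sin t.
Definition radial_der V1 V2 (a b c d : R * R -> R) r t :=
  V1 (pol r t) * cos t + V2 (pol r t) * sin t +
  r * ((a (pol r t) * cos t + b (pol r t) * sin t) * cos t + (c (pol r t) * cos t + d (pol r t) * sin t) * sin t).

Lemma is_derive_rcos r t : is_derive r 1 (fun s => s * cos t) (cos t).
Proof.
have h := is_deriveM (is_derive_id r 1) (is_derive_cst (cos t) r 1).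
by apply: (is_derive_ext h) => //; rewrite /GRing.scale /= mulr0 add0r mulr1.
Qed.

Lemma is_derive_rsin r t : is_derive r 1 (fun s => s * sin t) (sin t).
Proof.
have h := is_deriveM (is_derive_id r 1) (is_derive_cst (sin t) r 1).
by apply: (is_derive_ext h) => //; rewrite /GRing.scale /= mulr0 add0r mulr1.
Qed.

Lemma polar_conserved V1 V2 a b c d r t : let y := pol r t in
  is_grad V1 y (a y, b y) -> is_grad V2 y (c y, d y) -> a y + d y = 0 ->
  {for y, continuous V1} -> {for y, continuous V2} -> {for y, continuous a} -> {for y, continuous b} ->
  {for y, continuous c} -> {for y, continuous d} ->
  conserved (radial V1 V2) (angular V1 V2) (radial_der V1 V2 a b c d) r t.
Proof.
move=> y g1 g2 ad c1 c2 ca cb cc cd; split; [split|split].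
- have h1 := g1 _ _ r _ _ erefl (is_derive_rcos r t) (is_derive_rsin r t).
  have h2 := g2 _ _ r _ _ erefl (is_derive_rcos r t) (is_derive_rsin r t).
  have H := is_deriveM (is_derive_id r 1) (is_deriveD (is_deriveM h1 (is_derive_cst (cos t) r 1)) (is_deriveM h2 (is_derive_cst (sin t) r 1))).
  apply: (is_derive_ext H) => //; rewrite !fctE /radial_der /GRing.scale /= -/(pol r t) -/y.
  ring.
- have dc : is_derive t 1 (fun t => r * cos t) (- (r * sin t)).
    have h := is_deriveZ r (is_derive_cos t).
    by apply: (is_derive_ext h) => //; rewrite /GRing.scale /= mulrN.
  have ds : is_derive t 1 (fun t => r * sin t) (r * cos t).
    have h := is_deriveZ r (is_derive_sin t).
    by apply: (is_derive_ext h).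
  have h1 := g1 _ _ t _ _ erefl dc ds; have h2 := g2 _ _ t _ _ erefl dc ds.
  have H := is_deriveB (is_deriveM h2 (is_derive_cos t)) (is_deriveM h1 (is_derive_sin t)).
  apply: (is_derive_ext H) => //; rewrite ?fctE /radial_der /GRing.scale /= -/(pol r t) -/y.
  have -> : d y = - a y by move/eqP: ad; rewrite addrC addr_eq0 => /eqP.
  move: (cos2Dsin2 t); move: (a y) (b y) (c y) (V1 y) (V2 y) (cos t) (sin t) => A B G W1 W2 C S E.
  have -> : A = A * (C ^+ 2 + S ^+ 2) by rewrite E mulr1.
  ring.
- apply: cvgM; first exact: fst_continuous.
  by apply: cvgD; apply: cvgM; first [exact: comp_pol_continuous|exact: cos2_continuous|exact: sin2_continuous].
- by apply: cvgB; apply: cvgM; first [exact: comp_pol_continuous|exact: cos2_continuous|exact: sin2_continuous].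
- apply: cvgD; first by apply: cvgD; apply: cvgM; first [exact: comp_pol_continuous|exact: cos2_continuous|exact: sin2_continuous].
  apply: cvgM; first exact: fst_continuous.
  apply: cvgD; apply: cvgM; try first [exact: cos2_continuous|exact: sin2_continuous].
    by apply: cvgD; apply: cvgM; first [exact: comp_pol_continuous|exact: cos2_continuous|exact: sin2_continuous].
  by apply: cvgD; apply: cvgM; first [exact: comp_pol_continuous|exact: cos2_continuous|exact: sin2_continuous].
Qed.

End PolarFields.

Section Jets.
Variable R : realType.
Variable k : R.
Hypothesis k_gt0 : 0 < k.
Local Notation tau := (tau k).
Implicit Types (x y z : R * R) (r t c : R).

(** Derivatives are carried as data, so that the kernels, with explicit formulas, and analytic
    functions, with ['D], are treated alike. [hjet] certifies the data and the Helmholtz equation at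
    one point. *)
Record jet := Jet { j0 : R * R -> R; j1 : R * R -> R; j2 : R * R -> R;
  j11 : R * R -> R; j12 : R * R -> R; j21 : R * R -> R; j22 : R * R -> R }.
Implicit Types u w : jet.

Definition hjet w y := [/\ is_grad (j0 w) y (j1 w y, j2 w y), is_grad (j1 w) y (j11 w y, j12 w y),
  is_grad (j2 w) y (j21 w y, j22 w y) & j11 w y + j22 w y = - k ^+ 2 * j0 w y].

Definition cjet1 w y := [/\ {for y, continuous (j0 w)}, {for y, continuous (j1 w)} & {for y, continuous (j2 w)}].
Definition cjet2 w y := [/\ {for y, continuous (j11 w)}, {for y, continuous (j12 w)},
  {for y, continuous (j21 w)} & {for y, continuous (j22 w)}].

Definition solves w y := [/\ hjet w y, cjet1 w y & cjet2 w y].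

(* The flow of [u grad w - w grad u] in polar coordinates. *)
Definition vf1 u w y := j0 u y * j1 w y - j0 w y * j1 u y.
Definition vf2 u w y := j0 u y * j2 w y - j0 w y * j2 u y.
Definition rad u w := radial (vf1 u w) (vf2 u w).
Definition ang u w := angular (vf1 u w) (vf2 u w).
Definition raddiv u w := radial_der (vf1 u w) (vf2 u w)
  (fun y => j1 u y * j1 w y + j0 u y * j11 w y - (j1 w y * j1 u y + j0 w y * j11 u y))
  (fun y => j2 u y * j1 w y + j0 u y * j12 w y - (j2 w y * j1 u y + j0 w y * j12 u y))
  (fun y => j1 u y * j2 w y + j0 u y * j21 w y - (j1 w y * j2 u y + j0 w y * j21 u y))
  (fun y => j2 u y * j2 w y + j0 u y * j22 w y - (j2 w y * j2 u y + j0 w y * j22 u y)).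

Lemma jet_conserved u w r t : solves u (pol r t) -> solves w (pol r t) ->
  conserved (rad u w) (ang u w) (raddiv u w) r t.
Proof.
move=> [[u0 u1 u2 ue] [cu0 cu1 cu2] [cu11 cu12 cu21 cu22]] [[w0 w1 w2 we] [cw0 cw1 cw2] [cw11 cw12 cw21 cw22]].
set y := pol r t in u0 u1 u2 ue w0 w1 w2 we *.
apply: polar_conserved; rewrite -/y.
- refine (is_grad_ext (is_gradB (is_gradM u0 w1) (is_gradM w0 u1)) _ _) => //=.
  by congr pair; ring.
- refine (is_grad_ext (is_gradB (is_gradM u0 w2) (is_gradM w0 u2)) _ _) => //=.
  by congr pair; ring.
- have -> : j11 u y = - k ^+ 2 * j0 u y - j22 u y by rewrite -ue addrK.
  have -> : j11 w y = - k ^+ 2 * j0 w y - j22 w y by rewrite -we addrK.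
  ring.
- by apply: cvgB; apply: cvgM.
- by apply: cvgB; apply: cvgM.
- by apply: cvgB; apply: cvgD; apply: cvgM.
- by apply: cvgB; apply: cvgD; apply: cvgM.
- by apply: cvgB; apply: cvgD; apply: cvgM.
- by apply: cvgB; apply: cvgD; apply: cvgM.
Qed.

Definition jsub w c u := Jet (fun y => j0 w y - c * j0 u y) (fun y => j1 w y - c * j1 u y)
  (fun y => j2 w y - c * j2 u y) (fun y => j11 w y - c * j11 u y) (fun y => j12 w y - c * j12 u y)
  (fun y => j21 w y - c * j21 u y) (fun y => j22 w y - c * j22 u y).

Lemma cjet1_sub w c u y : cjet1 w y -> cjet1 u y -> cjet1 (jsub w c u) y.
Proof.
by move=> [a1 a2 a3] [b1 b2 b3]; split; apply: cvgB => //; apply: cvgM => //; exact: cvg_cst.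
Qed.

Lemma solves_sub w c u y : solves w y -> solves u y -> solves (jsub w c u) y.
Proof.
move=> [[u0 u1 u2 ue] cu1 [cu11 cu12 cu21 cu22]] [[w0 w1 w2 we] cw1 [cw11 cw12 cw21 cw22]].
split; last 1 first.
- by split; apply: cvgB => //; apply: cvgM => //; exact: cvg_cst.
- split; rewrite /=.
  + exact: (is_gradB u0 (is_gradZ c w0)).
  + exact: (is_gradB u1 (is_gradZ c w1)).
  + exact: (is_gradB u2 (is_gradZ c w2)).
  + by rewrite addrACA ue -opprD -mulrDr we; ring.
- exact: cjet1_sub.
Qed.

Lemma rad_sub w c u v r t : rad (jsub w c u) v r t = rad w v r t - c * rad u v r t.
Proof. by rewrite /rad /radial /vf1 /vf2 /=; ring. Qed.

Lemma ang_sub w c u v r t : ang (jsub w c u) v r t = ang w v r t - c * ang u v r t.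
Proof. by rewrite /ang /angular /vf1 /vf2 /=; ring. Qed.

(** The function C_0(k |y - x|) of [y], where C is J for [bj] and Y for [by_]; the derivatives
    follow from g_n' = - g_(n+1). *)
Definition kjet (g : nat -> R -> R) x := Jet (fun y => g 0%N (tau (y - x)))
  (fun y => - (k ^+ 2 / 2) * (g 1%N (tau (y - x)) * (y - x).1))
  (fun y => - (k ^+ 2 / 2) * (g 1%N (tau (y - x)) * (y - x).2))
  (fun y => - (k ^+ 2 / 2) * (g 1%N (tau (y - x)) - k ^+ 2 / 2 * (g 2%N (tau (y - x)) * (y - x).1 * (y - x).1)))
  (fun y => (k ^+ 2 / 2) ^+ 2 * (g 2%N (tau (y - x)) * (y - x).1 * (y - x).2))
  (fun y => (k ^+ 2 / 2) ^+ 2 * (g 2%N (tau (y - x)) * (y - x).1 * (y - x).2))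
  (fun y => - (k ^+ 2 / 2) * (g 1%N (tau (y - x)) - k ^+ 2 / 2 * (g 2%N (tau (y - x)) * (y - x).2 * (y - x).2))).

Lemma tau_gt0 z : z != 0 -> 0 < tau z.
Proof.
case: z => a b; rewrite -[0]/(0, 0) xpair_eqE negb_and /= => h.
rewrite /tau mulr_gt0//; first by rewrite exprn_gt0// divr_gt0.
by rewrite lt0r addr_ge0 ?sqr_ge0// andbT paddr_eq0 ?sqr_ge0// negb_and !sqrf_eq0.
Qed.

Lemma sub1_continuous x y : {for y, continuous (fun y : R * R => (y - x).1)}.
Proof. by apply: cvgB; [exact: fst_continuous|exact: cvg_cst]. Qed.

Lemma sub2_continuous x y : {for y, continuous (fun y : R * R => (y - x).2)}.
Proof. by apply: cvgB; [exact: snd_continuous|exact: cvg_cst]. Qed.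

Lemma tau_continuous x y : {for y, continuous (fun y => tau (y - x))}.
Proof.
have h1 := @sub1_continuous x y; have h2 := @sub2_continuous x y.
apply: cvgM; first exact: cvg_cst.
by apply: cvgD; rewrite expr2; under eq_fun do rewrite expr2; apply: cvgM.
Qed.

(** This covers the pole y = x, where it is applied to [bj]. *)
Lemma kjet_cont1 (g : nat -> R -> R) x y : (forall n, {for tau (y - x), continuous (g n)}) -> cjet1 (kjet g x) y.
Proof.
move=> cg.
have c n : {for y, continuous (fun y => g n (tau (y - x)))}.
  by apply: (@continuous_comp _ _ _ (fun y => tau (y - x)) (g n)); [exact: tau_continuous|exact: cg].
split => //=; (apply: cvgM; [exact: cvg_cst|apply: cvgM; [exact: c|]]).
  exact: sub1_continuous.
exact: sub2_continuous.
Qed.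

Lemma kjet_solves g x y : cyl_family g -> y != x -> solves (kjet g x) y.
Proof.
move=> cg yx; have t0 : 0 < tau (y - x) by apply: tau_gt0; rewrite subr_eq0.
have cn n : {for tau (y - x), continuous (g n)} by exact: is_derive_cont (cg.1 n _ t0).
have c n : {for y, continuous (fun y => g n (tau (y - x)))}.
  by apply: (@continuous_comp _ _ _ (fun y => tau (y - x)) (g n)); [exact: tau_continuous|exact: cn].
have c1 := @sub1_continuous x y; have c2 := @sub2_continuous x y.
have g1 : is_grad (fun y => (y - x).1) y (1, 0).
  refine (is_grad_ext (is_gradB (@is_grad_fst R y) (@is_grad_cst R x.1 y)) _ _) => //=.
  by rewrite !subr0.
have g2 : is_grad (fun y => (y - x).2) y (0, 1).
  refine (is_grad_ext (is_gradB (@is_grad_snd R y) (@is_grad_cst R x.2 y)) _ _) => //=.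
  by rewrite !subr0.
have gt : is_grad (fun y => tau (y - x)) y (k ^+ 2 / 2 * (y - x).1, k ^+ 2 / 2 * (y - x).2).
  refine (is_grad_ext (is_gradZ ((k / 2) ^+ 2) (is_gradD (is_gradM g1 g1) (is_gradM g2 g2))) _ _) => //=.
  by congr pair; field.
have gg n := @is_grad_comp R (fun y => tau (y - x)) (g n) y _ _ (cg.1 n _ t0) gt.
split; last 1 first.
- have m (p q : R * R -> R) : {for y, continuous p} -> {for y, continuous q} ->
      {for y, continuous (fun y => g 2%N (tau (y - x)) * p y * q y)}.
    by move=> hp hq; apply: cvgM hq; apply: cvgM hp; exact: c.
  have m1 (p q : R * R -> R) : {for y, continuous p} -> {for y, continuous q} ->
      {for y, continuous (fun y => - (k ^+ 2 / 2) * (g 1%N (tau (y - x)) - k ^+ 2 / 2 * (g 2%N (tau (y - x)) * p y * q y)))}.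
    move=> hp hq; apply: cvgM; first exact: cvg_cst.
    by apply: cvgB; [exact: c|apply: cvgM; [exact: cvg_cst|exact: m]].
  split; [exact (m1 _ _ c1 c1)| | |exact (m1 _ _ c2 c2)]; apply: cvgM; try exact: cvg_cst; exact (m _ _ c1 c2).
- split; rewrite /=.
  + by refine (is_grad_ext (gg 0%N) _ _) => //=; congr pair; ring.
  + refine (is_grad_ext (is_gradZ (- (k ^+ 2 / 2)) (is_gradM (gg 1%N) g1)) _ _) => //=.
    by congr pair; ring.
  + refine (is_grad_ext (is_gradZ (- (k ^+ 2 / 2)) (is_gradM (gg 1%N) g2)) _ _) => //=.
    by congr pair; ring.
  + have := cg.2 0%N _ t0; rewrite /tau /=.
    set T := (k / 2) ^+ 2 * _; move: (g 0%N T) (g 1%N T) (g 2%N T) => G0 G1 G2.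
    move: (y.1 - x.1) (y.2 - x.2) @T => a b T; rewrite mul1r => E.
    have -> : G0 = G1 - T * G2 by rewrite E; ring.
    by rewrite /T; field.
- exact: kjet_cont1.
Qed.

End Jets.

(** * Flux of the fundamental solution *)

Section SingularCell.
Variables (R : realType) (k : R).
Hypothesis k_gt0 : 0 < k.
Local Notation tau := (tau k).
Local Notation rad := (@rad R).
Local Notation ang := (@ang R).
Local Notation kjet := (kjet k).
Local Notation solves := (solves k).
Implicit Types (r t : R) (x y : R * R).

Lemma cos_near1 : exists2 d : R, 0 < d & forall c, `|c| < d -> 2^-1 <= cos c.
Proof.
have c0 : cos c @[c --> (0:R)] --> cos (0:R) := @continuous_cos R 0.
move: c0; rewrite cos0 => /cvgrPdist_le /(_ 2^-1).
rewrite invr_gt0 ltr0n => /(_ isT)/nbhs_ballP[d /= d0 hd]; exists d => // c cd.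
have := hd c; rewrite -ball_normE /= sub0r normrN => /(_ cd).
by rewrite ler_distlC => /andP[+ _]; apply: le_trans; lra.
Qed.

Lemma sin_lower : exists2 d : R, 0 < d & forall c, `|c| < d -> c ^+ 2 / 4 <= 1 - cos c ^+ 2.
Proof.
have [d d0 hd] := cos_near1; exists d => // c cd.
have [x /andP[x0 xc]] := mvt (normr_ge0 c) (fun (z : R) _ => is_derive_sin z).
rewrite sin0 !subr0 => E.
have hx : 2^-1 <= cos x by apply: hd; rewrite ger0_norm// (le_lt_trans xc).
have -> : 1 - cos c ^+ 2 = sin `|c| ^+ 2.
  have -> : sin `|c| ^+ 2 = sin c ^+ 2.
    by case: (leP 0 c) => h; [rewrite ger0_norm|rewrite ltr0_norm// sinN sqrrN].
  by rewrite -(cos2Dsin2 c) addrAC subrr add0r.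
rewrite E exprMn real_normK ?num_real// mulrC ler_wpM2r ?sqr_ge0//.
have -> : 4^-1 = 2^-1 ^+ 2 :> R by rewrite exprVn -natrX.
by rewrite lerXn2r// nnegrE ?invr_ge0// (le_trans _ hx).
Qed.

Lemma tau_pol r t r0 t0 :
  tau (pol r t - pol r0 t0) = (k / 2) ^+ 2 * (r ^+ 2 + r0 ^+ 2 - 2 * (r * r0 * cos (t - t0))).
Proof.
rewrite /tau /= cosB; congr (_ * _).
move: (cos2Dsin2 t) (cos2Dsin2 t0).
move: (cos t) (sin t) (cos t0) (sin t0) => C S C0 S0 e1 e2.
transitivity (r ^+ 2 * (C ^+ 2 + S ^+ 2) + r0 ^+ 2 * (C0 ^+ 2 + S0 ^+ 2) - 2 * (r * r0 * (C * C0 + S * S0))).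
  ring.
by rewrite e1 e2 !mulr1.
Qed.

(** By the law of cosines in [tau_pol], polar coordinates near a point other than the origin shrink
    distances by a bounded factor at most. Singularities in |y - x| thereby become singularities in
    (r, t). *)
Lemma tau_lower r0 t0 : 0 < r0 -> exists e m : R, [/\ 0 < e, e <= r0, 0 < m & forall r t,
  `|r - r0| < e -> `|t - t0| < e -> (m * Num.max `|r - r0| `|t - t0|) ^+ 2 <= tau (pol r t - pol r0 t0)].
Proof.
move=> r00; have [d d0 hd] := sin_lower.
pose e := Num.min d r0; pose m := k / 2 * Num.min 1 (r0 / 2).
have k2 : 0 < k / 2 by rewrite divr_gt0.
have m0 : 0 < Num.min 1 (r0 / 2) by rewrite lt_min ltr01 divr_gt0.
exists e, m; split; rewrite ?lt_min ?d0 ?ge_min ?lexx ?orbT//; first exact: mulr_gt0.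
move=> r t hr ht; rewrite tau_pol /m -mulrA exprMn ler_wpM2l ?sqr_ge0// exprMn.
have rp : 0 <= r.
  have : `|r - r0| < r0 by rewrite (lt_le_trans hr)// ge_min lexx orbT.
  by rewrite ltr_distl => /andP[h _]; move: h; rewrite subrr => /ltW.
have td : `|t - t0| < d by rewrite (lt_le_trans ht)// ge_min lexx.
have := hd _ td; have c1 := cos_max (t - t0).
set C := cos (t - t0) in c1 *; set m' := Num.min 1 (r0 / 2) in m0 * => hC.
have m1 : m' <= 1 by rewrite ge_min lexx.
have m2 : m' <= r0 / 2 by rewrite ge_min lexx orbT.
have C1 : C <= 1 by move: c1; rewrite ler_norml => /andP[].
have s1 : m' ^+ 2 <= 1 by rewrite -(expr1n _ 2) lerXn2r// nnegrE ltW.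
have s2 : m' ^+ 2 <= r0 ^+ 2 / 4.
  by rewrite (_ : r0 ^+ 2 / 4 = (r0 / 2) ^+ 2) ?lerXn2r ?nnegrE ?divr_ge0 ?(ltW m0) ?(ltW r00)//; field.
case: (leP `|r - r0| `|t - t0|) => _; rewrite real_normK ?num_real//.
  have sq : 0 <= (r - r0 * C) ^+ 2 by exact: sqr_ge0.
  have h1 : m' ^+ 2 * (t - t0) ^+ 2 <= r0 ^+ 2 / 4 * (t - t0) ^+ 2 by rewrite ler_wpM2r ?sqr_ge0.
  have h2 : r0 ^+ 2 * ((t - t0) ^+ 2 / 4) <= r0 ^+ 2 * (1 - C ^+ 2) by rewrite ler_wpM2l ?sqr_ge0.
  by move: sq h1 h2; set q := (t - t0) ^+ 2; nra.
have h1 : m' ^+ 2 * (r - r0) ^+ 2 <= 1 * (r - r0) ^+ 2 by rewrite ler_wpM2r ?sqr_ge0.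
have h2 : 0 <= r * r0 * (1 - C) by rewrite mulr_ge0 ?mulr_ge0 ?subr_ge0// ltW.
by move: h1 h2; rewrite mul1r; nra.
Qed.

Lemma cos_eq1 (d : R) : `|d| < 2 * pi -> cos d = 1 -> d = 0.
Proof.
move=> dp cd; pose c := `|d| / 2.
have c0 : 0 <= c by rewrite divr_ge0.
have cp : c < pi by rewrite ltr_pdivrMr// mulrC.
have : cos (c + c) = 1.
  by rewrite /c -splitr; case: (leP 0 d) => h; [rewrite ger0_norm|rewrite ltr0_norm// cosN].
rewrite cosD -!expr2 -(cos2Dsin2 c) => E.
have s0 : sin c ^+ 2 = 0 by move: E; lra.
move/eqP: s0; rewrite sqrf_eq0 => s0.
case: (ltP 0 c) => [cpos|c1]; first by rewrite gt_eqF ?sin_gt0_pi ?cpos in s0.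
have : c == 0 by rewrite eq_le c1.
by rewrite mulf_eq0 invr_eq0 pnatr_eq0 orbF normr_eq0 => /eqP.
Qed.

(** [t] ranges over the closed interval, whose ends give the same ray; [t0] strictly inside is not
    affected by this. *)
Lemma pol_inj r t r0 t0 : 0 <= r -> 0 <= t <= 2 * pi -> 0 < r0 -> 0 < t0 < 2 * pi ->
  pol r t = pol r0 t0 -> r = r0 /\ t = t0.
Proof.
move=> rp /andP[tl tr] r00 /andP[tl0 tr0] E.
have T0 : tau (pol r t - pol r0 t0) = 0 by rewrite E subrr /tau /= expr0n /= addr0 mulr0.
have kn : (k / 2) ^+ 2 != 0 by rewrite expf_neq0// gt_eqF// divr_gt0.
move/eqP: T0; rewrite tau_pol mulf_eq0 (negbTE kn) /= => /eqP T0.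
have C1 : cos (t - t0) <= 1 by have := cos_max (t - t0); rewrite ler_norml => /andP[].
have h2 : 0 <= r * r0 * (1 - cos (t - t0)) by rewrite mulr_ge0 ?mulr_ge0 ?subr_ge0// ltW.
have h1 : 0 <= (r - r0) ^+ 2 by exact: sqr_ge0.
have e1 : (r - r0) ^+ 2 = 0 by move: T0 h1 h2; nra.
have rr : r = r0 by apply/eqP; rewrite -subr_eq0 -sqrf_eq0 e1.
split => //; have e2 : r0 * r0 * (1 - cos (t - t0)) = 0 by move: T0 h2; rewrite rr; nra.
move/eqP: e2; rewrite !mulf_eq0 gt_eqF//= subr_eq0 eq_sym => /eqP/cos_eq1 h.
apply/eqP; rewrite -subr_eq0 h// ltr_norml; apply/andP; split; lra.
Qed.

(** The variable is proportional to the squared distance from the pole. So the kernel is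
    o(1/distance), and its gradient, in which [g 1] is multiplied by y - x, is O(1/distance). *)
Definition sing (g : nat -> R -> R) :=
  (exists2 B, 0 < B & exists2 d, 0 < d & forall s, 0 < s -> s < d -> `|s * g 1%N s| <= B) /\
  (forall e, 0 < e -> exists2 d, 0 < d & forall s, 0 < s -> s < d -> `|Num.sqrt s * g 0%N s| <= e).

Lemma at_right0 (f : R -> R) l : f s @[s --> (0:R)^'+] --> l ->
  forall e, 0 < e -> exists2 d, 0 < d & forall s, 0 < s -> s < d -> `|f s - l| <= e.
Proof.
move=> /cvgrPdist_le h e /h; rewrite near_withinE => /nbhs_ballP[d /= d0 hd].
exists d => // s s0 sd; rewrite distrC; apply: hd => //.
by rewrite -ball_normE /= sub0r normrN gtr0_norm.
Qed.

Lemma sing_of_cvg (g : nat -> R -> R) (l : R) : s * g 1%N s @[s --> (0:R)^'+] --> l ->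
  Num.sqrt s * g 0%N s @[s --> (0:R)^'+] --> (0:R) -> sing g.
Proof.
move=> h1 h0; split.
  exists (`|l| + 1); first by rewrite ltr_wpDl.
  have [d d0 hd] := at_right0 h1 ltr01; exists d => // s s0 sd.
  have := hd s s0 sd; have := ler_normD (s * g 1%N s - l) l; rewrite subrK => h h'.
  by apply: le_trans h _; rewrite addrC lerD2l.
move=> e e0; have [d d0 hd] := at_right0 h0 e0; exists d => // s s0 sd.
by have := hd s s0 sd; rewrite subr0.
Qed.

Lemma cvg_right0 : s @[s --> (0:R)^'+] --> (0:R).
Proof. by apply: cvg_at_right_filter; exact: cvg_id. Qed.

Lemma sing_bj : sing (@bj R).
Proof.
apply: (@sing_of_cvg _ 0).
  rewrite -[X in _ --> X](mul0r (1%N`!%:R^-1 : R)); apply: cvgM; first exact: cvg_right0.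
  exact: (@cvg_bj0 R 1).
rewrite -[X in _ --> X](mul0r (0%N`!%:R^-1 : R)); apply: cvgM; last exact: (@cvg_bj0 R 0).
by rewrite -[X in _ --> X]sqrtr0; apply: cvg_at_right_filter; exact: sqrt_continuous.
Qed.

Lemma sing_by : sing (@by_ R).
Proof. exact: sing_of_cvg (@cvg_by1 R) (@cvg_by0 R). Qed.

Lemma pol_near (V : R * R -> R) r0 t0 (e : R) : {for pol r0 t0, continuous V} -> 0 < e ->
  exists2 d, 0 < d & forall r t, `|r - r0| < d -> `|t - t0| < d -> `|V (pol r t) - V (pol r0 t0)| <= e.
Proof.
move=> cV e0; have /cvgrPdist_le /(_ e e0)/nbhs_ballP[d /= d0 hd] := comp_pol_continuous cV.
exists d => // r t hr ht; rewrite distrC; apply: (hd (r, t)).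
by split; rewrite -ball_normE /= distrC.
Qed.

Lemma rflux_sub (P Q N P' Q' N' : R -> R -> R) r1 r2 t1 t2 r0 t0 c : r1 < r0 < r2 -> t1 < t0 < t2 ->
  (forall r t, r1 <= r <= r2 -> t1 <= t <= t2 -> (r != r0) || (t != t0) -> conserved P Q N r t) ->
  (forall r t, r1 <= r <= r2 -> t1 <= t <= t2 -> (r != r0) || (t != t0) -> conserved P' Q' N' r t) ->
  rflux (fun r t => P r t - c * P' r t) (fun r t => Q r t - c * Q' r t) r1 r2 t1 t2 =
  rflux P Q r1 r2 t1 t2 - c * rflux P' Q' r1 r2 t1 t2.
Proof.
move=> /andP[r10 r02] /andP[t10 t02] H H'.
have r12 : r1 <= r2 by rewrite ltW// (lt_trans r10).
have t12 : t1 <= t2 by rewrite ltW// (lt_trans t10).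
have i1 : r1 <= r1 <= r2 by rewrite lexx. have i2 : r1 <= r2 <= r2 by rewrite lexx andbT.
have l1 : t1 <= t1 <= t2 by rewrite lexx. have l2 : t1 <= t2 <= t2 by rewrite lexx andbT.
have n1 : r1 != r0 by rewrite lt_eqF. have n2 : r2 != r0 by rewrite gt_eqF.
have m1 : t1 != t0 by rewrite lt_eqF. have m2 : t2 != t0 by rewrite gt_eqF.
have wP A B D r : (forall r t, r1 <= r <= r2 -> t1 <= t <= t2 -> (r != r0) || (t != t0) -> conserved A B D r t) ->
    r1 <= r <= r2 -> r != r0 -> {within `[t1, t2], continuous (A r)}.
  move=> HA hr rn; apply: within_cont => t ht.
  by have [|_ [h _ _]] := HA r t hr ht; [rewrite rn|exact: cont_slice2 h].
have wQ A B D t : (forall r t, r1 <= r <= r2 -> t1 <= t <= t2 -> (r != r0) || (t != t0) -> conserved A B D r t) ->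
    t1 <= t <= t2 -> t != t0 -> {within `[r1, r2], continuous (B ^~ t)}.
  move=> HA ht tn; apply: within_cont => r hr.
  by have [|_ [_ h _]] := HA r t hr ht; [rewrite tn orbT|exact: cont_slice1 h].
have wZ (f : R -> R) a b : {within `[a, b], continuous f} -> {within `[a, b], continuous (fun s => c * f s)}.
  by move=> cf s; apply: cvgM; [exact: cvg_cst|exact: cf].
have p1 := wP _ _ _ _ H i1 n1; have p2 := wP _ _ _ _ H i2 n2.
have p1' := wP _ _ _ _ H' i1 n1; have p2' := wP _ _ _ _ H' i2 n2.
have q1 := wQ _ _ _ _ H l1 m1; have q2 := wQ _ _ _ _ H l2 m2.
have q1' := wQ _ _ _ _ H' l1 m1; have q2' := wQ _ _ _ _ H' l2 m2.
rewrite /rflux (IntB p2 (wZ _ _ _ p2')) (IntB p1 (wZ _ _ _ p1')) (IntB q2 (wZ _ _ _ q2')) (IntB q1 (wZ _ _ _ q1')).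
by rewrite (IntZ _ p1') (IntZ _ p2') (IntZ _ q1') (IntZ _ q2'); ring.
Qed.

(* [w - w(x) J] vanishes at the pole [x] of [K], so that its flow against [K] has no singularity. *)
Lemma flux_kernel w g r1 r2 t1 t2 r0 t0 : cyl_family g -> sing g -> 0 < r0 ->
  r1 < r0 < r2 -> t1 < t0 < t2 ->
  (forall r t, r1 <= r <= r2 -> t1 <= t <= t2 -> (r != r0) || (t != t0) -> pol r t != pol r0 t0) ->
  (forall r t, r1 <= r <= r2 -> t1 <= t <= t2 -> solves w (pol r t)) ->
  let K := kjet g (pol r0 t0) in let J := kjet (@bj R) (pol r0 t0) in
  rflux (rad w K) (ang w K) r1 r2 t1 t2 = j0 w (pol r0 t0) * rflux (rad J K) (ang J K) r1 r2 t1 t2.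
Proof.
move=> cg [[B B0 [dB dB0 hB]] hS] r00 r012 t012 inj hw K J.
set x := pol r0 t0 in inj hw K J *; pose c := j0 w x; rewrite -/c.
have sK r t : r1 <= r <= r2 -> t1 <= t <= t2 -> (r != r0) || (t != t0) -> solves K (pol r t).
  by move=> hr ht n; apply: kjet_solves => //; exact: inj.
have sJ r t : r1 <= r <= r2 -> t1 <= t <= t2 -> (r != r0) || (t != t0) -> solves J (pol r t).
  by move=> hr ht n; apply: kjet_solves => //; [exact: cyl_bj|exact: inj].
have cw r t : r1 <= r <= r2 -> t1 <= t <= t2 -> (r != r0) || (t != t0) -> conserved (rad w K) (ang w K) (raddiv w K) r t.
  by move=> hr ht n; apply: (jet_conserved (k := k)); [exact: hw|exact: sK].
have cJ r t : r1 <= r <= r2 -> t1 <= t <= t2 -> (r != r0) || (t != t0) -> conserved (rad J K) (ang J K) (raddiv J K) r t.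
  by move=> hr ht n; apply: (jet_conserved (k := k)); [exact: sJ|exact: sK].
apply/eqP; rewrite -subr_eq0 -(rflux_sub c r012 t012 cw cJ).
(* As [U] vanishes at the pole, U grad K is o(1) times O(1/distance), and K grad U is o(1/distance)
   times O(1), as [rflux_singular] requires. *)
pose U := jsub w c J.
have -> : (fun r t => rad w K r t - c * rad J K r t) = rad U K.
  by apply/funext => r; apply/funext => t; rewrite /U rad_sub.
have -> : (fun r t => ang w K r t - c * ang J K r t) = ang U K.
  by apply/funext => r; apply/funext => t; rewrite /U ang_sub.
have i0 : r1 <= r0 <= r2 by case/andP: r012 => a b; rewrite !ltW.
have l0 : t1 <= t0 <= t2 by case/andP: t012 => a b; rewrite !ltW.
have cU : cjet1 U x.
  apply: cjet1_sub; first by have [_ []] := hw r0 t0 i0 l0.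
  by apply: kjet_cont1 => n; exact: is_derive_cont (is_derive_bj n _).
have tE : tau (x - x) = 0 by rewrite subrr /tau /= expr0n /= addr0 mulr0.
have U0 : j0 U x = 0.
  have bE : bj 0 0 = 1 :> R.
    rewrite /bj psum0; last exact: entire_jcoef.
    by rewrite /jcoef expr0 addn0 fact0 !mul1r invr1.
  by rewrite /U /= tE bE mulr1 subrr.
apply/eqP; apply: (@rflux_singular _ _ _ (raddiv U K) r1 r2 t1 t2 r0 t0) => //.
  move=> r t hr ht n; apply: (jet_conserved (k := k)); last exact: sK.
  by apply: solves_sub; [exact: hw|exact: sJ].
move=> eta eta0; have [e1 [m [e10 e1r m0 hm]]] := tau_lower t0 r00.
have [cU0 cU1 cU2] := cU.
pose M := `|j1 U x| + `|j2 U x| + 1.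
have M0 : 0 < M by rewrite ltr_wpDl// addr_ge0.
(* Each component of the flow times [D] is at most 2 E / m; the radial density adds two of them and
   has a factor |r| <= 2 r0, which makes eta. [E'] serves the angular density, which lacks this
   factor. *)
pose E := eta * m / (4 * (r0 + r0)).
have E0 : 0 < E by rewrite /E divr_gt0 ?mulr_gt0 ?addr_gt0.
have eps1 : 0 < E / (k * B) by rewrite divr_gt0// mulr_gt0.
have eps2 : 0 < E / M by rewrite divr_gt0.
pose E' := eta * m / 4; have E'0 : 0 < E' by rewrite divr_gt0// mulr_gt0.
have eps3 : 0 < E' / (k * B) by rewrite divr_gt0// mulr_gt0.
have eps4 : 0 < E' / M by rewrite divr_gt0.
have [d1 d10 hd1] := pol_near cU0 eps1.
have [d1' d1'0 hd1'] := pol_near cU0 eps3.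
have [d2 d20 hd2] := pol_near cU1 ltr01.
have [d3 d30 hd3] := pol_near cU2 ltr01.
have [s1 s10 hs1] := hS _ eps2.
have [s1' s1'0 hs1'] := hS _ eps4.
pose s := Num.min (Num.min s1 s1') dB.
have s0 : 0 < s by rewrite !lt_min s10 s1'0.
have s20 : 0 < s / 2 by rewrite divr_gt0.
have [d4 d40 hd4] := pol_near (tau_continuous (k := k) (x := x) (y := x)) s20.
pose e := Num.min (Num.min e1 d1) (Num.min (Num.min d2 d3) (Num.min d4 d1')).
have ee0 : 0 < e by rewrite !lt_min e10 d10 d20 d30 d40 d1'0.
exists e => // r t hr ht n.
have {hr ht} [[re1 te1] [rd1 td1] [rd2 td2] [rd3 td3] [[rd4 td4] [rd5 td5]]] : [/\ `|r - r0| < e1 /\ `|t - t0| < e1,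
   `|r - r0| < d1 /\ `|t - t0| < d1, `|r - r0| < d2 /\ `|t - t0| < d2, `|r - r0| < d3 /\ `|t - t0| < d3 &
   (`|r - r0| < d4 /\ `|t - t0| < d4) /\ (`|r - r0| < d1' /\ `|t - t0| < d1')].
  move: hr ht; rewrite !lt_min => /andP[/andP[-> ->] /andP[/andP[-> ->] /andP[-> ->]]].
  by move=> /andP[/andP[-> ->] /andP[/andP[-> ->] /andP[-> ->]]].
set D := Num.max _ _; have hD := hm r t re1 te1; rewrite -/D -/x in hD.
have D0 : 0 < D.
  by rewrite lt_max !normr_gt0 !subr_eq0.
set y := pol r t in hD *.
set T := tau (y - x) in hD *.
have T0 : 0 < T by apply: lt_le_trans hD; rewrite exprn_gt0// mulr_gt0.
have Ts : T < s.
  have := hd4 r t rd4 td4; rewrite -/x -/y -/T tE subr0 (gtr0_norm T0).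
  by move=> h; apply: le_lt_trans h _; rewrite ltr_pdivrMr// ltr_pMr// ltr1n.
have [Ts1 Ts1' TdB] : [/\ T < s1, T < s1' & T < dB] by move: Ts; rewrite !lt_min => /andP[/andP[]].
have W0 : 0 < Num.sqrt T by rewrite sqrtr_gt0.
set W := Num.sqrt T in W0; have WT : W ^+ 2 = T by rewrite sqr_sqrtr// ltW.
have mDW : m * D <= W.
  by rewrite -(@ler_pXn2r _ 2) ?nnegrE ?mulr_ge0 ?(ltW m0) ?(ltW D0) ?(ltW W0)// WT.
have hG1 := hB T T0 TdB; have hG0 := hs1 T T0 Ts1; have hG0' := hs1' T T0 Ts1'.
rewrite -/W in hG0 hG0'.
have u0 := hd1 r t rd1 td1; have u0' := hd1' r t rd5 td5.
have u1 := hd2 r t rd2 td2; have u2 := hd3 r t rd3 td3.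
rewrite -/y -/x U0 subr0 in u0 u0'; rewrite -/y -/x in u1 u2.
have hu1 : `|j1 U y| <= M.
  have := ler_normD (j1 U y - j1 U x) (j1 U x); rewrite subrK /M => h.
  apply: le_trans h _; have := normr_ge0 (j2 U x); move: u1; clear; set a := `| _ - _ |; lra.
have hu2 : `|j2 U y| <= M.
  have := ler_normD (j2 U y - j2 U x) (j2 U x); rewrite subrK /M => h.
  apply: le_trans h _; have := normr_ge0 (j1 U x); move: u2; clear; set a := `| _ - _ |; lra.
have k20 : 0 < k / 2 by rewrite divr_gt0.
have zW (z : R) : z ^+ 2 <= (y - x).1 ^+ 2 + (y - x).2 ^+ 2 -> k / 2 * `|z| <= W.
  move=> hz; have p := mulr_ge0 (ltW k20) (normr_ge0 z).
  rewrite -(@ler_pXn2r _ 2) ?nnegrE ?p ?(ltW W0)// WT exprMn real_normK ?num_real//.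
  by rewrite /T /tau ler_wpM2l ?sqr_ge0.
have z1 : k / 2 * `|(y - x).1| <= W by apply: zW; rewrite lerDl sqr_ge0.
have z2 : k / 2 * `|(y - x).2| <= W by apply: zW; rewrite lerDr sqr_ge0.
have kz (z : R) : k / 2 * `|z| <= W -> `|- (k ^+ 2 / 2) * (g 1%N T * z)| * W <= k * B.
  move=> hz; have -> : `|- (k ^+ 2 / 2) * (g 1%N T * z)| * W = k * (`|g 1%N T| * (k / 2 * `|z|) * W).
    have kk : 0 <= k ^+ 2 / 2 by rewrite divr_ge0// sqr_ge0.
    by rewrite normrM normrN (ger0_norm kk) normrM; field.
  rewrite ler_wpM2l ?(ltW k_gt0)//; apply: le_trans hG1.
  rewrite normrM (gtr0_norm T0) -WT expr2 mulrC -!mulrA ler_wpM2l ?(ltW W0)// mulrC mulrA [leRHS]mulrC.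
  by rewrite mulrC ler_wpM2l// mulrC.
have v0 : `|j0 K y| * W <= E / M by rewrite mulrC -(gtr0_norm W0) -normrM.
have v0' : `|j0 K y| * W <= E' / M by rewrite mulrC -(gtr0_norm W0) -normrM.
have v1 : `|j1 K y| * W <= k * B by exact: kz.
have v2 : `|j2 K y| * W <= k * B by exact: kz.
have prod_le (a b c' d' A1 A2 : R) e' : 0 < e' -> `|a| <= e' / (k * B) -> `|b| * W <= k * B -> `|c'| * W <= e' / M -> `|d'| <= M ->
   `|a * b - c' * d'| * D <= 2 * e' / m.
  move=> ee ha hb hc hd'; rewrite ler_pdivlMr// -mulrA (mulrC D) .
  have p1 : `|a| * (`|b| * W) <= e' / (k * B) * (k * B) by apply: ler_pM => //; rewrite mulr_ge0// ltW.
  rewrite divfK in p1; last by rewrite mulf_neq0// gt_eqF.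
  have p2 : `|c'| * W * `|d'| <= e' / M * M by apply: ler_pM => //; rewrite mulr_ge0// ltW.
  rewrite divfK in p2; last by rewrite gt_eqF.
  apply: (@le_trans _ _ ((`|a * b| + `|c' * d'|) * W)).
    by apply: ler_pM => //; [rewrite mulr_ge0// ltW|exact: ler_normB].
  by rewrite !normrM; move: p1 p2; clear; lra.
have V1 := prod_le _ _ _ _ 0 0 _ E0 u0 v1 v0 hu1; have V2 := prod_le _ _ _ _ 0 0 _ E0 u0 v2 v0 hu2.
have V1' := prod_le _ _ _ _ 0 0 _ E'0 u0' v1 v0' hu1; have V2' := prod_le _ _ _ _ 0 0 _ E'0 u0' v2 v0' hu2.
have trig (a b C S : R) : `|C| <= 1 -> `|S| <= 1 -> `|a * C + b * S| <= `|a| + `|b|.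
  move=> hC hS'; apply: le_trans (ler_normD _ _) _; rewrite !normrM.
  by apply: lerD; rewrite ler_piMr.
have cm := cos_max t; have sm := sin_max t.
split.
  have rr : `|r| <= r0 + r0.
    have := ler_normD (r - r0) r0; rewrite subrK (gtr0_norm r00) => h; apply: le_trans h _.
    by rewrite lerD2r ltW// (lt_le_trans re1).
  rewrite /rad /radial normrM -mulrA.
  apply: (@le_trans _ _ ((r0 + r0) * ((`|vf1 U K y| + `|vf2 U K y|) * D))).
    apply: ler_pM => //; first by rewrite mulr_ge0// ltW.
    by rewrite ler_wpM2r ?(ltW D0)//; exact: trig.
  rewrite [(_ + `|vf2 _ _ _|) * D]mulrDl; apply: (@le_trans _ _ ((r0 + r0) * (2 * E / m + 2 * E / m))).
    by rewrite ler_wpM2l ?addr_ge0 ?(ltW r00)//; exact: lerD.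
  by rewrite /E le_eqVlt; apply/orP; left; apply/eqP; field; rewrite !gt_eqF ?addr_gt0.
rewrite /ang /angular; apply: (@le_trans _ _ ((`|vf2 U K y| + `|vf1 U K y|) * D)).
  by rewrite ler_wpM2r ?(ltW D0)// -mulrN; apply: trig; rewrite ?normrN.
rewrite mulrDl; apply: (@le_trans _ _ (2 * E' / m + 2 * E' / m)); first exact: lerD.
by rewrite /E' le_eqVlt; apply/orP; left; apply/eqP; field; rewrite gt_eqF.
Qed.

(** The inner arc degenerates at r = 0, and the two radial sides coincide. *)
Lemma rflux_full u w r : rflux (rad u w) (ang u w) 0 r 0 (2 * pi) = Int 0 (2 * pi) (rad u w r).
Proof.
rewrite /rflux; have -> : rad u w 0 = fun=> 0 by apply/funext => t; rewrite /rad /radial mul0r.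
have pi2 s : pol s (2 * pi) = pol s 0 :> R * R by rewrite /pol mulr_natl cos2pi sin2pi cos0 sin0.
have -> : (ang u w)^~ (2 * pi) = (ang u w)^~ 0.
  by apply/funext => s; rewrite /ang /angular pi2 mulr_natl cos2pi sin2pi cos0 sin0.
rewrite subrr addr0 Int_cst ?mul0r ?subr0//.
by rewrite mulr_ge0// pi_ge0.
Qed.

(** The Wronskian eliminates the Bessel functions and [k]: what is left is 2 / pi times [r] times
    the radial derivative of ln |y - x|, the flux density of the Laplace kernel. *)
Lemma rad_kernels r t r0 t0 : let K := kjet (@by_ R) (pol r0 t0) in let J := kjet (@bj R) (pol r0 t0) in
  pol r t != pol r0 t0 ->
  rad J K r t = 2 / pi * (r * (r - r0 * cos (t - t0)) / (r ^+ 2 + r0 ^+ 2 - 2 * (r * r0 * cos (t - t0)))).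
Proof.
move=> K J ne; have T0 : 0 < tau (pol r t - pol r0 t0) by apply: tau_gt0; rewrite ?subr_eq0.
have W := cyl_wronskian T0.
have TE := tau_pol r t r0 t0.
rewrite /rad /radial /vf1 /vf2 /=; set T := tau _ in T0 W TE *.
set q := r ^+ 2 + _ - _ in TE *.
have q0 : q != 0 by apply/eqP => q0; move: T0; rewrite TE q0 mulr0 ltxx.
have ne0 : (k / 2) ^+ 2 != 0 by rewrite expf_neq0// gt_eqF// divr_gt0.
have kn : k != 0 by rewrite gt_eqF.
have -> : bj 0 T * (- (k ^+ 2 / 2) * (by_ 1 T * (r * cos t - r0 * cos t0))) -
    by_ 0 T * (- (k ^+ 2 / 2) * (bj 1 T * (r * cos t - r0 * cos t0))) =
    - (k ^+ 2 / 2) * ((bj 0 T * by_ 1 T - bj 1 T * by_ 0 T) * (r * cos t - r0 * cos t0)) by ring.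
have -> : bj 0 T * (- (k ^+ 2 / 2) * (by_ 1 T * (r * sin t - r0 * sin t0))) -
    by_ 0 T * (- (k ^+ 2 / 2) * (bj 1 T * (r * sin t - r0 * sin t0))) =
    - (k ^+ 2 / 2) * ((bj 0 T * by_ 1 T - bj 1 T * by_ 0 T) * (r * sin t - r0 * sin t0)) by ring.
set X := bj 0 T * by_ 1 T - bj 1 T * by_ 0 T in W *.
have XE : X = - pi^-1 / ((k / 2) ^+ 2 * q).
  by rewrite -TE -W; field; rewrite gt_eqF.
have -> : r * (- (k ^+ 2 / 2) * (X * (r * cos t - r0 * cos t0)) * cos t +
   - (k ^+ 2 / 2) * (X * (r * sin t - r0 * sin t0)) * sin t) =
   - (k ^+ 2 / 2) * X * (r * (r * (cos t ^+ 2 + sin t ^+ 2) - r0 * (cos t * cos t0 + sin t * sin t0))) by ring.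
rewrite cos2Dsin2 -cosB mulr1 XE; set p1 := pi^-1; set Y := r * (_ - _).
by field; rewrite q0 kn.
Qed.

(* The flux does not depend on the rectangle; on large circles the integrand tends to [2 / pi] by [rad_kernels]. *)
Lemma flux_kernels r1 r2 t1 t2 r0 t0 : 0 <= r1 -> r1 < r0 < r2 -> 0 <= t1 -> t2 <= 2 * pi -> t1 < t0 < t2 ->
  let K := kjet (@by_ R) (pol r0 t0) in let J := kjet (@bj R) (pol r0 t0) in
  rflux (rad J K) (ang J K) r1 r2 t1 t2 = 4.
Proof.
move=> r1p /andP[r10 r02] t1p t2p /andP[t10 t02] K J.
have r00 : 0 < r0 by exact: le_lt_trans r10.
have t0p : 0 < t0 < 2 * pi by rewrite (le_lt_trans t1p)//= (lt_le_trans t02).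
have inj r t : 0 <= r -> 0 <= t <= 2 * pi -> (r != r0) || (t != t0) -> pol r t != pol r0 t0.
  move=> rp tp; apply: contraTneq => /(pol_inj rp tp r00 t0p)[-> ->]; by rewrite !eqxx.
have cJ r t : 0 <= r -> 0 <= t <= 2 * pi -> (r != r0) || (t != t0) -> conserved (rad J K) (ang J K) (raddiv J K) r t.
  move=> rp tp n; apply: (jet_conserved (k := k)); apply: kjet_solves; rewrite ?inj//; [exact: cyl_bj|exact: cyl_by].
have big r : r2 <= r -> rflux (rad J K) (ang J K) r1 r2 t1 t2 = Int 0 (2 * pi) (rad J K r).
  move=> rr; rewrite -rflux_full; apply/esym; apply: (@rflux_localize _ _ _ (raddiv J K)) => //.
  - by rewrite ltW// (lt_trans r10).
  - by rewrite ltW// (lt_trans t10).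
  - move=> s u /andP[s0 _] hu n; apply: cJ => //.
    rewrite -negb_and; apply: contraNN n => /andP[/eqP-> /eqP->].
    by rewrite r10 r02 t10.
set F := rflux _ _ _ _ _ _ in big *.
apply/eqP; rewrite -subr_eq0; apply/eqP.
apply: (@eq0_of_small _ _ 12 (Num.min 1 (r0 / r2))).
  by rewrite lt_min ltr01 divr_gt0// (lt_trans r00).
move=> e e0; rewrite lt_min => /andP[e1 er].
(* On this circle the distance to the pole is at least r0 / e, so that the density is within O(e) of
   its limit 2 / pi. *)
pose r := r0 + r0 / e.
have rr2 : r2 <= r.
  rewrite /r; apply: (@le_trans _ _ (r0 / e)); last by rewrite lerDr ltW.
  rewrite ler_pdivlMr// mulrC -ler_pdivlMr ?(lt_trans r00)// ltW//.
have rr0 : r0 < r by rewrite /r ltrDl divr_gt0.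
have rp : 0 < r by exact: lt_trans rr0.
have pp : 0 <= 2 * pi :> R by rewrite mulr_ge0// pi_ge0.
have pn : pi != 0 :> R by rewrite gt_eqF// pi_gt0.
have cr : {within `[0, 2 * pi], continuous (rad J K r)}.
  apply: within_cont => t ht.
  by have [|_ [h _ _]] := cJ r t (ltW rp) ht; [rewrite gt_eqF|exact: cont_slice2 h].
have -> : F - 4 = Int 0 (2 * pi) (fun t => rad J K r t - 2 / pi).
  rewrite IntB//; last exact: cst_within.
  rewrite -(big r rr2) Int_cst// subr0; congr (_ - _).
  by rewrite [2 * pi]mulrC mulrA divfK// -natrM.
have -> : e * 12 = 6 * e / pi * (2 * pi - 0).
  by rewrite subr0 [2 * pi]mulrC mulrA divfK//; ring.
apply: Int_bound => //.
  by move=> u; apply: cvgB; [exact: cr|exact: cvg_cst].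
move=> t ht; rewrite rad_kernels; last by apply: inj (ltW rp) ht _; rewrite gt_eqF.
have c1 := cos_max (t - t0); set C := cos _ in c1 *.
have q0 : (r0 / e) ^+ 2 <= r ^+ 2 + r0 ^+ 2 - 2 * (r * r0 * C).
  have h : 0 <= r * r0 * (1 - C).
    by rewrite mulr_ge0 ?mulr_ge0 ?(ltW rp) ?(ltW r00)// subr_ge0; move: c1; rewrite ler_norml => /andP[].
  have -> : r0 / e = r - r0 by rewrite /r; ring.
  by move: h; lra.
set q := r ^+ 2 + _ - _ in q0 *.
have re0 : 0 < r0 / e by rewrite divr_gt0.
have qp : 0 < q by apply: lt_le_trans q0; rewrite exprn_gt0.
have -> : 2 / pi * (r * (r - r0 * C) / q) - 2 / pi = 2 / pi * ((r * r0 * C - r0 ^+ 2) / q).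
  rewrite -[X in _ - X]mulr1 -mulrBr; congr (_ * _); apply: (mulIf (lt0r_neq0 qp)).
  by rewrite mulrBl !divfK ?lt0r_neq0// mul1r /q; ring.
have -> : 6 * e / pi = 2 / pi * (3 * e) by ring.
have p0 : 0 < 2 / pi :> R by rewrite divr_gt0// pi_gt0.
rewrite normrM (gtr0_norm p0) ler_wpM2l ?(ltW p0)// normrM normfV (gtr0_norm qp) ler_pdivrMr//.
apply: (@le_trans _ _ (3 * e * (r0 / e) ^+ 2)); last by rewrite ler_wpM2l// mulr_ge0// ltW.
have -> : 3 * e * (r0 / e) ^+ 2 = 3 * r0 * (r0 / e) by field; rewrite gt_eqF.
apply: le_trans (ler_normB _ _) _; rewrite normrM normrM (gtr0_norm rp) (gtr0_norm r00) (ger0_norm (sqr_ge0 r0)).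
have h1 : r * r0 * `|C| <= r * r0 * 1 by rewrite ler_wpM2l// mulr_ge0 ?(ltW rp) ?(ltW r00).
have h2 : r0 <= r0 / e by rewrite ler_pdivlMr// ler_piMr// ltW.
move: h1 h2; rewrite /r; nra.
Qed.

End SingularCell.

(** * Radiation condition *)

Section YoungEstimates.
Variable R : realType.
Implicit Types r w d C : R.

Lemma young_weight w (z : R) : 0 < w -> `|z| <= (w * z ^+ 2 + 1 / w) / 2.
Proof.
move=> w0; rewrite -(ler_pM2l w0) (_ : w * ((w * z ^+ 2 + 1 / w) / 2) = ((w * z) ^+ 2 + 1) / 2); last by field; rewrite gt_eqF.
have -> : w * `|z| = `|w * z| by rewrite normrM gtr0_norm.
have := sqr_ge0 (`|w * z| - 1); rewrite -[(w * z) ^+ 2]real_normK ?num_real//; nra.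
Qed.

Lemma young_product r d C (y z : R) : 0 < r -> 0 < d -> r * y ^+ 2 <= C -> r * z ^+ 2 <= d ^+ 2 -> r * `|y * z| <= d * (C + 1) / 2.
Proof.
move=> rp d0 hy hz; have h : `|y * z| <= (d * y ^+ 2 + z ^+ 2 / d) / 2.
  rewrite -(ler_pM2l d0) (_ : d * ((d * y ^+ 2 + z ^+ 2 / d) / 2) = ((d * y) ^+ 2 + z ^+ 2) / 2); last by field; rewrite gt_eqF.
  have -> : d * `|y * z| = `|d * y| * `|z| by rewrite [`|d * y|]normrM (gtr0_norm d0) [`|y * z|]normrM mulrA.
  have := sqr_ge0 (`|d * y| - `|z|).
  rewrite -[(d * y) ^+ 2]real_normK ?num_real// -[z ^+ 2]real_normK ?num_real//; clear; nra.
apply: le_trans (ler_wpM2l (ltW rp) h) _.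
have -> : r * ((d * y ^+ 2 + z ^+ 2 / d) / 2) = (d * (r * y ^+ 2) + (r * z ^+ 2) / d) / 2 by ring.
have h1 : d * (r * y ^+ 2) <= d * C by rewrite ler_wpM2l// ltW.
have h2 : r * z ^+ 2 / d <= d by rewrite ler_pdivrMr// -expr2.
by move: h1 h2; clear; lra.
Qed.

(** [x1], [x2] stand for values of the field, controlled in mean square only; [y1], [y2] for values
    of the kernels; [p], [q] and [al], [be] for the defects of the kernels and of the field in the
    radiation condition. The weight [w] will be sqrt r. *)
Lemma energy_estimate r w d C (x1 x2 y1 y2 p q al be : R) : 0 < r -> 0 < w -> 0 < d -> 0 < C ->
  r * (y1 ^+ 2 + y2 ^+ 2) <= C -> `|p| <= C / r -> `|q| <= C / r -> r * (al ^+ 2 + be ^+ 2) <= d ^+ 2 ->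
  `|r * (x1 * p + x2 * q + y1 * al + y2 * be)| <= C / 2 * (w * (x1 ^+ 2 + x2 ^+ 2) + 2 / w) + d * (2 * (C + 1)).
Proof.
move=> rp w0 d0 C0 hy hp hq hab.
have sg (z : R) : 0 <= r * z ^+ 2 by rewrite mulr_ge0 ?sqr_ge0// ltW.
have := sg y1; have := sg y2; have := sg al; have := sg be => g1 g2 g3 g4.
rewrite !mulrDr in hy hab.
have hy1 : r * y1 ^+ 2 <= C by move: hy g3; clear; lra.
have hy2 : r * y2 ^+ 2 <= C by move: hy g4; clear; lra.
have ha1 : r * al ^+ 2 <= d ^+ 2 by move: hab g1; clear; lra.
have ha2 : r * be ^+ 2 <= d ^+ 2 by move: hab g2; clear; lra.
have e1 := young_product rp d0 hy1 ha1; have e2 := young_product rp d0 hy2 ha2.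
have rq (x z : R) : `|z| <= C / r -> r * `|x * z| <= C * `|x|.
  move=> hz; rewrite normrM mulrCA [leRHS]mulrC ler_wpM2l// mulrC -ler_pdivlMr//.
have e3 := rq x1 p hp; have e4 := rq x2 q hq.
have f1 := ler_wpM2l (ltW C0) (young_weight x1 w0); have f2 := ler_wpM2l (ltW C0) (young_weight x2 w0).
rewrite normrM (gtr0_norm rp).
apply: (@le_trans _ _ (r * (`|x1 * p| + `|x2 * q| + `|y1 * al| + `|y2 * be|))).
  rewrite ler_wpM2l ?(ltW rp)//; apply: le_trans (ler_normD _ _) _; rewrite lerD2r.
  by apply: le_trans (ler_normD _ _) _; rewrite lerD2r; exact: ler_normD.
rewrite !mulrDr.
have -> : C / 2 * (w * x1 ^+ 2) + C / 2 * (w * x2 ^+ 2) + C / 2 * (2 / w) + (d * (2 * C) + d * (2 * 1)) =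
  C * ((w * x1 ^+ 2 + 1 / w) / 2) + C * ((w * x2 ^+ 2 + 1 / w) / 2) + 2 * (d * (C + 1)) by field; rewrite gt_eqF.
have dC : 0 <= d * (C + 1) by rewrite mulr_ge0 ?addr_ge0// ltW.
by move: e1 e2 e3 e4 f1 f2 dC; clear; lra.
Qed.

End YoungEstimates.

(** * Field and kernels on large circles *)

Section FarField.
Variables (R : realType) (k : R).
Hypothesis k_gt0 : 0 < k.
Local Notation tau := (tau k).
Local Notation rad := (@rad R).
Local Notation ang := (@ang R).
Local Notation kjet := (kjet k).
Local Notation solves := (solves k).
Implicit Types (r t s : R) (x y : R * R) (u w a b : jet R).

Definition val u r t := j0 u (pol r t).
Definition dr u r t := j1 u (pol r t) * cos t + j2 u (pol r t) * sin t.

Lemma radE u w r t : rad u w r t = r * (val u r t * dr w r t - val w r t * dr u r t).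
Proof. by rewrite /rad /radial /vf1 /vf2 /val /dr; ring. Qed.

Lemma dr_kjet g r t r0 t0 : dr (kjet g (pol r0 t0)) r t =
  - (k ^+ 2 / 2) * (g 1%N (tau (pol r t - pol r0 t0)) * (r - r0 * cos (t - t0))).
Proof.
rewrite /dr /=; set G := g 1%N _; rewrite cosB; move: (cos2Dsin2 t).
move: (cos t) (sin t) (cos t0) (sin t0) => C S C0 S0 e.
transitivity (- (k ^+ 2 / 2) * (G * (r * (C ^+ 2 + S ^+ 2) - r0 * (C * C0 + S * S0)))); first by ring.
by rewrite e mulr1.
Qed.

(** The kernels are radial about the pole whereas [dr] is radial about the origin. The cosine [ca]
    of the angle between the two directions satisfies 1 - ca = O(1/s^2), so the estimates of H_0
    survive the change of direction. *)
Lemma kernel_far r0 t0 : 0 < r0 -> let J := kjet (@bj R) (pol r0 t0) in let Y := kjet (@by_ R) (pol r0 t0) in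
  exists C A, [/\ 0 < C, 0 < A & forall r t, A < r ->
    [/\ r * (val J r t ^+ 2 + val Y r t ^+ 2) <= C, `|dr J r t + k * val Y r t| <= C / r &
        `|dr Y r t - k * val J r t| <= C / r]].
Proof.
move=> r00 J Y; have [C1 C10 hC1] := hankel0_outgoing R; have [C2 C20 hC2] := hankel0_decay R.
pose B := k * C1 + k * (k ^+ 2 * r0 ^+ 2) * (C2 + 1).
have B0 : 0 < B by rewrite /B addr_gt0 ?mulr_gt0 ?exprn_gt0// addr_gt0.
pose A := 2 * r0 + 2 / k.
have A0 : 0 < A by rewrite /A addr_gt0 ?mulr_gt0 ?invr_gt0.
exists (2 / k * (C2 + B)), A; split => //; first by apply: mulr_gt0; [rewrite divr_gt0|rewrite addr_gt0].
move=> r t Ar.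
have k2 : 0 < 2 / k by rewrite divr_gt0.
have rr0 : r / 2 <= r - r0 by move: Ar k2; rewrite /A; lra.
have r0r : r0 < r by move: Ar k2 r00; rewrite /A; lra.
have rp : 0 < r by exact: lt_trans r0r.
have kr1 : 1 <= k * (r / 2).
  have : 2 / k <= r by move: Ar r00; rewrite /A; lra.
  by rewrite ler_pdivrMr// => h; move: h; lra.
set C := cos (t - t0).
have c1 : `|C| <= 1 by exact: cos_max.
have /andP[cl cr] : -1 <= C <= 1 by rewrite -ler_norml.
pose q := r ^+ 2 + r0 ^+ 2 - 2 * (r * r0 * C).
have TE : tau (pol r t - pol r0 t0) = (k / 2) ^+ 2 * q by rewrite tau_pol.
have q1 : (r - r0) ^+ 2 <= q.
  have : 0 <= r * r0 * (1 - C) by rewrite mulr_ge0 ?mulr_ge0 ?(ltW rp) ?(ltW r00)// subr_ge0.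
  by rewrite /q; nra.
have q0 : 0 <= q by apply: le_trans q1; exact: sqr_ge0.
pose s := k * Num.sqrt q.
have sr : k * (r - r0) <= s.
  rewrite /s ler_wpM2l ?(ltW k_gt0)// -(ger0_norm (_ : 0 <= r - r0)) ?subr_ge0 ?(ltW r0r)//.
  by rewrite -sqrtr_sqr ler_wsqrtr.
have sr2 : k * (r / 2) <= s by apply: le_trans sr; rewrite ler_wpM2l// ltW.
have s1 : 1 <= s by exact: le_trans sr2.
have s0 : 0 < s by exact: lt_le_trans s1.
have sT : (s / 2) ^+ 2 = tau (pol r t - pol r0 t0).
  rewrite TE /s (_ : k * Num.sqrt q / 2 = k / 2 * Num.sqrt q); last by ring.
  by rewrite exprMn sqr_sqrtr.
have sq : s ^+ 2 = k ^+ 2 * q by rewrite /s exprMn sqr_sqrtr.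
pose ca := k * (r - r0 * C) / s.
have n0 : 0 <= r - r0 * C.
  have : r0 * C <= r0 * 1 by rewrite ler_wpM2l// ltW.
  by move: r0r; lra.
have ca0 : 0 <= ca by rewrite /ca divr_ge0 ?mulr_ge0// ltW.
have ca2 : 1 - ca ^+ 2 = k ^+ 2 * r0 ^+ 2 * (1 - C ^+ 2) / s ^+ 2.
  rewrite /ca expr_div_n exprMn -[X in X - _](divff (x := s ^+ 2)) ?expf_neq0 ?gt_eqF//.
  by rewrite -mulrBl; congr (_ / _); rewrite sq /q; ring.
have C21 : 0 <= 1 - C ^+ 2.
  by rewrite subr_ge0 -real_normK ?num_real// expr_le1.
have ca1 : ca <= 1.
  rewrite -(@ler_pXn2r _ 2) ?nnegrE// expr1n -subr_ge0 ca2 divr_ge0 ?sqr_ge0// mulr_ge0//.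
  by rewrite mulr_ge0 ?sqr_ge0.
have kr : 0 <= k ^+ 2 * r0 ^+ 2 by exact: mulr_ge0 (sqr_ge0 _) (sqr_ge0 _).
have ca3 : 1 - ca <= k ^+ 2 * r0 ^+ 2 / s ^+ 2.
  apply: (@le_trans _ _ (1 - ca ^+ 2)); first by rewrite lerD2l lerN2 expr2 ler_piMr.
  have C22 : 1 - C ^+ 2 <= 1 by rewrite lerBlDr lerDl sqr_ge0.
  by rewrite ca2 ler_wpM2r ?invr_ge0 ?sqr_ge0// ler_piMr.
have zE g : val (kjet g (pol r0 t0)) r t = cylZ g s by rewrite /val /= /cylZ sT.
have dE g : dr (kjet g (pol r0 t0)) r t = k * ca * (cylW g s / s).
  rewrite dr_kjet -/C -sT /cylW /ca; field; exact: lt0r_neq0.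
have [D1 D2] := hC1 s s0; have D3 := hC2 s s1.
have si : s^-1 <= 2 / k / r.
  rewrite -[X in _ <= X]invrK lef_pV2 ?posrE ?invr_gt0 ?divr_gt0//.
  have -> : (2 / k / r)^-1 = k * (r / 2) by field; rewrite !gt_eqF.
  exact: sr2.
have si1 : s^-1 <= 1 by rewrite invf_le1.
have sip : 0 <= s^-1 by rewrite invr_ge0 ltW.
have sq1 (z : R) : z ^+ 2 <= C2 -> `|z| <= C2 + 1.
  move=> hz; rewrite -(@ler_pXn2r _ 2)// ?nnegrE ?addr_ge0 ?(ltW C20)//.
  by rewrite real_normK ?num_real//; nra.
have C2s : C2 / s <= C2 by rewrite ler_piMr// ltW.
have bJ : `|cylZ (@bj R) s| <= C2 + 1 by apply: sq1; move: D3 C2s (sqr_ge0 (cylZ (@by_ R) s)); clear; lra.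
have bY : `|cylZ (@by_ R) s| <= C2 + 1 by apply: sq1; move: D3 C2s (sqr_ge0 (cylZ (@bj R) s)); clear; lra.
have key (p z : R) : `|p| <= C1 / s -> `|z| <= C2 + 1 -> `|k * ca * p + k * (1 - ca) * z| <= 2 / k * (C2 + B) / r.
  move=> hp hz; apply: (@le_trans _ _ (B / s)); last first.
    rewrite [leRHS]mulrAC; apply: (@le_trans _ _ (B * (2 / k / r))); first by rewrite ler_wpM2l// ltW.
    by rewrite mulrC ler_wpM2l ?lerDr ?(ltW C20)// divr_ge0 ?ltW.
  apply: le_trans (ler_normD _ _) _; have n1 : `|k * ca * p| = k * ca * `|p| by rewrite normrM ger0_norm// mulr_ge0// ltW.
  have n2 : `|k * (1 - ca) * z| = k * (1 - ca) * `|z| by rewrite normrM ger0_norm// mulr_ge0 ?subr_ge0// ltW.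
  rewrite n1 n2.
  rewrite /B mulrDl; apply: lerD.
    have h1 : ca * `|p| <= 1 * `|p| by rewrite ler_wpM2r.
    rewrite -[k * ca * _]mulrA -[k * C1 / s]mulrA ler_wpM2l ?(ltW k_gt0)//.
    by apply: le_trans h1 _; rewrite mul1r.
  have h1 : 1 - ca <= k ^+ 2 * r0 ^+ 2 * s^-1.
    apply: le_trans ca3 _; apply: (ler_wpM2l kr); have -> : s ^- 2 = s^-1 * s^-1 by rewrite expr2 invfM.
    by rewrite ler_piMr.
  have -> : k * (k ^+ 2 * r0 ^+ 2) * (C2 + 1) / s = k * (k ^+ 2 * r0 ^+ 2 * s^-1) * (C2 + 1) by ring.
  apply: ler_pM => //; first by rewrite mulr_ge0 ?subr_ge0// ltW.
  by rewrite ler_wpM2l// ltW.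
split.
- rewrite !zE; apply: (@le_trans _ _ (r * (C2 / s))); first by rewrite ler_wpM2l// ltW.
  apply: (@le_trans _ _ (r * (C2 * (2 / k / r)))); first by rewrite !ler_wpM2l ?(ltW rp) ?(ltW C20).
  have -> : r * (C2 * (2 / k / r)) = 2 / k * C2 by field; rewrite !gt_eqF.
  by rewrite ler_wpM2l ?(ltW k2)// lerDl ltW.
- rewrite zE dE; have -> : k * ca * (cylW (@bj R) s / s) + k * cylZ (@by_ R) s =
    k * ca * (cylW (@bj R) s / s + cylZ (@by_ R) s) + k * (1 - ca) * cylZ (@by_ R) s by ring.
  exact: key.
- rewrite zE dE; have -> : k * ca * (cylW (@by_ R) s / s) - k * cylZ (@bj R) s =
    k * ca * (cylW (@by_ R) s / s - cylZ (@bj R) s) + k * (1 - ca) * - cylZ (@bj R) s by ring.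
  by apply: key; rewrite ?normrN.
Qed.

Variables (a b : jet R) (R0 : R).
Hypothesis R0_gt0 : 0 < R0.
Hypothesis sol_a : forall r t, R0 <= r -> solves a (pol r t).
Hypothesis sol_b : forall r t, R0 <= r -> solves b (pol r t).
Hypothesis radiating : forall e, 0 < e -> exists A, forall r t, A < r ->
  r * ((dr a r t + k * val b r t) ^+ 2 + (dr b r t - k * val a r t) ^+ 2) <= e.

Let twopi_ge0 : 0 <= 2 * pi :> R. Proof. by rewrite mulr_ge0// pi_ge0. Qed.

Lemma rad_within u w r : (forall t, solves u (pol r t)) -> (forall t, solves w (pol r t)) ->
  {within `[0, 2 * pi], continuous (rad u w r)}.
Proof.
move=> hu hw; apply: within_cont => t _.
have [_ [h _ _]] := jet_conserved (hu t) (hw t); exact: cont_slice2 h.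
Qed.

Lemma val_within u r : (forall t, solves u (pol r t)) -> {within `[0, 2 * pi], continuous (val u r)}.
Proof.
move=> hu; apply: within_cont => t _; have [_ [h _ _] _] := hu t.
exact: (@cont_slice2 _ (fun z => j0 u (pol z.1 z.2)) r t (comp_pol_continuous h)).
Qed.

(** The flux of [a] against [b] is the same through all large circles. Completing squares with the
    radiation condition bounds k r (a^2 + b^2) / 2 pointwise by the density of this flux plus a
    constant. *)
Lemma farfield_bound : exists2 M, 0 < M & exists A, forall r, A < r ->
  r * Int 0 (2 * pi) (fun t => val a r t ^+ 2 + val b r t ^+ 2) <= M.
Proof.
have [A hA] := radiating ltr01.
pose c0 := Int 0 (2 * pi) (rad a b R0).
pose M := `|2 / k * (c0 + 1 / (2 * k) * (2 * pi))| + 1.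
exists M; first by rewrite ltr_wpDl.
exists (Num.max A R0) => r; rewrite gt_max => /andP[Ar R0r].
have rp : 0 < r by exact: lt_trans R0r.
have sa t : solves a (pol r t) by apply: sol_a; exact: ltW.
have sb t : solves b (pol r t) by apply: sol_b; exact: ltW.
have cE : c0 = Int 0 (2 * pi) (rad a b r).
  have := @rflux_zero _ (rad a b) (ang a b) (raddiv a b) R0 r 0 (2 * pi) (ltW R0r) twopi_ge0.
  have pi2 s : pol s (2 * pi) = pol s 0 :> R * R by rewrite /pol mulr_natl cos2pi sin2pi cos0 sin0.
  have -> : rflux (rad a b) (ang a b) R0 r 0 (2 * pi) = Int 0 (2 * pi) (rad a b r) - c0.
    rewrite /rflux; have -> : (ang a b)^~ (2 * pi) = (ang a b)^~ 0.
      by apply/funext => s; rewrite /ang /angular pi2 mulr_natl cos2pi sin2pi cos0 sin0.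
    by rewrite subrr addr0.
  have h s t : R0 <= s <= r -> 0 <= t <= 2 * pi -> conserved (rad a b) (ang a b) (raddiv a b) s t.
    by move=> /andP[hs _] _; apply: (jet_conserved (k := k)); [exact: sol_a|exact: sol_b].
  by move=> /(_ h)/eqP; rewrite subr_eq0 eq_sym => /eqP.
have ca := val_within sa; have cb := val_within sb.
have cab : {within `[0, 2 * pi], continuous (fun t => val a r t ^+ 2 + val b r t ^+ 2)}.
  by move=> t; apply: cvgD; [apply: cvgM; exact: ca|apply: cvgM; exact: cb].
have pt t : 0 <= t <= 2 * pi -> k / 2 * r * (val a r t ^+ 2 + val b r t ^+ 2) <= rad a b r t + 1 / (2 * k).
  move=> _; rewrite radE; have := hA r t Ar.
  set va := val a r t; set vb := val b r t; set da := dr a r t; set db := dr b r t => h.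
  have -> : da = (da + k * vb) - k * vb by ring. have -> : db = (db - k * va) + k * va by ring.
  move: h; set al := da + k * vb; set be := db - k * va => h.
  have k2 : 0 < 2 * k by rewrite mulr_gt0.
  have -> : 1 / (2 * k) = (2 * k)^-1 * 1 by rewrite mulrC.
  have h' : (2 * k)^-1 * (r * (al ^+ 2 + be ^+ 2)) <= (2 * k)^-1 * 1 by rewrite ler_wpM2l// invr_ge0 ltW.
  rewrite -lerBlDl; apply: le_trans h'; rewrite -subr_ge0.
  have -> : (2 * k)^-1 * (r * (al ^+ 2 + be ^+ 2)) - (k / 2 * r * (va ^+ 2 + vb ^+ 2) - r * (va * (be + k * va) - vb * (al - k * vb)))
     = r * (2 * k)^-1 * ((k * va + be) ^+ 2 + (k * vb - al) ^+ 2) by field; rewrite gt_eqF.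
  by rewrite mulr_ge0 ?addr_ge0 ?sqr_ge0// mulr_ge0 ?invr_ge0// ltW.
have cr := rad_within sa sb.
have : Int 0 (2 * pi) (fun t => k / 2 * r * (val a r t ^+ 2 + val b r t ^+ 2)) <=
    Int 0 (2 * pi) (fun t => rad a b r t + 1 / (2 * k)).
  apply: le_Int => //.
    by move=> t; apply: cvgM; [exact: cvg_cst|exact: cab].
  by move=> t; apply: cvgD; [exact: cr|exact: cvg_cst].
rewrite (IntZ _ cab) (IntD cr (@cst_within _ _ _ _)) Int_cst// subr0 -cE => h.
have k2 : 0 < 2 / k by rewrite divr_gt0.
have := ler_wpM2l (ltW k2) h.
have -> : forall I, 2 / k * (k / 2 * r * I) = r * I by move=> I; field; rewrite gt_eqF.
by move=> h2; apply: le_trans h2 _; apply: le_trans (ler_norm _) _; rewrite /M lerDl.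
Qed.

(** These are the real and imaginary parts of the flux of a + i b against the outgoing kernel. Each
    term of the density contains a defect in the radiation condition: that of the kernel multiplies
    a field bounded in mean square, that of the field multiplies a kernel of size r^(-1/2). *)
Lemma farfield_vanish r0 t0 : 0 < r0 -> let J := kjet (@bj R) (pol r0 t0) in let Y := kjet (@by_ R) (pol r0 t0) in
  forall e, 0 < e -> exists A, forall r, A < r ->
  `|Int 0 (2 * pi) (rad a J r) - Int 0 (2 * pi) (rad b Y r)| <= e /\
  `|Int 0 (2 * pi) (rad a Y r) + Int 0 (2 * pi) (rad b J r)| <= e.
Proof.
move=> r00 J Y e e0.
have [C [A1 [C0 A10 hK]]] := kernel_far t0 r00.
have [M M0 [A2 hM]] := farfield_bound.
(* [d] makes the part with the defect of the field integrate to e / 4; the condition r > L^2 below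
   makes the other part at most e / 2. *)
pose d := e / (8 * (C + 1) * (2 * pi)).
have pp : 0 < 2 * pi :> R by rewrite mulr_gt0// pi_gt0.
have C10 : 0 < C + 1 by rewrite addr_gt0.
have d0 : 0 < d.
  by rewrite /d divr_gt0//; apply: mulr_gt0 => //; apply: mulr_gt0.
have [A3 hA3] := radiating (exprn_gt0 2 d0).
pose L := C * (M + 4 * pi) / e.
have L0 : 0 < L by rewrite /L divr_gt0// mulr_gt0// addr_gt0// mulr_gt0// pi_gt0.
exists (Num.max (Num.max A1 A2) (Num.max (Num.max A3 (L ^+ 2)) (Num.max R0 r0))) => r.
rewrite !gt_max => /andP[/andP[rA1 rA2] /andP[/andP[rA3 rL] /andP[rR0 rr0]]].
have rp : 0 < r by exact: lt_trans rr0.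
have sa t : solves a (pol r t) by apply: sol_a; exact: ltW.
have sb t : solves b (pol r t) by apply: sol_b; exact: ltW.
have ne t : pol r t != pol r0 t0.
  apply/eqP => E; have : tau (pol r t - pol r0 t0) = 0 by rewrite E subrr /tau /= expr0n /= addr0 mulr0.
  have kn : (k / 2) ^+ 2 != 0 by rewrite expf_neq0// gt_eqF// divr_gt0.
  move/eqP; rewrite tau_pol mulf_eq0 (negbTE kn) /= => /eqP T0.
  have C1 : cos (t - t0) <= 1 by have := cos_max (t - t0); rewrite ler_norml => /andP[].
  have h2 : 0 <= r * r0 * (1 - cos (t - t0)) by rewrite mulr_ge0 ?mulr_ge0 ?(ltW rp) ?(ltW r00)// subr_ge0.
  have h1 : 0 < (r - r0) ^+ 2 by rewrite exprn_gt0// subr_gt0.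
  by move: T0 h1 h2; nra.
have sJ t : solves J (pol r t) by exact: (kjet_solves k_gt0 (@cyl_bj R) (ne t)).
have sY t : solves Y (pol r t) by exact: (kjet_solves k_gt0 (@cyl_by R) (ne t)).
have caJ := rad_within sa sJ; have caY := rad_within sa sY.
have cbJ := rad_within sb sJ; have cbY := rad_within sb sY.
have ca := val_within sa; have cb := val_within sb.
have cab : {within `[0, 2 * pi], continuous (fun t => val a r t ^+ 2 + val b r t ^+ 2)}.
  by move=> t; apply: cvgD; [apply: cvgM; exact: ca|apply: cvgM; exact: cb].
pose w := Num.sqrt r; have w0 : 0 < w by rewrite sqrtr_gt0.
have wr : w ^+ 2 = r by rewrite sqr_sqrtr// ltW.
have Lw : L < w.
  by rewrite -(@ltr_pXn2r _ 2) ?nnegrE ?(ltW L0) ?(ltW w0)// wr.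
pose G t := C / 2 * (w * (val a r t ^+ 2 + val b r t ^+ 2) + 2 / w) + d * (2 * (C + 1)).
have cG : {within `[0, 2 * pi], continuous G}.
  move=> t; apply: cvgD; last exact: cvg_cst.
  apply: cvgM; first exact: cvg_cst.
  by apply: cvgD; [apply: cvgM; [exact: cvg_cst|exact: cab]|exact: cvg_cst].
have IG : Int 0 (2 * pi) G <= e.
  have cw : {within `[0, 2 * pi], continuous (fun t => w * (val a r t ^+ 2 + val b r t ^+ 2))}.
    by move=> t; apply: cvgM; [exact: cvg_cst|exact: cab].
  have cw2 : {within `[0, 2 * pi], continuous (fun t => w * (val a r t ^+ 2 + val b r t ^+ 2) + 2 / w)}.
    by move=> t; apply: cvgD; [exact: cw|exact: cvg_cst].
  have cw3 : {within `[0, 2 * pi], continuous (fun t => C / 2 * (w * (val a r t ^+ 2 + val b r t ^+ 2) + 2 / w))}.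
    by move=> t; apply: cvgM; [exact: cvg_cst|exact: cw2].
  rewrite /G (IntD cw3 (@cst_within _ _ _ _)) (IntZ _ cw2) (IntD cw (@cst_within _ _ _ _)) (IntZ _ cab) !Int_cst//.
  rewrite !subr0; have := hM r rA2; set I := Int _ _ _ => hI.
  have -> : d * (2 * (C + 1)) * (2 * pi) = e / 4.
    rewrite /d; have Cn := lt0r_neq0 C10; have Pn := lt0r_neq0 pp; move: Cn Pn.
    by move: (C + 1) (2 * pi) => X Z Xn Zn; field; rewrite Xn Zn.
  have h1 : C / 2 * (w * I + 2 / w * (2 * pi)) <= e / 2.
    rewrite -(ler_pM2l w0) mulrCA.
    have -> : w * (w * I + 2 / w * (2 * pi)) = r * I + 4 * pi by rewrite -wr; field; rewrite gt_eqF.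
    apply: (@le_trans _ _ (C / 2 * (M + 4 * pi))).
      by rewrite ler_wpM2l ?divr_ge0 ?(ltW C0)// lerD2r.
    have -> : C / 2 * (M + 4 * pi) = L * (e / 2) by rewrite /L; field; rewrite gt_eqF.
    by rewrite ler_wpM2r ?divr_ge0 ?(ltW e0)// ltW.
  by move: h1 e0; lra.
have est t (x1 x2 y1 y2 p q al be : R) :
    r * (x1 ^+ 2 + x2 ^+ 2) = r * (val a r t ^+ 2 + val b r t ^+ 2) ->
    r * (y1 ^+ 2 + y2 ^+ 2) <= C -> `|p| <= C / r -> `|q| <= C / r -> r * (al ^+ 2 + be ^+ 2) <= d ^+ 2 ->
    `|r * (x1 * p + x2 * q + y1 * al + y2 * be)| <= G t.
  move=> hx hy hp hq hab.
  have {}hx : x1 ^+ 2 + x2 ^+ 2 = val a r t ^+ 2 + val b r t ^+ 2 by apply: (mulfI (lt0r_neq0 rp)).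
  by rewrite /G -hx; exact: energy_estimate.
have fin (f : R -> R) : {within `[0, 2 * pi], continuous f} -> (forall t, `|f t| <= G t) -> `|Int 0 (2 * pi) f| <= e.
  move=> cf hf; apply: le_trans IG; rewrite ler_norml; apply/andP; split.
    have -> : - Int 0 (2 * pi) G = Int 0 (2 * pi) (fun t => -1 * G t) by rewrite IntZ// mulN1r.
    apply: le_Int => //; first by move=> t; apply: cvgM; [exact: cvg_cst|exact: cG].
    by move=> t _; have := hf t; rewrite mulN1r ler_norml => /andP[].
  by apply: le_Int => // t _; have := hf t; rewrite ler_norml => /andP[].
split.
  rewrite -IntB//; apply: fin.
    by move=> t; apply: cvgB; [exact: caJ|exact: cbY].
  move=> t; rewrite !radE; have [k1 k2 k3] := hK r t rA1; have k4 := hA3 r t rA3.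
  set p := dr J r t + _ in k2; set q := dr Y r t - _ in k3.
  set al := dr a r t + _ in k4; set be := dr b r t - _ in k4.
  (* Once the derivatives are expressed by the defects, all products without a defect cancel. *)
  have -> : r * (val a r t * dr J r t - val J r t * dr a r t) - r * (val b r t * dr Y r t - val Y r t * dr b r t) =
    r * (val a r t * p + - val b r t * q + - val J r t * al + val Y r t * be) by rewrite /p /q /al /be; ring.
  by apply: est; rewrite ?sqrrN.
rewrite -IntD//; apply: fin.
  by move=> t; apply: cvgD; [exact: caY|exact: cbJ].
move=> t; rewrite !radE; have [k1 k2 k3] := hK r t rA1; have k4 := hA3 r t rA3.
set p := dr J r t + _ in k2; set q := dr Y r t - _ in k3.
set al := dr a r t + _ in k4; set be := dr b r t - _ in k4.
have -> : r * (val a r t * dr Y r t - val Y r t * dr a r t) + r * (val b r t * dr J r t - val J r t * dr b r t) =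
  r * (val b r t * p + val a r t * q + - val Y r t * al + - val J r t * be) by rewrite /p /q /al /be; ring.
by apply: est; rewrite ?sqrrN// [X in r * X]addrC.
Qed.

End FarField.

(** * Integrals of multipoles along curves *)

Section EdgeIntegrals.
Variables (R : realType) (k : R).
Hypothesis k_gt0 : 0 < k.
Local Notation C := R[i].
Local Notation multipole := (multipole k).
Local Notation tau := (tau k).
Implicit Types (f g c : R -> C) (p q s t d e : R) (x y z v : R * R) (n : int) (F : set (R * R)).

Definition IntC p q f : C := (Int p q (fun s => complex.Re (f s)) +i* Int p q (fun s => complex.Im (f s)))%C.

Definition contC f s := {for s, continuous (fun s => complex.Re (f s))} /\ {for s, continuous (fun s => complex.Im (f s))}.

Lemma contCP f s : (forall e, 0 < e -> exists2 d, 0 < d & forall s', `|s' - s| < d -> normc (f s' - f s) <= e) -> contC f s.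
Proof.
move=> h; split; apply/cvgrPdist_le => e e0; have [d d0 hd] := h e e0; apply/nbhs_ballP.
  exists d; first exact: d0.
  move=> s' /=; rewrite distrC => /hd {}hd; rewrite distrC; apply: le_trans hd.
  have -> : complex.Re (f s') - complex.Re (f s) = complex.Re (f s' - f s) by case: (f s') (f s) => ? ? [].
  exact: Re_le_normc.
exists d; first exact: d0.
move=> s' /=; rewrite distrC => /hd {}hd; rewrite distrC; apply: le_trans hd.
have -> : complex.Im (f s') - complex.Im (f s) = complex.Im (f s' - f s) by case: (f s') (f s) => ? ? [].
exact: Im_le_normc.
Qed.

Lemma contC_dist f s e : contC f s -> 0 < e -> exists2 d, 0 < d & forall s', `|s' - s| < d -> normc (f s' - f s) <= e.
Proof.
move=> [h1 h2] e0; have e2 : 0 < e / 2 by rewrite divr_gt0.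
move: h1 h2 => /cvgrPdist_le /(_ _ e2)/nbhs_ballP[d1 /= d10 h1] /cvgrPdist_le /(_ _ e2)/nbhs_ballP[d2 /= d20 h2].
exists (Num.min d1 d2); first by rewrite lt_min d10.
move=> s'; rewrite lt_min => /andP[b1 b2]; apply: le_trans (normc_le_ReIm _) _.
rewrite [e]splitr; apply: lerD.
  have := h1 s'; rewrite -ball_normE /= distrC => /(_ b1); rewrite distrC.
  by case: (f s') (f s) => ? ? [].
have := h2 s'; rewrite -ball_normE /= distrC => /(_ b2); rewrite distrC.
by case: (f s') (f s) => ? ? [].
Qed.

Lemma contCD f g s : contC f s -> contC g s -> contC (fun s => f s + g s) s.
Proof.
move=> [h1 h2] [h3 h4]; split.
  have -> : (fun s => complex.Re (f s + g s)) = (fun s => complex.Re (f s) + complex.Re (g s)).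
    by apply/funext => u; case: (f u) (g u) => ? ? [].
  exact: cvgD.
have -> : (fun s => complex.Im (f s + g s)) = (fun s => complex.Im (f s) + complex.Im (g s)).
  by apply/funext => u; case: (f u) (g u) => ? ? [].
exact: cvgD.
Qed.

Lemma contCN f s : contC f s -> contC (fun s => - f s) s.
Proof.
move=> [h1 h2]; split.
  have -> : (fun s => complex.Re (- f s)) = (fun s => - complex.Re (f s)).
    by apply/funext => u; case: (f u).
  exact: cvgN.
have -> : (fun s => complex.Im (- f s)) = (fun s => - complex.Im (f s)).
  by apply/funext => u; case: (f u).
exact: cvgN.
Qed.

Lemma contC_within f p q : (forall s, p <= s <= q -> contC f s) ->
  {within `[p, q], continuous (fun s => complex.Re (f s))} /\ {within `[p, q], continuous (fun s => complex.Im (f s))}.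
Proof. by move=> h; split; apply: within_cont => s /h[]. Qed.

Lemma IntCD p q f g : (forall s, p <= s <= q -> contC f s) -> (forall s, p <= s <= q -> contC g s) ->
  IntC p q (fun s => f s + g s) = IntC p q f + IntC p q g.
Proof.
move=> /contC_within[h1 h2] /contC_within[h3 h4]; rewrite /IntC.
apply/eqP; rewrite eq_complex /= -IntD// -IntD//; apply/andP; split; apply/eqP; apply: eq_Int => s _.
  by case: (f s) (g s) => ? ? [].
by case: (f s) (g s) => ? ? [].
Qed.

Lemma IntC_split p t q f : p <= t -> t <= q -> (forall s, p <= s <= q -> contC f s) ->
  IntC p q f = IntC p t f + IntC t q f.
Proof.
move=> pt tq /contC_within[h1 h2]; rewrite /IntC (Int_split pt tq h1) (Int_split pt tq h2).
by [].
Qed.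

Lemma IntC_bound p q f (M : R) : p <= q -> (forall s, p <= s <= q -> contC f s) ->
  (forall s, p <= s <= q -> normc (f s) <= M) -> normc (IntC p q f) <= 2 * M * (q - p).
Proof.
move=> pq /contC_within[h1 h2] hM; apply: le_trans (normc_le_ReIm _) _.
have -> : 2 * M * (q - p) = M * (q - p) + M * (q - p) by ring.
apply: lerD; rewrite /IntC /=; apply: Int_bound => // s hs.
  exact: le_trans (Re_le_normc _) (hM s hs).
exact: le_trans (Im_le_normc _) (hM s hs).
Qed.

Lemma contC_cst (w0 : C) s : contC (fun=> w0) s.
Proof. by split; exact: cvg_cst. Qed.

Lemma IntC_cst p q (z0 : C) : p <= q -> IntC p q (fun=> z0) = (q - p)%:C%C * z0.
Proof.
move=> pq; rewrite /IntC !Int_cst//; case: z0 => u w /=.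
by apply/eqP; rewrite eq_complex /= !mul0r subr0 addr0 !(mulrC (q - p)) !eqxx.
Qed.

(** These are orders 0 and 1 of [taylor_coef_bound], valid along the whole segment, which stays at
    distance d / 2 from the pole. *)
Lemma multipole_near n d : 0 < d -> exists2 K, 0 < K & forall z v, d <= `|z| -> `|v| <= d / 2 ->
  [/\ normc (multipole n z) <= K, normc (multipole n (z + v)) <= K &
      normc (multipole n (z + v) - multipole n z) <= K * `|v|].
Proof.
move=> d0; have t0 : 0 < (k / 2) ^+ 2 * (d / 2) ^+ 2 by rewrite mulr_gt0 ?exprn_gt0 ?divr_gt0.
have [M [B [M0 B1 hM]]] := taylor_coef_bound k_gt0 t0.
have B0 : 0 < B by exact: lt_le_trans B1.
pose m := absz n; pose K0 := M * (m`!%:R * B ^+ m); pose K1 := M * ((m + 1)`!%:R * B ^+ (m + 1)).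
have K00 : 0 < K0 by rewrite /K0 !mulr_gt0 ?ltr0n ?fact_gt0// exprn_gt0.
have K10 : 0 < K1 by rewrite /K1 !mulr_gt0 ?ltr0n ?fact_gt0// exprn_gt0.
exists (K0 + 4 * k * K1).
  by apply: addr_gt0 => //; apply: mulr_gt0 => //; apply: mulr_gt0.
move=> z v hz hv.
have far t : 0 <= t <= 1 -> (k / 2) ^+ 2 * (d / 2) ^+ 2 <= tau (z + t *: v).
  move=> /andP[h0 h1]; apply: le_trans (tau_ge _ _); rewrite ler_wpM2l ?sqr_ge0// lerXn2r ?nnegrE ?divr_ge0 ?(ltW d0)//.
  have := ler_normB (z + t *: v) (t *: v); rewrite addrK normrZ (ger0_norm h0).
  have : t * `|v| <= 1 * (d / 2) by apply: ler_pM.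
  lra.
have b0 w : (k / 2) ^+ 2 * (d / 2) ^+ 2 <= tau w -> normc (multipole n w) <= K0 + 4 * k * K1.
  move=> hw; have := hM 0 0%N n w hw; rewrite expr0 mul1r addn0 /= -/K0 => h; apply: le_trans h _.
  by rewrite lerDl mulr_ge0 ?(ltW K10)// mulr_ge0// ltW.
split.
- by apply: b0; have := far 0; rewrite scale0r addr0; apply; rewrite lexx ler01.
- by apply: b0; have := far 1; rewrite scale1r; apply; rewrite lexx ler01.
- have der t : 0 <= t <= 1 -> is_derC (fun t => multipole n (z + t *: v)) t (taylor_coef k v 1 n (z + t *: v)).
    move=> ht; apply: (@is_derC_taylor R k v 0 n z t); exact: lt_le_trans (far t ht).
  have bd t : 0 <= t <= 1 -> normc (taylor_coef k v 1 n (z + t *: v)) <= 2 * (k * `|v|) * K1.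
    move=> ht; apply: le_trans (hM v 1%N n _ (far t ht)) _; rewrite expr1 -/K1 ler_wpM2r ?(ltW K10)//.
    by rewrite ler_wpM2l// normc_cpt_le.
  have := mvt_normc ler01 der bd; rewrite scale1r scale0r addr0 subr0 mulr1 => h; apply: le_trans h _.
  have -> : 2 * (2 * (k * `|v|) * K1) = 4 * k * K1 * `|v| by ring.
  by rewrite ler_wpM2r// lerDr ltW.
Qed.

Lemma curve_dist (yy : R -> R * R) p q x : p <= q -> (forall s, p <= s <= q -> {for s, continuous yy}) ->
  (forall s, p <= s <= q -> x != yy s) -> exists2 m : R, 0 < m & forall s, p <= s <= q -> m <= `|x - yy s|.
Proof.
move=> pq cyy ne.
have cn : {within `[p, q], continuous (fun s => `|x - yy s|)}.
  apply: within_cont => s hs; apply: (@cvg_norm _ _ _ (nbhs s)); apply: cvgB; first exact: cvg_cst.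
  exact: cyy.
have [s0 hs0 hmin] := EVT_min pq cn; exists `|x - yy s0|.
  by rewrite normr_gt0 subr_eq0; apply: ne; move: hs0; rewrite in_itv.
by move=> s hs; apply: hmin; rewrite in_itv.
Qed.

Section Term.
Variables (yy : R -> R * R) (c : R -> C) (n : int).

Definition term x s := c s * multipole n (x - yy s).

(** The radius [r] does not depend on [x]; this is what makes Riemann sums converge uniformly
    outside [S]. *)
Lemma term_equi s d : 0 < d -> {for s, continuous yy} -> contC c s -> forall e, 0 < e ->
  exists2 r, 0 < r & forall s', `|s' - s| < r -> forall x, d <= `|x - yy s| -> normc (term x s' - term x s) <= e.
Proof.
move=> d0 cy cc e e0; have [K K0 hK] := multipole_near n d0.
have [|d1 d10 h1] := contC_dist cc (e := e / (2 * K)); first by rewrite divr_gt0// mulr_gt0.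
pose m := normc (c s) + 1; have m0 : 0 < m by rewrite ltr_wpDl ?normc_ge0.
pose r0 := Num.min (d / 2) (e / (2 * K * m)).
have r00 : 0 < r0 by rewrite lt_min !divr_gt0// !mulr_gt0.
have /cvgrPdist_le /(_ _ r00)/nbhs_ballP[d2 /= d20 h2] := cy.
exists (Num.min d1 d2); first by rewrite lt_min d10.
move=> s'; rewrite lt_min => /andP[b1 b2] x hx.
have hv : `|yy s - yy s'| <= r0 by have := h2 s'; rewrite -ball_normE /= distrC; apply.
have hv2 : `|yy s - yy s'| <= d / 2 by apply: le_trans hv _; rewrite ge_min lexx.
have := hK _ _ hx hv2; rewrite addrA subrK => -[k1 k2 k3].
have -> : term x s' - term x s = (c s' - c s) * multipole n (x - yy s') + c s * (multipole n (x - yy s') - multipole n (x - yy s)).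
  by rewrite /term mulrBl mulrBr addrA subrK.
apply: le_trans (le_normcD _ _) _; rewrite !normcM.
have g1 : normc (c s' - c s) * normc (multipole n (x - yy s')) <= e / (2 * K) * K.
  by apply: ler_pM => //; rewrite ?normc_ge0// h1.
have g2 : normc (c s) * normc (multipole n (x - yy s') - multipole n (x - yy s)) <= m * (K * (e / (2 * K * m))).
  apply: ler_pM => //; rewrite ?normc_ge0//; first by rewrite lerDl.
  apply: le_trans k3 _; rewrite ler_wpM2l ?(ltW K0)//; apply: le_trans hv _.
  by rewrite ge_min lexx orbT.
have E1 : e / (2 * K) * K = e / 2 by field; rewrite gt_eqF.
have E2 : m * (K * (e / (2 * K * m))) = e / 2 by field; rewrite !gt_eqF.
rewrite [e]splitr; apply: lerD; first by apply: le_trans g1 _; rewrite E1.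
by apply: le_trans g2 _; rewrite E2.
Qed.

Lemma term_contC x s : {for s, continuous yy} -> contC c s -> x != yy s -> contC (term x) s.
Proof.
move=> cy cc xy; have d0 : 0 < `|x - yy s| by rewrite normr_gt0 subr_eq0.
apply: contCP => e e0; have [r r0 hr] := term_equi d0 cy cc e0.
by exists r => // s' /hr; apply.
Qed.

Variables (p q : R).
Hypothesis pq : p <= q.
Hypothesis cyy : forall s, p <= s <= q -> {for s, continuous yy}.
Hypothesis cc : forall s, p <= s <= q -> contC c s.

Lemma term_approx (I : Type) (fam : I -> R * R -> C) (S : set (R * R)) : open S ->
  (forall s, p <= s <= q -> S (yy s)) ->
  (forall s, p <= s <= q -> approx (~` S) fam (fun x => multipole n (x - yy s))) ->
  approx (~` S) fam (fun x => IntC p q (term x)).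
Proof.
move=> oS yS hap; apply: approx_lim => e e0.
have ne x s : (~` S) x -> p <= s <= q -> x != yy s by move=> Sx hs; apply/eqP => E; apply: Sx; rewrite E; exact: yS.
have ct x s : (~` S) x -> p <= s <= q -> contC (term x) s.
  by move=> Sx hs; apply: term_contC; [exact: cyy|exact: cc|exact: ne].
pose e1 := e / (2 * (q - p + 1)).
have qp1 : 0 < q - p + 1 by rewrite ltr_wpDl// subr_ge0.
have e10 : 0 < e1 by rewrite divr_gt0// mulr_gt0.
(* Riemann sums by induction along the interval: the allowed error grows linearly, and over a short
   piece near [t] the integrand is frozen at [t], which gives one multiple of a multipole with pole
   [yy t]. *)
pose P t := exists2 g, approx (~` S) fam g & forall x, (~` S) x -> normc (IntC p t (term x) - g x) <= 2 * e1 * (t - p).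
have : P q.
  apply: (@itv_chain R P p q) => //.
    exists (fun=> 0); first exact: approx0.
    move=> x _; rewrite subrr mulr0 subr0 /IntC !Int_xx.
    have -> : (0 +i* 0)%C = 0 :> C by [].
    by rewrite normc0.
  move=> t ht; have := open_nbhs_nbhs (conj oS (yS t ht)) => /nbhs_ballP[d /= d0 dS].
  have far x : (~` S) x -> d <= `|x - yy t|.
    by move=> Sx; rewrite leNgt; apply/negP => h; apply: Sx; apply: dS; rewrite -ball_normE /= distrC.
  have [r r0 hr] := term_equi d0 (cyy ht) (cc ht) e10.
  exists r; first exact: r0.
  move=> t1 t2 /andP[h1 h1'] /andP[h2 h2'] t12 b1 b2 [g ag hg].
  exists (fun x => g x + ((t2 - t1)%:C%C * c t) * multipole n (x - yy t)).
    by apply: approxD => //; apply: approxZ; exact: hap.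
  move=> x Sx; have ct' s : p <= s <= t2 -> contC (term x) s.
    by move=> /andP[a1 a2]; apply: ct => //; rewrite a1 (le_trans a2).
  rewrite (IntC_split h1 t12 ct').
  have -> : IntC p t1 (term x) + IntC t1 t2 (term x) - (g x + (t2 - t1)%:C%C * c t * multipole n (x - yy t)) =
    (IntC p t1 (term x) - g x) + (IntC t1 t2 (term x) + (t2 - t1)%:C%C * (- term x t)).
    by rewrite /term; ring.
  apply: le_trans (le_normcD _ _) _.
  have -> : 2 * e1 * (t2 - p) = 2 * e1 * (t1 - p) + 2 * e1 * (t2 - t1) by ring.
  apply: lerD; first exact: hg.
  have cs s : t1 <= s <= t2 -> contC (term x) s by move=> /andP[a1 a2]; apply: ct'; rewrite a2 (le_trans h1).
  have c0 s : t1 <= s <= t2 -> contC (fun=> - term x t) s by move=> _; exact: contC_cst.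
  have cD s : t1 <= s <= t2 -> contC (fun s => term x s - term x t) s by move=> hs; exact: contCD (cs s hs) (c0 s hs).
  rewrite -(IntC_cst _ t12) -(IntCD cs c0); apply: (IntC_bound t12 cD) => s /andP[a1 a2].
  apply: hr; last exact: far.
  move: b1 b2; rewrite !ltr_norml => /andP[c1 c2] /andP[c3 c4].
  by apply/andP; split; move: c1 c2 c3 c4 a1 a2; lra.
case=> g ag hg; exists g => // x Sx; apply: le_trans (hg x Sx) _.
have -> : 2 * e1 * (q - p) = e * ((q - p) / (q - p + 1)) by rewrite /e1; field; rewrite gt_eqF.
by rewrite ler_piMr ?(ltW e0)// ler_pdivrMr// mul1r lerDl.
Qed.

Lemma term_cont x : (forall s, p <= s <= q -> x != yy s) -> forall e, 0 < e ->
  exists2 d, 0 < d & forall x', `|x' - x| < d -> normc (IntC p q (term x') - IntC p q (term x)) <= e.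
Proof.
move=> ne e e0.
have [m m0 hm] := curve_dist pq cyy ne.
have [K K0 hK] := multipole_near n m0.
have [B1 hB1] := bounded_itv (fun s hs => (cc hs).1).
have [B2 hB2] := bounded_itv (fun s hs => (cc hs).2).
pose B := `|B1| + `|B2| + 1; have B0 : 0 < B by rewrite ltr_wpDl// addr_ge0.
have cB s : p <= s <= q -> normc (c s) <= B.
  move=> hs; apply: le_trans (normc_le_ReIm _) _.
  have h1 := hB1 s hs; have h2 := hB2 s hs; have h3 := ler_norm B1; have h4 := ler_norm B2.
  by rewrite /B; move: h1 h2 h3 h4; lra.
have qp1 : 0 < q - p + 1 by rewrite ltr_wpDl// subr_ge0.
pose d := Num.min (m / 2) (e / (2 * B * K * (q - p + 1))).
have D0 : 0 < 2 * B * K * (q - p + 1) by rewrite !mulr_gt0.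
have d0 : 0 < d by rewrite lt_min !divr_gt0.
exists d => // x' hx'.
have hv : `|x' - x| <= m / 2 by rewrite ltW// (lt_le_trans hx')// ge_min lexx.
have hv2 : `|x' - x| <= e / (2 * B * K * (q - p + 1)) by rewrite ltW// (lt_le_trans hx')// ge_min lexx orbT.
have sh s : x' - yy s = (x - yy s) + (x' - x) by rewrite [RHS]addrC addrA subrK.
have ne' s : p <= s <= q -> x' != yy s.
  move=> hs; rewrite -subr_eq0 -normr_gt0 sh; have := ler_normB (x - yy s + (x' - x)) (x' - x).
  by rewrite addrK; have := hm s hs; move: hv m0; lra.
have ct s : p <= s <= q -> contC (term x) s by move=> hs; apply: term_contC; [exact: cyy|exact: cc|exact: ne].
have ct' s : p <= s <= q -> contC (term x') s by move=> hs; apply: term_contC; [exact: cyy|exact: cc|exact: ne'].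
have cN s : p <= s <= q -> contC (fun s => - term x s) s by move=> /ct; exact: contCN.
have cD s : p <= s <= q -> contC (fun s => term x' s - term x s) s by move=> hs; exact: contCD (ct' s hs) (cN s hs).
have E : IntC p q (term x') = IntC p q (term x) + IntC p q (fun s => term x' s - term x s).
  rewrite -(IntCD ct cD).
  by congr (IntC _ _ _); apply/funext => s; rewrite addrC subrK.
have {E} -> : IntC p q (term x') - IntC p q (term x) = IntC p q (fun s => term x' s - term x s) by rewrite E addrC addKr.
apply: (@le_trans _ _ (2 * (B * (K * `|x' - x|)) * (q - p))).
  apply: (IntC_bound pq cD) => s hs.
  rewrite /term -mulrBr normcM; apply: ler_pM; rewrite ?normc_ge0//; first exact: cB.
  by rewrite sh; have [_ _] := hK _ _ (hm s hs) hv.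
have h : `|x' - x| * (2 * B * K * (q - p + 1)) <= e by rewrite -ler_pdivlMr.
apply: le_trans h.
have -> : 2 * (B * (K * `|x' - x|)) * (q - p) = `|x' - x| * (2 * B * K * (q - p)) by ring.
by rewrite ler_wpM2l// ler_wpM2l ?lerDl// !mulr_ge0// ltW.
Qed.

End Term.
End EdgeIntegrals.

(** * Green's representation over a polar grid *)

Section EdgeDensity.
Variables (R : realType) (k : R).
Hypothesis k_gt0 : 0 < k.
Local Notation C := R[i].
Local Notation multipole := (multipole k).
Local Notation tau := (tau k).
Local Notation cpt := (cpt k).
Variables a b : jet R.
Implicit Types (r t s p q e : R) (x y z : R * R).

Definition vC x : C := (j0 a x +i* j0 b x)%C.

(* The flux density of [v grad H - H grad v] through a curve element with normal [(n1, n2)] at [y],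
   where [v = a + i b] and [H] is the outgoing fundamental solution centered at [x]. *)
Definition dens x y n1 n2 : C :=
  let J := kjet k (@bj R) x in let Y := kjet k (@by_ R) x in
  (((n1 * vf1 a J y + n2 * vf2 a J y) - (n1 * vf1 b Y y + n2 * vf2 b Y y)) +i*
   ((n1 * vf1 a Y y + n2 * vf2 a Y y) + (n1 * vf1 b J y + n2 * vf2 b J y)))%C.

Lemma tauN z : tau (- z) = tau z.
Proof. by rewrite /tau /= !sqrrN. Qed.

(** As a function of x, H_0(k |x - y|) is the multipole of order 0 with pole [y], and its first
    derivatives in [y] are combinations of those of orders 1 and -1. *)
Lemma dens_terms x y n1 n2 : dens x y n1 n2 =
  (k / 2)%:C%C * (vC y * (n1 -i* n2)%C) * multipole 1 (x - y) +
  - (k / 2)%:C%C * (vC y * (n1 +i* n2)%C) * multipole (-1) (x - y) +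
  - ((n1 * j1 a y + n2 * j2 a y) +i* (n1 * j1 b y + n2 * j2 b y))%C * multipole 0 (x - y).
Proof.
have tE : tau (x - y) = tau (y - x) by rewrite -tauN opprB.
rewrite /multipole /dens /vf1 /vf2 /hcyl /vC /= !expr1 tE.
move: (bj 0 (tau (y - x))) (bj 1 (tau (y - x))) (by_ 0 (tau (y - x))) (by_ 1 (tau (y - x))) => J0 J1 Y0 Y1.
move: (j0 a y) (j1 a y) (j2 a y) (j0 b y) (j1 b y) (j2 b y) => a0 a1 a2 b0 b1 b2.
rewrite /cpt /= ; apply/eqP; rewrite eq_complex /=; apply/andP; split; apply/eqP; by field.
Qed.

Variables (p q : R) (yy : R -> R * R) (n1 n2 : R -> R).
Hypothesis pq : p <= q.
Hypothesis cyy : forall s, p <= s <= q -> {for s, continuous yy}.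
Hypothesis cn1 : forall s, p <= s <= q -> {for s, continuous n1}.
Hypothesis cn2 : forall s, p <= s <= q -> {for s, continuous n2}.
Hypothesis ca : forall s, p <= s <= q -> cjet1 a (yy s).
Hypothesis cb : forall s, p <= s <= q -> cjet1 b (yy s).

Definition edge x := IntC p q (fun s => dens x (yy s) (n1 s) (n2 s)).

Let c1 s : C := (k / 2)%:C%C * (vC (yy s) * (n1 s -i* n2 s)%C).
Let cm s : C := - (k / 2)%:C%C * (vC (yy s) * (n1 s +i* n2 s)%C).
Let c0 s : C := - ((n1 s * j1 a (yy s) + n2 s * j2 a (yy s)) +i* (n1 s * j1 b (yy s) + n2 s * j2 b (yy s)))%C.

Lemma comp_cont (f : R * R -> R) s : p <= s <= q -> {for yy s, continuous f} -> {for s, continuous (fun s => f (yy s))}.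
Proof. by move=> hs cf; apply: (@continuous_comp _ _ _ yy f); [exact: cyy|]. Qed.

Lemma contC_c1 s : p <= s <= q -> contC c1 s.
Proof.
move=> hs; have [h0 h1 h2] := ca hs; have [g0 g1 g2] := cb hs.
have A0 := comp_cont hs h0; have B0 := comp_cont hs g0; have N1 := cn1 hs; have N2 := cn2 hs.
split.
  have -> : (fun s => complex.Re (c1 s)) = (fun s => k / 2 * (j0 a (yy s) * n1 s + j0 b (yy s) * n2 s)).
    by apply/funext => u; rewrite /c1 /=; ring.
  by apply: cvgM; [exact: cvg_cst|apply: cvgD; apply: cvgM].
have -> : (fun s => complex.Im (c1 s)) = (fun s => k / 2 * (j0 b (yy s) * n1 s - j0 a (yy s) * n2 s)).
  by apply/funext => u; rewrite /c1 /=; ring.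
by apply: cvgM; [exact: cvg_cst|apply: cvgB; apply: cvgM].
Qed.

Lemma contC_cm s : p <= s <= q -> contC cm s.
Proof.
move=> hs; have [h0 h1 h2] := ca hs; have [g0 g1 g2] := cb hs.
have A0 := comp_cont hs h0; have B0 := comp_cont hs g0; have N1 := cn1 hs; have N2 := cn2 hs.
split.
  have -> : (fun s => complex.Re (cm s)) = (fun s => - (k / 2) * (j0 a (yy s) * n1 s - j0 b (yy s) * n2 s)).
    by apply/funext => u; rewrite /cm /=; ring.
  by apply: cvgM; [exact: cvg_cst|apply: cvgB; apply: cvgM].
have -> : (fun s => complex.Im (cm s)) = (fun s => - (k / 2) * (j0 b (yy s) * n1 s + j0 a (yy s) * n2 s)).
  by apply/funext => u; rewrite /cm /=; ring.
by apply: cvgM; [exact: cvg_cst|apply: cvgD; apply: cvgM].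
Qed.

Lemma contC_c0 s : p <= s <= q -> contC c0 s.
Proof.
move=> hs; have [h0 h1 h2] := ca hs; have [g0 g1 g2] := cb hs.
have A1 := comp_cont hs h1; have B1 := comp_cont hs g1.
have A2 := comp_cont hs h2; have B2 := comp_cont hs g2; have N1 := cn1 hs; have N2 := cn2 hs.
by split; apply: cvgN; apply: cvgD; apply: cvgM.
Qed.

Lemma edge_terms x : (forall s, p <= s <= q -> x != yy s) -> edge x =
  IntC p q (term k yy c1 1 x) + IntC p q (term k yy cm (-1) x) + IntC p q (term k yy c0 0 x).
Proof.
move=> ne; have t1 s : p <= s <= q -> contC (term k yy c1 1 x) s.
  by move=> hs; exact: (term_contC k_gt0 _ (cyy hs) (contC_c1 hs) (ne s hs)).
have tm s : p <= s <= q -> contC (term k yy cm (-1) x) s.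
  by move=> hs; exact: (term_contC k_gt0 _ (cyy hs) (contC_cm hs) (ne s hs)).
have t0 s : p <= s <= q -> contC (term k yy c0 0 x) s.
  by move=> hs; exact: (term_contC k_gt0 _ (cyy hs) (contC_c0 hs) (ne s hs)).
have tD s : p <= s <= q -> contC (fun s => term k yy c1 1 x s + term k yy cm (-1) x s) s.
  by move=> hs; exact: contCD (t1 s hs) (tm s hs).
rewrite -(IntCD t1 tm) -(IntCD tD t0).
by congr (IntC _ _ _); apply/funext => s; rewrite dens_terms.
Qed.

Lemma edge_approx (I : Type) (fam : I -> R * R -> C) (S : set (R * R)) : open S ->
  (forall s, p <= s <= q -> S (yy s)) ->
  (forall y n, S y -> approx (~` S) fam (fun x => multipole n (x - y))) ->
  approx (~` S) fam edge.
Proof.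
move=> oS yS hap.
have h (c : R -> C) n : (forall s, p <= s <= q -> contC c s) -> approx (~` S) fam (fun x => IntC p q (term k yy c n x)).
  by move=> hc; apply: term_approx => // s hs; apply: hap; exact: yS.
have := approxD (approxD (h c1 1 contC_c1) (h cm (-1) contC_cm)) (h c0 0 contC_c0).
apply: eq_approx => x Sx; rewrite edge_terms// => s hs; apply/eqP => E; apply: Sx; rewrite E; exact: yS.
Qed.

Definition cont_at (g : R * R -> C) x := forall e : R, 0 < e -> exists2 d : R, 0 < d &
  forall x', `|x' - x| < d -> normc (g x' - g x) <= e.

Lemma cont_atD g h x : cont_at g x -> cont_at h x -> cont_at (fun x => g x + h x) x.
Proof.
move=> hg hh e e0; have e2 : 0 < e / 2 by rewrite divr_gt0.
have [d1 d10 h1] := hg _ e2; have [d2 d20 h2] := hh _ e2.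
exists (Num.min d1 d2); first by rewrite lt_min d10.
move=> x'; rewrite lt_min => /andP[b1 b2]; rewrite opprD addrACA.
by apply: le_trans (le_normcD _ _) _; rewrite [e]splitr lerD ?h1 ?h2.
Qed.

Lemma cont_atN g x : cont_at g x -> cont_at (fun x => - g x) x.
Proof.
by move=> hg e /hg[d d0 h]; exists d => // x' /h; rewrite -opprD normcN.
Qed.

Lemma cont_atZ (c : C) g x : cont_at g x -> cont_at (fun x => c * g x) x.
Proof.
move=> hg e e0; have m0 : 0 < normc c + 1 by rewrite ltr_wpDl ?normc_ge0.
have [|d d0 h] := hg (e / (normc c + 1)); first exact: divr_gt0.
exists d => // x' /h {}h; rewrite -mulrBr normcM.
apply: (@le_trans _ _ ((normc c + 1) * (e / (normc c + 1)))); last by rewrite mulrC divfK// gt_eqF.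
by apply: ler_pM; rewrite ?normc_ge0// lerDl.
Qed.

Lemma cont_at_cst (c : C) x : cont_at (fun=> c) x.
Proof. by move=> e e0; exists 1 => // x' _; rewrite subrr normc0 ltW. Qed.

Lemma cont_at_near g h x d0 : 0 < d0 -> (forall x', `|x' - x| < d0 -> g x' = h x') -> cont_at g x -> cont_at h x.
Proof.
move=> d00 E hg e /hg[d d1 hd]; exists (Num.min d d0); first by rewrite lt_min d1.
move=> x'; rewrite lt_min => /andP[b1 b2]; rewrite -!E ?subrr ?normr0//; exact: hd.
Qed.

(** Continuity serves to extend the representation from the interiors of the cells to points on the
    grid. *)
Lemma edge_cont x : (forall s, p <= s <= q -> x != yy s) -> cont_at edge x.
Proof.
move=> ne.
have h (c : R -> C) n : (forall s, p <= s <= q -> contC c s) -> cont_at (fun x => IntC p q (term k yy c n x)) x.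
  by move=> hc; exact: term_cont.
have [m m0 hm] := curve_dist pq cyy ne.
apply: (cont_at_near m0) (cont_atD (cont_atD (h c1 1 contC_c1) (h cm (-1) contC_cm)) (h c0 0 contC_c0)) => x' hx'.
rewrite edge_terms// => s hs; apply/eqP => E; have := hm s hs; rewrite -E leNgt distrC hx'//.
Qed.

End EdgeDensity.

(** * Fluxes summed over the cells *)

Section Representation.
Variables (R : realType) (k : R).
Hypothesis k_gt0 : 0 < k.
Local Notation C := R[i].
Local Notation solves := (solves k).
Variables (a b : jet R) (D : set (R * R)) (h dl : R) (M N0 : nat).
Hypothesis h_gt0 : 0 < h.
Hypothesis dl_gt0 : 0 < dl.
Hypothesis Mdl : M%:R * dl = 2 * pi.
Hypothesis N0_gt0 : (0 < N0)%N.
Hypothesis sol_a : forall y, D y -> solves a y.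
Hypothesis sol_b : forall y, D y -> solves b y.
Hypothesis far : forall r t, N0%:R * h <= r -> D (pol r t).
Hypothesis radiating : forall e, 0 < e -> exists A, forall r t, A < r ->
  r * ((dr a r t + k * val b r t) ^+ 2 + (dr b r t - k * val a r t) ^+ 2) <= e.
Implicit Types (i j N : nat) (r t : R) (x : R * R).

Definition ra i : R := i%:R * h.
Definition an j : R := j%:R * dl.
Definition incell i j r t := ra i <= r <= ra i.+1 /\ an j <= t <= an j.+1.
Definition good i j : bool := `[< forall r t, incell i j r t -> D (pol r t) >].

Definition radC x r t : C := dens k a b x (pol r t) (r * cos t) (r * sin t).
Definition angC x r t : C := dens k a b x (pol r t) (- sin t) (cos t).

(* Edges that leave [D] are given flux [0]; they only occur between two cells that are not good. *)
Definition arc x i j : C := if `[< forall t, an j <= t <= an j.+1 -> D (pol (ra i) t) >]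
  then IntC (an j) (an j.+1) (radC x (ra i)) else 0.
Definition seg x i j : C := if `[< forall r, ra i <= r <= ra i.+1 -> D (pol r (an j)) >]
  then IntC (ra i) (ra i.+1) (angC x ^~ (an j)) else 0.
Definition cellflux x i j : C := arc x i.+1 j - arc x i j + (seg x i j.+1 - seg x i j).
Definition bad_flux x : C := \sum_(0 <= i < N0) \sum_(0 <= j < M) (if good i j then 0 else cellflux x i j).

Lemma ra_le i : ra i <= ra i.+1.
Proof. by rewrite /ra -natr1 mulrDl mul1r lerDl ltW. Qed.

Lemma an_le i : an i <= an i.+1.
Proof. by rewrite /an -natr1 mulrDl mul1r lerDl ltW. Qed.

Lemma ra_ge0 i : 0 <= ra i.
Proof. by rewrite /ra mulr_ge0// ltW. Qed.

Lemma an_ge0 i : 0 <= an i.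
Proof. by rewrite /an mulr_ge0// ltW. Qed.

Lemma an_le2pi j : (j <= M)%N -> an j <= 2 * pi.
Proof. by move=> jM; rewrite -Mdl /an ler_wpM2r ?(ltW dl_gt0)// ler_nat. Qed.

Lemma pol_2pi r : pol r (2 * pi) = pol r 0 :> R * R.
Proof. by rewrite /pol mulr_natl cos2pi sin2pi cos0 sin0. Qed.

Lemma pol_neq r t r0 t0 : 0 < r0 -> r0 < r -> pol r t != pol r0 t0.
Proof.
move=> r00 r0r; apply/eqP => E.
have nrm s u : (pol s u).1 ^+ 2 + (pol s u).2 ^+ 2 = s ^+ 2 :> R.
  by rewrite /= !exprMn -mulrDr cos2Dsin2 mulr1.
have := nrm r t; rewrite E nrm => /eqP; rewrite eqf_sqr => /orP[/eqP|/eqP] e.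
  by rewrite e ltxx in r0r.
by have := lt_trans r00 r0r; rewrite -oppr_lt0 -e ltNge (ltW r00).
Qed.

Lemma radC_E x r t : let J := kjet k (@bj R) x in let Y := kjet k (@by_ R) x in
  radC x r t = ((rad a J r t - rad b Y r t) +i* (rad a Y r t + rad b J r t))%C.
Proof. by move=> J Y; rewrite /radC /dens /rad /radial; congr Complex; ring. Qed.

Lemma angC_E x r t : let J := kjet k (@bj R) x in let Y := kjet k (@by_ R) x in
  angC x r t = ((ang a J r t - ang b Y r t) +i* (ang a Y r t + ang b J r t))%C.
Proof. by move=> J Y; rewrite /angC /dens /ang /angular; congr Complex; ring. Qed.

Lemma arc0 x j : arc x 0 j = 0.
Proof.
rewrite /arc; case: ifP => // _.
have E : radC x (ra 0) = fun=> 0.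
  by apply/funext => t; rewrite radC_E /ra mul0r /rad /radial !mul0r subrr addr0.
by rewrite E IntC_cst ?an_le// mulr0.
Qed.

Lemma segM x i : seg x i M = seg x i 0.
Proof.
have e0 : an 0 = 0 by rewrite /an mul0r.
have eM : an M = 2 * pi by exact: Mdl.
have E : angC x ^~ (an M) = angC x ^~ (an 0).
  by apply/funext => r; rewrite /angC eM e0 pol_2pi mulr_natl cos2pi sin2pi cos0 sin0.
rewrite /seg E; congr (if `[< _ >] then _ else _); apply/propext.
by rewrite eM e0; split=> H r /H; rewrite pol_2pi.
Qed.

(** Each inner edge occurs in two cells with opposite signs, also on the ray t = 0, which is
    identified with t = 2 pi; the arcs at r = 0 contribute nothing. *)
Lemma cellflux_sum x N : \sum_(0 <= i < N) \sum_(0 <= j < M) cellflux x i j = \sum_(0 <= j < M) arc x N j.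
Proof.
under eq_bigr => i _ do rewrite big_split /= (telescope_sumr (fun j => seg x i j) (leq0n M)) segM subrr addr0.
rewrite exchange_big_nat /=; apply: eq_bigr => j _.
by rewrite (telescope_sumr (fun i => arc x i j) (leq0n N)) arc0 subr0.
Qed.

Section Point.
Variables (r0 t0 : R) (ic jc : nat).
Hypothesis r0i : ra ic < r0 < ra ic.+1.
Hypothesis t0j : an jc < t0 < an jc.+1.
Hypothesis j0M : (jc < M)%N.
Hypothesis good0 : good ic jc.
Local Notation x := (pol r0 t0).
Local Notation J := (kjet k (@bj R) x).
Local Notation Y := (kjet k (@by_ R) x).

Let r0_gt0 : 0 < r0. Proof. by case/andP: r0i => h1 _; exact: le_lt_trans (ra_ge0 ic) h1. Qed.
Let t0_2pi : 0 < t0 < 2 * pi.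
Proof. by case/andP: t0j => h1 h2; rewrite (le_lt_trans (an_ge0 jc) h1)//= (lt_le_trans h2)// an_le2pi. Qed.

Lemma cell_neq i j r t : (j < M)%N -> incell i j r t -> (r != r0) || (t != t0) -> pol r t != x.
Proof.
move=> jM [/andP[h1 h2] /andP[h3 h4]]; apply: contraTneq => E.
have [||-> ->] := pol_inj k_gt0 _ _ r0_gt0 t0_2pi E; last by rewrite !eqxx.
  exact: le_trans (ra_ge0 i) h1.
by rewrite (le_trans (an_ge0 j))//= (le_trans h4)// an_le2pi.
Qed.

Lemma solves_J y : y != x -> solves J y.
Proof. by apply: (kjet_solves k_gt0); exact: cyl_bj. Qed.

Lemma solves_Y y : y != x -> solves Y y.
Proof. by apply: (kjet_solves k_gt0); exact: cyl_by. Qed.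

Lemma incell_point i j : incell i j r0 t0 -> i = ic /\ j = jc.
Proof.
have aux (c u : R) n m : 0 < c -> n%:R * c < u -> u < m%:R * c -> (n < m)%N.
  by move=> c0 h1 h2; have := lt_trans h1 h2; rewrite ltr_pM2r// ltr_nat.
case/andP: r0i => a1 a2; case/andP: t0j => b1 b2 [/andP[h1 h2] /andP[h3 h4]].
have aux2 (c u : R) n m : 0 < c -> n%:R * c < u -> u <= m%:R * c -> (n < m)%N.
  by move=> c0 g1 g2; have := lt_le_trans g1 g2; rewrite ltr_pM2r// ltr_nat.
have aux3 (c u : R) n m : 0 < c -> n%:R * c <= u -> u < m%:R * c -> (n < m)%N.
  by move=> c0 g1 g2; have := le_lt_trans g1 g2; rewrite ltr_pM2r// ltr_nat.
have p1 := aux2 _ _ _ _ h_gt0 a1 h2; have p2 := aux3 _ _ _ _ h_gt0 h1 a2.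
have p3 := aux2 _ _ _ _ dl_gt0 b1 h4; have p4 := aux3 _ _ _ _ dl_gt0 h3 b2.
by split; apply/eqP; rewrite eqn_leq; apply/andP.
Qed.

Lemma IntC_radC p q r : {within `[p, q], continuous (rad a J r)} -> {within `[p, q], continuous (rad b Y r)} ->
  {within `[p, q], continuous (rad a Y r)} -> {within `[p, q], continuous (rad b J r)} ->
  IntC p q (radC x r) = ((Int p q (rad a J r) - Int p q (rad b Y r)) +i* (Int p q (rad a Y r) + Int p q (rad b J r)))%C.
Proof.
move=> c1 c2 c3 c4; rewrite /IntC -IntB// -IntD//.
by under eq_fun do rewrite radC_E; under [X in (_ +i* Int _ _ X)%C]eq_fun do rewrite radC_E.
Qed.

Lemma IntC_angC p q t : {within `[p, q], continuous (ang a J ^~ t)} -> {within `[p, q], continuous (ang b Y ^~ t)} ->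
  {within `[p, q], continuous (ang a Y ^~ t)} -> {within `[p, q], continuous (ang b J ^~ t)} ->
  IntC p q (angC x ^~ t) = ((Int p q (ang a J ^~ t) - Int p q (ang b Y ^~ t)) +i* (Int p q (ang a Y ^~ t) + Int p q (ang b J ^~ t)))%C.
Proof.
move=> c1 c2 c3 c4; rewrite /IntC -IntB// -IntD//.
by under eq_fun do rewrite angC_E; under [X in (_ +i* Int _ _ X)%C]eq_fun do rewrite angC_E.
Qed.

Lemma rflux_same u r1 r2 t1 t2 : r1 <= r2 -> t1 <= t2 -> rflux (rad u u) (ang u u) r1 r2 t1 t2 = 0.
Proof.
move=> r12 t12.
have E1 r : rad u u r = fun=> 0 by apply/funext => t; rewrite /rad /radial /vf1 /vf2 !(mulrC (j0 u _)) !subrr !mul0r addr0 mulr0.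
have E2 t : (ang u u) ^~ t = fun=> 0 by apply/funext => r; rewrite /ang /angular /vf1 /vf2 !(mulrC (j0 u _)) !subrr !mul0r subr0.
by rewrite /rflux !E1 !E2 !Int_cst// !mul0r !subrr addr0.
Qed.

(** In the cell of the pole, [flux_kernel] reduces everything to the flux of J_0, which is 0 against
    itself and 4 against Y_0. The real and imaginary parts are then - 4 b and 4 a at the pole, that
    is 4 i (a + i b). *)
Lemma cellflux_good i j : (j < M)%N -> good i j ->
  cellflux x i j = if (i == ic) && (j == jc) then 4 * 'i%C * vC a b x else 0.
Proof.
move=> jM /asboolP gij.
have ri := ra_le i; have tj := an_le j.
have i1 : ra i <= ra i <= ra i.+1 by rewrite lexx. have i2 : ra i <= ra i.+1 <= ra i.+1 by rewrite lexx andbT.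
have l1 : an j <= an j <= an j.+1 by rewrite lexx. have l2 : an j <= an j.+1 <= an j.+1 by rewrite lexx andbT.
have cons r t : ra i <= r <= ra i.+1 -> an j <= t <= an j.+1 -> (r != r0) || (t != t0) ->
   [/\ conserved (rad a J) (ang a J) (raddiv a J) r t, conserved (rad b Y) (ang b Y) (raddiv b Y) r t,
       conserved (rad a Y) (ang a Y) (raddiv a Y) r t & conserved (rad b J) (ang b J) (raddiv b J) r t].
  move=> hr ht n; have ne := cell_neq jM (conj hr ht) n; have Dp := gij r t (conj hr ht).
  by split; apply: (jet_conserved (k := k)); first [exact: sol_a|exact: sol_b|exact: solves_J|exact: solves_Y].
(* [r0], and likewise [t0] below, lies strictly between two grid values, so no edge passes through
   the pole. *)
have er r : ra i <= r <= ra i.+1 -> r = ra i \/ r = ra i.+1 -> r != r0.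
  move=> _ hr; apply/eqP => E; case/andP: r0i => u1 u2; case: hr => e; rewrite -E e /ra in u1 u2.
    by move: u1 u2; rewrite !ltr_pM2r// !ltr_nat => v1 v2; clear -v1 v2; lia.
  by move: u1 u2; rewrite !ltr_pM2r// !ltr_nat => v1 v2; clear -v1 v2; lia.
have et t : an j <= t <= an j.+1 -> t = an j \/ t = an j.+1 -> t != t0.
  move=> _ ht; apply/eqP => E; case/andP: t0j => u1 u2; case: ht => e; rewrite -E e /an in u1 u2.
    by move: u1 u2; rewrite !ltr_pM2r// !ltr_nat => v1 v2; clear -v1 v2; lia.
  by move: u1 u2; rewrite !ltr_pM2r// !ltr_nat => v1 v2; clear -v1 v2; lia.
have wr r : ra i <= r <= ra i.+1 -> r != r0 -> [/\ {within `[an j, an j.+1], continuous (rad a J r)},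
   {within `[an j, an j.+1], continuous (rad b Y r)}, {within `[an j, an j.+1], continuous (rad a Y r)} &
   {within `[an j, an j.+1], continuous (rad b J r)}].
  move=> hr n; split; apply: within_cont => t ht; have [|c1 c2 c3 c4] := cons r t hr ht; rewrite ?n//.
  - by have [_ [c _ _]] := c1; exact: cont_slice2 c.
  - by have [_ [c _ _]] := c2; exact: cont_slice2 c.
  - by have [_ [c _ _]] := c3; exact: cont_slice2 c.
  - by have [_ [c _ _]] := c4; exact: cont_slice2 c.
have wt t : an j <= t <= an j.+1 -> t != t0 -> [/\ {within `[ra i, ra i.+1], continuous (ang a J ^~ t)},
   {within `[ra i, ra i.+1], continuous (ang b Y ^~ t)}, {within `[ra i, ra i.+1], continuous (ang a Y ^~ t)} &
   {within `[ra i, ra i.+1], continuous (ang b J ^~ t)}].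
  move=> ht n; split; apply: within_cont => r hr; have [|c1 c2 c3 c4] := cons r t hr ht; rewrite ?n ?orbT//.
  - by have [_ [_ c _]] := c1; exact: cont_slice1 c.
  - by have [_ [_ c _]] := c2; exact: cont_slice1 c.
  - by have [_ [_ c _]] := c3; exact: cont_slice1 c.
  - by have [_ [_ c _]] := c4; exact: cont_slice1 c.
have -> : cellflux x i j = ((rflux (rad a J) (ang a J) (ra i) (ra i.+1) (an j) (an j.+1) -
      rflux (rad b Y) (ang b Y) (ra i) (ra i.+1) (an j) (an j.+1)) +i*
     (rflux (rad a Y) (ang a Y) (ra i) (ra i.+1) (an j) (an j.+1) +
      rflux (rad b J) (ang b J) (ra i) (ra i.+1) (an j) (an j.+1)))%C.
  rewrite /cellflux /arc /seg.
  have -> : `[< forall t, an j <= t <= an j.+1 -> D (pol (ra i.+1) t) >].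
    by apply/asboolP => t ht; apply: gij.
  have -> : `[< forall t, an j <= t <= an j.+1 -> D (pol (ra i) t) >].
    by apply/asboolP => t ht; apply: gij.
  have -> : `[< forall r, ra i <= r <= ra i.+1 -> D (pol r (an j.+1)) >].
    by apply/asboolP => r hr; apply: gij.
  have -> : `[< forall r, ra i <= r <= ra i.+1 -> D (pol r (an j)) >].
    by apply/asboolP => r hr; apply: gij.
  have [a1 a2 a3 a4] := wr _ i1 (er _ i1 (or_introl erefl)).
  have [b1 b2 b3 b4] := wr _ i2 (er _ i2 (or_intror erefl)).
  have [c1 c2 c3 c4] := wt _ l1 (et _ l1 (or_introl erefl)).
  have [d1 d2 d3 d4] := wt _ l2 (et _ l2 (or_intror erefl)).
  rewrite !IntC_radC// !IntC_angC// /rflux; apply/eqP; rewrite eq_complex /=.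
  by apply/andP; split; apply/eqP; ring.
case: ifP => [/andP[/eqP ei /eqP ej]|n].
  subst i j.
  have hr t r : ra ic <= r <= ra ic.+1 -> an jc <= t <= an jc.+1 -> solves a (pol r t) by move=> ? ?; apply: sol_a; exact: gij.
  have hb t r : ra ic <= r <= ra ic.+1 -> an jc <= t <= an jc.+1 -> solves b (pol r t) by move=> ? ?; apply: sol_b; exact: gij.
  have inj r t : ra ic <= r <= ra ic.+1 -> an jc <= t <= an jc.+1 -> (r != r0) || (t != t0) -> pol r t != x.
    by move=> ? ? ?; apply: (@cell_neq ic jc).
  have FJ w : (forall r t, ra ic <= r <= ra ic.+1 -> an jc <= t <= an jc.+1 -> solves w (pol r t)) ->
      rflux (rad w J) (ang w J) (ra ic) (ra ic.+1) (an jc) (an jc.+1) = 0.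
    move=> hw; have := flux_kernel k_gt0 (@cyl_bj R) (@sing_bj R) r0_gt0 r0i t0j inj hw.
    by rewrite /= rflux_same// mulr0.
  have FY w : (forall r t, ra ic <= r <= ra ic.+1 -> an jc <= t <= an jc.+1 -> solves w (pol r t)) ->
      rflux (rad w Y) (ang w Y) (ra ic) (ra ic.+1) (an jc) (an jc.+1) = j0 w x * 4.
    move=> hw; have := flux_kernel k_gt0 (@cyl_by R) (@sing_by R) r0_gt0 r0i t0j inj hw.
    by rewrite /= (flux_kernels k_gt0 (ra_ge0 ic) r0i (an_ge0 jc) (an_le2pi jM) t0j).
  rewrite (FJ a (fun r t => hr t r)) (FJ b (fun r t => hb t r)) (FY a (fun r t => hr t r)) (FY b (fun r t => hb t r)) /vC.
  have -> : (4 : C) = (4%:R : R)%:C%C by rewrite rmorph_nat.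
  apply/eqP; rewrite eq_complex /=; apply/andP; split; apply/eqP; ring.
have out r t : ra i <= r <= ra i.+1 -> an j <= t <= an j.+1 -> (r != r0) || (t != t0).
  move=> hr ht; rewrite -negb_and; apply/negP => /andP[/eqP er0 /eqP et0].
  have [] := @incell_point i j; first by rewrite -er0 -et0.
  by move=> ei ej; rewrite ei ej !eqxx in n.
have Z1 := rflux_zero ri tj (fun r t hr ht => let: And4 c _ _ _ := cons r t hr ht (out r t hr ht) in c).
have Z2 := rflux_zero ri tj (fun r t hr ht => let: And4 _ c _ _ := cons r t hr ht (out r t hr ht) in c).
have Z3 := rflux_zero ri tj (fun r t hr ht => let: And4 _ _ c _ := cons r t hr ht (out r t hr ht) in c).
have Z4 := rflux_zero ri tj (fun r t hr ht => let: And4 _ _ _ c := cons r t hr ht (out r t hr ht) in c).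
rewrite Z1 Z2 Z3 Z4.
by rewrite subr0 addr0.
Qed.

Lemma far_good i j : (N0 <= i)%N -> good i j.
Proof.
move=> Ni; apply/asboolP => r t [/andP[h1 _] _]; apply: far; apply: le_trans h1.
by rewrite /ra ler_wpM2r ?(ltW h_gt0)// ler_nat.
Qed.

Lemma arc_sum N : (N0 <= N)%N -> (ic < N)%N ->
  \sum_(0 <= j < M) arc x N j = IntC 0 (2 * pi) (radC x (ra N)).
Proof.
move=> N0N iN.
have rN : r0 < ra N.
  case/andP: r0i => _ h2; apply: lt_le_trans h2 _; by rewrite /ra ler_wpM2r ?(ltW h_gt0)// ler_nat.
have DN t : D (pol (ra N) t) by apply: far; rewrite /ra ler_wpM2r ?(ltW h_gt0)// ler_nat.
have ct t : contC (radC x (ra N)) t.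
  have ne := pol_neq t t0 r0_gt0 rN.
  have c u w : solves u (pol (ra N) t) -> solves w (pol (ra N) t) -> {for t, continuous (rad u w (ra N))}.
    by move=> hu hw; have [_ [c _ _]] := jet_conserved hu hw; exact: cont_slice2 c.
  have s1 := sol_a (DN t); have s2 := sol_b (DN t); have s3 := solves_J ne; have s4 := solves_Y ne.
  split.
    have -> : (fun s => complex.Re (radC x (ra N) s)) = (fun s => rad a J (ra N) s - rad b Y (ra N) s).
      by apply/funext => s; rewrite radC_E.
    by apply: cvgB; exact: c.
  have -> : (fun s => complex.Im (radC x (ra N) s)) = (fun s => rad a Y (ra N) s + rad b J (ra N) s).
    by apply/funext => s; rewrite radC_E.
  by apply: cvgD; exact: c.
have : forall m, (m <= M)%N -> \sum_(0 <= j < m) arc x N j = IntC 0 (an m) (radC x (ra N)).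
  elim=> [|m IH] mM.
    by rewrite big_geq// /an mul0r /IntC !Int_xx.
  rewrite big_nat_recr//= IH ?(ltnW mM)// (IntC_split (an_ge0 m) (an_le m))//; congr (_ + _).
  rewrite /arc; have -> // : `[< forall t, an m <= t <= an m.+1 -> D (pol (ra N) t) >].
  by apply/asboolP.
by move=> ->//; rewrite /an Mdl.
Qed.

Lemma representation_interior : bad_flux x + 4 * 'i%C * vC a b x = 0.
Proof.
(* All cells from [N0] on are good, so the right-hand side does not depend on [N], while the
   left-hand side tends to 0. *)
have key N : (N0 <= N)%N -> (ic < N)%N -> IntC 0 (2 * pi) (radC x (ra N)) = bad_flux x + 4 * 'i%C * vC a b x.
  move=> N0N iN; rewrite -arc_sum// -cellflux_sum.
  have -> : \sum_(0 <= i < N) \sum_(0 <= j < M) cellflux x i j =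
     \sum_(0 <= i < N) \sum_(0 <= j < M) (if good i j then 0 else cellflux x i j) +
     \sum_(0 <= i < N) \sum_(0 <= j < M) (if (i == ic) && (j == jc) then 4 * 'i%C * vC a b x else 0).
    rewrite -big_split /=; apply: eq_bigr => i _; rewrite -big_split /= !big_nat; apply: eq_bigr => j /andP[_ jM].
    case: ifP => g; first by rewrite add0r cellflux_good.
    case: ifP => [/andP[/eqP ei /eqP ej]|]; last by rewrite addr0.
    by rewrite ei ej good0 in g.
  congr (_ + _).
    rewrite (big_cat_nat (leq0n N0) N0N) /= [X in _ + X]big_nat [X in _ + X]big1 ?addr0//.
    by move=> i /andP[Ni _]; apply: big1 => j _; rewrite far_good.
  rewrite (bigD1_seq ic) ?iota_uniq ?mem_index_iota//= (bigD1_seq jc) ?iota_uniq ?mem_index_iota//= !eqxx /=.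
  rewrite big1 => [|j jj]; last by rewrite (negbTE jj).
  rewrite addr0 big1 ?addr0// => i ii; apply: big1 => j _; by rewrite (negbTE ii).
set Z := bad_flux x + _ in key *.
have N0h : 0 < N0%:R * h by rewrite mulr_gt0 ?ltr0n.
have sa r t : N0%:R * h <= r -> solves a (pol r t) by move=> hr; apply: sol_a; exact: far.
have sb r t : N0%:R * h <= r -> solves b (pol r t) by move=> hr; apply: sol_b; exact: far.
have V := @farfield_vanish R k k_gt0 a b _ N0h sa sb radiating r0 t0 r0_gt0.
have small e : 0 < e -> normc Z <= 2 * e.
  move=> e0; have [A hA] := V e e0.
  pose N := maxn (maxn N0 ic.+1) (Num.truncn (`|A| / h)).+1.
  have NA : A < ra N.
    apply: le_lt_trans (ler_norm A) _; rewrite /ra -ltr_pdivrMr//.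
    have := truncnS_gt (`|A| / h); move/lt_le_trans; apply; rewrite ler_nat; exact: leq_maxr.
  have N1 : (N0 <= N)%N by rewrite /N -maxnA leq_maxl.
  have N2 : (ic < N)%N by rewrite /N maxnAC leq_maxr.
  have [h1 h2] := hA _ NA.
  rewrite -(key N N1 N2).
  have rN : r0 < ra N.
    case/andP: r0i => _ hh; apply: lt_le_trans hh _; by rewrite /ra ler_wpM2r ?(ltW h_gt0)// ler_nat.
  have rNh : N0%:R * h <= ra N by rewrite /ra ler_wpM2r ?(ltW h_gt0)// ler_nat.
  have ne t := pol_neq t t0 r0_gt0 rN.
  have s1 t := sa (ra N) t rNh; have s2 t := sb (ra N) t rNh; have s3 t := solves_J (ne t); have s4 t := solves_Y (ne t).
  rewrite IntC_radC; [|exact: (rad_within s1 s3)|exact: (rad_within s2 s4)|exact: (rad_within s1 s4)|exact: (rad_within s2 s3)].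
  have -> : 2 * e = e + e by ring.
  by apply: le_trans (normc_le_ReIm _) _; apply: lerD.
apply/eqP; apply/eqP; apply: eq0_normc; apply: (@eq0_of_small _ _ 2 1) => // e e0 _.
by rewrite ger0_norm ?normc_ge0// mulrC small.
Qed.

End Point.
End Representation.

(** * Approximation of the representation *)

Lemma polar_exists (R : realType) (x : R * R) : exists r t, [/\ 0 <= r, 0 <= t < 2 * pi & x = pol r t].
Proof.
case: x => x1 x2; pose r := Num.sqrt (x1 ^+ 2 + x2 ^+ 2).
have s0 : 0 <= x1 ^+ 2 + x2 ^+ 2 by rewrite addr_ge0 ?sqr_ge0.
have rE : r ^+ 2 = x1 ^+ 2 + x2 ^+ 2 by rewrite sqr_sqrtr.
have p0 : 0 < pi :> R by exact: pi_gt0.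
have [r0|r0] := eqVneq r 0.
  exists 0, 0; rewrite lexx /= mulr_gt0//; split => //; move/eqP: rE; rewrite r0 expr0n /= eq_sym paddr_eq0 ?sqr_ge0// !sqrf_eq0.
  by case/andP => /eqP -> /eqP ->; rewrite /pol !mul0r.
have rp : 0 < r by rewrite lt_def r0 sqrtr_ge0.
have c1 : -1 <= x1 / r <= 1.
  by rewrite -ler_norml normrM normfV (gtr0_norm rp) ler_pdivrMr// mul1r -sqrtr_sqr ler_wsqrtr// lerDl sqr_ge0.
have cE : cos (acos (x1 / r)) = x1 / r by rewrite acosK// in_itv.
have sE : sin (acos (x1 / r)) = `|x2| / r.
  rewrite sin_acos//; have -> : 1 - (x1 / r) ^+ 2 = (`|x2| / r) ^+ 2.
    rewrite !expr_div_n real_normK ?num_real//; have -> : x2 ^+ 2 = r ^+ 2 - x1 ^+ 2 by rewrite rE addrAC subrr add0r.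
    by field.
  by rewrite sqrtr_sqr ger0_norm// divr_ge0// ltW.
have a0 := acos_ge0 c1; have ap := acos_lepi c1.
have [x20|x20] := leP 0 x2.
  exists r, (acos (x1 / r)); rewrite ltW// a0 /= (le_lt_trans ap)/=; last by move: p0; lra.
  by split => //; rewrite /pol cE sE ger0_norm// !(mulrC r) !divfK.
have aN : 0 < acos (x1 / r).
  rewrite lt_def a0 andbT; apply/eqP => a1; move/eqP: sE; rewrite a1 sin0 eq_sym mulf_eq0 invr_eq0 (negbTE r0) orbF normr_eq0.
  by move/eqP => x2E; rewrite x2E ltxx in x20.
exists r, (2 * pi - acos (x1 / r)); split; first exact: ltW.
  by apply/andP; split; move: aN ap p0; lra.
have -> : 2 * pi - acos (x1 / r) = - acos (x1 / r) + pi *+ 2 by rewrite addrC mulr_natl.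
by rewrite /pol cosD2pi sinD2pi cosN sinN cE sE ltr0_norm// mulNr opprK !(mulrC r) !divfK.
Qed.

Section Representation.
Variables (R : realType) (k : R).
Hypothesis k_gt0 : 0 < k.
Local Notation C := R[i].
Local Notation solves := (solves k).
Variables (a b : jet R) (D S : set (R * R)) (h dl : R) (M N0 : nat).
Hypothesis h_gt0 : 0 < h.
Hypothesis dl_gt0 : 0 < dl.
Hypothesis Mdl : M%:R * dl = 2 * pi.
Hypothesis N0_gt0 : (0 < N0)%N.
Hypothesis sol_a : forall y, D y -> solves a y.
Hypothesis sol_b : forall y, D y -> solves b y.
Hypothesis far : forall r t, N0%:R * h <= r -> D (pol r t).
Hypothesis radiating : forall e, 0 < e -> exists A, forall r t, A < r ->
  r * ((dr a r t + k * val b r t) ^+ 2 + (dr b r t - k * val a r t) ^+ 2) <= e.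
Hypothesis S_open : open S.
Hypothesis SD : ~` S `<=` D.
Local Notation ra := (ra h).
Local Notation an := (an dl).
Local Notation good := (good D h dl).
Local Notation incell := (incell h dl).
Local Notation arc := (arc k a b D h dl).
Local Notation seg := (seg k a b D h dl).
Local Notation bad_flux := (bad_flux k a b D h dl M N0).
Hypothesis badS : forall i j, (i < N0)%N -> (j < M)%N -> ~~ good i j -> forall r t, incell i j r t -> S (pol r t).
Implicit Types (i j N : nat) (r t : R) (x : R * R).

Lemma pol_cont r t : {for t, continuous (pol r)}.
Proof.
apply: (@continuous_comp R (R * R)%type (R * R)%type (fun t => (r, t)) (fun y => pol y.1 y.2)); last exact: pol_continuous.
exact: (@cvg_pair R R R (nbhs t) (nbhs r) (nbhs t) _ _ _ (cst r) id (cvg_cst r) cvg_id).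
Qed.

Lemma polr_cont r t : {for r, continuous ((@pol R)^~ t)}.
Proof.
apply: (@continuous_comp R (R * R)%type (R * R)%type (fun r => (r, t)) (fun y => pol y.1 y.2)); last exact: pol_continuous.
exact: (@cvg_pair R R R (nbhs r) (nbhs r) (nbhs t) _ _ _ id (cst t) cvg_id (cvg_cst t)).
Qed.

Lemma Mcos_continuous r t : {for t, continuous (fun t => r * cos t)}.
Proof. by apply: cvgM; [exact: cvg_cst|exact: continuous_cos]. Qed.

Lemma Msin_continuous r t : {for t, continuous (fun t => r * sin t)}.
Proof. by apply: cvgM; [exact: cvg_cst|exact: continuous_sin]. Qed.

Lemma cst_cont (c r : R) : {for r, continuous (fun=> c)}.
Proof. exact: cvg_cst. Qed.

Section Approx.
Variables (I : Type) (fam : I -> R * R -> C).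
Hypothesis fam_S : forall y n, S y -> approx (~` S) fam (fun x => multipole k n (x - y)).

Lemma arc_approx i j : (forall t, an j <= t <= an j.+1 -> S (pol (ra i) t)) -> approx (~` S) fam (fun x => arc x i j).
Proof.
move=> hS; rewrite /arc; case: asboolP => H; last exact: approx0.
have ca t : an j <= t <= an j.+1 -> cjet1 a (pol (ra i) t) by move/H/sol_a; case.
have cb t : an j <= t <= an j.+1 -> cjet1 b (pol (ra i) t) by move/H/sol_b; case.
change (approx (~` S) fam (edge k a b (an j) (an j.+1) (pol (ra i)) (fun t => ra i * cos t) (fun t => ra i * sin t))).
exact (edge_approx k_gt0 (an_le dl_gt0 j) (fun t _ => @pol_cont (ra i) t) (fun t _ => @Mcos_continuous (ra i) t)
  (fun t _ => @Msin_continuous (ra i) t) ca cb S_open hS fam_S).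
Qed.

Lemma seg_approx i j : (forall r, ra i <= r <= ra i.+1 -> S (pol r (an j))) -> approx (~` S) fam (fun x => seg x i j).
Proof.
move=> hS; rewrite /seg; case: asboolP => H; last exact: approx0.
have ca r : ra i <= r <= ra i.+1 -> cjet1 a (pol r (an j)) by move/H/sol_a; case.
have cb r : ra i <= r <= ra i.+1 -> cjet1 b (pol r (an j)) by move/H/sol_b; case.
change (approx (~` S) fam (edge k a b (ra i) (ra i.+1) (@pol R ^~ (an j)) (fun=> - sin (an j)) (fun=> cos (an j)))).
exact (edge_approx k_gt0 (ra_le h_gt0 i) (fun r _ => @polr_cont r (an j)) (fun r _ => @cst_cont (- sin (an j)) r)
  (fun r _ => @cst_cont (cos (an j)) r) ca cb S_open hS fam_S).
Qed.

Lemma bad_flux_approx : approx (~` S) fam bad_flux.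
Proof.
have E x : bad_flux x = \sum_(i < N0) \sum_(j < M) (if good i j then 0 else cellflux k a b D h dl x i j).
  by rewrite /bad_flux big_mkord; apply: eq_bigr => i _; rewrite big_mkord.
apply: (@eq_approx _ _ _ _ _ (fun x => \sum_(i < N0) \sum_(j < M) (if good i j then 0 else cellflux k a b D h dl x i j))).
  by move=> x _; rewrite E.
apply: approx_sum => i; apply: approx_sum => j; case: (boolP (good i j)) => [_|bad]; first exact: approx0.
have hS := badS (ltn_ord i) (ltn_ord j) bad.
have r1 : ra i <= ra i <= ra i.+1 by rewrite lexx ra_le.
have r2 : ra i <= ra i.+1 <= ra i.+1 by rewrite lexx ra_le.
have t1 : an j <= an j <= an j.+1 by rewrite lexx an_le.
have t2 : an j <= an j.+1 <= an j.+1 by rewrite lexx an_le.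
have a1 := @arc_approx i.+1 j (fun t ht => hS (ra i.+1) t (conj r2 ht)).
have a2 := @arc_approx i j (fun t ht => hS (ra i) t (conj r1 ht)).
have s1 := @seg_approx i j.+1 (fun r hr => hS r (an j.+1) (conj hr t2)).
have s2 := @seg_approx i j (fun r hr => hS r (an j) (conj hr t1)).
have := approxD (approxD a1 (approxZ (-1) a2)) (approxD s1 (approxZ (-1) s2)).
by apply: eq_approx => x _; rewrite /cellflux !mulN1r.
Qed.

End Approx.

Lemma arc_cont_at i j x : ~ S x -> (forall t, an j <= t <= an j.+1 -> S (pol (ra i) t)) -> cont_at (fun x => arc x i j) x.
Proof.
move=> Sx hS; rewrite /arc; case: asboolP => H; last exact: cont_at_cst.
have ca t : an j <= t <= an j.+1 -> cjet1 a (pol (ra i) t) by move/H/sol_a; case.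
have cb t : an j <= t <= an j.+1 -> cjet1 b (pol (ra i) t) by move/H/sol_b; case.
change (cont_at (edge k a b (an j) (an j.+1) (pol (ra i)) (fun t => ra i * cos t) (fun t => ra i * sin t)) x).
refine (edge_cont k_gt0 (an_le dl_gt0 j) (fun t _ => @pol_cont (ra i) t) (fun t _ => @Mcos_continuous (ra i) t)
  (fun t _ => @Msin_continuous (ra i) t) ca cb _).
by move=> t ht; apply/eqP => E; apply: Sx; rewrite E; exact: hS.
Qed.

Lemma seg_cont_at i j x : ~ S x -> (forall r, ra i <= r <= ra i.+1 -> S (pol r (an j))) -> cont_at (fun x => seg x i j) x.
Proof.
move=> Sx hS; rewrite /seg; case: asboolP => H; last exact: cont_at_cst.
have ca r : ra i <= r <= ra i.+1 -> cjet1 a (pol r (an j)) by move/H/sol_a; case.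
have cb r : ra i <= r <= ra i.+1 -> cjet1 b (pol r (an j)) by move/H/sol_b; case.
change (cont_at (edge k a b (ra i) (ra i.+1) (@pol R ^~ (an j)) (fun=> - sin (an j)) (fun=> cos (an j))) x).
refine (edge_cont k_gt0 (ra_le h_gt0 i) (fun r _ => @polr_cont r (an j)) (fun r _ => @cst_cont (- sin (an j)) r)
  (fun r _ => @cst_cont (cos (an j)) r) ca cb _).
by move=> r hr; apply/eqP => E; apply: Sx; rewrite E; exact: hS.
Qed.

Lemma cont_at_sum (J : Type) (s : seq J) (g : J -> R * R -> C) x : (forall u, cont_at (g u) x) ->
  cont_at (fun x => \sum_(u <- s) g u x) x.
Proof.
move=> H; elim: s => [|u s IH].
  by under [fun x => _]funext => y do rewrite big_nil; exact: cont_at_cst.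
by under [fun x => _]funext => y do rewrite big_cons; exact: cont_atD.
Qed.

Lemma bad_flux_cont_at x : ~ S x -> cont_at bad_flux x.
Proof.
move=> Sx.
have -> : bad_flux = fun x => \sum_(i < N0) \sum_(j < M) (if good i j then 0 else cellflux k a b D h dl x i j).
  by apply/funext => y; rewrite /bad_flux big_mkord; apply: eq_bigr => i _; rewrite big_mkord.
apply: cont_at_sum => i; apply: cont_at_sum => j; case: (boolP (good i j)) => [_|bad]; first exact: cont_at_cst.
have hS := badS (ltn_ord i) (ltn_ord j) bad.
have r1 : ra i <= ra i <= ra i.+1 by rewrite lexx ra_le.
have r2 : ra i <= ra i.+1 <= ra i.+1 by rewrite lexx ra_le.
have t1 : an j <= an j <= an j.+1 by rewrite lexx an_le.
have t2 : an j <= an j.+1 <= an j.+1 by rewrite lexx an_le.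
have a1 := @arc_cont_at i.+1 j x Sx (fun t ht => hS (ra i.+1) t (conj r2 ht)).
have a2 := @arc_cont_at i j x Sx (fun t ht => hS (ra i) t (conj r1 ht)).
have s1 := @seg_cont_at i j.+1 x Sx (fun r hr => hS r (an j.+1) (conj hr t2)).
have s2 := @seg_cont_at i j x Sx (fun r hr => hS r (an j) (conj hr t1)).
exact: cont_atD (cont_atD a1 (cont_atN a2)) (cont_atD s1 (cont_atN s2)).
Qed.

Lemma cont_dist (f : R * R -> R) x (e : R) : {for x, continuous f} -> 0 < e ->
  exists2 d : R, 0 < d & forall y, `|y - x| < d -> `|f y - f x| <= e.
Proof.
move=> /cvgrPdist_le cf e0; have /nbhs_ballP[d /= d0 hd] := cf e e0.
by exists d => // y hy; rewrite distrC; apply: (hd y); rewrite -ball_normE /= distrC.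
Qed.

Lemma vC_cont_at x : D x -> cont_at (vC a b) x.
Proof.
move=> Dx e e0; have [_ [ca _ _] _] := sol_a Dx; have [_ [cb _ _] _] := sol_b Dx.
have e2 : 0 < e / 2 by rewrite divr_gt0.
have [d1 d10 h1] := cont_dist ca e2; have [d2 d20 h2] := cont_dist cb e2.
exists (Num.min d1 d2); first by rewrite lt_min d10.
move=> y; rewrite lt_min => /andP[b1 b2]; apply: le_trans (normc_le_ReIm _) _.
by rewrite [e]splitr; apply: lerD; [exact: h1|exact: h2].
Qed.

(** The point may lie on the grid, for instance on the ray t = 0. Increasing both polar coordinates
    slightly moves it into the interior of its half-open cell, and continuity gives the identity at
    the point itself. *)
Lemma representation x : ~ S x -> bad_flux x + 4 * 'i%C * vC a b x = 0.
Proof.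
move=> Sx; have [r [t [r0 /andP[t0 t2] xE]]] := polar_exists x.
pose i := Num.truncn (r / h); pose j := Num.truncn (t / dl).
have ri : ra i <= r < ra i.+1.
  have /truncn_itv : 0 <= r / h by rewrite divr_ge0 ?(ltW h_gt0).
  by rewrite -/i ler_pdivlMr// ltr_pdivrMr.
have tj : an j <= t < an j.+1.
  have /truncn_itv : 0 <= t / dl by rewrite divr_ge0 ?(ltW dl_gt0).
  by rewrite -/j ler_pdivlMr// ltr_pdivrMr.
have jM : (j < M)%N.
  case/andP: tj => h1 _; have := le_lt_trans h1 t2; rewrite -Mdl /an ltr_pM2r// ltr_nat; exact.
(* A cell that is not good lies entirely in [S] and cannot contain the point. *)
have gij : good i j.
  case: (leqP N0 i) => [|iN]; first by move=> ?; apply: (@far_good R D h dl N0).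
  case gE: (good i j) => //; case: Sx; rewrite xE; apply: (badS iN jM (negbT gE)).
  by case/andP: ri => ? /ltW ?; case/andP: tj => ? /ltW ?; split; apply/andP.
pose g y := bad_flux y + 4 * 'i%C * vC a b y.
have cg : cont_at g x.
  apply: cont_atD; first exact: bad_flux_cont_at.
  exact: cont_atZ (vC_cont_at (SD Sx)).
change (g x = 0).
apply: eq0_normc; apply/eqP; rewrite eq_le normc_ge0 andbT; apply/ler_addgt0Pr => e e0; rewrite add0r.
have [d d0 hd] := cg e e0.
have /cvgrPdist_lt /(_ d d0)/nbhs_ballP[d1 /= d10 h1] := @pol_continuous R (r, t).
case/andP: ri => ri1 ri2; case/andP: tj => tj1 tj2.
pose s := Num.min (d1 / 2) (Num.min ((ra i.+1 - r) / 2) ((an j.+1 - t) / 2)).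
have s0 : 0 < s by rewrite !lt_min !divr_gt0//= subr_gt0 ?ri2 ?tj2.
have s1 : s <= d1 / 2 by rewrite ge_min lexx.
have s2 : s <= (ra i.+1 - r) / 2 by rewrite !ge_min lexx orbT.
have s3 : s <= (an j.+1 - t) / 2 by rewrite !ge_min lexx !orbT.
have r' : ra i < r + s < ra i.+1 by apply/andP; split; move: s0 s2 ri1 ri2; lra.
have t' : an j < t + s < an j.+1 by apply/andP; split; move: s0 s3 tj1 tj2; lra.
have g0 : g (pol (r + s) (t + s)) = 0.
  exact: (representation_interior k_gt0 h_gt0 dl_gt0 Mdl N0_gt0 sol_a sol_b far radiating r' t' jM gij).
have near : `|pol (r + s) (t + s) - x| < d.
  rewrite xE distrC; apply: (h1 (r + s, t + s)).
  rewrite -ball_normE /=; have -> : (r, t) - (r + s, t + s) = - (s, s).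
    by apply/eqP; rewrite xpair_eqE /= !opprD !addrA !subrr !add0r !eqxx.
  rewrite normrN prod_normE /= maxxx gtr0_norm//; move: s1 d10 s0; lra.
by have := hd _ near; rewrite g0 sub0r normcN.
Qed.

Lemma field_approx (I : Type) (fam : I -> R * R -> C) :
  (forall y n, S y -> approx (~` S) fam (fun x => multipole k n (x - y))) -> approx (~` S) fam (vC a b).
Proof.
move=> hap; apply: (@eq_approx _ _ _ _ _ (fun x => - (4 * 'i%C)^-1 * bad_flux x)); last first.
  exact: approxZ (bad_flux_approx hap).
move=> x Sx; have /eqP := representation Sx; rewrite addr_eq0 => /eqP ->.
rewrite mulrNN mulKf// mulf_neq0 ?pnatr_eq0//.
by rewrite eq_complex /= negb_and oner_eq0 orbT.
Qed.

End Representation.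

(** * Geometry of the scatterers and choice of the grid *)

Section Grid.
Variable R : realType.
Implicit Types (D S K : set (R * R)) (r t : R) (x y : R * R).

Lemma compact_margin S K : compact K -> open S -> K `<=` S ->
  exists2 d : R, 0 < d & forall y z, K y -> `|z - y| < d -> S z.
Proof.
move=> /compact_near_coveringP cK oS KS.
have : \forall d \near (0:R)^'+, K `<=` (fun y => forall z, `|z - y| < d -> S z).
  apply: (cK R ((0:R)^'+) (fun d y => forall z, `|z - y| < d -> S z)) => y Ky.
  have /nbhs_ballP[e /= e0 he] := open_nbhs_nbhs (conj oS (KS y Ky)).
  have e2 : 0 < e / 2 by rewrite divr_gt0.
  exists (ball y (e / 2), [set d | d < e / 2]).
    by split; [exact: nbhsx_ballx|exact: nbhs_right_lt].
  move=> [y' d] /= [hy hd] z hz; apply: he; rewrite -ball_normE /=.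
  move: hy; rewrite -ball_normE /= => hy.
  have -> : y - z = (y - y') - (z - y') by rewrite opprB addrA subrK.
  by have := ler_normB (y - y') (z - y'); move: hy hd hz; lra.
move=> H; have [d [d0 hd]] : exists d : R, 0 < d /\ K `<=` (fun y => forall z, `|z - y| < d -> S z).
  near (0:R)^'+ => d; exists d; split; first by near: d; exact: nbhs_right_gt.
  by near: d.
by exists d => // y z /hd; apply.
Unshelve. all: by end_near. Qed.

Lemma bounded_compact K (B : R) : closed K -> (forall y, K y -> `|y| <= B) -> compact K.
Proof.
move=> cK hB; apply: (subclosed_compact cK (compact_setX (@segment_compact R (- B) B) (@segment_compact R (- B) B))).
move=> y /hB; rewrite prod_normE ge_max => /andP[h1 h2].
by split => /=; rewrite in_itv /= -ler_norml.
Qed.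

Lemma cos_lip s t : `|cos s - cos t| <= `|s - t| :> R.
Proof.
wlog st : s t / t <= s.
  by move=> H; have [/H//|/ltW/H] := leP t s; rewrite distrC (distrC t).
have d u : u \in `]t, s[ -> is_derive u 1 cos (- sin u) by move=> _; exact: is_derive_cos.
have c : {within `[t, s], continuous (@cos R)} by apply: continuous_subspaceT; exact: continuous_cos.
have [u _ ->] := MVT_segment st d c.
by rewrite normrM normrN ler_piMl// ler_norml sin_geN1 sin_le1.
Qed.

Lemma sin_lip s t : `|sin s - sin t| <= `|s - t| :> R.
Proof.
wlog st : s t / t <= s.
  by move=> H; have [/H//|/ltW/H] := leP t s; rewrite distrC (distrC t).
have d u : u \in `]t, s[ -> is_derive u 1 sin (cos u) by move=> _; exact: is_derive_sin.
have c : {within `[t, s], continuous (@sin R)} by apply: continuous_subspaceT; exact: continuous_sin.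
have [u _ ->] := MVT_segment st d c.
by rewrite normrM ler_piMl// ler_norml cos_geN1 cos_le1.
Qed.

Lemma pol_dist r t r' t' (h e : R) : `|r - r'| <= h -> 0 <= r' -> r' * `|t - t'| <= e -> `|pol r t - pol r' t'| <= h + e.
Proof.
move=> hr r0 ht.
have aux (f : R -> R) : `|f t| <= 1 -> `|f t - f t'| <= `|t - t'| -> `|r * f t - r' * f t'| <= h + e.
  move=> f1 f2; have -> : r * f t - r' * f t' = (r - r') * f t + r' * (f t - f t') by ring.
  apply: le_trans (ler_normD _ _) _; apply: lerD; rewrite normrM.
    by apply: le_trans hr; rewrite ler_piMr.
  by apply: le_trans ht; rewrite (ger0_norm r0) ler_wpM2l.
rewrite prod_normE ge_max /=; apply/andP; split; apply: aux.
- by rewrite ler_norml cos_geN1 cos_le1.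
- exact: cos_lip.
- by rewrite ler_norml sin_geN1 sin_le1.
- exact: sin_lip.
Qed.

Lemma eucl_pol r t : 0 <= r -> eucl (pol r t) = r.
Proof.
by move=> r0; rewrite /eucl /= !exprMn -mulrDr cos2Dsin2 mulr1 sqrtr_sqr ger0_norm.
Qed.

Lemma pol_norm r t : 0 <= r -> r <= 2 * `|pol r t|.
Proof.
move=> r0; rewrite -[X in X <= _](eucl_pol t r0).
have h1 : `|(pol r t).1| <= `|pol r t| by rewrite prod_normE le_max lexx.
have h2 : `|(pol r t).2| <= `|pol r t| by rewrite prod_normE le_max lexx orbT.
have p0 : 0 <= `|pol r t| by [].
rewrite /eucl; move: h1 h2 p0; move: (pol r t).1 (pol r t).2 `|pol r t| => u v w h1 h2 p0.
have -> : 2 * w = Num.sqrt ((2 * w) ^+ 2) by rewrite sqrtr_sqr ger0_norm// mulr_ge0.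
apply: ler_wsqrtr; rewrite -(real_normK (num_real u)) -(real_normK (num_real v)).
have q1 : `|u| ^+ 2 <= w ^+ 2 by rewrite lerXn2r ?nnegrE.
have q2 : `|v| ^+ 2 <= w ^+ 2 by rewrite lerXn2r ?nnegrE.
by rewrite exprMn; have := sqr_ge0 w; move: q1 q2; lra.
Qed.

Lemma polar_grid D S (B : R) : open D -> ~` D `<=` S -> open S -> (forall y, S y -> `|y| <= B) ->
  exists h dl : R, exists M N0 : nat, [/\ 0 < h, 0 < dl, M%:R * dl = 2 * pi, (0 < N0)%N &
   (forall r t, N0%:R * h <= r -> D (pol r t)) /\
   (forall i j, (i < N0)%N -> (j < M)%N -> ~~ good D h dl i j -> forall r t, incell h dl i j r t -> S (pol r t))].
Proof.
move=> oD DS oS SB.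
have cK : compact (~` D).
  by apply: (@bounded_compact _ B); [exact: open_closedC|move=> y /DS/SB].
have [d d0 hd] := compact_margin cK oS DS.
(* Points of one cell will be at most 2 h = d / 2 apart, which is within the margin [d]: a cell that
   meets the complement of [D] lies in [S]. *)
pose h := d / 4; have h0 : 0 < h by rewrite divr_gt0.
(* Beyond radius N0 h the sup norm exceeds [B]; the factor 2 is that of [pol_norm]. *)
pose N0 := (Num.truncn ((2 * `|B| + 1) / h)).+1.
have N0h : 2 * `|B| + 1 < N0%:R * h by rewrite -ltr_pdivrMr// truncnS_gt.
have Nh0 : 0 < N0%:R * h by apply: lt_trans N0h; rewrite ltr_wpDl// mulr_ge0.
(* So many sectors that even the arcs of radius N0 h are no longer than [h]. *)
pose M := (Num.truncn (2 * pi * (N0%:R * h) / h)).+1.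
have M0 : 0 < M%:R :> R by rewrite ltr0n.
pose dl : R := 2 * pi / M%:R; have dl0 : 0 < dl by rewrite divr_gt0// mulr_gt0// pi_gt0.
have Mdl : M%:R * dl = 2 * pi by rewrite /dl mulrC divfK// gt_eqF.
have dlh : N0%:R * h * dl <= h.
  have hM : 2 * pi * (N0%:R * h) / h < M%:R by exact: truncnS_gt.
  have -> : N0%:R * h * dl = 2 * pi * (N0%:R * h) / M%:R by rewrite /dl mulrA (mulrC (2 * pi)).
  by rewrite ler_pdivrMr// (mulrC h); apply: ltW; rewrite -ltr_pdivrMr.
exists h, dl, M, N0; split => //; split.
  move=> r t hr; apply: contrapT => /DS/SB hB.
  have r0 : 0 <= r by apply: le_trans hr; exact: ltW.
  by have := pol_norm t r0; have := ler_norm B; move: hB hr N0h; lra.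
move=> i j iN jM bad r t [/andP[r1 r2] /andP[t1 t2]].
have [r' [t' [[/andP[r1' r2'] /andP[t1' t2']] nD]]] : exists r' t', incell h dl i j r' t' /\ ~ D (pol r' t').
  apply: contrapT => H; move/negP: bad; apply; apply/asboolP => r' t' hc.
  by apply: contrapT => nD; apply: H; exists r', t'.
apply: (hd _ _ nD).
have e1 : ra h i.+1 = ra h i + h by rewrite /ra -natr1 mulrDl mul1r.
have e2 : an dl j.+1 = an dl j + dl by rewrite /an -natr1 mulrDl mul1r.
have rN : r' <= N0%:R * h by apply: le_trans r2' _; rewrite /ra ler_wpM2r ?(ltW h0)// ler_nat.
have r0' : 0 <= r' by apply: le_trans r1'; rewrite /ra mulr_ge0// ltW.
have a1 : `|r - r'| <= h by rewrite ler_norml; apply/andP; split; move: r1 r2 r1' r2'; rewrite e1; lra.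
have a2 : `|t - t'| <= dl by rewrite ler_norml; apply/andP; split; move: t1 t2 t1' t2'; rewrite e2; lra.
have a3 : r' * `|t - t'| <= h.
  by apply: le_trans dlh; apply: ler_pM.
apply: le_lt_trans (pol_dist a1 r0' a3) _; rewrite /h; move: d0; lra.
Qed.

End Grid.

(** * The continuation as a radiating solution *)

Section Continuation.
Variables (R : realType) (k : R).
Local Notation C := R[i].
Local Notation "\d1 f" := ('D_(1, 0) f) (at level 10, f at level 9).
Local Notation "\d2 f" := ('D_(0, 1) f) (at level 10, f at level 9).
Implicit Types (f g : R * R -> R) (D U : set (R * R)) (x : R * R).

Definition ajet f := Jet f (\d1 f) (\d2 f) (\d1 (\d1 f)) (\d2 (\d1 f)) (\d1 (\d2 f)) (\d2 (\d2 f)).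

Lemma ajet_solves D f x : analytic D f -> D x -> \d1 (\d1 f) x + \d2 (\d2 f) x = - k ^+ 2 * f x ->
  solves k (ajet f) x.
Proof.
move=> af Dx E; have a1 := analytic_d1 af; have a2 := analytic_d2 af.
have g0 := analytic_grad af Dx; have g1 := analytic_grad a1 Dx; have g2 := analytic_grad a2 Dx.
have c0 := analytic_cont af Dx; have c1 := analytic_cont a1 Dx; have c2 := analytic_cont a2 Dx.
have c11 := analytic_cont (analytic_d1 a1) Dx; have c12 := analytic_cont (analytic_d2 a1) Dx.
have c21 := analytic_cont (analytic_d1 a2) Dx; have c22 := analytic_cont (analytic_d2 a2) Dx.
exact (And3 (And4 g0 g1 g2 E) (And3 c0 c1 c2) (And4 c11 c12 c21 c22)).
Qed.

Lemma real_analytic_analytic D f : (forall x, D x -> real_analytic_at f x) -> analytic D f.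
Proof. by move=> h x /h/expansionP. Qed.

Lemma ajet_dr D f g r t (U : set (R * R)) : analytic D f -> open U -> (forall x, U x -> D x /\ f x = g x) ->
  0 < r -> U (pol r t) -> 'D_((eucl (pol r t))^-1 *: pol r t) g (pol r t) = dr (ajet f) r t.
Proof.
move=> af oU hU r0 Ur; have [Dr _] := hU _ Ur.
rewrite eucl_pol ?(ltW r0)//.
have -> : r^-1 *: pol r t = (cos t, sin t).
  by rewrite /pol; congr pair; rewrite /GRing.scale /= mulrA mulVf ?mul1r// gt_eqF.
rewrite -(derive_open_eq (cos t, sin t) oU (fun x Ux => (hU x Ux).2) Ur).
by rewrite (derive_val (is_derive := is_grad_derive (cos t, sin t) (analytic_grad af Dr))).
Qed.

(** The field and its continuation agree on the open set of points of norm larger than [B], hence so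
    do their derivatives there. *)
Lemma sommerfeld_radiating D S (B : R) (u v : R * R -> C) : 0 < k -> ~` S `<=` D -> (forall y, S y -> `|y| <= B) ->
  analytic D (reF v) -> analytic D (imF v) -> (forall x, ~ S x -> v x = u x) -> sommerfeld k u ->
  let a := ajet (reF v) in let b := ajet (imF v) in
  forall e, 0 < e -> exists A, forall r t, A < r ->
    r * ((dr a r t + k * val b r t) ^+ 2 + (dr b r t - k * val a r t) ^+ 2) <= e.
Proof.
move=> k0 SD SB av bv vu som a b e e0.
(* The Sommerfeld condition bounds a modulus, the conclusion its square. *)
have [A hA] := som (Num.sqrt e) (etrans (sqrtr_gt0 e) e0).
exists (`|A| + 2 * `|B| + 1) => r t hr.
have r0 : 0 < r by apply: le_lt_trans hr; rewrite !addr_ge0// mulr_ge0.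
have Ar : A < r by have := ler_norm A; have : 0 <= `|B| by []; move: hr; lra.
have Br : B < `|pol r t|.
  by have := pol_norm t (ltW r0); have := ler_norm B; have : 0 <= `|A| by []; move: hr; lra.
pose U := [set y : R * R | B < `|y|].
have oU : open U.
  rewrite /U; have -> : [set y : R * R | B < `|y|] = (fun y : R * R => `|y|) @^-1` [set s | B < s] by [].
  by apply: open_comp; [move=> y _; exact: norm_continuous|exact: open_gt].
have US y : U y -> ~ S y by move=> Uy /SB; rewrite leNgt => /negP; apply.
have dra := @ajet_dr D (reF v) (reF u) r t U av oU (fun y Uy => conj (SD y (US y Uy)) (congr1 _ (vu y (US y Uy)))) r0 Br.
have drb := @ajet_dr D (imF v) (imF u) r t U bv oU (fun y Uy => conj (SD y (US y Uy)) (congr1 _ (vu y (US y Uy)))) r0 Br.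
have := hA (pol r t); rewrite eucl_pol ?(ltW r0)// => /(_ Ar).
have -> : radial_deriv u (pol r t) = (dr a r t +i* dr b r t)%C.
  by rewrite /radial_deriv /derivC; congr Complex; [exact: dra|exact: drb].
rewrite -(vu _ (US _ Br)) normrE ltcR normcM normc_real ger0_norm ?sqrtr_ge0//.
have -> : ((dr a r t +i* dr b r t)%C - 'i%C * k%:C%C * v (pol r t)) =
  ((dr a r t + k * val b r t) +i* (dr b r t - k * val a r t))%C.
  rewrite /val /a /b /= /reF /imF; case: (v (pol r t)) => p q /=.
  by apply/eqP; rewrite eq_complex /=; apply/andP; split; apply/eqP; ring.
rewrite /normc -sqrtrM ?(ltW r0)// ltr_sqrt//; exact: ltW.
Qed.

End Continuation.

(** * Transfer to the prescribed poles *)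

Section Poles.
Variables (R : realType) (k : R).
Hypothesis k_gt0 : 0 < k.
Local Notation C := R[i].
Implicit Types (x y : R * R) (n : int) (t : R).

Lemma cisD s t : cis (s + t) = cis s * cis t :> C.
Proof. by rewrite /cis cosD sinD; apply/eqP; rewrite eq_complex /= eqxx addrC eqxx. Qed.

Lemma cisX t m : cis t ^+ m = cis (m%:R * t) :> C.
Proof.
elim: m => [|m IH]; first by rewrite expr0 mul0r /cis cos0 sin0.
by rewrite exprS IH -cisD -natr1 mulrDl mul1r addrC.
Qed.

Lemma hankel_cis n (r t : R) : 0 < r -> hankel n (k * r) * cis (n%:~R * t) = multipole k n (pol r t).
Proof.
move=> r0; have kr : 0 < k * r by rewrite mulr_gt0.
have tE : tau k (pol r t) = (k * r / 2) ^+ 2.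
  by rewrite /tau /= !exprMn -mulrDr cos2Dsin2 mulr1; ring.
have cE : cpt k (pol r t) = (k * r / 2)%:C%C * cis t.
  by rewrite /cpt /cis; apply/eqP; rewrite eq_complex /=; apply/andP; split; apply/eqP; ring.
have X m : cpt k (pol r t) ^+ m = ((k * r / 2) ^+ m)%:C%C * cis (m%:R * t).
  by rewrite cE exprMn cisX rmorphXn.
case: n => m.
  rewrite /multipole X tE /hankel /besselJ /besselY /= besselJnE besselYnE// /hcyl mulrA; congr (_ * _).
  by apply/eqP; rewrite eq_complex /=; apply/andP; split; apply/eqP; ring.
have -> : (Negz m)%:~R * t = - (m.+1%:R * t) by rewrite NegzE mulrNz mulNr.
rewrite /multipole -rmorphXn X tE /hankel /besselJ /besselY /= besselJnE besselYnE// /hcyl.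
have -> : ((-1) ^+ m.+1 : C) = ((-1) ^+ m.+1)%:C%C by rewrite rmorphXn rmorphN1.
rewrite /cis cosN sinN; apply/eqP; rewrite eq_complex /=; apply/andP; split; apply/eqP; ring.
Qed.

Variables (L : nat) (O : 'I_L -> R * R) (r theta : 'I_L -> R * R -> R).
Hypothesis polar : forall l, polar_coordinates (O l) (r l) (theta l).

Definition pole_family (p : int * 'I_L) x : C := hankel p.1 (k * r p.2 x) * cis (p.1%:~R * theta p.2 x).

Lemma pole_familyE p x : x != O p.2 -> pole_family p x = multipole k p.1 (x - O p.2).
Proof.
move=> xO; have [r0 e1 e2] := polar p.2 x.
have E : x - O p.2 = pol (r p.2 x) (theta p.2 x).
  by apply/eqP; rewrite xpair_eqE /= e1 e2 !(addrC (O _).1) !(addrC (O _).2) !addrK !eqxx.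
rewrite E -hankel_cis// lt_def r0 andbT; apply: contraNneq xO => rE.
by rewrite -subr_eq0 E rE /pol !mul0r.
Qed.

Lemma poles_approx Q (scat : 'I_Q -> set (R * R)) S : (forall q, open (scat q)) ->
  (forall q, path_connected (scat q)) -> S = \bigcup_q scat q -> (forall q, exists l, scat q (O l)) ->
  forall y n, S y -> approx (~` S) pole_family (fun x => multipole k n (x - y)).
Proof.
move=> oS cS SE hO y n Sy; have [q _ qy] : (\bigcup_q scat q) y by rewrite -SE.
have [l ql] := hO q; have [g [cg gS g0 g1]] := cS q _ _ ql qy.
have FA x : (~` S) x -> ~ scat q x by move=> Sx qx; apply: Sx; rewrite SE; exists q.
have := push_path k_gt0 (oS q) FA cg gS n; rewrite g0 g1; apply: approx_trans => m.
apply: (@eq_approx _ _ _ _ _ (pole_family (m, l))); last exact: approx_gen.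
move=> x Sx; rewrite pole_familyE//=; apply/eqP => E; apply: (FA x Sx); rewrite E//.
Qed.

Definition coefs (s : seq (C * (int * 'I_L))) n l : C := \sum_(p <- s) (if p.2 == (n, l) then p.1 else 0).

Lemma coefs_finite s : finite_set [set nl : int * 'I_L | coefs s nl.1 nl.2 != 0].
Proof.
apply: (@sub_finite_set _ _ [set` [seq p.2 | p <- s]]); last exact: finite_seq.
move=> [n l] /=; apply: contraNT => hn; rewrite /coefs big_seq big1// => p ps; case: eqP => // E.
by move/negP: hn; case; apply/mapP; exists p.
Qed.

Lemma multipole_sum_coefs s x : multipole_sum k r theta (coefs s) x = lincomb pole_family s x.
Proof.
pose ns := undup [seq p.2.1 | p <- s].
have E l : \sum_(n \in [set: int]) coefs s n l * hankel n (k * r l x) * cis (n%:~R * theta l x) =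
   \sum_(n <- ns) \sum_(p <- s) (if p.2 == (n, l) then p.1 * pole_family p.2 x else 0).
  rewrite (@fsbigE _ _ _ _ _ ns) ?undup_uniq//; last first.
    move=> n _; rewrite mem_undup => hn; rewrite /coefs big_seq big1 ?mul0r// => p ps; case: eqP => // E.
    by move/negP: hn; case; apply/mapP; exists p => //; rewrite E.
  rewrite big_mkcond /=; apply: eq_bigr => n _; rewrite in_setT /coefs !mulr_suml; apply: eq_bigr => p _.
  by case: eqP => [->|]; rewrite ?mul0r// /pole_family mulrA.
rewrite /multipole_sum /lincomb (eq_bigr _ (fun l _ => E l)).
under eq_bigr do rewrite exchange_big /=.
rewrite exchange_big /= big_seq [RHS]big_seq; apply: eq_bigr => p ps.
rewrite (bigD1 p.2.2)//= [X in _ + X]big1 ?addr0; last first.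
  by move=> l lp; apply: big1 => n _; case: eqP => // e; rewrite e eqxx in lp.
have pn : p.2.1 \in ns by rewrite mem_undup; apply/mapP; exists p.
rewrite (bigD1_seq p.2.1) ?undup_uniq//= -surjective_pairing eqxx big1 ?addr0// => n np.
by case: eqP => // e; rewrite e eqxx in np.
Qed.

Lemma approx_multipole_sums (F : set (R * R)) (u : R * R -> C) : approx F pole_family u ->
  exists beta : nat -> int -> 'I_L -> C,
    (forall N, finite_set [set nl : int * 'I_L | beta N nl.1 nl.2 != 0]) /\
    uniformly_converges_on F (fun N => multipole_sum k r theta (beta N)) u.
Proof.
move=> hu; have hs N : exists s, forall x, F x -> normc (u x - lincomb pole_family s x) <= N.+1%:R^-1.
  by apply: hu; rewrite invr_gt0.
have [s hS] := choice hs.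
exists (fun N => coefs (s N)); split=> [N|e e0]; first exact: coefs_finite.
have [N0 _ hN] := near_infty_natSinv_lt (PosNum e0).
exists N0 => // N /= NN x Fx; rewrite multipole_sum_coefs normrE ltcR -normcN opprB.
exact: le_lt_trans (hS N x Fx) (hN N NN).
Qed.

End Poles.

Lemma bigcup_bounded (R : realType) Q (scat : 'I_Q -> set (R * R)) : (forall q, bounded_set (scat q)) ->
  exists B : R, forall y, (\bigcup_q scat q) y -> `|y| <= B.
Proof.
move=> hb; have hB q : exists B : R, forall y, scat q y -> `|y| <= B.
  have [M [Mr hM]] := hb q; exists (M + 1) => y; apply: hM; rewrite ltrDl ltr01//.
have [B hB'] := choice hB.
exists (\sum_q `|B q|) => y [q _ qy]; apply: le_trans (hB' q y qy) _; apply: le_trans (ler_norm _) _.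
by rewrite (bigD1 q)//= lerDl sumr_ge0.
Qed.

Theorem theorem1 (R : realType) (Q : nat) (scat : 'I_Q -> set (R * R))
  (scat_open : forall q, open (scat q))
  (scat_bounded : forall q, bounded_set (scat q))
  (scat_simply_connected : forall q, simply_connected (scat q))
  (scat_disjoint : trivIset setT (fun q => closure (scat q)))
  (S : set (R * R)) (S_def : S = \bigcup_q scat q)
  (k : R) (k_gt0 : 0 < k)
  (ui us : R * R -> R[i]) (us_scattered : scattered_field S k ui us)
  (L : nat) (O : 'I_L -> R * R)
  (O_in : forall l, S (O l))
  (O_each : forall q, exists l, scat q (O l))
  (r theta : 'I_L -> R * R -> R)
  (polar : forall l, polar_coordinates (O l) (r l) (theta l))
  (us_continuable : analytically_continuable S us) :
  exists beta : nat -> int -> 'I_L -> R[i],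
    (forall N, finite_set [set nl : int * 'I_L | beta N nl.1 nl.2 != 0]) /\
    uniformly_converges_on (~` S)
      (fun N => multipole_sum k r theta (beta N)) us.
Proof.
have oS : open S by rewrite S_def; apply: bigcup_open.
have [B hB] := bigcup_bounded scat_bounded; rewrite -S_def in hB.
have [[_ _ helm] _ _ som] := us_scattered.
have [D [v [[oD cD] SD av vu]]] := us_continuable.
have ar : analytic D (reF v) by apply: real_analytic_analytic => x /av[].
have ai : analytic D (imF v) by apply: real_analytic_analytic => x /av[].
(* The equation for [us] is given on this open set; since [S] is bounded it is nonempty, as the
   identity theorem on [D] requires. *)
pose U := ~` closure S.
have oU : open U by apply: closed_openC; exact: closed_closure.
have US x : U x -> ~ S x by move=> Ux Sx; apply: Ux; exact: subset_closure.
have U0 : U !=set0.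
  exists (`|B| + 1, 0) => cl.
  have : `|(`|B| + 1, 0 : R)| <= B.
    have cB : closed [set y : R * R | `|y| <= B].
      have -> : [set y : R * R | `|y| <= B] = (fun y : R * R => `|y|) @^-1` [set s | s <= B] by [].
      by apply: closed_comp; [move=> y _; exact: norm_continuous|exact: closed_le].
    have := @closure_subset _ S [set y : R * R | `|y| <= B] hB _ cl.
    by rewrite -((closure_id _).1 cB).
  rewrite prod_normE /= normr0 ger0_norm ?addr_ge0// max_l ?addr_ge0//.
  by have := ler_norm B; lra.
have UD : U `<=` D by move=> x /US/SD.
have sol x : D x -> solves k (ajet (reF v)) x /\ solves k (ajet (imF v)) x.
  move=> Dx; split; apply: (ajet_solves _ Dx) => //.
    apply: (@helmholtz_continuation R D U k (reF v) (reF us)) => // y Uy; first by rewrite /reF vu//; exact: US.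
    have := congr1 (@complex.Re R) (helm y Uy); rewrite /laplacianC.
    by rewrite /reF; case: (us y) => p q /=; rewrite mul0r subr0.
  apply: (@helmholtz_continuation R D U k (imF v) (imF us)) => // y Uy; first by rewrite /imF vu//; exact: US.
  have := congr1 (@complex.Im R) (helm y Uy); rewrite /laplacianC.
    by rewrite /imF; case: (us y) => p q /=; rewrite mul0r addr0.
have DS : ~` D `<=` S by move=> x nDx; apply: contrapT => /SD.
have [h [dl [M [N0 [h0 dl0 Mdl N00 [far badS]]]]]] := polar_grid oD DS oS hB.
have rad := sommerfeld_radiating k_gt0 SD hB ar ai vu som.
have poles := poles_approx k_gt0 polar scat_open (fun q => (scat_simply_connected q).1) S_def O_each.
have ap := field_approx k_gt0 h0 dl0 Mdl N00 (fun y Dy => (sol y Dy).1) (fun y Dy => (sol y Dy).2) far rad oS SD badS poles.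
apply: approx_multipole_sums; apply: eq_approx ap => x Sx.
by rewrite /vC /= -vu// /reF /imF; case: (v x).
Qed.
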